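(* Let $b,\sigma:\mathbb{R}\to\mathbb{R}$ be Lipschitz continuous, let $h:\mathbb{R}\to\mathbb{R}$ be an increasing function for which there are constants $0<m\le M$ with $m|x-y|\le|h(x)-h(y)|\le M|x-y|$ for all $x,y\in\mathbb{R}$, and let $X_0$ be a real random variable such that $\mathbb{E}[h(X_0)]\ge0$ and $\mathbb{E}[|X_0|^p]<\infty$ for some $p>4$. Let $T>0$. For integers $N\ge1$ and $n\ge2$, let $(\bar X^i)_{1\le i\le N}$ be the independent copies of the solution of the mean reflected SDE and $(\tilde X^i)_{1\le i\le N}$ the Euler-discretized particle system with step $T/n$, as defined in the context. (i) There exists a constant $C$ depending on $T,b,\sigma,h$ and $X_0$ (but not on $N$, $n$, $i$) such that for all $N\ge 1$, $n\ge2$ and $i\in\{1,\dots,N\}$, $$\mathbb{E}\Big[\sup_{t\le T}|\bar X^i_t-\tilde X^i_t|^2\Big]\le C\Big(\frac{\log n}{n}+N^{-1/2}\Big).$$ (ii) If in addition $h$ is twice continuously differentiable with bounded derivatives, there exists a positive constant $C$ depending on $T,b,\sigma,h$ and $X_0$ (but not on $N$, $n$, $i$) such that for all $N\ge 1$, $n\ge2$ and $i\in\{1,\dots,N\}$, $$\mathbb{E}\Big[\sup_{t\le T}|\bar X^i_t-\tilde X^i_t|^2\Big]\le C\Big(\frac{\log n}{n}+N^{-1}\Big).$$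
   Context: $(B_t)_{t\ge0}$ is a standard Brownian motion on a complete probability space, independent of $X_0$. The mean reflected SDE is the system $$X_t=X_0+\int_0^t b(X_s)\,ds+\int_0^t\sigma(X_s)\,dB_s+K_t,\quad \mathbb{E}[h(X_t)]\ge0,\quad \int_0^t\mathbb{E}[h(X_s)]\,dK_s=0,\qquad t\ge0.$$ A flat deterministic solution is a pair of continuous processes $(X,K)$ satisfying this system with $K$ a non-decreasing deterministic function and $K_0=0$. Under the stated hypotheses there is a unique flat deterministic solution $(X,K)$. For a probability measure $\nu$ on $\mathbb{R}$ with finite first moment, $G_0(\nu)=\inf\{x\ge0:\int h(x+z)\,\nu(dz)\ge0\}$. Let $\mu_t$ be the law of $U_t=X_0+\int_0^t b(X_r)\,dr+\int_0^t\sigma(X_r)\,dB_r$; one has $K_t=\sup_{s\le t}G_0(\mu_s)$. Let $(X_0^i)_{i\ge1}$ be independent copies of $X_0$ and $(B^i)_{i\ge1}$ independent standard Brownian motions, independent of $(X_0^i)_{i\ge1}$. The independent copies of $X$ are $$\bar X^i_t=X^i_0+\int_0^t b(\bar X^i_s)\,ds+\int_0^t\sigma(\bar X^i_s)\,dB^i_s+\sup_{s\le t}G_0(\mu_s),\quad 1\le i\le N.$$ Let $T_k=kT/n$, $k=0,\dots,n$, and for $s\in[T_k,T_{k+1})$, $0\le k\le n-1$, set $\underline{s}=T_k$, with $\underline{T}=T$. The discretized particle system (same Brownian motions and initial variables) is $$\tilde X^i_t=X^i_0+\int_0^t b(\tilde X^i_{\underline s})\,ds+\int_0^t\sigma(\tilde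 X^i_{\underline s})\,dB^i_s+\sup_{s\le t}G_0(\tilde\mu^N_{\underline s}),\quad 1\le i\le N,\ t\in[0,T],$$ where $\tilde\mu^N_s=\frac1N\sum_{i=1}^N\delta_{\tilde U^i_s}$ and $\tilde U^i_t=X^i_0+\int_0^t b(\tilde X^i_{\underline s})\,ds+\int_0^t\sigma(\tilde X^i_{\underline s})\,dB^i_s$. (In these equations $X_0^i$ on the right-hand side is the given initial random variable; the value of $\tilde X^i$ at time $0$ also includes the term $G_0(\tilde\mu_0^N)$.) *)

(* Defs.v *)
From HB Require Import structures.
From mathcomp Require Import all_boot all_order all_algebra.
From mathcomp Require Import all_classical all_reals all_analysis.

Set Implicit Arguments.
Unset Strict Implicit.
Unset Printing Implicit Defensive.
Import Order.TTheory GRing.Theory Num.Theory.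
Import numFieldNormedType.Exports.

Local Open Scope classical_set_scope.
Local Open Scope ring_scope.

(* Processes are functions [R -> Omega -> R] of time and outcome; only their
   values at nonnegative times (or at times in [0, T]) are ever constrained. *)

Section stochastic_basis.
Context d (Omega : measurableType d) (R : realType) (P : probability Omega R).

Definition indep_systems (F G : set (set Omega)) :=
  forall A B, F A -> G B -> P (A `&` B) = (P A * P B)%E.

Definition mutually_indep_systems (I : eqType) (F : I -> set (set Omega)) :=
  forall (s : seq I) (A : I -> set Omega), uniq s ->
    (forall i, i \in s -> F i (A i)) ->
    P (\bigcap_(i in [set` s]) A i) = (\prod_(i <- s) P (A i))%E.

Definition sigma_rvs (I : Type) (D : set I) (Y : I -> Omega -> R) :
  set (set Omega) := <<s \bigcup_(i in D) g_sigma_algebra_preimage (Y i) >>.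

Definition sigma_process (W : R -> Omega -> R) :=
  sigma_rvs `[0, +oo[%classic W.

Definition rv_wrt (G : set (set Omega)) (f : Omega -> R) :=
  g_sigma_algebra_preimage f `<=` G.

Definition adapted (F : R -> set (set Omega)) (D : set R)
  (X : R -> Omega -> R) := forall t, D t -> rv_wrt (F t) (X t).

(* The augmented filtration generated by initial values [Y i] and driving
   processes [W i]. *)
Definition aug_filtration (I : Type) (Y : I -> Omega -> R)
    (W : I -> R -> Omega -> R) (t : R) : set (set Omega) :=
  <<s P.-negligible
      `|` \bigcup_(i in [set: I]) g_sigma_algebra_preimage (Y i)
      `|` \bigcup_(i in [set: I]) sigma_rvs `[0, t]%classic (W i) >>.

Definition aug_filtration1 (Y : Omega -> R) (W : R -> Omega -> R) :=
  aug_filtration (fun _ : unit => Y) (fun _ : unit => W).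

Definition ae_continuous (D : set R) (X : R -> Omega -> R) :=
  \forall w \ae P, {within D, continuous (fun t => X t w)}.

(* [normal_prob] takes the standard deviation as its second parameter. *)
Record brownian_motion (W : R -> Omega -> R) : Prop := {
  bm_measurable : forall t, 0 <= t -> measurable_fun setT (W t) ;
  bm_start : \forall w \ae P, W 0 w = 0 ;
  bm_continuous : ae_continuous `[0, +oo[ W ;
  bm_increment : forall s t, 0 <= s -> s < t -> forall A : set R, measurable A ->
    pushforward P (fun w => W t w - W s w) A
      = normal_prob 0 (Num.sqrt (t - s)) A ;
  bm_indep : forall s t, 0 <= s -> s < t ->
    indep_systems (g_sigma_algebra_preimage (fun w => W t w - W s w))
                  (sigma_rvs `[0, s]%classic W) }.

(* Stated with the outer measure of P, so that no measurability of the [f k]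
   is presupposed. *)
Definition cvg_to0_in_probability (f : nat -> Omega -> \bar R) :=
  forall e : R, 0 < e ->
    ((P^*)%mu [set w | (e%:E <= f k w)%E] @[k --> \oo] --> 0%E).

(* The simple process sum_(j < sp_size) sp_coef j * 1_]sp_time j, sp_time j.+1]. *)
Record step_process := StepProcess {
  sp_size : nat ;
  sp_time : nat -> R ;
  sp_coef : nat -> Omega -> R }.

Definition is_simple (F : R -> set (set Omega)) (S : step_process) :=
  0 <= sp_time S 0 /\
  forall j, (j < sp_size S)%N ->
    [/\ sp_time S j <= sp_time S j.+1,
        rv_wrt (F (sp_time S j)) (sp_coef S j) &
        exists c : R, forall w, `|sp_coef S j w| <= c].

Definition sp_val (S : step_process) (s : R) (w : Omega) : R :=
  \sum_(j < sp_size S)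
    sp_coef S j w * (sp_time S j < s <= sp_time S j.+1)%R%:R.

Definition sp_integral (S : step_process) (W : R -> Omega -> R)
    (t : R) (w : Omega) : R :=
  \sum_(j < sp_size S) sp_coef S j w *
    (W (Num.min t (sp_time S j.+1)) w - W (Num.min t (sp_time S j)) w).

(* [J] is (a continuous version of) the Ito integral of [H] against [W] over
   [0, T]: the limit in probability of integrals of simple processes that
   approximate [H] in L^2([0, T]) in probability. *)
Definition ito_integral (F : R -> set (set Omega)) (T : R)
    (W H J : R -> Omega -> R) :=
  [/\ adapted F `[0, T]%classic J,
      ae_continuous `[0, T] J &
      exists S : nat -> step_process,
        [/\ forall k, is_simple F (S k),
            cvg_to0_in_probability (fun k w =>
              (\int[lebesgue_measure]_(s in `[0%R, T])
                 ((H s w - sp_val (S k) s w) ^+ 2)%:E)%E) &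
            forall t, t \in `[0, T] ->
              cvg_to0_in_probability (fun k w =>
                `|J t w - sp_integral (S k) W t w|%:E)]].

(* U_t = Y + int_0^t b(X_s) ds + int_0^t sigma(X_s) dW_s for t in [0, T]. *)
Definition driven_by (F : R -> set (set Omega)) (T : R) (b sigma : R -> R)
    (Y : Omega -> R) (W X U : R -> Omega -> R) :=
  exists2 J, ito_integral F T W (fun s w => sigma (X s w)) J &
    \forall w \ae P, forall t, t \in `[0, T] ->
      U t w = Y w + \int[lebesgue_measure]_(s in `[0, t]) b (X s w) + J t w.

End stochastic_basis.

Section mean_reflection.
Context d (Omega : measurableType d) (R : realType) (P : probability Omega R).
Variables (b sigma h : R -> R).

Definition G0 (nu : set R -> \bar R) : R :=
  inf [set x | 0 <= x /\ (0 <= \int[nu]_z (h (x + z))%:E)%E].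

(* [K] is typed as a nondecreasing right-continuous function on the whole line
   to match [lebesgue_stieltjes_measure]; its values at negative times are
   irrelevant. *)
Record flat_solution (Y : Omega -> R) (W X U : R -> Omega -> R)
    (K : cumulative R R) : Prop := {
  flat_adapted : adapted (aug_filtration1 P Y W) `[0, +oo[%classic X ;
  flat_continuous : ae_continuous P `[0, +oo[ X ;
  flat_K_continuous : {within `[0, +oo[, continuous K} ;
  flat_K0 : K 0 = 0 ;
  flat_U : forall T, 0 < T ->
    driven_by P (aug_filtration1 P Y W) T b sigma Y W X U ;
  flat_eq : \forall w \ae P, forall t, 0 <= t -> X t w = U t w + K t ;
  flat_constraint : forall t, 0 <= t -> (0 <= 'E_P[h \o X t])%E ;
  flat_minimality : forall t, 0 <= t ->
    (\int[lebesgue_stieltjes_measure K]_(s in `]0%R, t]) 'E_P[h \o X s] = 0)%E }.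

(* [mu t] plays the role of the law of U_t for the mean reflected SDE. *)
Record solution_copy (mu : R -> set R -> \bar R) (Y : Omega -> R)
    (W X : R -> Omega -> R) : Prop := {
  copy_adapted : adapted (aug_filtration1 P Y W) `[0, +oo[%classic X ;
  copy_continuous : ae_continuous P `[0, +oo[ X ;
  copy_eq : exists2 U : R -> Omega -> R,
    forall T, 0 < T -> driven_by P (aug_filtration1 P Y W) T b sigma Y W X U &
    \forall w \ae P, forall t, 0 <= t ->
      X t w = U t w + sup [set G0 (mu s) | s in `[0, t]] }.

(* Index i : nat stands for the (i+1)-st copy or particle. *)
Record mean_reflected_setting (X0 : {RV P >-> R})
    (B X U : R -> Omega -> R) (K : cumulative R R)
    (Y : nat -> {RV P >-> R}) (W Xbar : nat -> R -> Omega -> R) : Prop := {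
  setting_B : brownian_motion P B ;
  setting_B_X0 :
    indep_systems P (g_sigma_algebra_preimage X0) (sigma_process B) ;
  setting_X : flat_solution X0 B X U K ;
  setting_Y_law : forall i (A : set R), measurable A ->
    distribution P (Y i) A = distribution P X0 A ;
  setting_Y_indep :
    mutually_indep_systems P (fun i => g_sigma_algebra_preimage (Y i)) ;
  setting_W : forall i, brownian_motion P (W i) ;
  setting_W_indep : mutually_indep_systems P (fun i => sigma_process (W i)) ;
  setting_W_Y : indep_systems P
    (sigma_rvs [set: nat] (fun i => Y i : Omega -> R))
    <<s \bigcup_i sigma_process (W i) >> ;
  setting_Xbar : forall i,
    solution_copy (fun t => pushforward P (U t)) (Y i) (W i) (Xbar i) }.

(* The largest grid point kT/n below s; it equals T at s = T. *)
Definition grid (T : R) (n : nat) (s : R) : R :=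
  (Num.floor (s * n%:R / T))%:~R * T / n%:R.

Definition empirical_measure (N : nat) (u : nat -> R) : set R -> \bar R :=
  mscale (N%:R^-1)%:nng (msum (fun i => \d_(u i)) N).

Definition euler_system (T : R) (N n : nat) (Y : nat -> Omega -> R)
    (W Xt Ut : nat -> R -> Omega -> R) :=
  let F := aug_filtration P (fun i : 'I_N => Y i) (fun i : 'I_N => W i) in
  forall i, (i < N)%N ->
    [/\ adapted F `[0, T]%classic (Xt i),
        driven_by P F T b sigma (Y i) (W i)
          (fun s => Xt i (grid T n s)) (Ut i) &
        \forall w \ae P, forall t, t \in `[0, T] ->
          Xt i t w = Ut i t w +
            sup [set G0 (empirical_measure N (fun j => Ut j (grid T n s) w))
                | s in `[0, t]]].

(* In the extended reals, so an upper bound entails finiteness. *)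
Definition sup_square_error (T : R) (X X' : R -> Omega -> R) : \bar R :=
  (\int[P]_w ereal_sup [set ((X t w - X' t w) ^+ 2)%:E | t in `[0%R, T]])%E.

End mean_reflection.

Definition C2_bounded_derivatives (R : realType) (h : R -> R) :=
  [/\ forall x, derivable h x 1,
      forall x, derivable (h^`())%classic x 1,
      continuous (h^`(2))%classic &
      exists L : R, forall x, `|(h^`())%classic x| <= L /\ `|(h^`(2))%classic x| <= L].

(* Main.v *)
(** The mean constraint acts on the solution only through the deterministic
    function K_t = sup_(s <= t) G0(law of U_s), so each copy solves an SDE with
    exogenous drift K, and Gronwall's lemma with the Lipschitz property of G0 bounds
    the fourth moments of U and the 1/2-Hoelder constants of K and of
    g_s = G0(law of U_s).  The map x |-> E h(x + U) has slope at least m, so its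
    root moves by at most 1/m times the change of the map there; hence the
    reflection error at a grid time is at most a multiple of the average over i
    of the errors on U^i plus the fluctuation of
    N^-1 sum_i (h(g_s + U^i_s) - E h(g_s + U_s)).  This is an average of centred
    independent processes whose increments over [s, t] have fourth moments
    O(N^-2 (t - s)^2), so by Moricz's maximal inequality the square of its
    maximum over the grid has mean O(1/N).  The oscillation of g between grid
    times and the Euler error contribute O(1/n), and a discrete Gronwall argument
    yields the bound C(1/n + 1/N), which implies both parts.

    Stochastic integrals are handled without Ito's formula: for adapted
    integrands that are continuous on an interval they are limits in probability
    of Riemann sums, and moment bounds pass from these discrete martingale sums
    to the limit by Fatou's lemma. *)

(* The orders come from what is sampled where. The processes U are compared at all times but carry
   no reflection, so the Euler error meets only mean squares of increments of X over one cell. The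
   reflections are compared at grid times, and between them only the deterministic g oscillates; the
   modulus of continuity of Brownian paths, which would cost a logarithm, never appears. The root
   comparison evaluates both maps at the single deterministic point g_s, so no distance between an
   empirical measure and a law has to be estimated. Fourth moments are the price of the maximum over
   the grid: chaining needs a power of t - s above 1. Two obstacles shape the rest. Moments of a
   solution are not finite a priori, so Gronwall's argument is first run on events where the path
   stays bounded, then once more to free the constants from the size of K. And the centring uses E
   h(g_s + U_s) for a U driven by another Brownian motion, so the copies must be shown to have the
   law of that U. *)
Require Import Defs.
From HB Require Import structures.
From mathcomp Require Import all_boot all_order all_algebra.
From mathcomp Require Import all_classical all_reals all_analysis measurable_realfun.
From mathcomp Require Import ring lra zify.

Set Implicit Arguments.
Unset Strict Implicit.
Unset Printing Implicit Defensive.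
Import Order.TTheory GRing.Theory Num.Theory.
Import numFieldNormedType.Exports.

Local Open Scope classical_set_scope.
Local Open Scope ring_scope.

(** * Means of nonnegative and of centred random variables *)

Section mean_le.
Context d (Omega : measurableType d) (R : realType) (P : probability Omega R).
Implicit Types (f g : Omega -> R) (a b c : R).

(* Bundles measurability and sign with the bound, so that moment estimates can
   be added, scaled and compared without side conditions. *)
Definition mean_le f a :=
  [/\ measurable_fun setT f, forall w, 0 <= f w &
      (\int[P]_w (f w)%:E <= a%:E)%E].

Definition mean0 f :=
  P.-integrable setT (EFin \o f) /\ (\int[P]_w (f w)%:E = 0)%E.

Lemma mean_le_ge0 f a : mean_le f a -> 0 <= a.
Proof.
case=> _ f0 fa; rewrite -lee_fin; apply: le_trans fa.
by apply: integral_ge0 => w _; rewrite lee_fin.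
Qed.

Lemma mean_le_trans f a b : a <= b -> mean_le f a -> mean_le f b.
Proof. by move=> ab [? ? fa]; split=> //; apply: le_trans fa _; rewrite lee_fin. Qed.

Lemma mean_leD f g a b :
  mean_le f a -> mean_le g b -> mean_le (fun w => f w + g w) (a + b).
Proof.
move=> [mf f0 fa] [mg g0 gb]; split; first exact: measurable_funD.
- by move=> w; rewrite addr_ge0.
- under eq_integral do rewrite EFinD.
  rewrite ge0_integralD//.
  + by rewrite EFinD leeD.
  + by move=> w _; rewrite lee_fin.
  + exact/measurable_EFinP.
  + by move=> w _; rewrite lee_fin.
  + exact/measurable_EFinP.
Qed.

Lemma mean_leZ f a c : 0 <= c ->
  mean_le f a -> mean_le (fun w => c * f w) (c * a).
Proof.
move=> c0 [mf f0 fa]; split; first exact: measurable_funM.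
- by move=> w; rewrite mulr_ge0.
- under eq_integral do rewrite EFinM.
  rewrite ge0_integralZl//.
  + by rewrite EFinM lee_wpmul2l// lee_fin.
  + exact/measurable_EFinP.
  + by move=> w _; rewrite lee_fin.
Qed.

Lemma mean_le_cst c : 0 <= c -> mean_le (cst c) c.
Proof.
move=> c0; split=> //.
rewrite (integral_cst P measurableT c%:E) [X in (_ * X)%E](_ : _ = 1%E) ?mule1//.
exact: probability_setT.
Qed.

Lemma mean_le_sum_nat n (F : nat -> Omega -> R) (a : nat -> R) :
  (forall i, (i < n)%N -> mean_le (F i) (a i)) ->
  mean_le (fun w => \sum_(0 <= i < n) F i w) (\sum_(0 <= i < n) a i).
Proof.
elim: n => [|n IH] Fa.
  rewrite big_nil; under [X in mean_le X]funext do rewrite big_nil.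
  exact: mean_le_cst.
rewrite big_nat_recr//=; under [X in mean_le X]funext do rewrite big_nat_recr//=.
by apply: mean_leD; [apply: IH => i ni; apply: Fa; rewrite ltnS ltnW|exact: Fa].
Qed.

Lemma mean_le_ae f g a : measurable_fun setT f -> (forall w, 0 <= f w) ->
  (\forall w \ae P, f w <= g w) -> mean_le g a -> mean_le f a.
Proof.
move=> mf f0 fg [mg g0 ga]; split=> //; apply: le_trans ga.
apply: ae_ge0_le_integral => //.
- by move=> w _; rewrite lee_fin.
- exact/measurable_EFinP.
- by move=> w _; rewrite lee_fin.
- exact/measurable_EFinP.
- by apply: filterS fg => w fg _; rewrite lee_fin.
Qed.

Lemma mean_le_le f g a : measurable_fun setT f -> (forall w, 0 <= f w) ->
  (forall w, f w <= g w) -> mean_le g a -> mean_le f a.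
Proof. by move=> mf f0 fg; apply: mean_le_ae => //; apply: aeW. Qed.

Lemma mean_le_integrable f a : mean_le f a -> P.-integrable setT (EFin \o f).
Proof.
move=> [mf f0 fa]; apply/integrableP; split; first exact/measurable_EFinP.
under eq_integral do rewrite /= ger0_norm//.
exact: le_lt_trans fa (ltry _).
Qed.

Lemma mean_le_norm_integrable f a : measurable_fun setT f ->
  mean_le (fun w => `|f w|) a -> P.-integrable setT (EFin \o f).
Proof.
move=> mf [_ _ fa]; apply/integrableP; split; first exact/measurable_EFinP.
exact: le_lt_trans fa (ltry _).
Qed.

Lemma integrable_mean_le f : P.-integrable setT (EFin \o f) ->
  exists a, mean_le (fun w => `|f w|) a.
Proof.
move=> /integrableP[/measurable_EFinP mf fi].
have f0 : (0 <= \int[P]_w (`|f w|)%:E)%E.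
  by apply: integral_ge0 => w _; rewrite lee_fin.
exists (fine (\int[P]_w (`|f w|)%:E)); split=> //.
  by apply: measurableT_comp.
by rewrite fineK// ge0_fin_numE.
Qed.

(** The pattern of the moment bounds for sums: a power is expanded, its even terms are bounded in
    [f], and its odd terms, which are centred, are collected in [g]. Only the sum has to be
    nonnegative. *)
Lemma mean_le_add0 f g a : mean_le f a -> mean0 g ->
  (forall w, 0 <= f w + g w) -> mean_le (fun w => f w + g w) a.
Proof.
move=> fa [gi g0] fg0; have fi := mean_le_integrable fa.
have [mf f0 fa'] := fa.
have mg : measurable_fun setT g by apply/measurable_EFinP; case/integrableP: gi.
split; [exact: measurable_funD|by []|].
under eq_integral do rewrite EFinD.
by rewrite integralD// g0 adde0.
Qed.

Lemma mean0D f g : mean0 f -> mean0 g -> mean0 (fun w => f w + g w).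
Proof.
move=> [fi f0] [gi g0]; split; first exact: (integrableD _ fi gi).
under eq_integral do rewrite EFinD.
by rewrite integralD// f0 g0 adde0.
Qed.

Lemma mean0Z f c : mean0 f -> mean0 (fun w => c * f w).
Proof.
move=> [fi f0]; split; first exact: (integrableZl _ c fi).
under eq_integral do rewrite EFinM.
by rewrite integralZl// f0 mule0.
Qed.

Lemma mean0_0 : mean0 (cst 0).
Proof. by split; [exact: integrable0|rewrite integral0]. Qed.

Lemma mean0_sum_nat n (F : nat -> Omega -> R) :
  (forall i, (i < n)%N -> mean0 (F i)) ->
  mean0 (fun w => \sum_(0 <= i < n) F i w).
Proof.
elim: n => [|n IH] Fa.
  under [X in mean0 X]funext do rewrite big_nil.
  exact: mean0_0.
under [X in mean0 X]funext do rewrite big_nat_recr//=.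
by apply: mean0D; [apply: IH => i ni; apply: Fa; rewrite ltnS ltnW|exact: Fa].
Qed.

Lemma markov_mean_le f a e : mean_le f a -> 0 < e ->
  (P [set w | (e <= f w)%R] <= (a / e)%:E)%E.
Proof.
move=> [mf f0 fa] e0.
have mE : measurable [set w | e <= f w].
  by rewrite -[X in measurable X]setTI; apply: measurable_fun_le.
rewrite EFinM muleC -lee_pdivrMl ?invr_gt0// invrK.
apply: le_trans fa.
rewrite -[X in (X <= _)%E]mul1e -[1%E]/(1%:E) mul1e.
have -> : (e%:E * P [set w | (e <= f w)%R] = \int[P]_(w in [set w | (e <= f w)%R]) e%:E)%E.
  by rewrite integral_cst.
rewrite integral_mkcond; apply: ge0_le_integral => //.
- by move=> w _; apply: erestrict_ge0 => ? _; rewrite lee_fin ltW.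
- by apply/(measurable_restrictT _ mE); exact: measurable_cst.
- exact/measurable_EFinP.
- move=> w _; rewrite patchE; case: ifPn; last by rewrite lee_fin.
  by rewrite inE /= lee_fin.
Qed.

(** Monotone convergence; the supremum of the [F n] has to dominate [f] almost everywhere. It serves
    to remove truncations and localisations. *)
Lemma mean_le_lim (F : nat -> Omega -> R) f a : measurable_fun setT f ->
  (forall w, 0 <= f w) -> (forall n, mean_le (F n) a) ->
  (forall w, {homo F^~ w : n m / (n <= m)%N >-> n <= m}) ->
  (\forall w \ae P, forall e, 0 < e -> exists n, f w - e <= F n w) ->
  mean_le f a.
Proof.
move=> mf f0 Fa ndF Ff; split=> //.
have Flim w : (f w)%:E != +oo%E by [].
pose G w := limn (fun n => (F n w)%:E).
have mF n : measurable_fun setT (EFin \o F n).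
  by apply/measurable_EFinP; have [] := Fa n.
have cG w : (fun n => (F n w)%:E) @ \oo --> G w.
  by apply: ereal_nondecreasing_is_cvgn => n m nm; rewrite lee_fin ndF.
have mG : measurable_fun setT G.
  by apply: (emeasurable_fun_cvg (fun n => EFin \o F n)) => // w _; exact: cG.
have GF w n : ((F n w)%:E <= G w)%E.
  have nd : {homo (fun n => (F n w)%:E) : i j / (i <= j)%N >-> (i <= j)%E}.
    by move=> i j ij; rewrite lee_fin ndF.
  rewrite /G (cvg_lim _ (ereal_nondecreasing_cvgn nd))//.
  by apply: ereal_sup_ubound; exists n.
apply: (@le_trans _ _ (\int[P]_w G w)%E).
  apply: ae_ge0_le_integral => //.
  - by move=> w _; rewrite lee_fin.
  - exact/measurable_EFinP.
  - move=> w _; apply: le_trans (GF w 0%N); rewrite lee_fin.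
    by have [_ ->] := Fa 0%N.
  - apply: filterS Ff => w Ff _.
    apply/lee_subgt0Pr => e e0; have [n Hn] := Ff e e0.
    by apply: le_trans (GF w n); rewrite -EFinB lee_fin.
rewrite /G monotone_convergence//.
- apply: lime_le.
    apply: ereal_nondecreasing_is_cvgn => n m nm; apply: ge0_le_integral => //.
    + by move=> w _; rewrite lee_fin; have [_ ->] := Fa n.
    + exact: mF.
    + exact: mF.
    + by move=> w _; rewrite lee_fin ndF.
  by apply: nearW => n; have [] := Fa n.
- by move=> n w _; rewrite lee_fin; have [_ ->] := Fa n.
- by move=> w _ n m nm; rewrite lee_fin ndF.
Qed.

End mean_le.

(** * Independence and means of products *)

Section independence.
Context d (Omega : measurableType d) (R : realType) (P : probability Omega R).
Implicit Types (X Y : Omega -> R).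

Definition indep_rv X Y := forall A B : set R, measurable A -> measurable B ->
  P (X @^-1` A `&` Y @^-1` B) = (P (X @^-1` A) * P (Y @^-1` B))%E.

Lemma indep_rvC X Y : indep_rv X Y -> indep_rv Y X.
Proof. by move=> XY A B mA mB; rewrite setIC XY// muleC. Qed.

Lemma indep_rv_comp X Y (f g : R -> R) :
  measurable_fun setT f -> measurable_fun setT g ->
  indep_rv X Y -> indep_rv (f \o X) (g \o Y).
Proof.
move=> mf mg XY A B mA mB; apply: (XY (f @^-1` A) (g @^-1` B)).
- by rewrite -[X in measurable X]setTI; exact: mf.
- by rewrite -[X in measurable X]setTI; exact: mg.
Qed.

Definition mfun_of X (mX : measurable_fun setT X) : {mfun Omega >-> R} :=
  mfun_Sub (mem_set mX).

Lemma indep_joint_law X Y (mX : measurable_fun setT X)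
    (mY : measurable_fun setT Y) : indep_rv X Y ->
  forall C : set (R * R), measurable C ->
  P [set w | C (X w, Y w)] =
  (distribution P (mfun_of mX) \x distribution P (mfun_of mY))%E C.
Proof.
move=> XY C mC.
have mXY : measurable_fun setT (fun w => (X w, Y w)).
  exact: measurable_fun_pair.
pose Z : {mfun Omega >-> (R * R)%type} := mfun_Sub (mem_set mXY).
apply/esym; rewrite (product_measure_unique (m' := distribution P Z))//.
Qed.

Lemma indep_ge0_expectation X Y :
  measurable_fun setT X -> measurable_fun setT Y ->
  (forall w, 0 <= X w) -> (forall w, 0 <= Y w) -> indep_rv X Y ->
  (\int[P]_w (X w * Y w)%:E = \int[P]_w (X w)%:E * \int[P]_w (Y w)%:E)%E.
Proof.
move=> mX mY X0 Y0 XY.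
have mXY : measurable_fun setT (fun w => (X w, Y w)).
  exact: measurable_fun_pair.
pose Z : {mfun Omega >-> (R * R)%type} := mfun_Sub (mem_set mXY).
(* Tonelli's theorem asks for an integrand that is nonnegative on the whole plane, so the
   coordinates are replaced by their positive parts, which agree with them on the ranges of [X] and
   [Y]. *)
pose pos (x : R) : \bar R := (Num.max x 0)%:E.
have pos0 x : (0 <= pos x)%E by rewrite lee_fin le_max lexx orbT.
have mpos : measurable_fun setT pos.
  by apply/measurable_EFinP; apply: measurable_maxr.
have posX w : pos (X w) = (X w)%:E by rewrite /pos max_l.
have posY w : pos (Y w) = (Y w)%:E by rewrite /pos max_l.
pose f (z : R * R) := (pos z.1 * pos z.2)%E.
have f0 z : (0 <= f z)%E by rewrite mule_ge0.
have mf : measurable_fun setT f.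
  apply: emeasurable_funM.
    exact: (measurableT_comp mpos measurable_fst).
  exact: (measurableT_comp mpos measurable_snd).
transitivity (\int[distribution P Z]_z f z)%E.
  rewrite ge0_integral_distribution//.
  by apply: eq_integral => w _; rewrite /f/= posX posY EFinM.
transitivity (\int[distribution P (mfun_of mX) \x distribution P (mfun_of mY)]_z f z)%E.
  apply: eq_measure_integral => C mC _.
  exact: (indep_joint_law mX mY XY mC).
rewrite fubini_tonelli1//.
transitivity (\int[distribution P (mfun_of mX)]_x
   (pos x * \int[distribution P (mfun_of mY)]_y pos y))%E.
  apply: eq_integral => x _; rewrite /fubini_F /f/=.
  by rewrite ge0_integralZl.
rewrite ge0_integralZr//; last exact: integral_ge0.
rewrite !ge0_integral_distribution//.
by congr (_ * _)%E; apply: eq_integral => w _; rewrite /= ?posX ?posY.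
Qed.

Lemma mean_le_indepM X Y a b : indep_rv X Y ->
  mean_le P X a -> mean_le P Y b -> mean_le P (fun w => X w * Y w) (a * b).
Proof.
move=> XY [mX X0 Xa] [mY Y0 Yb]; split; first exact: measurable_funM.
  by move=> w; rewrite mulr_ge0.
rewrite indep_ge0_expectation// EFinM lee_pmul//.
- by apply: integral_ge0 => w _; rewrite lee_fin.
- by apply: integral_ge0 => w _; rewrite lee_fin.
Qed.

(** Means of products are available for nonnegative factors, so both variables are split into
    positive and negative parts; E Y+ = E Y- then cancels the products with each part of X
    separately. *)
Lemma mean0_indepM X Y : indep_rv X Y ->
  P.-integrable setT (EFin \o X) -> mean0 P Y -> mean0 P (fun w => X w * Y w).
Proof.
move=> XY Xi [Yi Y0].
have mX : measurable_fun setT X by apply/measurable_EFinP; case/integrableP: Xi.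
have mY : measurable_fun setT Y by apply/measurable_EFinP; case/integrableP: Yi.
have [a Xa] := integrable_mean_le Xi; have [b Yb] := integrable_mean_le Yi.
pose Xp w := Num.max (X w) 0; pose Xn w := Num.max (- X w) 0.
pose Yp w := Num.max (Y w) 0; pose Yn w := Num.max (- Y w) 0.
have mp : measurable_fun setT (fun x : R => Num.max x 0) by apply: measurable_maxr.
have mn : measurable_fun setT (fun x : R => Num.max (- x) 0).
  by apply: measurable_maxr => //; exact: measurable_funN.
have mXp : measurable_fun setT Xp by exact: (measurableT_comp mp mX).
have mXn : measurable_fun setT Xn by exact: (measurableT_comp mn mX).
have mYp : measurable_fun setT Yp by exact: (measurableT_comp mp mY).
have mYn : measurable_fun setT Yn by exact: (measurableT_comp mn mY).
have maxr0 (x : R) : 0 <= Num.max x 0 by rewrite le_max lexx orbT.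
have maxn (x : R) : Num.max x 0 <= `|x| by rewrite ge_max normr_ge0 ler_norm.
have pnE (x : R) : x = Num.max x 0 - Num.max (- x) 0.
  have [x0|x0] := leP 0 x.
    by rewrite (max_r (x := - x)) ?oppr_le0// subr0.
  by rewrite (max_l (x := - x)) ?oppr_ge0 ?ltW// sub0r opprK.
have cXp : mean_le P Xp a.
  by apply: (mean_le_le mXp _ _ Xa) => w; [exact: maxr0|exact: maxn].
have cXn : mean_le P Xn a.
  apply: (mean_le_le mXn _ _ Xa) => w; first exact: maxr0.
  by rewrite -normrN maxn.
have cYp : mean_le P Yp b.
  by apply: (mean_le_le mYp _ _ Yb) => w; [exact: maxr0|exact: maxn].
have cYn : mean_le P Yn b.
  apply: (mean_le_le mYn _ _ Yb) => w; first exact: maxr0.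
  by rewrite -normrN maxn.
have Ypn : (\int[P]_w (Yp w)%:E = \int[P]_w (Yn w)%:E)%E.
  have Ypi := mean_le_integrable cYp; have Yni := mean_le_integrable cYn.
  have : (\int[P]_w (Yp w)%:E - \int[P]_w (Yn w)%:E = 0)%E.
    rewrite -integralB// -[RHS]Y0; apply: eq_integral => w _.
    by rewrite -EFinB -pnE.
  have xy (x y : \bar R) : x \is a fin_num -> y \is a fin_num ->
      (x - y = 0)%E -> x = y.
    by case: x => [x| |]//; case: y => [y| |]// _ _ [/eqP];
      rewrite subr_eq0 => /eqP ->.
  apply: xy; first exact: (integrable_fin_num _ Ypi).
  exact: (integrable_fin_num _ Yni).
have key (Z : Omega -> R) : measurable_fun setT Z -> (forall w, 0 <= Z w) ->
    indep_rv Z Yp -> indep_rv Z Yn -> mean_le P Z a ->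
    mean0 P (fun w => Z w * Y w).
  move=> mZ Z0 ZYp ZYn Za.
  have Zpi := mean_le_integrable (mean_le_indepM ZYp Za cYp).
  have Zni := mean_le_integrable (mean_le_indepM ZYn Za cYn).
  have ZE : (fun w => (Z w * Y w)%:E) =
      (fun w => (Z w * Yp w)%:E - (Z w * Yn w)%:E)%E.
    by apply/funext => w; rewrite -EFinB -mulrBr -pnE.
  split; first by rewrite [X in integrable _ _ X]ZE; exact: integrableB.
  rewrite ZE integralB//.
  rewrite !indep_ge0_expectation//; try by move=> w; exact: maxr0.
  rewrite Ypn subee//; apply: fin_numM.
    exact: (integrable_fin_num _ (mean_le_integrable Za)).
  exact: (integrable_fin_num _ (mean_le_integrable cYn)).
have XYE : (fun w => X w * Y w) = (fun w => Xp w * Y w + (-1) * (Xn w * Y w)).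
  by apply/funext => w; rewrite [X w]pnE -/(Xp w) -/(Xn w) mulrBl mulN1r.
rewrite XYE; apply: mean0D; last apply: mean0Z.
- apply: key => //; [by move=> w; exact: maxr0|..].
  + exact: (indep_rv_comp mp mp XY).
  + exact: (indep_rv_comp mp mn XY).
- apply: key => //; [by move=> w; exact: maxr0|..].
  + exact: (indep_rv_comp mn mp XY).
  + exact: (indep_rv_comp mn mn XY).
Qed.

End independence.

(** * Gaussian moments *)

Section gaussian.
Context (R : realType).
Local Notation leb := (@lebesgue_measure R).

(** The Radon-Nikodym derivative of the law and [normal_pdf] have the same integral over every
    measurable set, hence agree almost everywhere. *)
Lemma ge0_integral_normal (s : R) (f : R -> \bar R) : s != 0 ->
  measurable_fun setT f -> (forall x, (0 <= f x)%E) ->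
  (\int[normal_prob 0%R s]_x f x = \int[leb]_x (f x * (normal_pdf 0 s x)%:E))%E.
Proof.
move=> s0 mf f0.
have dom := normal_prob_dominates 0 s.
rewrite -(Radon_Nikodym_SigmaFinite.change_of_variables dom)//.
apply: ae_eq_integral => //.
- apply: emeasurable_funM => //.
  exact: (measurable_int _ (Radon_Nikodym_SigmaFinite.f_integrable dom)).
- apply: emeasurable_funM => //; apply/measurable_EFinP.
  exact: measurable_normal_pdf.
- apply: ae_eqe_mul2l; apply: integral_ae_eq => //.
  + exact: Radon_Nikodym_SigmaFinite.f_integrable.
  + by apply/measurable_EFinP; exact: measurable_normal_pdf.
  + by move=> E _ mE; rewrite -Radon_Nikodym_SigmaFinite.f_integral.
Qed.

Lemma normal_prob_sym (s : R) (A : set R) : s != 0 -> measurable A ->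
  normal_prob 0 s (-%R @^-1` A) = normal_prob 0 s A.
Proof.
move=> s0 mA.
have mN : measurable_fun setT (-%R : R -> R) by exact: oppr_measurable.
have mp : measurable_fun setT (fun x => (normal_pdf 0 s x)%:E).
  by apply/measurable_EFinP; exact: measurable_normal_pdf.
have pe x : normal_pdf 0 s (- x) = normal_pdf 0 s x.
  rewrite !normal_pdfE// /normal_fun !subr0 sqrrN//.
rewrite /normal_prob.
transitivity (\int[pushforward leb (-%R : _ -> measurableTypeR R)]_(x in A) (normal_pdf 0 s x)%:E)%E.
  rewrite ge0_integral_pushforward//=.
  - by apply: eq_integral => x _ /=; rewrite pe.
  - exact: measurable_funS mp.
  - by move=> x _; rewrite lee_fin normal_pdf_ge0.
by apply: eq_measure_integral => B mB _; exact: lebesgue_measureN.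
Qed.

Lemma sqr_le_4expR (y : R) : 0 <= y -> y ^+ 2 <= 4 * expR y.
Proof.
move=> y0; have -> : expR y = expR (y / 2) ^+ 2.
  by rewrite -expRM_natl; congr expR; field.
have := expR_ge1Dx (y / 2); set e := expR _ => h.
have h2 : y / 2 <= e by apply: le_trans h; rewrite lerDr.
have : (y / 2) ^+ 2 <= e ^+ 2 by rewrite lerXn2r// nnegrE ?divr_ge0// (le_trans _ h2)// divr_ge0.
by rewrite expr_div_n; lra.
Qed.

(** The Gaussian of doubled variance keeps half of the exponent, and the other half absorbs x^4.
    With y = x^2 / (4 s^2) one has x^4 = 16 s^4 y^2 and y^2 exp (- y) <= 4, and the ratio of the
    peaks costs at most 2: 128 = 16 * 4 * 2. *)
Lemma normal_pdf_moment4 (s x : R) : 0 < s ->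
  x ^+ 4 * normal_pdf 0 s x <=
  128 * s ^+ 4 * normal_pdf 0 (Num.sqrt 2 * s) x.
Proof.
move=> s0.
have r20 : 0 < Num.sqrt 2 :> R by rewrite sqrtr_gt0.
have r2 : Num.sqrt 2 <= 2 :> R.
  have := sqr_sqrtr (ler0n R 2); set r := Num.sqrt _ in r20 *; nra.
rewrite !normal_pdfE ?gt_eqF ?mulr_gt0// /normal_fun /normal_peak !subr0.
have q : (Num.sqrt 2 * s) ^+ 2 = 2 * s ^+ 2 by rewrite exprMn sqr_sqrtr.
rewrite q.
set y := x ^+ 2 / (4 * s ^+ 2).
have y0 : 0 <= y.
  by apply: divr_ge0; [exact: sqr_ge0|apply: mulr_ge0; [|exact: sqr_ge0]].
have s2 : s != 0 by rewrite gt_eqF.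
have -> : - x ^+ 2 / (s ^+ 2 *+ 2) = - (2 * y) by rewrite /y; field.
have -> : - x ^+ 2 / (2 * s ^+ 2 *+ 2) = - y by rewrite /y; field.
have -> : x ^+ 4 = 16 * s ^+ 4 * y ^+ 2 by rewrite /y; field.
have -> : expR (- (2 * y)) = expR (- y) * expR (- y).
  by rewrite -expRD; congr expR; ring.
have -> : 2 * s ^+ 2 * pi *+ 2 = 2 * (s ^+ 2 * pi *+ 2) by ring.
rewrite (sqrtrM _ (ler0n R 2)) invfM.
set p := (Num.sqrt (s ^+ 2 * pi *+ 2))^-1.
have p0 : 0 <= p by rewrite invr_ge0 sqrtr_ge0.
have e0 : 0 <= expR (- y) by exact: expR_ge0.
have ye : y ^+ 2 * expR (- y) <= 4.
  by rewrite expRN ler_pdivrMr ?expR_gt0//; exact: sqr_le_4expR.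
have h : (Num.sqrt 2)^-1 >= 2^-1 :> R by rewrite lef_pV2 ?posrE.
have -> : 16 * s ^+ 4 * y ^+ 2 * (p * (expR (- y) * expR (- y))) =
   16 * s ^+ 4 * p * expR (- y) * (y ^+ 2 * expR (- y)) by ring.
have -> : 128 * s ^+ 4 * ((Num.sqrt 2)^-1 * p * expR (- y)) =
   16 * s ^+ 4 * p * expR (- y) * (8 * (Num.sqrt 2)^-1) by ring.
apply: ler_wpM2l; last by lra.
by rewrite mulr_ge0// mulr_ge0// mulr_ge0// exprn_ge0// ltW.
Qed.

Context d (Omega : measurableType d) (P : probability Omega R).

(* [normal_prob] lives on [measurableTypeR R], which is convertible to the
   canonical measurable structure of [R] but carries another display. *)
Definition mfunR_of (D : Omega -> R) (mD : measurable_fun setT D) :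
  {mfun Omega >-> measurableTypeR R} :=
  @mfun_Sub _ _ _ (measurableTypeR R) _ (mem_set mD).

Lemma mean_le_normal4 (D : Omega -> R) (s : R) : 0 < s ->
  measurable_fun setT D ->
  (forall A, measurable A -> P (D @^-1` A) = normal_prob 0 s A) ->
  mean_le P (fun w => D w ^+ 4) (128 * s ^+ 4).
Proof.
move=> s0 mD DE; split; first exact: measurable_funX.
  by move=> w; rewrite exprn_even_ge0.
have m4 : measurable_fun setT (fun x : R => (x ^+ 4)%:E).
  by apply/measurable_EFinP; exact: exprn_measurable.
have p4 (x : R) : (0 <= (x ^+ 4)%:E)%E by rewrite lee_fin exprn_even_ge0.
have s20 : Num.sqrt 2 * s != 0 by rewrite gt_eqF// mulr_gt0// sqrtr_gt0.
have -> : (\int[P]_w (D w ^+ 4)%:E = \int[distribution P (mfunR_of mD)]_x (x ^+ 4)%:E)%E.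
  by rewrite ge0_integral_distribution.
have -> : (\int[distribution P (mfunR_of mD)]_x (x ^+ 4)%:E =
    \int[normal_prob 0%R s]_x (x ^+ 4)%:E)%E.
  by apply: eq_measure_integral => A mA _; exact: DE.
rewrite ge0_integral_normal// ?gt_eqF//.
apply: (@le_trans _ _ (\int[leb]_x ((128 * s ^+ 4)%:E * (normal_pdf 0 (Num.sqrt 2 * s) x)%:E))%E).
  apply: ge0_le_integral => //.
  - by move=> x _; rewrite mule_ge0// lee_fin normal_pdf_ge0.
  - by apply: emeasurable_funM => //; apply/measurable_EFinP; exact: measurable_normal_pdf.
  - by apply: emeasurable_funM => //; apply/measurable_EFinP; exact: measurable_normal_pdf.
  - by move=> x _; rewrite -!EFinM lee_fin normal_pdf_moment4.
rewrite ge0_integralZl//.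
- by rewrite integral_normal_pdf// mule1.
- by apply/measurable_EFinP; exact: measurable_normal_pdf.
- by move=> x _; rewrite lee_fin normal_pdf_ge0.
- by rewrite lee_fin mulr_ge0// exprn_ge0// ltW.
Qed.

Lemma mean_le_normal2 (D : Omega -> R) (s : R) : 0 < s ->
  measurable_fun setT D ->
  (forall A, measurable A -> P (D @^-1` A) = normal_prob 0 s A) ->
  mean_le P (fun w => D w ^+ 2) (65 * s ^+ 2).
Proof.
move=> s0 mD DE; have h4 := mean_le_normal4 s0 mD DE.
have s20 : 0 < s ^+ 2 by rewrite exprn_gt0.
(* Young's inequality D^2 <= D^4 / (2 s^2) + s^2 / 2 gives 64 + 1/2, rounded up to 65. *)
apply: (@mean_le_trans _ _ _ _ _ ((2 * s ^+ 2)^-1 * (128 * s ^+ 4) + s ^+ 2 / 2)).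
  have -> : (2 * s ^+ 2)^-1 * (128 * s ^+ 4) = 64 * s ^+ 2.
    by field; rewrite gt_eqF.
  by lra.
apply: (@mean_le_le _ _ _ _ _ (fun w => (2 * s ^+ 2)^-1 * D w ^+ 4 + s ^+ 2 / 2)).
- exact: measurable_funX.
- by move=> w; exact: sqr_ge0.
- move=> w; rewrite -subr_ge0.
  have -> : (2 * s ^+ 2)^-1 * D w ^+ 4 + s ^+ 2 / 2 - D w ^+ 2 =
    (2 * s ^+ 2)^-1 * (D w ^+ 2 - s ^+ 2) ^+ 2 by field; rewrite gt_eqF.
  by rewrite mulr_ge0 ?sqr_ge0// invr_ge0 mulr_ge0// ltW.
- apply: mean_leD; last by apply: mean_le_cst; rewrite divr_ge0// ltW.
  by apply: mean_leZ => //; rewrite invr_ge0 mulr_ge0// ltW.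
Qed.

(** The laws of [D] and [- D] agree, so the mean of an odd function of [D] equals its own
    opposite. *)
Lemma mean0_odd_normal (D : Omega -> R) (s : R) (f : R -> R) a : 0 < s ->
  measurable_fun setT D ->
  (forall A, measurable A -> P (D @^-1` A) = normal_prob 0 s A) ->
  measurable_fun setT f -> (forall x, f (- x) = - f x) ->
  mean_le P (fun w => `|f (D w)|) a -> mean0 P (f \o D).
Proof.
move=> s0 mD DE mf fN fa.
have mfD : measurable_fun setT (f \o D) by exact: measurableT_comp.
have mND : measurable_fun setT (fun w => - D w) by exact: measurable_funN.
have fi := mean_le_norm_integrable mfD fa.
split=> //.
have Nfi : P.-integrable setT ((EFin \o f) \o (fun w => - D w)).
  apply: eq_integrable (integrableN fi) => // w _ /=.
  by rewrite fN EFinN.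
have e1 : (\int[P]_w ((f \o D) w)%:E = \int[distribution P (mfunR_of mD)]_x (EFin \o f) x)%E.
  by rewrite integral_distribution//; exact/measurable_EFinP.
have e2 : (\int[P]_w (((EFin \o f) \o (fun w => (- D w)%R)) w) =
    \int[distribution P (mfunR_of mND)]_x (EFin \o f) x)%E.
  by rewrite integral_distribution//; exact/measurable_EFinP.
have e3 : (\int[P]_w ((f \o D) w)%:E = - \int[P]_w ((f \o D) w)%:E)%E.
  rewrite -integralN//; last exact: integrable_add_def.
  rewrite [LHS]e1; transitivity (\int[distribution P (mfunR_of mND)]_x (EFin \o f) x)%E.
    apply: eq_measure_integral => A mA _.
    rewrite /distribution /pushforward /=.
    have mA' : measurable (-%R @^-1` A).
      by rewrite -[X in measurable X]setTI; exact: oppr_measurable.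
    transitivity (normal_prob 0 s A); first exact: DE.
    rewrite -normal_prob_sym ?gt_eqF//.
    exact: (esym (DE _ mA')).
  rewrite -e2; apply: eq_integral => w _ /=.
  by rewrite fN EFinN.
have := integrable_fin_num measurableT fi.
move: e3; case: (\int[P]_w _)%E => [r| |]//= [] e _.
by congr EFin; lra.
Qed.

End gaussian.

(** * Random variables measurable for a sub-sigma-algebra *)

Section rv_wrt.
Context d (Omega : measurableType d) (R : realType).
Implicit Types (G : set (set Omega)) (f g : Omega -> R).

(** Makes [G] the measurable structure of the sample space, so that the closure properties of
    measurable functions carry over to [rv_wrt G]. *)
Lemma rv_wrtP G f : sigma_algebra setT G ->
  rv_wrt G f <-> measurable_fun setT (f : g_sigma_algebraType G -> R).
Proof.
move=> sG; have GE : <<s G >> = G by exact: sigma_algebra_id.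
split=> [Gf _ B mB|mf _ [B mB <-]].
  by rewrite /measurable/= GE; apply: Gf; exists B.
by rewrite -GE; exact: mf.
Qed.

Lemma rv_wrtS G G' f : G `<=` G' -> rv_wrt G f -> rv_wrt G' f.
Proof. by move=> GG' Gf A /Gf /GG'. Qed.

Lemma rv_wrt_measurable G f : G `<=` measurable -> rv_wrt G f ->
  measurable_fun setT f.
Proof. by move=> Gm Gf _ B mB; apply: Gm; apply: Gf; exists B. Qed.

Lemma rv_wrt_preimage G f (B : set R) : rv_wrt G f -> measurable B ->
  G (f @^-1` B).
Proof. by move=> Gf mB; apply: Gf; exists B; rewrite ?setTI. Qed.

Lemma rv_wrt_cst G (c : R) : sigma_algebra setT G -> rv_wrt G (cst c).
Proof. by move=> sG; apply/rv_wrtP => //; exact: measurable_cst. Qed.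

Lemma rv_wrtD G f g : sigma_algebra setT G ->
  rv_wrt G f -> rv_wrt G g -> rv_wrt G (fun w => f w + g w).
Proof.
move=> sG /(rv_wrtP _ sG) mf /(rv_wrtP _ sG) mg; apply/(rv_wrtP _ sG).
exact: measurable_funD.
Qed.

Lemma rv_wrtM G f g : sigma_algebra setT G ->
  rv_wrt G f -> rv_wrt G g -> rv_wrt G (fun w => f w * g w).
Proof.
move=> sG /(rv_wrtP _ sG) mf /(rv_wrtP _ sG) mg; apply/(rv_wrtP _ sG).
exact: measurable_funM.
Qed.

Lemma rv_wrt_max G f g : sigma_algebra setT G ->
  rv_wrt G f -> rv_wrt G g -> rv_wrt G (fun w => Num.max (f w) (g w)).
Proof.
move=> sG /(rv_wrtP _ sG) mf /(rv_wrtP _ sG) mg; apply/(rv_wrtP _ sG).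
exact: measurable_maxr.
Qed.

Lemma rv_wrt_comp G f (phi : R -> R) : sigma_algebra setT G ->
  measurable_fun setT phi -> rv_wrt G f -> rv_wrt G (fun w => phi (f w)).
Proof.
move=> sG mphi /(rv_wrtP _ sG) mf; apply/(rv_wrtP _ sG).
exact: (measurableT_comp mphi mf).
Qed.

Lemma rv_wrtB G f g : sigma_algebra setT G ->
  rv_wrt G f -> rv_wrt G g -> rv_wrt G (fun w => f w - g w).
Proof.
move=> sG Gf Gg; apply: rv_wrtD => //.
by apply: (rv_wrt_comp (phi := -%R)) => //; exact: oppr_measurable.
Qed.

Lemma rv_wrtX G f n : sigma_algebra setT G ->
  rv_wrt G f -> rv_wrt G (fun w => f w ^+ n).
Proof.
by move=> sG; apply: (rv_wrt_comp (phi := fun x => x ^+ n)) => //; exact: exprn_measurable.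
Qed.

Lemma rv_wrt_norm G f : sigma_algebra setT G ->
  rv_wrt G f -> rv_wrt G (fun w => `|f w|).
Proof.
by move=> sG; apply: (rv_wrt_comp (phi := @Num.norm _ R)) => //; exact: normr_measurable.
Qed.

Lemma rv_wrt_sum_nat G n (F : nat -> Omega -> R) : sigma_algebra setT G ->
  (forall i, (i < n)%N -> rv_wrt G (F i)) ->
  rv_wrt G (fun w => \sum_(0 <= i < n) F i w).
Proof.
move=> sG; elim: n => [|n IH] Fa.
  under [X in rv_wrt _ X]funext do rewrite big_nil.
  exact: rv_wrt_cst.
under [X in rv_wrt _ X]funext do rewrite big_nat_recr//=.
by apply: rv_wrtD => //; [apply: IH => i ni; apply: Fa; rewrite ltnS ltnW|exact: Fa].
Qed.

Lemma rv_wrt_indic G (A : set Omega) : sigma_algebra setT G -> G A ->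
  rv_wrt G (\1_A : Omega -> R).
Proof.
move=> sG GA; apply/(rv_wrtP _ sG).
apply: (@measurable_indic _ (g_sigma_algebraType G)).
by rewrite /measurable/= sigma_algebra_id.
Qed.

Lemma rv_wrt_set_le G f (c : R) : rv_wrt G f -> G [set w | f w <= c].
Proof.
move=> Gf; have -> : [set w | f w <= c] = f @^-1` `]-oo, c].
  by apply/seteqP; split=> w /=; rewrite in_itv.
exact: rv_wrt_preimage.
Qed.

End rv_wrt.

Lemma expr3M_le (R : realDomainType) (x y : R) :
  `|x ^+ 3 * y| <= x ^+ 4 + y ^+ 4.
Proof.
rewrite normrM normrX.
rewrite -(ger0_norm (exprn_even_ge0 x (isT : ~~ odd 4))).
rewrite -(ger0_norm (exprn_even_ge0 y (isT : ~~ odd 4))) !normrX.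
have [xy|/ltW xy] := leP `|y| `|x|.
  apply: (@le_trans _ _ (`|x| ^+ 4)); last by rewrite lerDl exprn_ge0.
  by rewrite [leRHS]exprSr ler_wpM2l// exprn_ge0.
apply: (@le_trans _ _ (`|y| ^+ 4)); last by rewrite lerDr exprn_ge0.
by rewrite [leRHS]exprSr ler_wpM2r// lerXn2r// nnegrE.
Qed.

(** * Discrete martingale sums *)

Section brownian_filtration.
Context d (Omega : measurableType d) (R : realType) (P : probability Omega R).

(* [W] is a Brownian motion for a filtration [F] that may be larger than its
   own. *)
Record fbm (F : R -> set (set Omega)) (W : R -> Omega -> R) : Prop := {
  fbm_sa : forall t, 0 <= t -> sigma_algebra setT (F t) ;
  fbm_sub : forall t, 0 <= t -> F t `<=` measurable ;
  fbm_mono : forall s t, 0 <= s -> s <= t -> F s `<=` F t ;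
  fbm_adapted : forall t, 0 <= t -> rv_wrt (F t) (W t) ;
  fbm_cont : ae_continuous P `[0, +oo[ W ;
  fbm_law : forall s t, 0 <= s -> s < t -> forall A : set R, measurable A ->
    P ((fun w => W t w - W s w) @^-1` A) = normal_prob 0 (Num.sqrt (t - s)) A ;
  fbm_indep : forall s t, 0 <= s -> s < t ->
    indep_systems P (F s)
      (g_sigma_algebra_preimage (fun w => W t w - W s w)) }.

Context (F : R -> set (set Omega)) (W : R -> Omega -> R) (FW : fbm F W).

Lemma fbm_measurable t : 0 <= t -> measurable_fun setT (W t).
Proof.
move=> t0; apply: (rv_wrt_measurable (fbm_sub FW t0)); exact: (fbm_adapted FW).
Qed.

Lemma adapted_measurable (X : Omega -> R) t : 0 <= t -> rv_wrt (F t) X -> measurable_fun setT X.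
Proof. by move=> t0; apply: rv_wrt_measurable; exact: (fbm_sub FW). Qed.

Lemma fbm_incr_measurable s t : 0 <= s -> s < t ->
  measurable_fun setT (fun w => W t w - W s w).
Proof.
move=> s0 st; apply: measurable_funB; apply: fbm_measurable => //.
by rewrite (le_trans s0)// ltW.
Qed.

Lemma fbm_indep_rv s t (X : Omega -> R) : 0 <= s -> s < t -> rv_wrt (F s) X ->
  indep_rv P X (fun w => W t w - W s w).
Proof.
move=> s0 st FX A B mA mB; apply: (fbm_indep FW s0 st).
  exact: rv_wrt_preimage.
by exists B => //; rewrite setTI.
Qed.

Lemma fbm_incr2 s t : 0 <= s -> s < t ->
  mean_le P (fun w => (W t w - W s w) ^+ 2) (65 * (t - s)).
Proof.
move=> s0 st; have st0 : 0 < t - s by rewrite subr_gt0.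
have := mean_le_normal2 (s := Num.sqrt (t - s)) _ (fbm_incr_measurable s0 st)
  (fbm_law FW s0 st).
by rewrite sqr_sqrtr ?sqrtr_gt0//; [exact|exact: ltW].
Qed.

Lemma fbm_incr4 s t : 0 <= s -> s < t ->
  mean_le P (fun w => (W t w - W s w) ^+ 4) (128 * (t - s) ^+ 2).
Proof.
move=> s0 st; have st0 : 0 < t - s by rewrite subr_gt0.
have := mean_le_normal4 (s := Num.sqrt (t - s)) _ (fbm_incr_measurable s0 st)
  (fbm_law FW s0 st).
have -> : Num.sqrt (t - s) ^+ 4 = (t - s) ^+ 2.
  by rewrite -[in RHS](sqr_sqrtr (ltW st0)) -exprM.
by rewrite sqrtr_gt0; exact.
Qed.

Lemma fbm_incr_mean0 s t : 0 <= s -> s < t ->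
  mean0 P (fun w => W t w - W s w).
Proof.
move=> s0 st; have st0 : 0 < t - s by rewrite subr_gt0.
have mD := fbm_incr_measurable s0 st.
apply: (@mean0_odd_normal _ _ _ _ (fun w => W t w - W s w) (Num.sqrt (t - s)) id (1 + 65 * (t - s))) => //.
- by rewrite sqrtr_gt0.
- exact: (fbm_law FW).
- apply: (@mean_le_le _ _ _ _ _ (fun w => 1 + (W t w - W s w) ^+ 2)).
  + exact: measurableT_comp.
  + by move=> w; exact: normr_ge0.
  + move=> w; rewrite -real_normK ?num_real//.
    have := normr_ge0 (W t w - W s w); set x := `|_|; nra.
  + by apply: mean_leD; [exact: mean_le_cst|exact: fbm_incr2].
Qed.

Lemma fbm_incr3_mean0 s t : 0 <= s -> s < t ->
  mean0 P (fun w => (W t w - W s w) ^+ 3).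
Proof.
move=> s0 st; have st0 : 0 < t - s by rewrite subr_gt0.
have mD := fbm_incr_measurable s0 st.
apply: (@mean0_odd_normal _ _ _ _ (fun w => W t w - W s w) (Num.sqrt (t - s)) (fun x => x ^+ 3) (128 * (t - s) ^+ 2 + 1)) => //.
- by rewrite sqrtr_gt0.
- exact: (fbm_law FW).
- by move=> x; rewrite exprNn; ring.
- apply: (@mean_le_le _ _ _ _ _ (fun w => (W t w - W s w) ^+ 4 + 1)).
  + by apply: measurableT_comp => //; exact: measurable_funX.
  + by move=> w; exact: normr_ge0.
  + by move=> w; have := expr3M_le (W t w - W s w) 1; rewrite mulr1 expr1n.
  + by apply: mean_leD; [exact: fbm_incr4|exact: mean_le_cst].
Qed.

Section martingale_sums.
Context (tau : nat -> R) (tau0 : 0 <= tau 0%N)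
  (tau_incr : forall i, tau i < tau i.+1).
Context (D : nat -> Omega -> R) (FD : forall i, rv_wrt (F (tau i)) (D i)).

Lemma tau_le i j : (i <= j)%N -> tau i <= tau j.
Proof.
move=> /subnKC <-; elim: (j - i)%N => [|k IH]; first by rewrite addn0.
by rewrite addnS (le_trans IH)// ltW.
Qed.

Lemma tau_ge0 i : 0 <= tau i.
Proof. by rewrite (le_trans tau0)// tau_le. Qed.

Definition incr i w := W (tau i.+1) w - W (tau i) w.

Definition msum_ n w := \sum_(0 <= i < n) D i w * incr i w.

Lemma msum_S n w : msum_ n.+1 w = msum_ n w + D n w * incr n w.
Proof. by rewrite /msum_ big_nat_recr. Qed.

Lemma rv_wrt_tau i j (f : Omega -> R) : (i <= j)%N -> rv_wrt (F (tau i)) f -> rv_wrt (F (tau j)) f.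
Proof. by move=> ij; apply: rv_wrtS; apply: (fbm_mono FW); [exact: tau_ge0|exact: tau_le]. Qed.

Lemma incr_adapted i : rv_wrt (F (tau i.+1)) (incr i).
Proof.
have sa := fbm_sa FW (tau_ge0 i.+1); apply: rv_wrtB => //.
  by apply: (fbm_adapted FW); exact: tau_ge0.
by apply: (rv_wrt_tau (i := i)) => //; apply: (fbm_adapted FW); exact: tau_ge0.
Qed.

Lemma msum_adapted n : rv_wrt (F (tau n)) (msum_ n).
Proof.
have sa := fbm_sa FW (tau_ge0 n); apply: rv_wrt_sum_nat => // i ni.
apply: rv_wrtM => //; first by apply: (rv_wrt_tau (i := i)) => //; exact: ltnW.
by apply: (rv_wrt_tau (i := i.+1)) => //; exact: incr_adapted.
Qed.

Lemma msum_measurable n : measurable_fun setT (msum_ n).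
Proof. by apply: (adapted_measurable (tau_ge0 n)); exact: msum_adapted. Qed.

Lemma D_measurable n : measurable_fun setT (D n).
Proof. exact: (adapted_measurable (tau_ge0 n)). Qed.

Lemma mean0_incrM n (X : Omega -> R) a : rv_wrt (F (tau n)) X ->
  mean_le P (fun w => `|X w|) a -> mean0 P (fun w => X w * incr n w).
Proof.
move=> FX Xa; apply: mean0_indepM.
- by apply: fbm_indep_rv => //; exact: tau_ge0.
- apply: mean_le_norm_integrable Xa; apply: (adapted_measurable (tau_ge0 n)) => //.
- by apply: fbm_incr_mean0 => //; exact: tau_ge0.
Qed.

Lemma mean0_incr3M n (X : Omega -> R) a : rv_wrt (F (tau n)) X ->
  mean_le P (fun w => `|X w|) a -> mean0 P (fun w => X w * incr n w ^+ 3).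
Proof.
move=> FX Xa; apply: mean0_indepM.
- apply: (indep_rv_comp (f := id) (g := fun x => x ^+ 3)) => //.
  by apply: fbm_indep_rv => //; exact: tau_ge0.
- apply: mean_le_norm_integrable Xa; apply: (adapted_measurable (tau_ge0 n)) => //.
- by apply: fbm_incr3_mean0 => //; exact: tau_ge0.
Qed.

Lemma mean_le_incr2M n (X : Omega -> R) a : rv_wrt (F (tau n)) X ->
  mean_le P X a ->
  mean_le P (fun w => X w * incr n w ^+ 2) (a * (65 * (tau n.+1 - tau n))).
Proof.
move=> FX Xa; apply: mean_le_indepM => //.
- apply: (indep_rv_comp (f := id) (g := fun x => x ^+ 2)) => //.
  by apply: fbm_indep_rv => //; exact: tau_ge0.
- by apply: fbm_incr2 => //; exact: tau_ge0.
Qed.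

Lemma mean_le_incr4M n (X : Omega -> R) a : rv_wrt (F (tau n)) X ->
  mean_le P X a ->
  mean_le P (fun w => X w * incr n w ^+ 4) (a * (128 * (tau n.+1 - tau n) ^+ 2)).
Proof.
move=> FX Xa; apply: mean_le_indepM => //.
- apply: (indep_rv_comp (f := id) (g := fun x => x ^+ 4)) => //.
  by apply: fbm_indep_rv => //; exact: tau_ge0.
- by apply: fbm_incr4 => //; exact: tau_ge0.
Qed.

(** Ito's isometry as an inequality. The cross term is centred since [D n] and the preceding sum are
    known at [tau n]; 65 is the variance constant of [fbm_incr2]. *)
Lemma mean_le_msum2 (q : nat -> R) n :
  (forall i, (i < n)%N -> mean_le P (fun w => D i w ^+ 2) (q i)) ->
  mean_le P (fun w => msum_ n w ^+ 2)
    (65 * \sum_(0 <= i < n) q i * (tau i.+1 - tau i)).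
Proof.
elim: n => [|n IH] Dq.
  under [X in mean_le _ X]funext do rewrite /msum_ big_nil expr0n/=.
  by rewrite big_nil mulr0; exact: mean_le_cst.
have {}IH := IH (fun i ni => Dq i (ltnW ni)).
have Dn := Dq n (ltnSn n).
have sa := fbm_sa FW (tau_ge0 n).
rewrite big_nat_recr//= mulrDr.
have -> : (fun w => msum_ n.+1 w ^+ 2) = (fun w =>
  (msum_ n w ^+ 2 + D n w ^+ 2 * incr n w ^+ 2) +
  2 * ((msum_ n w * D n w) * incr n w)).
  by apply/funext => w; rewrite msum_S; ring.
apply: mean_le_add0; last first.
  move=> w; have -> : msum_ n w ^+ 2 + D n w ^+ 2 * incr n w ^+ 2 +
      2 * (msum_ n w * D n w * incr n w) = (msum_ n w + D n w * incr n w) ^+ 2.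
    by ring.
  exact: sqr_ge0.
- apply: mean0Z.
  apply: (@mean0_incrM _ _ (65 * (\sum_(0 <= i < n) q i * (tau i.+1 - tau i)) + q n)).
    by apply: rv_wrtM => //; exact: msum_adapted.
  apply: (mean_le_le _ _ _ (mean_leD IH Dn)).
  + apply: measurableT_comp => //; apply: measurable_funM;
      [exact: msum_measurable|exact: D_measurable].
  + by move=> w; exact: normr_ge0.
  + move=> w /=; rewrite normrM -[X in _ <= X + _]real_normK ?num_real//.
    rewrite -[X in _ <= _ + X]real_normK ?num_real//.
    set x := `|msum_ n w|; set y := `|D n w|; nra.
- apply: mean_leD => //.
  rewrite [X in mean_le _ _ X](_ : _ = q n * (65 * (tau n.+1 - tau n))); last by ring.
  by apply: mean_le_incr2M => //; exact: rv_wrtX.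
Qed.

Fixpoint runmax (u : nat -> R) n :=
  if n is n'.+1 then Num.max (runmax u n') `|u n| else `|u 0%N|.

Lemma runmax_ge u n k : (k <= n)%N -> `|u k| <= runmax u n.
Proof.
elim: n => [|n IH]; first by rewrite leqn0 => /eqP ->.
rewrite leq_eqVlt => /predU1P[->/=|kn]; first by rewrite le_max lexx orbT.
by rewrite /= le_max IH.
Qed.

Lemma runmax_ge0 u n : 0 <= runmax u n.
Proof. by rewrite (le_trans _ (@runmax_ge u n 0%N _)). Qed.

Lemma runmax_le u n c : (forall k, (k <= n)%N -> `|u k| <= c) -> runmax u n <= c.
Proof.
elim: n => [|n IH] h /=; first exact: h.
by rewrite ge_max IH ?h// => k kn; apply: h; rewrite (leq_trans kn).
Qed.

(* Discrete integration by parts for the running maximum: the left-hand side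
   is a martingale sum, so taking means gives Doob's inequality. *)
Lemma runmax_doob (u : nat -> R) n :
  \sum_(0 <= k < n) runmax u k * Num.sg (u k) * (u k.+1 - u k) <=
  runmax u n * `|u n| - runmax u n ^+ 2 / 2.
Proof.
elim: n => [|n IH]; first by rewrite big_nil /=; have := sqr_ge0 `|u 0%N|; lra.
rewrite big_nat_recr//=.
have S0 := runmax_ge0 u n; have Su := runmax_ge u (leqnn n).
have h : Num.sg (u n) * (u n.+1 - u n) <= `|u n.+1| - `|u n|.
  rewrite mulrBr -normrEsg lerB//.
  rewrite (le_trans (ler_norm _))// normrM ler_piMl// normr_sg.
  by case: (u n != 0).
have h2 : runmax u n * Num.sg (u n) * (u n.+1 - u n) <= runmax u n * (`|u n.+1| - `|u n|).
  by rewrite -mulrA ler_wpM2l.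
have [a|a] := leP `|u n.+1| (runmax u n); nra.
Qed.

Lemma runmax_adapted n :
  rv_wrt (F (tau n)) (fun w => runmax (fun k => msum_ k w) n).
Proof.
elim: n => [|n IH] /=.
  by apply: rv_wrt_norm; [exact: (fbm_sa FW (tau_ge0 0))|exact: msum_adapted].
have sa := fbm_sa FW (tau_ge0 n.+1).
apply: rv_wrt_max => //; first by apply: (rv_wrt_tau (i := n)).
by apply: rv_wrt_norm => //; exact: msum_adapted.
Qed.

Lemma runmax_sqr_le (u : nat -> R) n :
  runmax u n ^+ 2 <= \sum_(0 <= k < n.+1) u k ^+ 2.
Proof.
elim: n => [|n IH] /=; first by rewrite big_nat1 real_normK ?num_real.
rewrite big_nat_recr//= -[u n.+1 ^+ 2]real_normK ?num_real//.
have := sqr_ge0 (runmax u n); have := sqr_ge0 `|u n.+1|.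
by have [a|a] := leP `|u n.+1| (runmax u n); lra.
Qed.

(** With S the running maximum and M the last value, adding 4 M^2 to -4 times the martingale of
    [runmax_doob] completes a square: the result is at least S^2 + (S - 2 |M|)^2, and only 4 M^2
    contributes to its mean. *)
Lemma mean_le_doob (q : nat -> R) n :
  (forall i, (i < n)%N -> mean_le P (fun w => D i w ^+ 2) (q i)) ->
  mean_le P (fun w => runmax (fun k => msum_ k w) n ^+ 2)
    (4 * (65 * \sum_(0 <= i < n) q i * (tau i.+1 - tau i))).
Proof.
move=> Dq.
pose X k w := runmax (fun k => msum_ k w) k * Num.sg (msum_ k w) * D k w.
have mr k : measurable_fun setT (fun w => runmax (fun k => msum_ k w) k).
  by apply: (adapted_measurable (tau_ge0 k)); exact: runmax_adapted.
have X0 : mean0 P (fun w => -4 * \sum_(0 <= k < n) X k w * incr k w).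
  apply: mean0Z; apply: mean0_sum_nat => k kn.
  have sa := fbm_sa FW (tau_ge0 k).
  have FX : rv_wrt (F (tau k)) (X k).
    apply: rv_wrtM => //; apply: rv_wrtM => //; first exact: runmax_adapted.
    apply: (rv_wrt_comp (phi := Num.sg)) => //; last exact: msum_adapted.
    apply: nondecreasing_measurable => // x y xy.
    have sg1 (z : R) : `|Num.sg z| <= 1 by rewrite normr_sg; case: (z != 0).
    have [x0|x0] := ltP x 0.
      rewrite (ltr0_sg x0) lerNl (le_trans _ (sg1 y))//.
      by rewrite -normrN ler_norm.
    have [y0|y0] := ltP 0 y.
      by rewrite (gtr0_sg y0) (le_trans _ (sg1 x))// ler_norm.
    have -> : x = y by apply/eqP; rewrite eq_le xy (le_trans y0).
    exact: lexx.
  have h : mean_le P (fun w => runmax (fun k => msum_ k w) k ^+ 2)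
      (\sum_(0 <= j < k.+1) 65 * \sum_(0 <= i < j) q i * (tau i.+1 - tau i)).
    apply: (@mean_le_le _ _ _ _ _ (fun w => \sum_(0 <= j < k.+1) msum_ j w ^+ 2)).
    - exact: measurable_funX.
    - by move=> w; exact: sqr_ge0.
    - by move=> w; exact: runmax_sqr_le.
    - apply: mean_le_sum_nat => j jk; apply: mean_le_msum2 => i ij.
      by apply: Dq; exact: (ltn_trans (leq_trans ij (jk : (j <= k)%N)) kn).
  apply: (mean0_incrM FX).
  apply: (mean_le_le _ _ _ (mean_leD h (Dq k kn))).
  - by apply: measurableT_comp => //; exact: (adapted_measurable (tau_ge0 k)).
  - by move=> w; exact: normr_ge0.
  - move=> w /=; rewrite /X !normrM (ger0_norm (runmax_ge0 _ _)) normr_sg.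
    rewrite -[X in _ <= _ + X]real_normK ?num_real//.
    have := runmax_ge0 (fun k => msum_ k w) k; have := normr_ge0 (D k w).
    set x := runmax _ _; set y := `|D k w|.
    by case: (msum_ k w != 0) => /=; nra.
have M2 := mean_le_msum2 Dq.
apply: (mean_le_le _ _ _ (mean_le_add0 (mean_leZ (ler0n R 4) M2) X0 _)).
- by apply: measurable_funX; exact: mr.
- by move=> w; exact: sqr_ge0.
- move=> w.
  have := runmax_doob (fun k => msum_ k w) n.
  under eq_big_nat do rewrite msum_S [msum_ _ w + _]addrC addrK mulrA -/(X _ w).
  rewrite -[msum_ n w ^+ 2]real_normK ?num_real//.
  by have := sqr_ge0 (runmax (msum_^~ w) n - 2 * `|msum_ n w|); nra.
- move=> w.
  have := runmax_doob (fun k => msum_ k w) n.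
  under eq_big_nat do rewrite msum_S [msum_ _ w + _]addrC addrK mulrA -/(X _ w).
  rewrite -[msum_ n w ^+ 2]real_normK ?num_real//.
  have := sqr_ge0 (runmax (msum_^~ w) n).
  by have := sqr_ge0 (runmax (msum_^~ w) n - 2 * `|msum_ n w|); nra.
Qed.

(** Gronwall's factor over a time span L at rate 3 * 65 / L, times the coefficients of E D^4: half
    of 6 * 65 from the mixed term and 128 from the fourth power of the increment. *)
Definition msum4_const : R := expR (3 * 65) * (3 * 65 + 128).

Lemma msum4_const_ge0 : 0 <= msum4_const.
Proof. by rewrite mulr_ge0 ?expR_ge0//; lra. Qed.

(** In the expansion of the fourth power the terms odd in the increment are centred. Young's
    inequality with weight L splits 6 M^2 D^2 into 3 M^4 / L and 3 L D^4, so that Gronwall's factor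
    over n steps depends on n only through n * delta <= L. *)
Lemma mean_le_msum4 (delta L : R) (q : nat -> R) n : 0 < L ->
  (forall i, tau i.+1 - tau i = delta) -> n%:R * delta <= L ->
  (forall i, (i < n)%N -> mean_le P (fun w => D i w ^+ 4) (q i)) ->
  mean_le P (fun w => msum_ n w ^+ 4) (msum4_const * L * (delta * \sum_(0 <= i < n) q i)).
Proof.
move=> L0 deltaE nL Dq.
have d0 : 0 < delta by rewrite -(deltaE 0%N) subr_gt0.
have q0 i : (i < n)%N -> 0 <= q i by move=> /Dq /mean_le_ge0.
set c := 3 * 65 * delta / L.
have c0 : 0 <= c by rewrite divr_ge0// ?mulr_ge0// ltW.
set K := (3 * 65 + 128) * L * delta.
have K0 : 0 <= K by rewrite mulr_ge0 ?mulr_ge0 ?ltW//; lra.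
have key k : (k <= n)%N -> mean_le P (fun w => msum_ k w ^+ 4)
    (expR (c * k%:R) * (K * \sum_(0 <= i < k) q i)).
  elim: k => [|k IH] kn.
    under [X in mean_le _ X]funext do rewrite /msum_ big_nil expr0n/=.
    by rewrite big_nil !mulr0; exact: mean_le_cst.
  have {}IH := IH (ltnW kn); have Dk := Dq k kn.
  have sa := fbm_sa FW (tau_ge0 k).
  set S := \sum_(0 <= i < k) q i in IH *.
  have S0 : 0 <= S.
    rewrite /S big_nat; apply: sumr_ge0 => i /andP[_ ik].
    by apply: q0; rewrite (ltn_trans ik).
  set a := expR _ * _ in IH.
  have -> : (fun w => msum_ k.+1 w ^+ 4) = (fun w =>
      (msum_ k w ^+ 4 + (6 * ((msum_ k w ^+ 2 * D k w ^+ 2) * incr k w ^+ 2)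
        + D k w ^+ 4 * incr k w ^+ 4)) +
      (4 * ((msum_ k w ^+ 3 * D k w) * incr k w) +
       4 * ((D k w ^+ 3 * msum_ k w) * incr k w ^+ 3))).
    by apply/funext => w; rewrite msum_S; ring.
  have FM : rv_wrt (F (tau k)) (msum_ k) := @msum_adapted k; have FDk : rv_wrt (F (tau k)) (D k) := @FD k.
  have nk : delta <= L.
    apply: le_trans nL; apply: ler_peMl; first exact: ltW.
    by rewrite ler1n; exact: leq_trans kn.
  have MD : mean_le P (fun w => msum_ k w ^+ 2 * D k w ^+ 2)
      ((2 * L)^-1 * a + L / 2 * q k).
    apply: (mean_le_le _ _ _ (mean_leD (mean_leZ _ IH) (mean_leZ _ Dk))).
    - by apply: measurable_funM; apply: measurable_funX;
        [exact: msum_measurable|exact: D_measurable].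
    - by move=> w; rewrite mulr_ge0 ?sqr_ge0.
    - move=> w /=; rewrite -subr_ge0.
      have -> : (2 * L)^-1 * msum_ k w ^+ 4 + L / 2 * D k w ^+ 4 -
         msum_ k w ^+ 2 * D k w ^+ 2 =
         (2 * L)^-1 * (msum_ k w ^+ 2 - L * D k w ^+ 2) ^+ 2 by field; rewrite gt_eqF.
      by rewrite mulr_ge0 ?sqr_ge0// invr_ge0 mulr_ge0// ltW.
    - by rewrite invr_ge0 mulr_ge0// ltW.
    - by rewrite divr_ge0// ltW.
  have FMD : rv_wrt (F (tau k)) (fun w => msum_ k w ^+ 2 * D k w ^+ 2).
    by apply: rv_wrtM => //; exact: rv_wrtX.
  have := mean_le_incr2M FMD MD; have := mean_le_incr4M (rv_wrtX (n := 4) sa FDk) Dk.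
  rewrite deltaE => h4 h2.
  have ha : mean_le P (fun w => msum_ k w ^+ 4 + (6 * ((msum_ k w ^+ 2 * D k w ^+ 2) * incr k w ^+ 2)
        + D k w ^+ 4 * incr k w ^+ 4)) (expR (c * k.+1%:R) * (K * \sum_(0 <= i < k.+1) q i)).
    apply: mean_le_trans (mean_leD IH (mean_leD (mean_leZ (ler0n R 6) h2) h4)).
    rewrite big_nat_recr//= -/S.
    have -> : c * k.+1%:R = c + c * k%:R by rewrite -natr1; ring.
    have e1 : 1 <= expR (c + c * k%:R).
      by rewrite -expR0 ler_expR addr_ge0// mulr_ge0.
    have e2 : (1 + c) * a <= expR (c + c * k%:R) * (K * S).
      rewrite expRD -mulrA ler_wpM2r ?expR_ge1Dx//.
      by rewrite mulr_ge0 ?expR_ge0// mulr_ge0.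
    have e3 : K * q k <= expR (c + c * k%:R) * (K * q k).
      by rewrite ler_peMl// mulr_ge0// q0.
    rewrite mulrDr mulrDr; apply: le_trans (lerD e2 e3).
    have -> : 6 * (((2 * L)^-1 * a + L / 2 * q k) * (65 * delta)) =
      c * a + 3 * 65 * L * delta * q k by rewrite /c; field; rewrite gt_eqF.
    have : delta ^+ 2 * q k <= L * delta * q k.
      by rewrite ler_wpM2r ?q0// expr2 ler_wpM2r// ltW.
    rewrite /K; lra.
  apply: mean_le_add0 => //; last first.
    move=> w; have -> : msum_ k w ^+ 4 + (6 * ((msum_ k w ^+ 2 * D k w ^+ 2) * incr k w ^+ 2)
        + D k w ^+ 4 * incr k w ^+ 4) +
      (4 * ((msum_ k w ^+ 3 * D k w) * incr k w) +
       4 * ((D k w ^+ 3 * msum_ k w) * incr k w ^+ 3)) =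
      (msum_ k w + D k w * incr k w) ^+ 4 by ring.
    exact: exprn_even_ge0.
  have ab := mean_leD IH Dk.
  apply: mean0D; apply: mean0Z.
  - have FX : rv_wrt (F (tau k)) (fun w => msum_ k w ^+ 3 * D k w).
      by apply: rv_wrtM => //; exact: rv_wrtX.
    apply: (mean0_incrM FX); apply: (mean_le_le _ _ _ ab) => [|w|w].
    + by apply: measurableT_comp => //; exact: (adapted_measurable (tau_ge0 k)).
    + exact: normr_ge0.
    + exact: expr3M_le.
  - have FX : rv_wrt (F (tau k)) (fun w => D k w ^+ 3 * msum_ k w).
      by apply: rv_wrtM => //; exact: rv_wrtX.
    apply: (mean0_incr3M FX); apply: (mean_le_le _ _ _ ab) => [|w|w].
    + by apply: measurableT_comp => //; exact: (adapted_measurable (tau_ge0 k)).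
    + exact: normr_ge0.
    + by rewrite addrC; exact: expr3M_le.
apply: mean_le_trans (key n (leqnn n)).
have -> : msum4_const * L * (delta * \sum_(0 <= i < n) q i) =
   expR (3 * 65) * (K * \sum_(0 <= i < n) q i) by rewrite /msum4_const /K; ring.
apply: ler_wpM2r.
  by rewrite mulr_ge0// big_nat; apply: sumr_ge0 => i /andP[_ ?]; exact: q0.
rewrite ler_expR /c mulrAC ler_pdivrMr// -!mulrA ler_wpM2l// ler_wpM2l//.
by rewrite mulrC.
Qed.

End martingale_sums.
End brownian_filtration.

(** Integrals of nonnegative functions are suprema over the simple functions below them, so the
    comparison is purely pointwise. This is what allows the supremum over all times in
    [sup_square_error] to be bounded. *)
Lemma ge0_le_integral_any d (T : measurableType d) (R : realType)
    (mu : {measure set T -> \bar R}) (A B : set T) (f g : T -> \bar R) :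
  (forall x, A x -> 0 <= f x)%E -> (forall x, B x -> 0 <= g x)%E ->
  A `<=` B -> (forall x, A x -> f x <= g x)%E ->
  (\int[mu]_(x in A) f x <= \int[mu]_(x in B) g x)%E.
Proof.
move=> f0 g0 AB fg; rewrite integral_mkcond [leRHS]integral_mkcond.
have f0' x : (0 <= (f \_ A) x)%E by rewrite patchE; case: ifPn => // /[!inE] /f0.
have g0' x : (0 <= (g \_ B) x)%E by rewrite patchE; case: ifPn => // /[!inE] /g0.
rewrite !ge0_integralTE//; apply: ge_ereal_sup => _ [h /= hf <-].
apply: ereal_sup_ubound; exists h => //= x; apply: le_trans (hf x) _.
rewrite !patchE; case: ifPn => [/[!inE] Ax|_]; last by rewrite -patchE.
by rewrite ifT ?fg// inE; exact: AB.
Qed.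

(** * Convergence in probability *)

Section convergence_in_probability.
Context d (Omega : measurableType d) (R : realType) (P : probability Omega R).
Implicit Types (X Y : nat -> Omega -> R) (x y : Omega -> R).
Local Notation "'P^*'" := ((P^*)%mu).

Lemma outer_negligible A : P.-negligible A -> (P^* A = 0)%E.
Proof.
move=> [N [mN N0 AN]]; apply/eqP; rewrite eq_le outer_measure_ge0 andbT.
apply: (@le_trans _ _ (P^* N)%E); first exact: le_outer_measure.
by rewrite measurable_mu_extE// [X in (X <= _)%E](_ : _ = 0%E).
Qed.

Lemma outer_le_ae A B : (\forall w \ae P, A w -> B w) -> (P^* A <= P^* B)%E.
Proof.
move=> AB; rewrite -[leRHS]adde0 -(outer_negligible AB).
apply: le_trans (outer_measureU2 _ _ _); apply: le_outer_measure => w Aw.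
by have [Bw|nB] := pselect (B w); [left|right => /= /(_ Aw)].
Qed.

(** Kept with the outer measure of [cvg_to0_in_probability], so that comparing events takes only
    monotonicity and subadditivity. *)
Definition cvgp X x := forall e eta : R, 0 < e -> 0 < eta ->
  \forall n \near \oo, (P^* [set w | (e <= `|X n w - x w|)%R] <= eta%:E)%E.

Lemma cvgpE X x :
  cvg_to0_in_probability P (fun n w => (`|X n w - x w|)%:E) -> cvgp X x.
Proof.
move=> h e eta e0 eta0; have /fine_cvgP[fin /cvgrPdist_le/(_ _ eta0) H] := h e e0.
near=> n.
have -> : [set w | (e <= `|X n w - x w|)%R] = [set w | (e%:E <= (`|X n w - x w|)%:E)%E].
  by apply/seteqP; split=> w /=; rewrite lee_fin.
have f : P^* [set w | (e%:E <= (`|X n w - x w|)%:E)%E] \is a fin_num by near: n.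
rewrite -(fineK f) lee_fin.
have : `|0 - fine (P^* [set w | (e%:E <= (`|X n w - x w|)%:E)%E])| <= eta by near: n.
by rewrite sub0r normrN; exact: le_trans (ler_norm _).
Unshelve. all: end_near. Qed.

Lemma cvgp_le X x Y y : cvgp X x ->
  (forall n, \forall w \ae P, `|Y n w - y w| <= `|X n w - x w|) -> cvgp Y y.
Proof.
move=> h XY e eta e0 eta0; apply: filterS (h e eta e0 eta0) => n.
apply: le_trans; apply: outer_le_ae; apply: filterS (XY n) => w /= + eY.
exact: le_trans.
Qed.

Lemma cvgp_sumle X x Y y (Z : nat -> Omega -> R) z : cvgp X x -> cvgp Y y ->
  (forall n, \forall w \ae P, `|Z n w - z w| <= `|X n w - x w| + `|Y n w - y w|) ->
  cvgp Z z.
Proof.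
move=> hX hY XY e eta e0 eta0.
have e2 : 0 < e / 2 by rewrite divr_gt0.
have eta2 : 0 < eta / 2 by rewrite divr_gt0.
apply: filterS2 (hX _ _ e2 eta2) (hY _ _ e2 eta2) => n a b.
rewrite (splitr eta) EFinD; apply: le_trans (leeD a b).
apply: le_trans (outer_measureU2 _ _ _); apply: outer_le_ae.
apply: filterS (XY n) => w /= h1 h2.
have [h|h] := leP (e / 2) `|X n w - x w|; [by left|right => /=].
by lra.
Qed.

Lemma cvgpD X x Y y : cvgp X x -> cvgp Y y ->
  cvgp (fun n w => X n w + Y n w) (fun w => x w + y w).
Proof.
move=> hX hY; apply: (cvgp_sumle hX hY) => n; apply: aeW => w.
by rewrite opprD addrACA ler_normD.
Qed.

Lemma cvgpB X x Y y : cvgp X x -> cvgp Y y ->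
  cvgp (fun n w => X n w - Y n w) (fun w => x w - y w).
Proof.
move=> hX hY; apply: (cvgp_sumle hX hY) => n; apply: aeW => w.
have -> : X n w - Y n w - (x w - y w) = (X n w - x w) - (Y n w - y w) by ring.
exact: ler_normB.
Qed.

Lemma cvgp_cst x : cvgp (fun=> x) x.
Proof.
move=> e eta e0 eta0; apply: nearW => n.
rewrite (_ : [set w | _] = set0) ?outer_measure0 ?lee_fin ?ltW//.
by apply/seteqP; split=> w //=; rewrite subrr normr0 leNgt e0.
Qed.

Lemma cvgp_ae_eq X x Y y : cvgp X x ->
  (forall n, \forall w \ae P, Y n w = X n w) -> (\forall w \ae P, y w = x w) ->
  cvgp Y y.
Proof.
move=> h XY xy; apply: (cvgp_le h) => n; apply: filterS2 (XY n) xy => w -> ->.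
exact: lexx.
Qed.

Lemma cvgp_sum n (X : nat -> nat -> Omega -> R) (x : nat -> Omega -> R) :
  (forall i, (i < n)%N -> cvgp (X i) (x i)) ->
  cvgp (fun k w => \sum_(0 <= i < n) X i k w) (fun w => \sum_(0 <= i < n) x i w).
Proof.
elim: n => [|n IH] h.
  apply: (cvgp_ae_eq (cvgp_cst (cst 0))) => [k|]; apply: aeW => w; by rewrite big_nil.
apply: (cvgp_ae_eq (cvgpD (IH _) (h n (ltnSn n)))) => [i ni|k|]; first by apply: h; rewrite ltnS ltnW.
- by apply: aeW => w; rewrite big_nat_recr.
- by apply: aeW => w; rewrite big_nat_recr.
Qed.

Lemma measurable_norm_ge X (x : Omega -> R) n e : measurable_fun setT (X n) ->
  measurable_fun setT x -> measurable [set w | (e <= `|X n w - x w|)%R].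
Proof.
move=> mX mx; rewrite -[X in measurable X]setTI; apply: measurable_fun_le => //.
by apply: measurableT_comp => //; exact: measurable_funB.
Qed.

(** Egorov's theorem: off an event of probability below [eta] the convergence is uniform. *)
Lemma cvgp_of_ae X x : (forall n, measurable_fun setT (X n)) ->
  measurable_fun setT x ->
  (\forall w \ae P, X^~ w @ \oo --> x w) -> cvgp X x.
Proof.
move=> mX mx Xx e eta e0 eta0.
have fin : (P setT < +oo)%E by rewrite probability_setT ltry.
have Xx' : {ae P, forall w, setT w -> X^~ w @ \oo --> x w}.
  by apply: filterS Xx.
have [B [mB PB uB]] := ae_pointwise_almost_uniform mX mx measurableT fin Xx' eta0.
have H : \forall n \near \oo, forall w, (setT `\` B) w -> ball (x w) e (X n w).
  apply: (uB [set f | forall w, (setT `\` B) w -> ball (x w) e (f w)]).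
  apply/uniform_nbhs; exists [set z | ball z.1 e z.2]; split=> //.
  by rewrite -entourage_ballE; exists e.
apply: filterS H => n H.
apply: (@le_trans _ _ (P B)); last exact: ltW.
rewrite -measurable_mu_extE//; apply: le_outer_measure => w /= ew.
apply: contrapT => nBw; have := H w (conj I nBw).
by rewrite /ball/= distrC ltNge ew.
Qed.

(** The upper limit is measurable, and completeness passes this on to [x], which equals it almost
    everywhere. *)
Lemma ae_cvg_measurable (Pc : measure_is_complete P) X x :
  (forall n, measurable_fun setT (X n)) ->
  (\forall w \ae P, X^~ w @ \oo --> x w) -> measurable_fun setT x.
Proof.
move=> mX Xx; apply/measurable_EFinP.
apply: (ae_measurable_fun Pc (f := fun w => limn_esup (fun n => (X n w)%:E))).
  apply: filterS Xx => w h _.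
  have h2 : (fun n => (X n w)%:E) @ \oo --> (x w)%:E.
    by apply: cvg_EFin => //; apply: nearW.
  by rewrite limn_esup_lim (cvg_lim _ (cvg_esups h2)).
apply: measurable_fun_limn_esup => n; exact/measurable_EFinP.
Qed.

Lemma ae_eq_measurable (Pc : measure_is_complete P) (x y : Omega -> R) :
  measurable_fun setT x -> (\forall w \ae P, x w = y w) -> measurable_fun setT y.
Proof.
move=> mx xy; apply/measurable_EFinP.
apply: (ae_measurable_fun Pc (f := EFin \o x)); last exact/measurable_EFinP.
by apply: filterS xy => w /= -> _.
Qed.

Lemma exprB_le (u v A : R) q : 0 <= u <= A -> 0 <= v <= A ->
  u ^+ q - v ^+ q <= q%:R * A ^+ q.-1 * `|u - v|.
Proof.
move=> /andP[u0 uA] /andP[v0 vA].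
have A0 : 0 <= A by rewrite (le_trans u0).
elim: q => [|q IH]; first by rewrite !expr0 subrr !mul0r.
have -> : u ^+ q.+1 - v ^+ q.+1 = u * (u ^+ q - v ^+ q) + v ^+ q * (u - v).
  by rewrite !exprS; ring.
have -> : q.+1%:R * A ^+ q.+1.-1 * `|u - v| =
    A * (q%:R * A ^+ q.-1 * `|u - v|) + A ^+ q * `|u - v|.
  by case: q {IH} => [|q] /=; rewrite ?mul0r ?mulr0 ?expr0 -?natr1 ?exprS; ring.
apply: lerD.
  apply: le_trans (ler_wpM2l u0 IH) _; apply: ler_wpM2r => //.
  by rewrite !mulr_ge0// exprn_ge0.
apply: le_trans (ler_norm _) _; rewrite normrM ger0_norm ?exprn_ge0//.
by apply: ler_wpM2r => //; rewrite lerXn2r// nnegrE.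
Qed.

(* Fatou's lemma in probability; the weight [psi] is a localising indicator. *)
Lemma mean_le_cvgp q (c : R) X x (psi : Omega -> R) :
  (forall n, measurable_fun setT (X n)) -> measurable_fun setT x ->
  measurable_fun setT psi -> (forall w, 0 <= psi w <= 1) -> cvgp X x ->
  (\forall n \near \oo, mean_le P (fun w => psi w * `|X n w| ^+ q) c) ->
  mean_le P (fun w => psi w * `|x w| ^+ q) c.
Proof.
move=> mX mx mpsi psi01 Xx Xc.
(* Truncation at level [A] makes the power bounded and Lipschitz, so that convergence in probability
   controls its mean; [A] then increases to infinity by monotone convergence. *)
pose G A w := psi w * Num.min `|x w| A%:R ^+ q.
have psi0 w : 0 <= psi w by have /andP[] := psi01 w.
have psi1 w : psi w <= 1 by have /andP[] := psi01 w.
have mG A : measurable_fun setT (G A).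
  apply: measurable_funM => //; apply: measurable_funX.
  by apply: measurable_minr => //; exact: measurableT_comp.
have min0 (z : R) (A : nat) : 0 <= Num.min `|z| A%:R by rewrite le_min normr_ge0/=.
have G0 A w : 0 <= G A w by rewrite mulr_ge0// exprn_ge0.
suff GA A : mean_le P (G A) c.
  apply: (mean_le_lim _ _ GA).
  - apply: measurable_funM => //; apply: measurable_funX; exact: measurableT_comp.
  - by move=> w; rewrite mulr_ge0// exprn_ge0.
  - move=> w i j ij; rewrite ler_wpM2l// lerXn2r ?nnegrE//.
    by rewrite le_min ge_min lexx/= ge_min ler_nat ij orbT.
  - apply: aeW => w e e0; exists (Num.truncn `|x w|).+1.
    rewrite /G min_l; first by rewrite gerBl ltW.
    by rewrite ltW// Num.Theory.truncnS_gt.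
split=> //; apply/lee_addgt0Pr => e e0.
pose B : R := q%:R * A%:R ^+ q.-1.
have B0 : 0 <= B by rewrite mulr_ge0// exprn_ge0.
(* Off the exceptional event the truncated powers differ by at most [B * e1], and on it, of
   probability at most [eta], by at most [A%:R ^+ q]; [e1] and [eta] make each contribution at most
   e / 2. *)
pose e1 : R := e / 2 / (B + 1).
have e10 : 0 < e1 by rewrite !divr_gt0//; lra.
pose eta : R := e / 2 / (A%:R ^+ q + 1).
have AA : 0 <= A%:R ^+ q :> R by rewrite exprn_ge0.
have eta0 : 0 < eta by rewrite !divr_gt0//; lra.
have [n [Pn Xn]] : exists n, (P^* [set w | (e1 <= `|X n w - x w|)%R] <= eta%:E)%E /\
    mean_le P (fun w => psi w * `|X n w| ^+ q) c.
  have := filterI (Xx _ _ e10 eta0) Xc => -[N _ HN].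
  by exists N; apply: (HN N) => /=.
set E := [set w | _] in Pn.
have mE : measurable E by exact: measurable_norm_ge.
have hE : mean_le P (\1_E : Omega -> R) eta.
  split; first exact: measurable_indic.
  - by move=> w; rewrite indicE.
  - by rewrite integral_indic// setIT -measurable_mu_extE.
have e1' : 0 <= B * e1 by rewrite mulr_ge0// ltW.
have h := mean_leD (mean_leD Xn (mean_le_cst P e1')) (mean_leZ AA hE).
have : mean_le P (G A) (c + B * e1 + A%:R ^+ q * eta).
  apply: mean_le_le h => // w.
  rewrite indicE; have [wE|wE] := boolP (w \in E) => /=.
    apply: (@le_trans _ _ (A%:R ^+ q)).
      rewrite -[leRHS]mul1r ler_pM// ?exprn_ge0// lerXn2r ?nnegrE//.
      by rewrite ge_min lexx orbT.
    rewrite mulr1 lerDr addr_ge0// mulr_ge0// exprn_ge0//.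
  rewrite mulr0 addr0.
  have he : `|X n w - x w| < e1.
    by move: wE; rewrite notin_setE /E/= => /negP; rewrite -ltNge.
  have h1 : Num.min `|x w| A%:R ^+ q - Num.min `|X n w| A%:R ^+ q <= B * e1.
    apply: le_trans (@exprB_le _ _ A%:R q _ _) _.
    - by rewrite min0 ge_min lexx orbT.
    - by rewrite min0 ge_min lexx orbT.
    - rewrite -/B ler_wpM2l//; apply: le_trans (ltW he).
      rewrite [leRHS]distrC; apply: le_trans (ler_dist_dist _ _).
      rewrite /Num.min; case: ifPn; case: ifPn; rewrite -?leNgt => a b;
        rewrite ?subrr ?normr0// ?ler_norml; move: (ler_norm (`|x w| - `|X n w|)) (ler_norm (- (`|x w| - `|X n w|))); rewrite normrN; lra.
  have h2 : Num.min `|X n w| A%:R ^+ q <= `|X n w| ^+ q.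
    by rewrite lerXn2r ?nnegrE// ge_min lexx.
  rewrite /G; apply: (@le_trans _ _ (psi w * (`|X n w| ^+ q + B * e1))).
    by rewrite ler_wpM2l//; lra.
  by rewrite mulrDr lerD2l ler_piMl.
move=> [_ _ /le_trans]; apply; rewrite -EFinD lee_fin -addrA lerD2l.
have : B * e1 <= e / 2.
  rewrite /e1 mulrCA ler_piMr ?divr_ge0 ?ltW//.
  by rewrite ltr_pdivrMr; lra.
have : A%:R ^+ q * eta <= e / 2.
  rewrite /eta mulrCA ler_piMr ?divr_ge0 ?ltW//.
  by rewrite ltr_pdivrMr; lra.
by lra.
Qed.

End convergence_in_probability.

(** * Ito integrals as limits of Riemann sums *)

Section uniform_grid.
Context (R : realType) (s t : R) (st : s < t).
Local Notation leb := (@lebesgue_measure R).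

(** There are [n.+1] cells, so that every [n] gives a genuine subdivision. *)
Definition mesh n : R := (t - s) / n.+1%:R.
Definition gridpt n j : R := s + j%:R * mesh n.

Lemma mesh_gt0 n : 0 < mesh n.
Proof. by rewrite divr_gt0// subr_gt0. Qed.

Lemma gridpt0 n : gridpt n 0 = s.
Proof. by rewrite /gridpt mul0r addr0. Qed.

Lemma gridptS n j : gridpt n j.+1 = gridpt n j + mesh n.
Proof. by rewrite /gridpt -natr1 mulrDl mul1r addrA. Qed.

Lemma gridptS_sub n j : gridpt n j.+1 - gridpt n j = mesh n.
Proof. by rewrite gridptS addrC addKr. Qed.

Lemma gridpt_last n : gridpt n n.+1 = t.
Proof. by rewrite /gridpt /mesh mulrC divfK ?pnatr_eq0// addrC subrK. Qed.

Lemma gridpt_lt n j : gridpt n j < gridpt n j.+1.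
Proof. by rewrite gridptS ltrDl mesh_gt0. Qed.

Lemma gridpt_le n i j : (i <= j)%N -> gridpt n i <= gridpt n j.
Proof.
by move=> ij; rewrite lerD2l ler_wpM2r ?ler_nat// ltW// mesh_gt0.
Qed.

Lemma gridpt_ge n j : s <= gridpt n j.
Proof. by rewrite -{1}(gridpt0 n) gridpt_le. Qed.

Lemma gridpt_lt_end n j : (j < n.+1)%N -> gridpt n j < t.
Proof.
by move=> jn; rewrite -(gridpt_last n) (lt_le_trans (gridpt_lt _ _))// gridpt_le.
Qed.

Lemma gridpt_le_end n j : (j <= n.+1)%N -> gridpt n j <= t.
Proof. by move=> jn; rewrite -(gridpt_last n) gridpt_le. Qed.

Lemma mesh_cvg0 (e : R) : 0 < e -> \forall n \near \oo, mesh n < e.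
Proof.
move=> e0; have ts : 0 < t - s by rewrite subr_gt0.
near=> n; rewrite /mesh ltr_pdivrMr// mulrC -ltr_pdivrMr//.
have : (t - s) / e < n%:R by near: n; exact: nbhs_infty_gtr.
by move=> /lt_le_trans; apply; rewrite ler_nat.
Unshelve. all: end_near. Qed.

Definition step_fun (G : R -> R) n k (x : R) : R :=
  \sum_(0 <= j < k) G (gridpt n j) * \1_`[gridpt n j, gridpt n j.+1[ x.

Lemma step_funE G n k x : s <= x -> x < gridpt n k ->
  exists j, [/\ (j < k)%N, gridpt n j <= x < gridpt n j.+1 &
    step_fun G n k x = G (gridpt n j)].
Proof.
move=> sx; elim: k => [|k IH].
  by rewrite gridpt0 => /(le_lt_trans sx); rewrite ltxx.
move=> xk; rewrite /step_fun; have [kx|xk'] := leP (gridpt n k) x.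
  exists k; split; rewrite ?kx// big_nat_recr//= big1_seq ?add0r => [|i].
    by rewrite indicE mem_set ?mulr1//= in_itv/= kx.
  rewrite mem_index_iota => /andP[_ ik]; rewrite indicE memNset ?mulr0//=.
  by rewrite in_itv/= => /andP[_]; rewrite ltNge (le_trans _ kx)// gridpt_le.
have [j [jk jx fj]] := IH xk'; exists j; split=> //; first by rewrite ltnS ltnW.
rewrite big_nat_recr//= -/(step_fun G n k x) fj indicE memNset ?mulr0 ?addr0//=.
by rewrite in_itv/= leNgt xk'.
Qed.

Lemma measurable_step_fun G n k : measurable_fun setT (step_fun G n k).
Proof.
elim: k => [|k IH].
  by rewrite /step_fun; under eq_fun do rewrite big_nil; exact: measurable_cst.
rewrite /step_fun; under eq_fun do rewrite big_nat_recr//=.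
by apply: measurable_funD => //; apply: measurable_funM.
Qed.

Lemma integral_step_fun G n k : (k <= n.+1)%N ->
  leb.-integrable `[s, t[ (EFin \o step_fun G n k) /\
  (\int[leb]_(x in `[s, t[) (step_fun G n k x)%:E =
    (\sum_(0 <= j < k) G (gridpt n j) * mesh n)%:E)%E.
Proof.
have fin : (leb `[s, t[%classic < +oo)%E.
  by rewrite lebesgue_measure_itv/= lte_fin st -EFinB ltry.
elim: k => [|k IH] kn.
  have -> : step_fun G n 0 = cst 0 by apply/funext => x; rewrite /step_fun big_nil.
  rewrite big_nil; split; first exact: integrable0.
  by rewrite integral0.
have [IH1 IH2] := IH (ltnW kn).
have mI : measurable `[gridpt n k, gridpt n k.+1[%classic by exact: measurable_itv.
have iI : leb.-integrable `[s, t[ (EFin \o \1_`[gridpt n k, gridpt n k.+1[%classic).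
  apply/integrableP; split.
    by apply/measurable_EFinP; apply: measurable_funTS.
  under eq_integral do rewrite /= ger0_norm//.
  rewrite integral_indic//; apply: le_lt_trans fin.
  by rewrite le_measure ?inE//; exact: measurableI.
have E : EFin \o step_fun G n k.+1 = (EFin \o step_fun G n k) \+
    (fun x => (G (gridpt n k))%:E * (\1_`[gridpt n k, gridpt n k.+1[ x)%:E)%E.
  by apply/funext => x /=; rewrite /step_fun big_nat_recr//=.
have iG : leb.-integrable `[s, t[
    (fun x => (G (gridpt n k))%:E * (\1_`[gridpt n k, gridpt n k.+1[ x)%:E)%E.
  by apply: integrableZl => //; exact: measurable_itv.
split; first by rewrite E; exact: integrableD.
rewrite [LHS](_ : _ = (\int[leb]_(x in `[s, t[) ((EFin \o step_fun G n k) \+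
    (fun x => (G (gridpt n k))%:E * (\1_`[gridpt n k, gridpt n k.+1[ x)%:E)) x)%E); last first.
  by apply: eq_integral => x _; exact: (congr1 (fun f => f x) E).
rewrite integralD// IH2 big_nat_recr//= EFinD; congr (_ + _)%E.
rewrite integralZl// integral_indic// EFinM; congr (_ * _)%E.
rewrite setIidl; last first.
  move=> x /=; rewrite !in_itv/= => /andP[a b].
  by rewrite (le_trans (gridpt_ge n k) a) (lt_le_trans b)// gridpt_le_end.
have lI : leb `[gridpt n k, gridpt n k.+1[%classic = (mesh n)%:E.
  by rewrite lebesgue_measure_itv/= lte_fin gridpt_lt -EFinB gridptS_sub.
exact: lI.
Qed.

(** The sums are integrals of left-endpoint step functions, which converge to [G] at its continuity
    points; dominated convergence concludes. *)
Lemma riemann_sum_cvg (G : R -> R) (c : R) : measurable_fun `[s, t[ G ->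
  (forall x, s <= x < t -> `|G x| <= c) ->
  (\forall x \ae leb, s < x < t -> {for x, continuous G}) ->
  \sum_(0 <= j < n.+1) G (gridpt n j) * mesh n @[n --> \oo] -->
    fine (\int[leb]_(x in `[s, t[) (G x)%:E)%E.
Proof.
move=> mG Gc Gcont.
have fin : (leb `[s, t[%classic < +oo)%E.
  by rewrite lebesgue_measure_itv/= lte_fin st -EFinB ltry.
have [|||||i1 _ i3] := @dominated_convergence _ _ _ leb `[s, t[%classic
  (measurable_itv `[s, t[) (fun n => EFin \o step_fun G n n.+1) (EFin \o G) (cst c%:E).
- by move=> n; apply/measurable_EFinP; apply: measurable_funTS;
    exact: measurable_step_fun.
- exact/measurable_EFinP.
- have [N [mN N0 sN]] := Gcont; exists N; split=> //.
  apply: subset_trans sN; apply: subsetC => x /= Gx.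
  rewrite in_itv/= => /andP[sx xt].
  apply: cvg_EFin; first exact: nearW.
  (* At [s] no continuity is assumed, but there every step function already takes the value
     [G s]. *)
  have [->|xs] := eqVneq x s.
    apply: cvg_near_cst; apply: nearW => n /=; apply/eqP.
    have [||j [_ /andP[js _] ->]] := @step_funE G n n.+1 s => //.
      by rewrite gridpt_last.
    by rewrite (_ : gridpt n j = s)//; apply/eqP; rewrite eq_le js gridpt_ge.
  have sx' : s < x by rewrite lt_def xs.
  have := Gx; rewrite sx' xt => /(_ isT) Gx'.
  apply/cvgrPdist_lt => e e0.
  have /cvgrPdist_lt/(_ e e0)[eta /= eta0 He] := Gx'.
  apply: filterS (mesh_cvg0 eta0) => n me /=.
  have [||j [_ /andP[jx xj] ->]] := @step_funE G n n.+1 x => //.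
    by rewrite gridpt_last.
  apply: He => /=; rewrite ger0_norm ?subr_ge0//.
  by apply: le_lt_trans me; rewrite -(gridptS_sub n j) lerD2r ltW.
- apply/integrableP; split; first exact: measurable_cst.
  rewrite (_ : (fun x => _) = cst `|c|%:E)//.
  rewrite integral_cst; last exact: measurable_itv.
  by apply: lte_mul_pinfty.
- apply: aeW => x n /=; rewrite in_itv/= => /andP[sx xt]; rewrite lee_fin.
  have [||j [jn /andP[jx xj] ->]] := @step_funE G n n.+1 x => //.
    by rewrite gridpt_last.
  by apply: Gc; rewrite gridpt_ge gridpt_lt_end.
have e : (fun n => \int[leb]_(x in `[s, t[) (EFin \o step_fun G n n.+1) x)%E =
    (fun n => (\sum_(0 <= j < n.+1) G (gridpt n j) * mesh n)%:E).
  by apply/funext => n; exact: (integral_step_fun G (leqnn n.+1)).2.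
move: i3; rewrite /= [X in X @ _]e -[X in _ --> X]fineK; last first.
  exact: (integrable_fin_num _ i1).
by move=> /fine_cvg.
Qed.

(** The cells whose left endpoint is at most [u] form an initial block, so the sum telescopes to a
    grid point. The last two clauses locate that point within one mesh of [u], unless the block is
    empty or contains all cells. *)
Lemma indic_sum_telescope (f : R -> R) n k (u : R) :
  exists j, [/\ (j <= k)%N,
    \sum_(0 <= i < k) (gridpt n i <= u)%R%:R * (f (gridpt n i.+1) - f (gridpt n i)) =
      f (gridpt n j) - f s,
    j = 0%N \/ gridpt n j <= u + mesh n & j = k \/ u < gridpt n j].
Proof.
elim: k => [|k [j [jk E h1 h2]]].
  by exists 0%N; rewrite big_nil gridpt0 subrr; split => //; left.
rewrite big_nat_recr//= E; have [ku|ku] := leP (gridpt n k) u.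
  have jk' : j = k.
    by case: h2 => // uj; move: (le_lt_trans ku uj); rewrite ltNge gridpt_le.
  exists k.+1; rewrite jk' mul1r; split => //; [by ring| |by left].
  by right; rewrite gridptS lerD2r.
exists j; rewrite mul0r addr0; split=> //; first by rewrite (leq_trans jk).
by right; case: h2 => [->|].
Qed.

(** By telescoping, the sum is an increment of [f] from [s] to a grid point that lies within one
    mesh of [u] clamped to [s, t]. *)
Lemma indic_sum_cvg (f : R -> R) (u : R) :
  (forall x, s <= x <= t -> forall e : R, 0 < e -> exists2 eta : R, 0 < eta &
     forall y, s <= y <= t -> `|y - x| < eta -> `|f y - f x| < e) ->
  \sum_(0 <= i < n.+1) (gridpt n i <= u)%R%:R * (f (gridpt n i.+1) - f (gridpt n i))
    @[n --> \oo] --> f (Num.min t u) - f (Num.min s u).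
Proof.
move=> fc; set y0 := Num.max s (Num.min t u).
have sty0 : s <= y0 <= t.
  by rewrite /y0 le_max lexx/= ge_max (ltW st) ge_min lexx.
have -> : f (Num.min t u) - f (Num.min s u) = f y0 - f s.
  rewrite /y0; have [us|us] := leP u s.
    rewrite (min_r (x := t)) ?(le_trans us (ltW st))// (max_l (x := s))//.
    by rewrite !subrr.
  by rewrite max_r// le_min (ltW st) ltW.
apply/cvgrPdist_lt => e e0; have [eta eta0 H] := fc _ sty0 e e0.
apply: filterS (mesh_cvg0 eta0) => n me.
have m0 := mesh_gt0 n.
have [j [jn -> h1 h2]] := indic_sum_telescope f n n.+1 u.
have -> : f y0 - f s - (f (gridpt n j) - f s) = f y0 - f (gridpt n j) by ring.
rewrite distrC; apply: H.
  by rewrite gridpt_ge gridpt_le_end.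
apply: le_lt_trans me.
have sj := gridpt_ge n j; have jt := gridpt_le_end jn.
have h1' : gridpt n j = s \/ gridpt n j <= u + mesh n.
  by case: h1 => [->|]; [left; rewrite gridpt0|right].
have h2' : gridpt n j = t \/ u < gridpt n j.
  by case: h2 => [->|]; [left; rewrite gridpt_last|right].
clear h1 h2; move: (gridpt n j) sj jt h1' h2' => r sr rt h1 h2.
rewrite /y0 ler_norml; have [ut|ut] := leP t u.
  by rewrite max_r ?(ltW st)//; move: st h1 h2 => st' [->|?] [->|?]; lra.
have [us|us] := leP u s.
  by move: st h1 h2 => st' [h1|h1] [h2|h2]; apply/andP; split; lra.
by move: st h1 h2 => st' [h1|h1] [h2|h2]; apply/andP; split; lra.
Qed.

End uniform_grid.

Lemma within_cont_dist (R : realType) (A : set R) (f : R -> R) (x : R) :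
  {within A, continuous f} -> A x -> forall e : R, 0 < e ->
  exists2 eta : R, 0 < eta & forall y, A y -> `|y - x| < eta -> `|f y - f x| < e.
Proof.
move=> cf Ax e e0; have := cf x.
rewrite /continuous_at /=.
rewrite -[X in X @ _ --> _]/f /nbhs/= -nbhs_subspace_in// => /cvgrPdist_lt/(_ e e0).
rewrite /within /= => -[eta /= eta0 H]; exists eta => // y Ay yx.
by rewrite distrC; apply: H => //=; rewrite distrC.
Qed.

Lemma cvg_ord_sum (R : realType) (T : Type) (G : set_system T) (FG : Filter G) n
    (f : 'I_n -> T -> R) (l : 'I_n -> R) : (forall i, f i x @[x --> G] --> l i) ->
  \sum_(i < n) f i x @[x --> G] --> \sum_(i < n) l i.
Proof.
elim: n f l => [|n IH] f l fl.
  by under eq_fun do rewrite big_ord0; rewrite big_ord0; exact: cvg_cst.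
under eq_fun do rewrite big_ord_recl; rewrite big_ord_recl.
by apply: cvgD; [exact: fl|apply: IH => i; exact: fl].
Qed.

Lemma cvg0_eventually (R : realType) (g : nat -> \bar R) (e : R) : 0 < e ->
  g @ \oo --> 0%E -> \forall k \near \oo, (g k <= e%:E)%E.
Proof.
move=> e0 /fine_cvgP[fin /cvgrPdist_le/(_ _ e0) H].
apply: filterS2 fin H => k f; rewrite /= sub0r normrN => h.
by rewrite -(fineK f) lee_fin (le_trans (ler_norm _) h).
Qed.

Lemma measurable_sum_nat d (T : measurableType d) (R : realType) n
    (F : nat -> T -> R) : (forall i, (i < n)%N -> measurable_fun setT (F i)) ->
  measurable_fun setT (fun w => \sum_(0 <= i < n) F i w).
Proof.
elim: n => [|n IH] mF.
  by under eq_fun do rewrite big_nil; exact: measurable_cst.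
under eq_fun do rewrite big_nat_recr//=.
by apply: measurable_funD; [apply: IH => i ni; apply: mF; exact: ltnW|exact: mF].
Qed.

Lemma bounded_integrable_itv (R : realType) (s t : R) (G : R -> R) (c : R) :
  s < t -> measurable_fun `[s, t[ G ->
  (forall x, s <= x < t -> `|G x| <= c) ->
  (@lebesgue_measure R).-integrable `[s, t[ (EFin \o G).
Proof.
move=> st mG Gc; apply/integrableP; split; first exact/measurable_EFinP.
have c0 : 0 <= c by rewrite (le_trans _ (Gc s _))// lexx.
apply: (@le_lt_trans _ _ (\int[lebesgue_measure]_(x in `[s, t[) (cst c%:E) x)%E).
  apply: ge0_le_integral_any => [x _|x _|//|x].
  - exact: abse_ge0.
  - by rewrite lee_fin.
  - by rewrite /= in_itv/= => sx; rewrite lee_fin Gc.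
rewrite integral_cst; last exact: measurable_itv.
apply: lte_mul_pinfty => //.
by rewrite [X in (X < _)%E]lebesgue_measure_itv/= lte_fin st -EFinB ltry.
Qed.

Lemma mean_le_exact d (Omega : measurableType d) (R : realType)
    (P : probability Omega R) (f : Omega -> R) a :
  mean_le P f a -> mean_le P f (fine (\int[P]_w (f w)%:E)%E).
Proof.
move=> fa; have [mf f0 _] := fa; split=> //.
by rewrite fineK// (integrable_fin_num _ (mean_le_integrable fa)).
Qed.

(** For Lenglart's inequality, where a bracket is bounded path by path. Adding the bounds of its
    single terms would lose a factor [n], so their exact means are summed. *)
Lemma sum_exact_le d (Omega : measurableType d) (R : realType)
    (P : probability Omega R) (f : nat -> Omega -> R) a (c N : R) n : 0 <= c ->
  (forall i, (i < n)%N -> mean_le P (f i) (a i)) ->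
  (forall w, \sum_(0 <= i < n) f i w * c <= N) ->
  \sum_(0 <= i < n) fine (\int[P]_w (f i w)%:E)%E * c <= N.
Proof.
move=> c0 fa fN.
have key k : (k <= n)%N ->
    (\int[P]_w (\sum_(0 <= i < k) f i w * c)%:E =
     (\sum_(0 <= i < k) fine (\int[P]_w (f i w)%:E) * c)%:E)%E.
  elim: k => [|k IH] kn.
    by under eq_integral do rewrite big_nil; rewrite integral0 big_nil.
  under eq_integral do rewrite big_nat_recr//= EFinD.
  rewrite big_nat_recr//= EFinD -IH ?(ltnW kn)//.
  have h i : (i < n)%N -> mean_le P (fun w => f i w * c) (c * a i).
    move=> ni; rewrite (_ : (fun w => _) = (fun w => c * f i w)).
      by apply: mean_leZ => //; exact: fa.
    by apply/funext => w; rewrite mulrC.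
  have hs : mean_le P (fun w => \sum_(0 <= i < k) f i w * c) (\sum_(0 <= i < k) c * a i).
    by apply: mean_le_sum_nat => i ik; apply: h; rewrite (ltn_trans ik).
  rewrite integralD//; last 2 first.
  - exact: (mean_le_integrable hs).
  - exact: (mean_le_integrable (h k kn)).
  congr (_ + _)%E.
  have hk := fa k kn; have [mk k0 _] := hk.
  under eq_integral do rewrite mulrC EFinM.
  rewrite integralZl//; last exact: (mean_le_integrable hk).
  rewrite mulrC EFinM fineK//.
  by rewrite (integrable_fin_num _ (mean_le_integrable hk)).
rewrite -lee_fin -key//.
apply: (@le_trans _ _ (\int[P]_w (cst N w)%:E)%E); last first.
  by rewrite (integral_cst P measurableT N%:E) [X in (_ * X)%E](_ : _ = 1%E) ?mule1//;
    exact: probability_setT.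
have S0 w : 0 <= \sum_(0 <= i < n) f i w * c.
  rewrite big_nat; apply: sumr_ge0 => i /andP[_ ni].
  by rewrite mulr_ge0//; have [_ ->] := fa i ni.
by apply: ge0_le_integral_any => // w _; rewrite lee_fin// (le_trans (S0 w)).
Qed.

Section ito_riemann.
Context d (Omega : measurableType d) (R : realType) (P : probability Omega R).
Hypothesis Pc : measure_is_complete P.
Context (F : R -> set (set Omega)) (W : R -> Omega -> R) (FW : fbm P F W).
Context (s t : R) (s0 : 0 <= s) (st : s < t).
Local Notation "'P^*'" := ((P^*)%mu).
Local Notation tau := (gridpt s t).

Lemma grid_ge0 n j : 0 <= tau n j.
Proof. exact: le_trans s0 (gridpt_ge st n j). Qed.

Definition rsum (H : R -> Omega -> R) n w :=
  \sum_(0 <= j < n.+1) H (tau n j) w * (W (tau n j.+1) w - W (tau n j) w).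

(* Lenglart's inequality: the coefficients are cut off, predictably, once the
   bracket exceeds [N]. *)
Lemma lenglart n (D : nat -> Omega -> R) (e N : R) : 0 < e -> 0 < N ->
  (forall j, (j < n.+1)%N -> rv_wrt (F (tau n j)) (D j)) ->
  (P^* [set w | (e <= `|\sum_(0 <= j < n.+1) D j w * (W (tau n j.+1) w - W (tau n j) w)|)%R]
   <= P^* [set w | (N <= \sum_(0 <= j < n.+1) D j w ^+ 2 * mesh s t n)%R]
     + (65 * N / e ^+ 2)%:E)%E.
Proof.
move=> e0 N0 FD.
have m0 : 0 < mesh s t n := mesh_gt0 st n.
pose A i w := \sum_(0 <= l < i.+1) D l w ^+ 2 * mesh s t n.
(* Index [i] is kept as long as the bracket including its own term is at most [N]: this is known at
   the time of index [i], and the cut bracket cannot overshoot. *)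
pose D' i w := if (i < n.+1)%N then D i w * \1_[set w | A i w <= N] w else 0.
have Amono w i j : (i <= j)%N -> A i w <= A j w.
  move=> ij; rewrite /A (@big_cat_nat _ _ _ i.+1 0%N j.+1)//= lerDl sumr_ge0// => l _.
  by rewrite mulr_ge0 ?sqr_ge0// ltW.
have FA i : (i < n.+1)%N -> rv_wrt (F (tau n i)) (A i).
  move=> ni; have sa := fbm_sa FW (grid_ge0 n i).
  apply: rv_wrt_sum_nat => // l li; apply: rv_wrtM; [by []| |exact: rv_wrt_cst].
  apply: rv_wrtX => //; apply: (rv_wrtS (fbm_mono FW (grid_ge0 n l) _)).
    exact: gridpt_le.
  by apply: FD; exact: leq_trans li ni.
have FD' i : rv_wrt (F (tau n i)) (D' i).
  have sa := fbm_sa FW (grid_ge0 n i).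
  have [ni|ni] := boolP (i < n.+1)%N; last first.
    rewrite (_ : D' i = cst 0); first exact: rv_wrt_cst.
    by apply/funext => w; rewrite /D' (negbTE ni).
  rewrite (_ : D' i = (fun w => D i w * \1_[set w | A i w <= N] w)); last first.
    by apply/funext => w; rewrite /D' ni.
  apply: rv_wrtM => //; first exact: FD.
  by apply: rv_wrt_indic => //; apply: rv_wrt_set_le; exact: FA.
have D'D i w : D' i w ^+ 2 <= D i w ^+ 2.
  rewrite /D'; case: ifPn => _; last by rewrite expr0n sqr_ge0.
  by rewrite indicE; case: (_ \in _); rewrite ?mulr1// mulr0 expr0n sqr_ge0.
have sumD' w k : (k <= n.+1)%N -> \sum_(0 <= i < k) D' i w ^+ 2 * mesh s t n <= N.
  elim: k => [|k IH] kn; first by rewrite big_nil ltW.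
  have [AN|AN] := leP (A k w) N.
    apply: le_trans AN; apply: ler_sum => i _.
    by rewrite ler_wpM2r// ltW.
  have D'0 : D' k w = 0.
    rewrite /D' kn indicE memNset ?mulr0//=.
    by apply/negP; rewrite -ltNge.
  by rewrite big_nat_recr//= D'0 expr0n/= mul0r addr0 IH// ltnW.
have mD' i : measurable_fun setT (D' i).
  exact: (adapted_measurable FW (grid_ge0 n i) (@FD' i)).
have bD' i : (i < n.+1)%N -> mean_le P (fun w => D' i w ^+ 2) (N / mesh s t n).
  move=> ni; apply: (mean_le_le _ _ _ (mean_le_cst P (c := N / mesh s t n) _)).
  - exact: measurable_funX.
  - by move=> w; exact: sqr_ge0.
  - move=> w /=; rewrite ler_pdivlMr//; apply: le_trans (sumD' w i.+1 ni).
    rewrite big_nat_recr//= lerDr sumr_ge0// => l _.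
    by rewrite mulr_ge0 ?sqr_ge0// ltW.
  - by rewrite divr_ge0// ltW.
have hM := mean_le_msum2 FW (tau := tau n) (grid_ge0 n 0) (gridpt_lt st n)
   (fun i => @FD' i) (fun i ni => mean_le_exact (bD' i ni)).
have hN : \sum_(0 <= i < n.+1) fine (\int[P]_w (D' i w ^+ 2)%:E)%E * (tau n i.+1 - tau n i) <= N.
  under eq_big_nat do rewrite gridptS_sub.
  apply: (sum_exact_le (ltW m0) bD') => w; exact: sumD'.
have {}hM := mean_le_trans (ler_wpM2l (ler0n R 65) hN) hM.
have e20 : 0 < e ^+ 2 by rewrite exprn_gt0.
have := markov_mean_le hM e20.
set E := [set w | _] => PE.
have mE : measurable E.
  have [mM _ _] := hM.
  by rewrite -[X in measurable X]setTI; apply: measurable_fun_le.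
apply: (@le_trans _ _ (P^* [set w | (N <= A n w)%R] + P^* E)%E); last first.
  by rewrite leeD2l// measurable_mu_extE.
apply: le_trans (outer_measureU2 _ _ _); apply: le_outer_measure => w /= ew.
have [NA|AN] := leP N (A n w); [by left|right].
rewrite /E/= -(ger0_norm (ltW e0)) -[leRHS]real_normK ?num_real// (ger0_norm (ltW e0)).
have -> : msum_ W (tau n) D' n.+1 w =
   \sum_(0 <= j < n.+1) D j w * (W (tau n j.+1) w - W (tau n j) w).
  apply: eq_big_nat => j /andP[_ jn]; congr (_ * _).
  rewrite /D' jn indicE mem_set ?mulr1//=.
  by apply: le_trans (ltW AN); apply: Amono.
by rewrite lerXn2r// nnegrE// ltW.
Qed.

Section simple_process.
Context (S : step_process Omega R) (simS : is_simple F S).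

Lemma sp_time_ge0 j : (j <= sp_size S)%N -> 0 <= sp_time S j.
Proof.
elim: j => [|j IH] jS; first by case: simS.
by have [_ /(_ j jS)[h _ _]] := simS; rewrite (le_trans (IH (ltnW jS))).
Qed.

Lemma sp_val_adapted r : 0 <= r -> rv_wrt (F r) (sp_val S r).
Proof.
move=> r0; have sa := fbm_sa FW r0; rewrite /sp_val.
pose G j w := sp_coef S j w * (sp_time S j < r <= sp_time S j.+1)%R%:R.
have -> : (fun w => \sum_(j < sp_size S) sp_coef S j w *
    (sp_time S j < r <= sp_time S j.+1)%R%:R) = (fun w => \sum_(0 <= j < sp_size S) G j w).
  by apply/funext => w; rewrite big_mkord.
apply: rv_wrt_sum_nat => // j jS; rewrite /G.
have [h|h] := boolP (sp_time S j < r <= sp_time S j.+1); last first.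
  rewrite (_ : (fun w => _) = cst 0); last by apply/funext => w; rewrite mulr0.
  exact: rv_wrt_cst.
apply: rv_wrtM => //; last exact: rv_wrt_cst.
have [_ /(_ j jS)[_ FS _]] := simS.
apply: rv_wrtS FS; apply: (fbm_mono FW); first by apply: sp_time_ge0; exact: ltnW.
by case/andP: h => /ltW.
Qed.

Lemma sp_integral_measurable r : 0 <= r -> measurable_fun setT (sp_integral S W r).
Proof.
move=> r0; rewrite /sp_integral.
pose G j w := if (j < sp_size S)%N then sp_coef S j w *
    (W (Num.min r (sp_time S j.+1)) w - W (Num.min r (sp_time S j)) w) else 0.
have -> : (fun w => \sum_(j < sp_size S) sp_coef S j w *
    (W (Num.min r (sp_time S j.+1)) w - W (Num.min r (sp_time S j)) w)) =
    (fun w => \sum_(j < sp_size S) G j w).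
  by apply/funext => w; apply: eq_bigr => j _; rewrite /G ltn_ord.
apply: measurable_sum => j.
have jS := ltn_ord j; rewrite /G jS.
have [_ /(_ _ jS)[_ FS _]] := simS.
have mn k : (k <= sp_size S)%N -> measurable_fun setT (W (Num.min r (sp_time S k))).
  by move=> kS; apply: (fbm_measurable FW); rewrite le_min r0 sp_time_ge0.
apply: measurable_funM.
  by apply: (adapted_measurable FW _ FS); apply: sp_time_ge0; exact: ltnW.
by apply: measurable_funB; apply: mn => //; exact: ltnW.
Qed.

(** The indicator of a half-open interval is a difference of two indicators of half-lines, each of
    which gives a telescoping sum; continuity of the path of [W] then yields the limit. *)
Lemma sp_rsum_cvg w : {within `[0, +oo[, continuous (fun r => W r w)} ->
  rsum (sp_val S) n w @[n --> \oo] --> sp_integral S W t w - sp_integral S W s w.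
Proof.
move=> cW.
have Wc x : s <= x <= t -> forall e : R, 0 < e -> exists2 eta : R, 0 < eta &
     forall y, s <= y <= t -> `|y - x| < eta -> `|W y w - W x w| < e.
  move=> /andP[sx _] e e0.
  have Ax : `[0, +oo[%classic x by rewrite /= in_itv/= andbT (le_trans s0).
  have [eta eta0 H] := within_cont_dist cW Ax e0; exists eta => // y /andP[sy _].
  by apply: H; rewrite /= in_itv/= andbT (le_trans s0).
pose I u n := \sum_(0 <= i < n.+1) (tau n i <= u)%R%:R *
   (W (tau n i.+1) w - W (tau n i) w).
have Ic u : I u n @[n --> \oo] --> _ := @indic_sum_cvg R s t st (fun r => W r w) u Wc.
have -> : sp_integral S W t w - sp_integral S W s w =
  \sum_(j < sp_size S) sp_coef S j w *
   ((W (Num.min t (sp_time S j.+1)) w - W (Num.min s (sp_time S j.+1)) w) -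
    (W (Num.min t (sp_time S j)) w - W (Num.min s (sp_time S j)) w)).
  rewrite /sp_integral -sumrB; apply: eq_bigr => j _; ring.
have -> : (fun n => rsum (sp_val S) n w) = (fun n => \sum_(j < sp_size S)
    sp_coef S j w * (I (sp_time S j.+1) n - I (sp_time S j) n)).
  apply/funext => n; rewrite /rsum /sp_val.
  under eq_bigr do rewrite mulr_suml.
  rewrite exchange_big/=; apply: eq_bigr => j _.
  rewrite /I -sumrB mulr_sumr; apply: eq_bigr => i _.
  rewrite -mulrBl mulrA; congr (_ * _ * _).
  have [_ /(_ _ (ltn_ord j))[ab _ _]] := simS.
  have [a|a] := ltP (sp_time S j) (tau n i) => /=; first by rewrite subr0.
  by rewrite (le_trans a ab) subrr.
apply: cvg_ord_sum => j; apply: cvgMl_tmp; apply: cvgB; exact: Ic.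
Qed.

Lemma sp_val_bounded w : exists c : R, forall r, `|sp_val S r w| <= c.
Proof.
exists (\sum_(j < sp_size S) `|sp_coef S j w|) => r.
apply: le_trans (ler_norm_sum _ _ _) _; apply: ler_sum => j _.
by rewrite normrM ler_piMr// ger0_norm//; case: (_ && _).
Qed.

Lemma sp_val_cont w : \forall r \ae (@lebesgue_measure R),
  {for r, continuous (fun r => sp_val S r w)}.
Proof.
exists (range (sp_time S)); split.
- by apply: countable_measurable => //; exact: card_image_le.
- by apply: countable_lebesgue_measure0; exact: card_image_le.
move=> r /= Nr; apply: contrapT => nr; apply: Nr.
have nj j : r != sp_time S j by apply/eqP => rj; apply: nr; exists j.
apply: cvg_ord_sum => j; apply: cvgMl_tmp.
have near_le u : r != u -> \forall x \near r, (x <= u) = (r <= u) /\ (u < x) = (u < r).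
  move=> ru; have [h|h|h] := ltgtP r u; last by rewrite h eqxx in ru.
  - near=> x; have xu : x < u by near: x; exact: lt_nbhsl.
    by rewrite (ltW xu) !ltNge (ltW xu).
  - near=> x; have xu : u < x by near: x; exact: lt_nbhsr.
    by rewrite xu leNgt xu.
apply: cvg_near_cst.
near=> x.
have [_ h1] : (x <= sp_time S j) = (r <= sp_time S j) /\
  (sp_time S j < x) = (sp_time S j < r) by near: x; exact: near_le.
have [h2 _] : (x <= sp_time S j.+1) = (r <= sp_time S j.+1) /\
  (sp_time S j.+1 < x) = (sp_time S j.+1 < r) by near: x; exact: near_le.
by rewrite h1 h2.
Unshelve. all: end_near. Qed.

Lemma sp_val_measurable_time w : measurable_fun setT (fun r => sp_val S r w).
Proof.
apply: measurable_sum => j; apply: measurable_funM => //.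
rewrite (_ : (fun r => _) = (\1_`]sp_time S j, sp_time S j.+1] : R -> R)).
  by apply: measurable_indic; exact: measurable_itv.
apply/funext => r; rewrite indicE; congr (_%:R); congr nat_of_bool.
by apply/idP/idP => [|/set_mem]; rewrite ?inE /= in_itv.
Qed.

End simple_process.

Lemma rsum_measurable (H : R -> Omega -> R) n :
  (forall r, s <= r < t -> measurable_fun setT (H r)) ->
  measurable_fun setT (rsum H n).
Proof.
move=> mH; rewrite /rsum.
apply: measurable_sum_nat => j jn.
apply: measurable_funM; first by apply: mH; rewrite gridpt_ge//= gridpt_lt_end.
by apply: (fbm_incr_measurable FW (grid_ge0 _ _)); exact: gridpt_lt.
Qed.

Lemma riemann_ito T H J : ito_integral P F T W H J -> t <= T ->
  (forall r, s <= r < t -> rv_wrt (F r) (H r)) ->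
  (\forall w \ae P, (exists c : R, forall r, s <= r < t -> `|H r w| <= c) /\
     forall r, s < r < t -> {for r, continuous (fun r => H r w)}) ->
  cvgp P (rsum H) (fun w => J t w - J s w).
Proof.
move=> [_ _ [S [simS cS cI]]] tT FH niceH e eta e0 eta0.
have t0 : 0 <= t by rewrite (le_trans s0)// ltW.
have mH r : s <= r < t -> measurable_fun setT (H r).
  move=> srt; apply: (adapted_measurable FW _ (FH r srt)).
  by case/andP: srt => sr _; rewrite (le_trans s0).
(* Four errors are added, each up to e / 4: the sum of the difference, that of the simple process,
   and the values of [J] at [t] and at [s]. Their probabilities are at most 3, 1, 1 and 1 times eta
   / 8. *)
pose e4 := e / 4; pose et := eta / 8.
have e40 : 0 < e4 by rewrite divr_gt0.
have et0 : 0 < et by rewrite divr_gt0.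
(* The level at which the last term of Lenglart's inequality, 65 N0 / e4^2, equals [et]. *)
pose N0 := et * e4 ^+ 2 / 65.
have e420 : 0 < e4 ^+ 2 by rewrite exprn_gt0.
have N00 : 0 < N0 by rewrite divr_gt0// mulr_gt0.
have N02 : 0 < N0 / 2 by rewrite divr_gt0.
have Jcv r : 0 <= r <= T -> \forall k \near \oo,
    (P^* [set w | (e4 <= `|sp_integral (S k) W r w - J r w|)%R] <= et%:E)%E.
  move=> rT; have rT' : r \in `[0, T] by rewrite in_itv.
  apply: cvgpE => //.
  rewrite [X in cvg_to0_in_probability _ X](_ : _ = (fun k w => `|J r w - sp_integral (S k) W r w|%:E)).
    exact: cI.
  by apply/funext => k; apply/funext => w; rewrite distrC.
have Scv : \forall k \near \oo, (P^* [set w | ((N0 / 2)%:E <=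
    \int[lebesgue_measure]_(r in `[0%R, T]) ((H r w - sp_val (S k) r w) ^+ 2)%:E)%E] <= et%:E)%E.
  exact: (cvg0_eventually et0 (cS _ N02)).
have [k [[Jt Js] Sk]] : exists k,
  ((P^* [set w | (e4 <= `|sp_integral (S k) W t w - J t w|)%R] <= et%:E)%E /\
   (P^* [set w | (e4 <= `|sp_integral (S k) W s w - J s w|)%R] <= et%:E)%E) /\
   (P^* [set w | ((N0 / 2)%:E <=
    \int[lebesgue_measure]_(r in `[0%R, T]) ((H r w - sp_val (S k) r w) ^+ 2)%:E)%E] <= et%:E)%E.
  have Jt := Jcv t; have Js := Jcv s.
  rewrite t0 tT in Jt; rewrite s0 (le_trans (ltW st) tT) in Js.
  have := filterI (filterI (Jt isT) (Js isT)) Scv => -[m _ Hm].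
  by exists m; apply: (Hm m) => /=.
have simk := simS k.
pose X n := rsum (sp_val (S k)) n.
have msp r : 0 <= r -> measurable_fun setT (sp_val (S k) r).
  by move=> r0; apply: (adapted_measurable FW r0); exact: sp_val_adapted.
have mX n : measurable_fun setT (X n).
  apply: rsum_measurable => r /andP[sr _]; apply: msp; exact: le_trans sr.
have Xcv : cvgp P X (fun w => sp_integral (S k) W t w - sp_integral (S k) W s w).
  apply: cvgp_of_ae => //.
    by apply: measurable_funB; exact: sp_integral_measurable.
  apply: filterS (fbm_cont FW) => w cw; exact: sp_rsum_cvg.
pose G r w := (H r w - sp_val (S k) r w) ^+ 2.
pose L n w := \sum_(0 <= j < n.+1) G (tau n j) w * mesh s t n.
pose Linf w := fine (\int[lebesgue_measure]_(r in `[s, t[) (G r w)%:E)%E.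
have Lcvw : \forall w \ae P, L^~ w @ \oo --> Linf w /\
    ((Linf w)%:E <= \int[lebesgue_measure]_(r in `[0%R, T]) (G r w)%:E)%E.
  apply: filterS niceH => w [[c Hc] Hcont].
  have [c' Sc] := sp_val_bounded (S k) w.
  have mG : measurable_fun `[s, t[ (fun r => G r w).
    apply: measurable_funX; apply: measurable_funB.
      apply/measurable_fun_itv_obnd_cbndP.
      apply: open_continuous_measurable_fun => // r /[!inE] /=.
      by rewrite in_itv/= => /Hcont.
    by apply: measurable_funTS; exact: sp_val_measurable_time.
  have Gb r : s <= r < t -> `|G r w| <= (c + c') ^+ 2.
    move=> srt; rewrite /G normrX lerXn2r ?nnegrE//.
      by rewrite (le_trans (normr_ge0 (H r w - sp_val (S k) r w)))//;
        rewrite (le_trans (ler_normB _ _))// lerD// Hc.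
    by rewrite (le_trans (ler_normB _ _))// lerD// Hc.
  split.
    apply: (riemann_sum_cvg st mG Gb).
    have [N [mN NN sN]] := sp_val_cont (S k) w; exists N; split=> //.
    apply: subset_trans sN; apply: subsetC => r /= Sr srt.
    rewrite /G; apply: cvgM; apply: cvgB => //; exact: Hcont.
  have iG : lebesgue_measure.-integrable `[s, t[ (fun r => (G r w)%:E).
    exact: bounded_integrable_itv mG Gb.
  rewrite /Linf fineK; last exact: (integrable_fin_num _ iG).
  apply: ge0_le_integral_any => [r _|r _||r _//].
  - by rewrite lee_fin sqr_ge0.
  - by rewrite lee_fin sqr_ge0.
  - move=> r; rewrite /= !in_itv/= => /andP[sr rt].
    by rewrite (le_trans s0 sr) (le_trans (ltW rt) tT).
have mL n : measurable_fun setT (L n).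
  rewrite /L.
  apply: measurable_sum_nat => j jn.
  apply: measurable_funM => //; apply: measurable_funX; apply: measurable_funB.
    by apply: mH; rewrite gridpt_ge//= gridpt_lt_end.
  by apply: msp; exact: grid_ge0.
(* The time integral of a random integrand is seen to be measurable only as an almost sure limit of
   its Riemann sums, by completeness. *)
have mLinf : measurable_fun setT Linf.
  by apply: (ae_cvg_measurable Pc mL); apply: filterS Lcvw => w [].
have Lcv : cvgp P L Linf.
  by apply: cvgp_of_ae => //; apply: filterS Lcvw => w [].
apply: filterS2 (Xcv _ _ e40 et0) (Lcv _ _ N02 et0) => n PX PL.
pose D j w := H (tau n j) w - sp_val (S k) (tau n j) w.
have FD j : (j < n.+1)%N -> rv_wrt (F (tau n j)) (D j).
  move=> jn; apply: rv_wrtB; first exact: (fbm_sa FW (grid_ge0 _ _)).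
    by apply: FH; rewrite gridpt_ge//= gridpt_lt_end.
  by apply: sp_val_adapted => //; exact: grid_ge0.
have PD := lenglart e40 N00 FD.
have h1 : 65 * N0 / e4 ^+ 2 = et by rewrite /N0; field; rewrite gt_eqF.
rewrite h1 in PD.
have PN : (P^* [set w | (N0 <= \sum_(0 <= j < n.+1) D j w ^+ 2 * mesh s t n)%R]
    <= (et + et)%:E)%E.
  rewrite EFinD; apply: le_trans (leeD PL Sk).
  apply: le_trans (outer_measureU2 _ _ _).
  apply: outer_le_ae; apply: filterS Lcvw => w [_ Lw] /=.
  rewrite -/(L n w) => NL.
  have [h|h] := leP (N0 / 2) `|L n w - Linf w|; [by left|right].
  apply: le_trans Lw; rewrite lee_fin.
  by have := ler_norm (L n w - Linf w); lra.
have -> : eta = (et + et + et) + et + et + et + et + et by rewrite /et; lra.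
rewrite EFinD; apply: (@le_trans _ _ ((et + et + et)%:E + et%:E + et%:E + et%:E)%E); last first.
  by rewrite -!EFinD lee_fin; lra.
have PDD : (P^* [set w | (e4 <= `|\sum_(0 <= j < n.+1) D j w * (W (tau n j.+1) w - W (tau n j) w)|)%R]
    <= (et + et + et)%:E)%E.
  by apply: le_trans PD _; rewrite EFinD leeD2r.
apply: le_trans (leeD (leeD (leeD PDD PX) Jt) Js).
apply: le_trans (leeD (le_trans _ (leeD (outer_measureU2 _ _ _) (lexx _))) (lexx _)).
2: exact: outer_measureU2.
apply: le_trans (outer_measureU2 _ _ _).
apply: le_outer_measure => w /= ew.
have E1 : rsum H n w = \sum_(0 <= j < n.+1) D j w * (W (tau n j.+1) w - W (tau n j) w) + X n w.
  rewrite /rsum /X /rsum -big_split/=; apply: eq_bigr => j _.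
  by rewrite /D; ring.
have [a|a] := leP e4 `|sp_integral (S k) W s w - J s w|; [by right|left].
have [b|b] := leP e4 `|sp_integral (S k) W t w - J t w|; [by right|left].
have [c|c] := leP e4 `|X n w - (sp_integral (S k) W t w - sp_integral (S k) W s w)|; [by right|left].
rewrite /= leNgt; apply/negP => f.
move: ew; rewrite leNgt => /negP; apply; rewrite E1.
move: a b c f; rewrite !ltr_norml => /andP[a1 a2] /andP[b1 b2] /andP[c1 c2] /andP[f1 f2].
by move: a1 a2 b1 b2 c1 c2 f1 f2; rewrite /e4 => *; apply/andP; split; lra.
Unshelve. all: end_near. Qed.

End ito_riemann.

Lemma big_nat_mul (R : nmodType) (K m : nat) (F : nat -> R) :
  \sum_(0 <= i < K * m) F i =
  \sum_(0 <= k < K) \sum_(0 <= j < m) F (k * m + j)%N.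
Proof.
elim: K => [|K IH]; first by rewrite mul0n !big_nil.
rewrite big_nat_recr//= -IH mulSn addnC (@big_cat_nat _ _ _ (K * m)%N)//=; last exact: leq_addr.
congr (_ + _); rewrite -{1}[(K * m)%N]add0n big_addn addKn.
by apply: eq_bigr => j _; rewrite addnC.
Qed.

Lemma sum_sqr_le (R : realFieldType) n (m : R) (x : nat -> R) : 0 <= m ->
  (\sum_(0 <= i < n) x i * m) ^+ 2 <=
  n%:R * m * \sum_(0 <= i < n) x i ^+ 2 * m.
Proof.
move=> m0; rewrite -!mulr_suml exprMn.
suff h : (\sum_(0 <= i < n) x i) ^+ 2 <= n%:R * \sum_(0 <= i < n) x i ^+ 2.
  have -> : n%:R * m * ((\sum_(0 <= i < n) x i ^+ 2) * m) =
    n%:R * (\sum_(0 <= i < n) x i ^+ 2) * m ^+ 2 by ring.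
  by rewrite ler_wpM2r// sqr_ge0.
elim: n => [|n IH]; first by rewrite !big_nil expr0n/= mul0r.
rewrite !big_nat_recr//= -natr1.
set S := \sum_(0 <= i < n) x i in IH *; set Q := \sum_(0 <= i < n) x i ^+ 2 in IH *.
have Q0 : 0 <= Q by rewrite /Q sumr_ge0// => i _; exact: sqr_ge0.
case: n => [|n] in S Q IH Q0 *.
  by rewrite /S /Q !big_nil !add0r mul1r.
have k0 : 0 < n.+1%:R :> R by [].
set k : R := n.+1%:R in IH k0 *; set y := x n.+1.
have h : 2 * S * y <= Q + k * y ^+ 2.
  rewrite -(ler_pM2l k0); have := sqr_ge0 (S - k * y); nra.
nra.
Qed.

Lemma sum_pow4_le (R : realFieldType) n (m : R) (x : nat -> R) : 0 <= m ->
  (\sum_(0 <= i < n) x i * m) ^+ 4 <=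
  (n%:R * m) ^+ 3 * \sum_(0 <= i < n) x i ^+ 4 * m.
Proof.
move=> m0; have h1 := sum_sqr_le n x m0.
have h2 := sum_sqr_le n (fun i => x i ^+ 2) m0.
have nm0 : 0 <= n%:R * m by rewrite mulr_ge0.
rewrite (exprM _ 2 2) [leRHS](_ : _ = (n%:R * m) ^+ 2 *
  (n%:R * m * \sum_(0 <= i < n) (x i ^+ 2) ^+ 2 * m)); last first.
  rewrite mulrA -exprSr; congr (_ * _); apply: eq_bigr => i _.
  by rewrite -exprM.
apply: (@le_trans _ _ ((n%:R * m * \sum_(0 <= i < n) x i ^+ 2 * m) ^+ 2)).
  rewrite lerXn2r ?nnegrE ?sqr_ge0// mulr_ge0// sumr_ge0// => i _.
  by rewrite mulr_ge0 ?sqr_ge0.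
by rewrite exprMn ler_wpM2l// sqr_ge0.
Qed.

Lemma pow4D_le (R : realFieldType) (x y : R) :
  (x + y) ^+ 4 <= 8 * x ^+ 4 + 8 * y ^+ 4.
Proof.
have h a b : (a + b) ^+ 2 <= 2 * (a ^+ 2 + b ^+ 2) :> R.
  by have := sqr_ge0 (a - b); nra.
have e z : z ^+ 4 = (z ^+ 2) ^+ 2 :> R by rewrite -exprM.
have h1 := h x y; have h2 := h (x ^+ 2) (y ^+ 2); rewrite !e.
have : ((x + y) ^+ 2) ^+ 2 <= (2 * (x ^+ 2 + y ^+ 2)) ^+ 2.
  by rewrite lerXn2r// nnegrE ?sqr_ge0// mulr_ge0// addr_ge0// sqr_ge0.
have -> : (2 * (x ^+ 2 + y ^+ 2)) ^+ 2 = 4 * (x ^+ 2 + y ^+ 2) ^+ 2 by ring.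
move: h2; lra.
Qed.

Section runmax.
Context (R : realType).
Implicit Types u v : nat -> R.

(** Carries convergence in probability at each index over to the running maximum. *)
Lemma runmax_dist u v n :
  `|runmax u n - runmax v n| <= \sum_(0 <= k < n.+1) `|u k - v k|.
Proof.
elim: n => [|n IH]; first by rewrite big_nat1; exact: ler_dist_dist.
rewrite big_nat_recr//=; have := ler_dist_dist (u n.+1) (v n.+1).
set a := runmax u n in IH *; set b := runmax v n in IH *.
set x := `|u n.+1|; set y := `|v n.+1|.
set S := \sum_(0 <= k < n.+1) _ in IH *; set D := `|u n.+1 - v n.+1|.
move: IH; rewrite !ler_norml => /andP[h1 h2] /andP[h3 h4].
have D0 : 0 <= D by exact: normr_ge0.
have S0 : 0 <= S by rewrite /S sumr_ge0.
by apply/andP; split; case: (leP a x) => ?; case: (leP b y) => ?; lra.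
Qed.

End runmax.

(** * Moments of increments of Ito processes *)

Section ito_increments.
Context d (Omega : measurableType d) (R : realType) (P : probability Omega R).
Context (F : R -> set (set Omega)) (W : R -> Omega -> R) (FW : fbm P F W).

Definition rs (s t : R) (f g : R -> Omega -> R) n w :=
  \sum_(0 <= j < n.+1) (f (gridpt s t n j) w * mesh s t n +
    g (gridpt s t n j) w * (W (gridpt s t n j.+1) w - W (gridpt s t n j) w)).

(* [a] is the increment over [s, t] of the process with drift [f] and
   diffusion coefficient [g]. *)
Definition ito_incr s t f g a := cvgp P (rs s t f g) a.

Lemma ito_incrB s t f g a f' g' a' : ito_incr s t f g a -> ito_incr s t f' g' a' ->
  ito_incr s t (fun r w => f r w - f' r w) (fun r w => g r w - g' r w)
    (fun w => a w - a' w).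
Proof.
move=> h h'; apply: (cvgp_ae_eq (cvgpB h h')) => [n|]; apply: aeW => w //.
by rewrite /rs -sumrB; apply: eq_bigr => j _; ring.
Qed.

Lemma ito_sum_measurable s t f g n : 0 <= s -> s < t ->
  (forall r, s <= r < t -> measurable_fun setT (f r)) ->
  (forall r, s <= r < t -> measurable_fun setT (g r)) ->
  measurable_fun setT (rs s t f g n).
Proof.
move=> s0 st mf mg; apply: measurable_sum_nat => j jn.
have sr : s <= gridpt s t n j < t by rewrite gridpt_ge//= gridpt_lt_end.
apply: measurable_funD; first by apply: measurable_funM => //; exact: mf.
apply: measurable_funM; first exact: mg.
apply: (fbm_incr_measurable FW); last exact: gridpt_lt.
by rewrite (le_trans s0)// gridpt_ge.
Qed.

(** The bound is that of the Riemann sums, passed to the limit by Fatou's lemma. The weight enters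
    each coefficient at its own time: this keeps it adapted, and where [psi t] is 1 it changes
    nothing, because [psi] was 1 before. The drift contributes (t - s)^3 by Jensen, the noise
    [msum4_const] times t - s, and the factor 8 separates them. *)
Lemma ito_incr4 s t f g a (psi : R -> Omega -> R) (q : R -> R) (Q : R) :
  0 <= s -> s < t ->
  (forall r, s <= r < t -> rv_wrt (F r) (f r)) ->
  (forall r, s <= r < t -> rv_wrt (F r) (g r)) ->
  (forall r, s <= r <= t -> rv_wrt (F r) (psi r)) ->
  (forall r w, psi r w = 0 \/ psi r w = 1) ->
  (forall r w, s <= r < t -> psi t w = 1 -> psi r w = 1) ->
  (forall r, s <= r < t -> mean_le P (fun w => psi r w * f r w ^+ 4) (q r)) ->
  (forall r, s <= r < t -> mean_le P (fun w => psi r w * g r w ^+ 4) (q r)) ->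
  (forall n, \sum_(0 <= j < n.+1) q (gridpt s t n j) * mesh s t n <= Q) ->
  measurable_fun setT a -> ito_incr s t f g a ->
  mean_le P (fun w => psi t w * `|a w| ^+ 4)
    (8 * ((t - s) ^+ 2 + msum4_const R) * (t - s) * Q).
Proof.
move=> s0 st Ff Fg Fpsi psi01 psit qf qg qQ ma ia.
have L0 : 0 < t - s by rewrite subr_gt0.
have r0 r : s <= r -> 0 <= r by exact: le_trans.
have m_ r (f' : Omega -> R) : s <= r -> rv_wrt (F r) f' -> measurable_fun setT f'.
  by move=> sr; apply: (adapted_measurable FW (r0 r sr)).
have mpsi : measurable_fun setT (psi t).
  by apply: (m_ t) => //; [exact: ltW|apply: Fpsi; rewrite ltW//=].
have psi01' w : 0 <= psi t w <= 1.
  by case: (psi01 t w) => ->; rewrite !lexx ler01.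
apply: (mean_le_cvgp _ ma mpsi psi01' ia).
  move=> n; apply: ito_sum_measurable => // r /[dup] srt /andP[sr _].
    by apply: m_ (Ff r srt).
  by apply: m_ (Fg r srt).
apply: nearW => n.
pose tau := gridpt s t n; pose m := mesh s t n.
have m0 : 0 < m := mesh_gt0 st n.
have tauI j : (j < n.+1)%N -> s <= tau j < t.
  by move=> jn; rewrite gridpt_ge//= gridpt_lt_end.
pose D (h : R -> Omega -> R) j w := if (j < n.+1)%N then psi (tau j) w * h (tau j) w else 0.
have tau0 j : 0 <= tau j by apply: r0; exact: gridpt_ge.
have FD h : (forall r, s <= r < t -> rv_wrt (F r) (h r)) ->
    forall j, rv_wrt (F (tau j)) (D h j).
  move=> Fh j; have sa := fbm_sa FW (tau0 j).
  have [jn|jn] := boolP (j < n.+1)%N.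
    rewrite (_ : D h j = (fun w => psi (tau j) w * h (tau j) w)).
      apply: rv_wrtM => //; last by apply: Fh; exact: tauI.
      by apply: Fpsi; have /andP[-> /ltW ->] := tauI j jn.
    by apply/funext => w; rewrite /D jn.
  rewrite (_ : D h j = cst 0); first exact: rv_wrt_cst.
  by apply/funext => w; rewrite /D (negbTE jn).
have qD h : (forall r, s <= r < t -> rv_wrt (F r) (h r)) ->
   (forall r, s <= r < t -> mean_le P (fun w => psi r w * h r w ^+ 4) (q r)) ->
   forall j, (j < n.+1)%N -> mean_le P (fun w => D h j w ^+ 4) (q (tau j)).
  move=> Fh qh j jn.
  rewrite (_ : (fun w => _) = (fun w => psi (tau j) w * h (tau j) w ^+ 4)).
    by apply: qh; exact: tauI.
  apply/funext => w; rewrite /D jn exprMn; congr (_ * _).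
  by case: (psi01 (tau j) w) => ->; rewrite ?expr0n ?expr1n.
have hg := @mean_le_msum4 _ _ _ _ _ _ FW tau (tau0 0%N) (gridpt_lt st n) (D g)
   (FD g Fg) m (t - s) (fun j => q (tau j)) n.+1 L0 (@gridptS_sub _ s t n) _ (qD g Fg qg).
have nm : n.+1%:R * m = t - s by rewrite /m /mesh mulrC divfK// pnatr_eq0.
have nmL : n.+1%:R * m <= t - s by rewrite nm.
have {}hg := hg nmL.
have hf : mean_le P (fun w => (\sum_(0 <= j < n.+1) D f j w * m) ^+ 4)
    ((t - s) ^+ 3 * \sum_(0 <= j < n.+1) m * q (tau j)).
  have h := mean_leZ (exprn_ge0 3 (ltW L0)) (mean_le_sum_nat (fun j jn => mean_leZ (ltW m0) (qD f Ff qf j jn))).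
  apply: (mean_le_le _ _ _ h).
  - apply: measurable_funX; apply: measurable_sum_nat => j jn.
    by apply: measurable_funM => //; apply: (m_ (tau j)); [exact: gridpt_ge|exact: FD].
  - by move=> w; exact: exprn_even_ge0.
  - move=> w; have := sum_pow4_le n.+1 (fun j => D f j w) (ltW m0); rewrite nm.
    move=> /le_trans; apply; apply: ler_wpM2l; first by rewrite exprn_ge0// ltW.
    by rewrite le_eqVlt; apply/orP; left; apply/eqP; apply: eq_bigr => j _; rewrite mulrC.
have h := mean_leD (mean_leZ (ler0n R 8) hf) (mean_leZ (ler0n R 8) hg).
apply: (mean_le_trans _ (mean_le_le _ _ _ h)).
- have e1 : \sum_(0 <= j < n.+1) m * q (tau j) = \sum_(0 <= j < n.+1) q (tau j) * m.
    by apply: eq_bigr => j _; rewrite mulrC.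
  have e2 : m * \sum_(0 <= j < n.+1) q (tau j) = \sum_(0 <= j < n.+1) q (tau j) * m.
    by rewrite -e1 mulr_sumr.
  rewrite e1 e2; set S := \sum_(0 <= j < n.+1) _.
  have -> : 8 * ((t - s) ^+ 3 * S) + 8 * (msum4_const R * (t - s) * S) =
    8 * ((t - s) ^+ 2 + msum4_const R) * (t - s) * S by ring.
  apply: ler_wpM2l; last exact: qQ.
  apply: mulr_ge0; last exact: ltW.
  by apply: mulr_ge0 => //; apply: addr_ge0; [exact: sqr_ge0|exact: msum4_const_ge0].
- apply: measurable_funM => //; apply: measurable_funX; apply: measurableT_comp => //.
  apply: ito_sum_measurable => // r /[dup] srt /andP[sr _].
    by apply: m_ (Ff r srt).
  by apply: m_ (Fg r srt).
- by move=> w; case: (psi01 t w) => ->; rewrite ?mul0r ?mul1r// exprn_ge0.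
- move=> w; case: (psi01 t w) => psiw.
    by rewrite psiw mul0r addr_ge0// mulr_ge0// exprn_even_ge0.
  rewrite psiw mul1r -normrX ger0_norm ?exprn_even_ge0//.
  apply: le_trans (pow4D_le _ _).
  rewrite le_eqVlt; apply/orP; left; apply/eqP; congr (_ ^+ 4).
  rewrite /rs /msum_ -big_split/=; apply: eq_big_nat => j /andP[_ jn].
  rewrite /D jn /incr (psit _ w (tauI j jn) psiw) !mul1r//.
Qed.

(** Every cell is refined into the same number of steps, so the Riemann sums up to the times k *
    delta are partial sums on one uniform grid, and Doob's inequality handles the noise for all k
    together: 520 = 2 * 4 * 65. The drift is bounded by Cauchy-Schwarz. *)
Lemma ito_max2 (delta : R) K (f g : R -> Omega -> R) (A : nat -> Omega -> R)
    (q : nat -> R) : 0 < delta ->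
  (forall r, 0 <= r < K%:R * delta -> rv_wrt (F r) (f r)) ->
  (forall r, 0 <= r < K%:R * delta -> rv_wrt (F r) (g r)) ->
  (forall k r, (k < K)%N -> k%:R * delta <= r < k.+1%:R * delta ->
     mean_le P (fun w => f r w ^+ 2) (q k)) ->
  (forall k r, (k < K)%N -> k%:R * delta <= r < k.+1%:R * delta ->
     mean_le P (fun w => g r w ^+ 2) (q k)) ->
  (forall k, (k <= K)%N -> measurable_fun setT (A k)) ->
  (forall k, (k < K)%N -> ito_incr (k%:R * delta) (k.+1%:R * delta) f g
     (fun w => A k.+1 w - A k w)) ->
  mean_le P (fun w => runmax (fun k => A k w - A 0%N w) K ^+ 2)
    ((2 * (K%:R * delta) + 520) * (delta * \sum_(0 <= k < K) q k)).
Proof.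
move=> d0 Ff Fg qf qg mA iA.
have kd0 k : 0 <= k%:R * delta by rewrite mulr_ge0// ltW.
have cell k : k%:R * delta < k.+1%:R * delta by rewrite ltr_pM2r// ltr_nat.
have kK k : (k < K)%N -> k.+1%:R * delta <= K%:R * delta.
  by move=> kK; rewrite ler_wpM2r ?ler_nat// ltW.
have inK k r : (k < K)%N -> k%:R * delta <= r < k.+1%:R * delta -> 0 <= r < K%:R * delta.
  by move=> kn /andP[a b]; rewrite (le_trans (kd0 k) a)/= (lt_le_trans b)// kK.
have mf r : 0 <= r < K%:R * delta -> measurable_fun setT (f r).
  by move=> h; apply: (adapted_measurable FW _ (Ff r h)); case/andP: h.
have mg r : 0 <= r < K%:R * delta -> measurable_fun setT (g r).
  by move=> h; apply: (adapted_measurable FW _ (Fg r h)); case/andP: h.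
pose Rl l k w := \sum_(0 <= k' < k) rs (k'%:R * delta) (k'.+1%:R * delta) f g l w.
have mRl l k : (k <= K)%N -> measurable_fun setT (Rl l k).
  move=> kn; apply: measurable_sum_nat => k' k'k.
  have k'K := leq_trans k'k kn.
  by apply: ito_sum_measurable => // r h; [apply: mf|apply: mg]; apply: (inK k').
pose Z l w := runmax (fun k => Rl l k w) K.
pose A' k w := A k w - A 0%N w.
pose Zi w := runmax (fun k => A' k w) K.
have m_runmax (u : nat -> Omega -> R) : (forall k, (k <= K)%N -> measurable_fun setT (u k)) ->
    measurable_fun setT (fun w => runmax (fun k => u k w) K).
  elim: (K) => [|n IH] mu /=; first by apply: measurableT_comp => //; exact: mu.
  apply: measurable_maxr; first by apply: IH => k kn; apply: mu; exact: leqW.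
  by apply: measurableT_comp => //; exact: mu.
have mZ l : measurable_fun setT (Z l) by apply: m_runmax => k kn; exact: mRl.
have mZi : measurable_fun setT Zi.
  by apply: m_runmax => k kn; apply: measurable_funB; exact: mA.
have RA k : (k <= K)%N -> cvgp P (fun l => Rl l k) (A' k).
  move=> kn; have h := cvgp_sum (fun i (ik : (i < k)%N) => iA i (leq_trans ik kn)).
  apply: (cvgp_ae_eq h) => [l|]; apply: aeW => w //.
  by rewrite /A' telescope_sumr.
have ZZ : cvgp P Z Zi.
  pose D k l w := `|Rl l k w - A' k w|.
  have D0 k : (k < K.+1)%N -> cvgp P (D k) (cst 0).
    move=> kn; apply: (cvgp_le (RA k _)) => // l; apply: aeW => w.
    by rewrite subr0 normr_id.
  apply: (cvgp_le (cvgp_sum D0)) => l; apply: aeW => w.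
  have -> : \sum_(0 <= i < K.+1) cst (0 : R) w = 0 by rewrite big1.
  rewrite subr0.
  apply: le_trans (runmax_dist _ _ _) _.
  by rewrite ger0_norm// sumr_ge0// => k _; exact: normr_ge0.
have psi01 : forall w : Omega, 0 <= (cst 1 : Omega -> R) w <= 1.
  by move=> w; rewrite ler01 lexx.
set c := (_ * _).
suff Zc l : mean_le P (fun w => cst 1 w * `|Z l w| ^+ 2) c.
  have m1 : measurable_fun setT (cst 1 : Omega -> R) by exact: measurable_cst.
  have nZ : \forall l \near \oo, mean_le P (fun w => cst 1 w * `|Z l w| ^+ 2) c.
    exact: nearW.
  have := mean_le_cvgp mZ mZi m1 psi01 ZZ nZ.
  rewrite (_ : (fun w => _) = (fun w => Zi w ^+ 2))//.
  by apply/funext => w; rewrite mul1r real_normK ?num_real.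
pose m := delta / l.+1%:R; pose tau i : R := i%:R * m.
have m0 : 0 < m by rewrite divr_gt0.
have ml : l.+1%:R * m = delta by rewrite /m mulrC divfK// pnatr_eq0.
have tau0 i : 0 <= tau i by rewrite mulr_ge0// ltW.
have tauS i : tau i < tau i.+1 by rewrite ltr_pM2r// ltr_nat.
have tauSB i : tau i.+1 - tau i = m by rewrite /tau -natr1; ring.
have taukd k : tau (k * l.+1)%N = k%:R * delta by rewrite /tau natrM -mulrA ml.
have tau_in i : (i %/ l.+1)%:R * delta <= tau i < (i %/ l.+1).+1%:R * delta.
  rewrite -!taukd /tau ler_wpM2r ?ler_nat ?leq_trunc_div ?ltW//=.
  by rewrite ltr_pM2r// ltr_nat -ltn_divLR//.
have meshE k : mesh (k%:R * delta) (k.+1%:R * delta) l = m.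
  by rewrite /mesh /m -natr1; congr (_ / _); ring.
have gridE k j : gridpt (k%:R * delta) (k.+1%:R * delta) l j = tau (k * l.+1 + j)%N.
  by rewrite /gridpt meshE /tau natrD mulrDl -{1}taukd.
pose N := (K * l.+1)%N.
have divK i : (i < N)%N -> (i %/ l.+1 < K)%N by move=> iN; rewrite ltn_divLR.
pose D (h : R -> Omega -> R) i w := if (i < N)%N then h (tau i) w else 0.
have FD h : (forall r, 0 <= r < K%:R * delta -> rv_wrt (F r) (h r)) ->
    forall i, rv_wrt (F (tau i)) (D h i).
  move=> Fh i; have [iN|iN] := boolP (i < N)%N.
    rewrite (_ : D h i = h (tau i)); last by apply/funext => w; rewrite /D iN.
    by apply: Fh; apply: (inK _ _ (divK i iN)).
  rewrite (_ : D h i = cst 0); last by apply/funext => w; rewrite /D (negbTE iN).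
  exact: rv_wrt_cst (fbm_sa FW (tau0 i)).
pose q' i := q (i %/ l.+1)%N.
have qD h : (forall k r, (k < K)%N -> k%:R * delta <= r < k.+1%:R * delta ->
     mean_le P (fun w => h r w ^+ 2) (q k)) ->
   forall i, (i < N)%N -> mean_le P (fun w => D h i w ^+ 2) (q' i).
  move=> qh i iN; rewrite (_ : (fun w => _) = (fun w => h (tau i) w ^+ 2)).
    by apply: qh; [exact: divK|exact: tau_in].
  by apply/funext => w; rewrite /D iN.
have q'E : \sum_(0 <= i < N) q' i * m = delta * \sum_(0 <= k < K) q k.
  rewrite big_nat_mul mulr_sumr; apply: eq_bigr => k _.
  rewrite (eq_big_nat _ _ (F2 := fun=> q k * m)); last first.
    by move=> j /andP[_ jl]; rewrite /q' divnMDl// divn_small// addn0.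
  by rewrite sumr_const_nat subn0 -mulr_natl mulrCA ml mulrC.
have mD h : (forall r, 0 <= r < K%:R * delta -> rv_wrt (F r) (h r)) ->
    forall i, measurable_fun setT (D h i).
  by move=> Fh i; apply: (adapted_measurable FW (tau0 i)); exact: FD.
have Nm : N%:R * m = K%:R * delta by rewrite /N natrM -mulrA ml.
have hf : mean_le P (fun w => (\sum_(0 <= i < N) `|D f i w| * m) ^+ 2)
    (K%:R * delta * (delta * \sum_(0 <= k < K) q k)).
  have h := mean_leZ (kd0 K) (mean_le_sum_nat (fun j jn => mean_leZ (ltW m0) (qD f qf j jn))).
  apply: (mean_le_trans _ (mean_le_le _ _ _ h)).
  - by rewrite -q'E ler_wpM2l// le_eqVlt; apply/orP; left; apply/eqP; apply: eq_bigr => i _; rewrite mulrC.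
  - apply: measurable_funX; apply: measurable_sum_nat => j jn.
    by apply: measurable_funM => //; apply: measurableT_comp => //; exact: mD.
  - by move=> w; exact: sqr_ge0.
  - move=> w; have := sum_sqr_le N (fun j => `|D f j w|) (ltW m0); rewrite Nm.
    move=> /le_trans; apply; rewrite ler_wpM2l// le_eqVlt; apply/orP; left; apply/eqP.
    by apply: eq_bigr => i _; rewrite real_normK ?num_real// mulrC.
have hg := mean_le_doob FW (tau0 0%N) tauS (FD g Fg) (qD g qg).
have h := mean_leD (mean_leZ (ler0n R 2) hf) (mean_leZ (ler0n R 2) hg).
apply: (mean_le_trans _ (mean_le_le _ _ _ h)).
- have -> : \sum_(0 <= i < N) q' i * (tau i.+1 - tau i) = delta * \sum_(0 <= k < K) q k.
    by rewrite -q'E; apply: eq_bigr => i _; rewrite tauSB.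
  rewrite /c le_eqVlt; apply/orP; left; apply/eqP; ring.
- by apply: measurable_funM => //; apply: measurable_funX; apply: measurableT_comp => //; exact: mZ.
- by move=> w; rewrite mul1r sqr_ge0.
- move=> w; rewrite mul1r real_normK ?num_real//.
  set x := \sum_(0 <= i < N) _; set y := runmax _ N.
  have x0 : 0 <= x by rewrite /x sumr_ge0// => i _; rewrite mulr_ge0// ltW.
  have y0 : 0 <= y by exact: runmax_ge0.
  suff zxy : Z l w <= x + y.
    have z0 : 0 <= Z l w by exact: runmax_ge0.
    apply: (@le_trans _ _ ((x + y) ^+ 2)); first by rewrite lerXn2r ?nnegrE ?addr_ge0.
    by have := sqr_ge0 (x - y); nra.
  apply: runmax_le => k kn.
  have kN : (k * l.+1 <= N)%N by rewrite leq_mul2r kn orbT.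
  have -> : Rl l k w = \sum_(0 <= i < k * l.+1) D f i w * m + msum_ W tau (D g) (k * l.+1) w.
    rewrite /Rl /msum_ -big_split/= big_nat_mul; apply: eq_big_nat => k' /andP[_ k'k].
    rewrite /rs; apply: eq_big_nat => j /andP[_ jl].
    have iN : (k' * l.+1 + j < N)%N.
      apply: leq_trans kN; apply: (@leq_trans (k'.+1 * l.+1)).
        by rewrite mulSn addnC ltn_add2r.
      by rewrite leq_mul2r k'k orbT.
    by rewrite !gridE meshE /D iN /incr -addnS.
  apply: le_trans (ler_normD _ _) _; apply: lerD; last exact: (runmax_ge _ kN).
  apply: le_trans (ler_norm_sum _ _ _) _.
  rewrite /x (@big_cat_nat _ _ _ (k * l.+1)%N 0%N N)//=.
  rewrite -[leLHS]addr0; apply: lerD.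
    by apply: ler_sum => i _; rewrite normrM (gtr0_norm m0).
  by apply: sumr_ge0 => i _; rewrite mulr_ge0// ltW.
Qed.

End ito_increments.

(** Left sums of an increasing function lie below its integral; for the exponential this is 1 + x <=
    exp x on each cell. *)
Lemma expR_riemann_le (R : realType) (lam s t : R) n : 0 < lam -> s < t ->
  \sum_(0 <= j < n.+1) expR (lam * gridpt s t n j) * mesh s t n <=
  expR (lam * t) / lam.
Proof.
move=> l0 st; rewrite ler_pdivlMr// mulr_suml.
apply: (@le_trans _ _ (\sum_(0 <= j < n.+1)
   (expR (lam * gridpt s t n j.+1) - expR (lam * gridpt s t n j)))).
  apply: ler_sum => j _.
  have -> : expR (lam * gridpt s t n j.+1) =
      expR (lam * gridpt s t n j) * expR (lam * mesh s t n).
    by rewrite gridptS mulrDr expRD.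
  have := expR_ge1Dx (lam * mesh s t n); have := expR_gt0 (lam * gridpt s t n j).
  set x := expR (lam * gridpt _ _ _ _); set y := expR (lam * mesh _ _ _); nra.
rewrite telescope_sumr// gridpt_last//; have := expR_gt0 (lam * gridpt s t n 0); lra.
Qed.

Section exact_mean.
Context d (Omega : measurableType d) (R : realType) (P : probability Omega R).

Definition exact_mean (f : Omega -> R) : R := fine (\int[P]_w (f w)%:E)%E.

Lemma exact_mean_le f a : mean_le P f a -> exact_mean f <= a.
Proof.
move=> fa; have [_ _ h] := fa; rewrite -lee_fin fineK//.
exact: (integrable_fin_num _ (mean_le_integrable fa)).
Qed.

Lemma exact_mean_ge0 f : (forall w, 0 <= f w) -> 0 <= exact_mean f.
Proof.
by move=> f0; apply: fine_ge0; apply: integral_ge0 => w _; rewrite lee_fin.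
Qed.

End exact_mean.

(** * Moments for an SDE with an exogenous drift *)

Section exogenous_sde.
Context d (Omega : measurableType d) (R : realType) (P : probability Omega R).
Context (F : R -> set (set Omega)) (W : R -> Omega -> R) (FW : fbm P F W).
Context (b sigma : R -> R) (beta T : R) (beta0 : 0 <= beta) (T0 : 0 < T).
Hypothesis b_lip : forall x y, `|b x - b y| <= beta * `|x - y|.
Hypothesis s_lip : forall x y, `|sigma x - sigma y| <= beta * `|x - y|.
Hypothesis b_grow : forall x, `|b x| <= beta * (1 + `|x|).
Hypothesis s_grow : forall x, `|sigma x| <= beta * (1 + `|x|).

(* X = Y + int b(X) dr + int sigma(X) dW + kap, with [kap] deterministic. *)
Record exo_sde (Y : Omega -> R) (X : R -> Omega -> R) (kap : R -> R) : Prop := {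
  exo_adapted : forall r, 0 <= r <= T -> rv_wrt (F r) (X r) ;
  exo_cont : \forall w \ae P, {within `[0, T], continuous (fun r => X r w)} ;
  exo_start : \forall w \ae P, X 0 w - kap 0 = Y w ;
  exo_incr : forall s t, 0 <= s -> s < t -> t <= T ->
    ito_incr P W s t (fun r w => b (X r w)) (fun r w => sigma (X r w))
      (fun w => (X t w - kap t) - (X s w - kap s)) }.

Lemma lip_measurable (f : R -> R) :
  (forall x y, `|f x - f y| <= beta * `|x - y|) -> measurable_fun setT f.
Proof.
move=> fl; apply: continuous_measurable_fun => x; apply/cvgrPdist_lt => e e0.
have b1 : 0 < beta + 1 by rewrite ltr_pwDr.
exists (e / (beta + 1)) => /=; first by rewrite divr_gt0.
move=> y /=; rewrite ltr_pdivlMr// => h; apply: le_lt_trans (fl x y) _.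
apply: le_lt_trans h; rewrite mulrC ler_wpM2l//; lra.
Qed.

Lemma grow4 (f : R -> R) (x k : R) :
  (forall x, `|f x| <= beta * (1 + `|x|)) ->
  f x ^+ 4 <= 64 * beta ^+ 4 * (1 + (x - k) ^+ 4 + k ^+ 4).
Proof.
move=> fg; have b4 : 0 <= beta ^+ 4 by rewrite exprn_ge0.
have e4 (z : R) : z ^+ 4 = `|z| ^+ 4 by rewrite -normrX ger0_norm// exprn_even_ge0.
rewrite (e4 (f x)); apply: (@le_trans _ _ ((beta * (1 + `|x|)) ^+ 4)).
  by rewrite lerXn2r// nnegrE// mulr_ge0// addr_ge0.
rewrite exprMn [leRHS](_ : _ = beta ^+ 4 * (64 * (1 + (x - k) ^+ 4 + k ^+ 4))); last by ring.
apply: ler_wpM2l => //.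
have h1 := pow4D_le 1 `|x|; rewrite expr1n -e4 in h1.
have h2 := pow4D_le (x - k) k; rewrite subrK in h2.
lra.
Qed.

(** Twice the coefficient of the fourth moment in the integral inequality. Integrating exp (rate *
    r) divides by the rate, so the unknown returns with a factor at most 1/2 and is absorbed, whence
    the leading 2 in [moment4_const]. The 1 keeps the rate positive. *)
Definition gron_rate (c1 : R) : R :=
  2 * (64 * (T ^+ 2 + msum4_const R) * T * (64 * beta ^+ 4 * (1 + c1))) + 1.

Definition moment4_const (y4 c0 c1 : R) : R :=
  2 * (8 * y4 + 64 * (T ^+ 2 + msum4_const R) * T * (64 * beta ^+ 4 * (1 + c0) * T)) *
  expR (gron_rate c1 * T).

Lemma moment4_const_ge0 y4 c0 c1 : 0 <= y4 -> 0 <= c0 -> 0 <= moment4_const y4 c0 c1.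
Proof.
move=> y0 c00; rewrite /moment4_const; have := msum4_const_ge0 R => C0.
apply: mulr_ge0; last exact: expR_ge0.
apply: mulr_ge0 => //; apply: addr_ge0; first exact: mulr_ge0.
apply: mulr_ge0; last first.
  apply: mulr_ge0; last exact: ltW.
  by apply: mulr_ge0; [rewrite mulr_ge0// exprn_ge0|exact: addr_ge0].
apply: mulr_ge0; last exact: ltW.
by apply: mulr_ge0 => //; apply: addr_ge0 => //; exact: sqr_ge0.
Qed.

(* [kap] is allowed to depend on the fourth moments of [X - kap] itself, as K
   does.  The a priori bound [B] only ensures finiteness: it does not enter the
   conclusion.  [psi] is the indicator of an adapted decreasing event. *)
Lemma gronwall4 Y X kap (psi : R -> Omega -> R) (B y4 c0 c1 : R) :
  exo_sde Y X kap -> mean_le P (fun w => Y w ^+ 4) y4 ->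
  (forall r, 0 <= r <= T -> rv_wrt (F r) (psi r)) ->
  (forall r w, psi r w = 0 \/ psi r w = 1) ->
  (forall s t w, 0 <= s -> s < t -> psi t w = 1 -> psi s w = 1) ->
  (forall r, 0 <= r <= T -> mean_le P (fun w => psi r w * (X r w - kap r) ^+ 4) B) ->
  0 <= c0 -> 0 <= c1 ->
  (forall r Q, 0 <= r <= T ->
    (forall s, 0 <= s <= r -> exact_mean P (fun w => psi s w * (X s w - kap s) ^+ 4) <= Q) ->
    kap r ^+ 4 <= c0 + c1 * Q) ->
  forall t, 0 <= t <= T ->
    mean_le P (fun w => psi t w * (X t w - kap t) ^+ 4) (moment4_const y4 c0 c1).
Proof.
move=> XS Yy Fpsi psi01 psimono XB c00 c10 kapQ.
pose v r := exact_mean P (fun w => psi r w * (X r w - kap r) ^+ 4).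
have psi0 r w : 0 <= psi r w by case: (psi01 r w) => ->.
have psi1 r w : psi r w <= 1 by case: (psi01 r w) => ->.
have U40 r w : 0 <= psi r w * (X r w - kap r) ^+ 4 by rewrite mulr_ge0// exprn_even_ge0.
have v0 r : 0 <= v r by exact: exact_mean_ge0.
have y40 := mean_le_ge0 Yy.
have Xv r : 0 <= r <= T -> mean_le P (fun w => psi r w * (X r w - kap r) ^+ 4) (v r).
  by move=> rT; apply: mean_le_exact (XB r rT).
have vB r : 0 <= r <= T -> v r <= B by move=> rT; apply: exact_mean_le; exact: XB.
set D := 64 * (T ^+ 2 + msum4_const R) * T.
have D0 : 0 <= D.
  apply: mulr_ge0; last exact: ltW.
  by apply: mulr_ge0 => //; apply: addr_ge0; [exact: sqr_ge0|exact: msum4_const_ge0].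
set b4 := 64 * beta ^+ 4.
have b40 : 0 <= b4 by rewrite mulr_ge0// exprn_ge0.
set lam := gron_rate c1.
have lamE : lam = 2 * (D * (b4 * (1 + c1))) + 1 by [].
have A10 : 0 <= D * (b4 * (1 + c1)).
  by apply: mulr_ge0 => //; apply: mulr_ge0 => //; apply: addr_ge0.
have lam0 : 0 < lam by rewrite lamE; lra.
set A0 := 8 * y4 + D * (b4 * (1 + c0) * T).
have A0y : 8 * y4 <= A0.
  rewrite lerDl; apply: mulr_ge0 => //; apply: mulr_ge0; last exact: ltW.
  by apply: mulr_ge0 => //; apply: addr_ge0.
have A00 : 0 <= A0 by apply: le_trans A0y; exact: mulr_ge0.
(* Gronwall's lemma through a weighted supremum: [L] is the supremum of v r * exp (- lam r), finite
   thanks to [B], and the integral inequality yields L <= A0 + L / 2. It works for a [v] that is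
   merely bounded. *)
pose E := [set v r * expR (- (lam * r)) | r in `[0, T]].
have E0 : E !=set0 by exists (v 0 * expR (- (lam * 0))); exists 0 => //=; rewrite in_itv/= lexx ltW.
have B0 : 0 <= B by apply: le_trans (v0 0) (vB 0 _); rewrite lexx ltW.
have Eub : has_ubound E.
  exists B; apply/ubP => _ [r /= rT' <-].
  have rT : 0 <= r <= T by move: rT'; rewrite in_itv.
  rewrite -[leRHS]mulr1 ler_pM// ?vB ?expR_ge0//.
  by rewrite -expR0 ler_expR oppr_le0 mulr_ge0 ?(ltW lam0)//; case/andP: rT.
pose L := sup E.
have vL r : 0 <= r <= T -> v r <= L * expR (lam * r).
  move=> rT; have : v r * expR (- (lam * r)) <= L.
    by apply: ub_le_sup => //; exists r => //=; rewrite in_itv.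
  by rewrite expRN ler_pdivrMr// expR_gt0.
have L0 : 0 <= L.
  have := vL 0; rewrite lexx (ltW T0) mulr0 expR0 mulr1 => /(_ isT).
  exact: le_trans.
have XF r : 0 <= r <= T -> rv_wrt (F r) (X r) by exact: (exo_adapted XS).
have mX r : 0 <= r <= T -> measurable_fun setT (X r).
  by move=> rT; apply: (adapted_measurable FW _ (XF r rT)); case/andP: rT.
have mpsi r : 0 <= r <= T -> measurable_fun setT (psi r).
  by move=> rT; apply: (adapted_measurable FW _ (Fpsi r rT)); case/andP: rT.
have mU4 r : 0 <= r <= T -> measurable_fun setT (fun w => psi r w * (X r w - kap r) ^+ 4).
  move=> rT; apply: measurable_funM; first exact: mpsi.
  by apply: measurable_funX; apply: measurable_funB => //; exact: mX.
pose q r := b4 * ((1 + c0) + (1 + c1) * (L * expR (lam * r))).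
have qf (f : R -> R) r : (forall x y, `|f x - f y| <= beta * `|x - y|) ->
    (forall x, `|f x| <= beta * (1 + `|x|)) -> 0 <= r <= T ->
    mean_le P (fun w => psi r w * f (X r w) ^+ 4) (q r).
  move=> fl fg rT.
  have k4 : kap r ^+ 4 <= c0 + c1 * (L * expR (lam * r)).
    apply: kapQ => // s /andP[s0 sr].
    apply: le_trans (vL s _) _; first by rewrite s0 (le_trans sr)//; case/andP: rT.
    by rewrite ler_wpM2l// ler_expR ler_wpM2l// ltW.
  have k40 : 0 <= kap r ^+ 4 by exact: exprn_even_ge0.
  have h := mean_leZ b40 (mean_leD (mean_le_cst P (addr_ge0 ler01 k40)) (Xv r rT)).
  apply: (mean_le_trans _ (mean_le_le _ _ _ h)).
  - rewrite /q ler_wpM2l//; have := vL r rT; set x := L * _ in k4 *; nra.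
  - apply: measurable_funM; first exact: mpsi.
    by apply: measurable_funX; apply: (measurableT_comp (lip_measurable fl)); exact: mX.
  - by move=> w; rewrite mulr_ge0// exprn_even_ge0.
  - move=> w; apply: (@le_trans _ _ (psi r w * (b4 * (1 + (X r w - kap r) ^+ 4 + kap r ^+ 4)))).
      by rewrite ler_wpM2l// grow4.
    rewrite mulrCA ler_wpM2l//=.
    have h1 := psi1 r w; have h0 := psi0 r w.
    have h4 : 0 <= (X r w - kap r) ^+ 4 by exact: exprn_even_ge0.
    set x := _ ^+ 4 in h4 *; nra.
have vt t : 0 <= t <= T -> v t <= A0 + L / 2 * expR (lam * t).
  move=> /[dup] tT /andP[t0 tT'].
  move: t0; rewrite le_eqVlt => /predU1P[t0|t0].
    apply: exact_mean_le.
    apply: (mean_le_trans _ (mean_le_ae (mU4 t tT) (U40 t) _ Yy)).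
      have h1 : 0 <= L / 2 * expR (lam * t).
        by apply: mulr_ge0; [exact: divr_ge0|exact: expR_ge0].
      lra.
    apply: filterS (exo_start XS) => w h; rewrite -t0 h.
    by rewrite ler_piMl// exprn_even_ge0.
  have inT r : 0 <= r < t -> 0 <= r <= T.
    by move=> /andP[-> rt]; rewrite ltW// (lt_le_trans rt).
  have inT' r : 0 <= r <= t -> 0 <= r <= T.
    by move=> /andP[-> rt]; rewrite (le_trans rt).
  have T0T : 0 <= (0 : R) <= T by apply/andP; split => //; exact: ltW.
  have Lexp : 0 <= L * expR (lam * t) by rewrite mulr_ge0// expR_ge0.
  have qQ n : \sum_(0 <= j < n.+1) q (gridpt 0 t n j) * mesh 0 t n <=
      b4 * ((1 + c0) * T + (1 + c1) * (L * (expR (lam * t) / lam))).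
    have -> : \sum_(0 <= j < n.+1) q (gridpt 0 t n j) * mesh 0 t n =
       b4 * ((1 + c0) * (n.+1%:R * mesh 0 t n) + (1 + c1) * (L *
         \sum_(0 <= j < n.+1) expR (lam * gridpt 0 t n j) * mesh 0 t n)).
      rewrite !mulr_sumr.
      have -> : (1 + c0) * (n.+1%:R * mesh 0 t n) = \sum_(0 <= j < n.+1) (1 + c0) * mesh 0 t n.
        by rewrite sumr_const_nat subn0 -[RHS]mulr_natl mulrCA.
      rewrite -big_split/= mulr_sumr; apply: eq_bigr => j _; rewrite /q; ring.
    apply: ler_wpM2l => //; apply: lerD.
      rewrite ler_wpM2l ?addr_ge0//.
      by rewrite /mesh subr0 mulrC divfK ?pnatr_eq0.
    rewrite ler_wpM2l ?addr_ge0// ler_wpM2l//; exact: expR_riemann_le.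
  have mUU : measurable_fun setT (fun w => (X t w - kap t) - (X 0 w - kap 0)).
    by apply: measurable_funB; apply: measurable_funB => //; exact: mX.
  have hh := ito_incr4 FW (lexx 0) t0
    (fun r rt => rv_wrt_comp (fbm_sa FW (proj1 (andP rt))) (lip_measurable b_lip) (XF r (inT r rt)))
    (fun r rt => rv_wrt_comp (fbm_sa FW (proj1 (andP rt))) (lip_measurable s_lip) (XF r (inT r rt)))
    (fun r rt => Fpsi r (inT' r rt)) psi01
    (fun r w rt => psimono r t w (proj1 (andP rt)) (proj2 (andP rt)))
    (fun r rt => qf b r b_lip b_grow (inT r rt))
    (fun r rt => qf sigma r s_lip s_grow (inT r rt))
    qQ mUU (exo_incr XS (lexx 0) t0 tT').
  apply: exact_mean_le.
  have h2 := mean_leD (mean_leZ (ler0n R 8) Yy) (mean_leZ (ler0n R 8) hh).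
  apply: (mean_le_trans _ (mean_le_ae (mU4 t tT) (U40 t) _ h2)).
    rewrite subr0; set Q := b4 * _.
    have Q0 : 0 <= Q.
      apply: mulr_ge0 => //; apply: addr_ge0; apply: mulr_ge0; rewrite ?addr_ge0 ?(ltW T0)//.
      by rewrite mulr_ge0// divr_ge0 ?expR_ge0// ltW.
    have : 8 * (8 * (t ^+ 2 + msum4_const R) * t * Q) <= D * Q.
      rewrite /D; have -> : 8 * (8 * (t ^+ 2 + msum4_const R) * t * Q) = 64 * (t ^+ 2 + msum4_const R) * t * Q by ring.
      apply: ler_wpM2r => //; apply: ler_pM.
      - by apply: mulr_ge0 => //; apply: addr_ge0; [exact: sqr_ge0|exact: msum4_const_ge0].
      - exact: ltW.
      - by apply: ler_wpM2l => //; rewrite lerD2r; apply: lerXn2r => //; rewrite nnegrE ltW.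
      - exact: tT'.
    move=> /(lerD (lexx (8 * y4)))/le_trans; apply.
    rewrite /A0 /Q -addrA lerD2l.
    have -> : D * (b4 * ((1 + c0) * T + (1 + c1) * (L * (expR (lam * t) / lam)))) =
      D * (b4 * (1 + c0) * T) + (D * (b4 * (1 + c1)) / lam) * (L * expR (lam * t)) by ring.
    rewrite lerD2l.
    have -> : L / 2 * expR (lam * t) = 2^-1 * (L * expR (lam * t)) by ring.
    apply: ler_wpM2r => //; rewrite ler_pdivrMr// lamE; lra.
  apply: filterS (exo_start XS) => w h.
  have [->|->] := psi01 t w.
    by rewrite !mul0r mulr0 addr0 mulr_ge0// exprn_even_ge0.
  rewrite !mul1r; have := pow4D_le (Y w) (X t w - kap t - (X 0 w - kap 0)).
  rewrite -h addrC subrK => /le_trans; apply; rewrite lerD2l ler_wpM2l//.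
  by rewrite -normrX ler_norm.
have LA : L <= 2 * A0.
  suff : L <= A0 + L / 2 by lra.
  apply: ge_sup => // _ [r /= rT' <-].
  have rT : 0 <= r <= T by move: rT'; rewrite in_itv.
  rewrite expRN ler_pdivrMr ?expR_gt0//; apply: le_trans (vt r rT) _.
  have : 1 <= expR (lam * r).
    by rewrite -expR0 ler_expR mulr_ge0 ?(ltW lam0)//; case/andP: rT.
  move=> e1; rewrite [leRHS]mulrDl; apply: lerD => //; exact: ler_peMr.
move=> t tT; apply: mean_le_trans (Xv t tT).
apply: le_trans (vL t tT) _; rewrite /moment4_const -/D -/b4 -/A0.
apply: ler_pM; [exact: L0|exact: expR_ge0|exact: LA|].
by rewrite ler_expR ler_wpM2l ?(ltW lam0)//; case/andP: tT.
Qed.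

End exogenous_sde.

Lemma sigma_algebraT T (G : set (set T)) : sigma_algebra setT G -> G setT.
Proof. by case=> s0 sC _; rewrite -(setD0 setT); exact: sC. Qed.

(** * Localisation by running bounds *)

Section running_bound.
Context d (Omega : measurableType d) (R : realType).

(* Rational times make the localising event measurable. *)
Definition rat_bounded (X : R -> Omega -> R) (n : nat) (r : R) (w : Omega) :=
  forall q : rat, 0 <= (ratr q : R) <= r -> `|X (ratr q) w| <= n%:R.

Lemma rat_bounded_measurable (F : R -> set (set Omega)) X n r :
  sigma_algebra setT (F r) ->
  (forall s, 0 <= s <= r -> rv_wrt (F r) (X s)) ->
  F r [set w | rat_bounded X n r w].
Proof.
move=> sa FX.
pose A (q : rat) : set Omega :=
  if 0 <= (ratr q : R) <= r then [set w | `|X (ratr q) w| <= n%:R] else setT.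
have FA q : F r (A q).
  rewrite /A; case: ifPn => qr; last exact: sigma_algebraT.
  by apply: rv_wrt_set_le; apply: rv_wrt_norm => //; exact: FX.
have -> : [set w | rat_bounded X n r w] =
    \bigcap_k (if unpickle k is Some q then A q else setT).
  apply/seteqP; split => [w wb k _|w wA q qr].
    case: unpickle => // q; rewrite /A; case: ifPn => // qr; exact: wb.
  by have := wA (pickle q) Logic.I; rewrite pickleK /A qr.
have GE : <<s F r >> = F r by exact: sigma_algebra_id.
rewrite -GE; apply: (@bigcapT_measurable _ (g_sigma_algebraType (F r))) => k.
rewrite /measurable/= GE; case: unpickle => [q|]; first exact: FA.
exact: sigma_algebraT.
Qed.

Lemma rat_bounded_at X n (T r : R) w : 0 <= r <= T ->
  {within `[0, T], continuous (fun s => X s w)} ->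
  rat_bounded X n r w -> `|X r w| <= n%:R.
Proof.
move=> /andP[r0 rT] Xc wb.
move: (r0); rewrite le_eqVlt => /predU1P[r0'|r0'].
  by have := wb 0; rewrite rmorph0 lexx r0 -r0' => /(_ isT).
apply/ler_addgt0Pr => e e0.
have rin : r \in `[0, T] by rewrite in_itv/= r0.
have [eta eta0 heta] := within_cont_dist Xc rin e0.
have mr : Num.max 0 (r - eta) < r by rewrite gt_max r0' ltrBlDr ltrDl.
have [q] := rat_in_itvoo mr.
rewrite in_itv/= gt_max => /andP[/andP[q0 qe] qr].
have qT : (ratr q : R) \in `[0, T] by rewrite in_itv/= (ltW q0) (ltW (lt_le_trans qr rT)).
have h : `|X (ratr q) w - X r w| < e.
  by apply: heta => //; rewrite ltr0_norm ?subr_lt0//; lra.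
have h2 : `|X (ratr q) w| <= n%:R by apply: wb; rewrite !ltW.
have h3 := ler_normB (X (ratr q) w) (X (ratr q) w - X r w).
move: h3; rewrite opprB addrC subrK; lra.
Qed.

Lemma cont_rat_bounded X (T : R) w : 0 <= T ->
  {within `[0, T], continuous (fun s => X s w)} ->
  exists n, rat_bounded X n T w.
Proof.
move=> T0 Xc.
have nc : {within `[0, T], continuous (fun s => `|X s w|)}.
  by move=> z; apply: cvg_norm; exact: Xc.
have [c _ hc] := EVT_max T0 nc.
exists (Num.trunc `|X c w|).+1 => q qT.
by rewrite (le_trans (hc _ _))// ?in_itv// ltW// truncnS_gt.
Qed.

End running_bound.

Section exogenous_moments.
Context d (Omega : measurableType d) (R : realType) (P : probability Omega R).
Context (F : R -> set (set Omega)) (W : R -> Omega -> R) (FW : fbm P F W).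
Context (b sigma : R -> R) (beta T : R) (beta0 : 0 <= beta) (T0 : 0 < T).
Hypothesis b_lip : forall x y, `|b x - b y| <= beta * `|x - y|.
Hypothesis s_lip : forall x y, `|sigma x - sigma y| <= beta * `|x - y|.
Hypothesis b_grow : forall x, `|b x| <= beta * (1 + `|x|).
Hypothesis s_grow : forall x, `|sigma x| <= beta * (1 + `|x|).

(** [psi n] restricts to paths bounded by n up to the current time, which supplies the a priori
    bound (n + k0)^4 of [gronwall4]. The conclusion does not depend on n, and monotone convergence
    lets n grow. *)
Lemma exo_moment Y X kap (y4 k0 : R) :
  exo_sde P F W b sigma T Y X kap -> mean_le P (fun w => Y w ^+ 4) y4 ->
  (forall r, 0 <= r <= T -> 0 <= kap r <= k0) ->
  forall t, 0 <= t <= T ->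
    mean_le P (fun w => (X t w - kap t) ^+ 4) (moment4_const beta T y4 (k0 ^+ 4) 0).
Proof.
move=> XS Yy kk t tT.
have XF r : 0 <= r <= T -> rv_wrt (F r) (X r) by exact: (exo_adapted XS).
have mX r : 0 <= r <= T -> measurable_fun setT (X r).
  by move=> rT; apply: (adapted_measurable FW _ (XF r rT)); case/andP: rT.
have mU r : 0 <= r <= T -> measurable_fun setT (fun w => (X r w - kap r) ^+ 4).
  by move=> rT; apply: measurable_funX; apply: measurable_funB => //; exact: mX.
have k00 : 0 <= k0.
  by have /kk/andP[a] : 0 <= t <= T by []; exact: le_trans.
pose psi n r w : R := \1_[set w | rat_bounded X n r w] w.
have psi01 n r w : psi n r w = 0 \/ psi n r w = 1.
  by rewrite /psi indicE; case: (_ \in _); [right|left].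
have psi1P n r w : psi n r w = 1 <-> rat_bounded X n r w.
  rewrite /psi indicE; split=> [|h]; last by rewrite mem_set.
  by case: (boolP (_ \in _)) => [/set_mem//|_ /eqP]; rewrite eq_sym oner_eq0.
have psile n m r w : (rat_bounded X n r w -> rat_bounded X m r w) -> psi n r w <= psi m r w.
  move=> h; case: (psi01 n r w) => /[dup] E ->.
    by case: (psi01 m r w) => ->; rewrite ?ler01.
  by have -> : psi m r w = 1 by apply/psi1P; apply: h; apply/psi1P.
have Fpsi n r : 0 <= r <= T -> rv_wrt (F r) (psi n r).
  move=> /andP[r0 rT]; apply: rv_wrt_indic; first exact: (fbm_sa FW).
  apply: rat_bounded_measurable; first exact: (fbm_sa FW).
  move=> s /andP[s0 sr]; apply: (rv_wrtS (fbm_mono FW s0 sr)).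
  by apply: XF; rewrite s0 (le_trans sr).
have U40 r w : 0 <= (X r w - kap r) ^+ 4 by exact: exprn_even_ge0.
have psi0 n r w : 0 <= psi n r w by case: (psi01 n r w) => ->.
have main n : mean_le P (fun w => psi n t w * (X t w - kap t) ^+ 4) (moment4_const beta T y4 (k0 ^+ 4) 0).
  apply: (gronwall4 FW beta0 T0 b_lip s_lip b_grow s_grow (B := (n%:R + k0) ^+ 4) XS Yy (Fpsi n) (psi01 n)) => //.
  - move=> s r w s0 sr /psi1P h; apply/psi1P => q /andP[q0 qs]; apply: h.
    by rewrite q0 (le_trans qs)// ltW.
  - move=> r rT; apply: (mean_le_ae _ _ _ (mean_le_cst P _)).
    + apply: measurable_funM; last exact: mU.
      by apply: (adapted_measurable FW _ (Fpsi n r rT)); case/andP: rT.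
    + by move=> w; apply: mulr_ge0.
    + apply: filterS (exo_cont XS) => w Xc /=.
      case: (psi01 n r w) => /[dup] E ->; first by rewrite mul0r exprn_even_ge0.
      have h : `|X r w| <= n%:R by apply: (rat_bounded_at rT Xc); apply/psi1P.
      rewrite mul1r -[leLHS]ger0_norm// normrX lerXn2r// ?nnegrE ?addr_ge0//.
      have /andP[a a'] := kk r rT; rewrite (le_trans (ler_normB _ _))// lerD//.
      by rewrite ger0_norm.
    + by rewrite exprn_even_ge0.
  - by rewrite exprn_ge0.
  - move=> r Q rT _; rewrite mul0r addr0; have /andP[a a'] := kk r rT.
    by rewrite lerXn2r// nnegrE.
apply: (mean_le_lim _ _ main) => //.
- exact: mU.
- move=> w n m nm; apply: ler_wpM2r => //; apply: psile => h q /h/le_trans; apply.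
  by rewrite ler_nat.
- apply: filterS (exo_cont XS) => w Xc e e0.
  have [n hn] := cont_rat_bounded (ltW T0) Xc; exists n.
  have -> : psi n t w = 1.
    apply/psi1P => q /andP[q0 qt]; apply: hn; rewrite q0 (le_trans qt)//.
    by case/andP: tT.
  by rewrite mul1r gerBl ltW.
Qed.

(** [exo_moment] now provides the a priori finiteness, so the weight can be 1 and [k0] disappears
    from the bound. For the flat solution this frees the constants from the size of K. *)
Lemma exo_moment_self Y X kap (y4 k0 c0 c1 : R) :
  exo_sde P F W b sigma T Y X kap -> mean_le P (fun w => Y w ^+ 4) y4 ->
  (forall r, 0 <= r <= T -> 0 <= kap r <= k0) -> 0 <= c0 -> 0 <= c1 ->
  (forall r Q, 0 <= r <= T ->
    (forall s, 0 <= s <= r -> exact_mean P (fun w => (X s w - kap s) ^+ 4) <= Q) ->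
    kap r ^+ 4 <= c0 + c1 * Q) ->
  forall t, 0 <= t <= T ->
    mean_le P (fun w => (X t w - kap t) ^+ 4) (moment4_const beta T y4 c0 c1).
Proof.
move=> XS Yy kk c00 c10 kQ t tT.
have E r : (fun w : Omega => (1 : R) * (X r w - kap r) ^+ 4) = (fun w => (X r w - kap r) ^+ 4).
  by apply/funext => w; rewrite mul1r.
rewrite -E; apply: (gronwall4 FW beta0 T0 b_lip s_lip b_grow s_grow
  (B := moment4_const beta T y4 (k0 ^+ 4) 0) XS Yy (psi := fun _ _ => 1)) => //.
- by move=> r /andP[r0 rT]; apply: rv_wrt_cst; exact: (fbm_sa FW).
- by move=> _ _; right.
- by move=> r rT; rewrite E; apply: (exo_moment XS Yy kk).
- by move=> r Q rT h; apply: kQ => // s sr; rewrite -E; exact: h.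
Qed.

Definition incr4_const (m4 k4 : R) : R :=
  8 * (T ^+ 2 + msum4_const R) * (64 * beta ^+ 4 * (1 + m4 + k4)).

Lemma exo_incr_moment Y X kap (m4 k4 : R) :
  exo_sde P F W b sigma T Y X kap ->
  (forall t, 0 <= t <= T -> mean_le P (fun w => (X t w - kap t) ^+ 4) m4) ->
  (forall t, 0 <= t <= T -> kap t ^+ 4 <= k4) ->
  forall s t, 0 <= s -> s < t -> t <= T ->
    mean_le P (fun w => ((X t w - kap t) - (X s w - kap s)) ^+ 4)
      (incr4_const m4 k4 * (t - s) ^+ 2).
Proof.
move=> XS mm kk s t s0 st tT.
have m40 : 0 <= m4 by apply: mean_le_ge0 (mm 0 _); rewrite lexx ltW.
have k40 : 0 <= k4.
  by apply: le_trans (kk 0 _); [exact: exprn_even_ge0|rewrite lexx ltW].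
have b40 : 0 <= 64 * beta ^+ 4 by rewrite mulr_ge0// exprn_ge0.
have inT r : s <= r <= t -> 0 <= r <= T.
  by move=> /andP[sr rt]; rewrite (le_trans s0)// (le_trans rt).
have inT' r : s <= r < t -> 0 <= r <= T.
  by move=> /andP[sr rt]; apply: inT; rewrite sr ltW.
have XF r : 0 <= r <= T -> rv_wrt (F r) (X r) by exact: (exo_adapted XS).
have mX r : 0 <= r <= T -> measurable_fun setT (X r).
  by move=> rT; apply: (adapted_measurable FW _ (XF r rT)); case/andP: rT.
set q := 64 * beta ^+ 4 * (1 + m4 + k4).
have q0 : 0 <= q by rewrite mulr_ge0// !addr_ge0.
have qf (f : R -> R) r : (forall x y, `|f x - f y| <= beta * `|x - y|) ->
    (forall x, `|f x| <= beta * (1 + `|x|)) -> 0 <= r <= T ->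
    mean_le P (fun w => (1 : R) * f (X r w) ^+ 4) q.
  move=> fl fg rT.
  apply: (mean_le_le _ _ _ (mean_leZ b40 (mean_leD (mean_leD (mean_le_cst P ler01) (mm r rT)) (mean_le_cst P k40)))).
  - apply: measurable_funM => //.
    by apply: measurable_funX; apply: (measurableT_comp (lip_measurable beta0 fl)); exact: mX.
  - by move=> w; rewrite mul1r exprn_even_ge0.
  - move=> w; rewrite mul1r/=; apply: le_trans (grow4 beta0 _ (kap r) fg) _.
    by rewrite ler_wpM2l// lerD2l; exact: kk.
have sa r : s <= r -> sigma_algebra setT (F r).
  by move=> sr; apply: (fbm_sa FW); exact: le_trans sr.
have tT' : 0 <= t <= T by apply: inT; rewrite lexx ltW.
have sT' : 0 <= s <= T by apply: inT; rewrite lexx ltW.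
have mUU : measurable_fun setT (fun w => (X t w - kap t) - (X s w - kap s)).
  by apply: measurable_funB; apply: measurable_funB => //; exact: mX.
have st0 : 0 < t - s by rewrite subr_gt0.
have qQ n : \sum_(0 <= j < n.+1) q * mesh s t n <= q * (t - s).
  by rewrite sumr_const_nat subn0 /mesh -[leLHS]mulr_natl mulrCA [n.+1%:R * _]mulrC divfK ?pnatr_eq0.
have hh := ito_incr4 FW s0 st
    (fun r rt => rv_wrt_comp (sa r (proj1 (andP rt))) (lip_measurable beta0 b_lip) (XF r (inT' r rt)))
    (fun r rt => rv_wrt_comp (sa r (proj1 (andP rt))) (lip_measurable beta0 s_lip) (XF r (inT' r rt)))
    (psi := fun _ _ => 1)
    (fun r rt => rv_wrt_cst (c := 1) (sa r (proj1 (andP rt))))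
    (fun _ _ => or_intror erefl) (fun _ _ _ _ => erefl)
    (q := fun=> q)
    (fun r rt => qf b r b_lip b_grow (inT' r rt))
    (fun r rt => qf sigma r s_lip s_grow (inT' r rt))
    qQ mUU (exo_incr XS s0 st tT).
apply: (mean_le_trans _ (mean_le_le _ _ _ hh)).
- have -> : 8 * ((t - s) ^+ 2 + msum4_const R) * (t - s) * (q * (t - s)) =
    (8 * ((t - s) ^+ 2 + msum4_const R) * q) * (t - s) ^+ 2 by ring.
  rewrite /incr4_const; apply: ler_wpM2r; first exact: sqr_ge0.
  apply: ler_wpM2r => //; apply: ler_wpM2l => //; rewrite lerD2r.
  by apply: lerXn2r; rewrite ?nnegrE; lra.
- exact: measurable_funX.
- by move=> w; exact: exprn_even_ge0.
- by move=> w; rewrite mul1r -normrX ler_norm.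
Qed.

End exogenous_moments.

(** * From integral equations to limits of Riemann sums *)

Lemma drift_riemann_cvg (R : realType) (T s t c : R) (G : R -> R) :
  0 <= s -> s < t -> t <= T -> measurable_fun `[0, T] G ->
  (forall r, 0 <= r <= T -> `|G r| <= c) ->
  (forall r, s < r < t -> {for r, continuous G}) ->
  \sum_(0 <= j < n.+1) G (gridpt s t n j) * mesh s t n @[n --> \oo] -->
  \int[lebesgue_measure]_(r in `[0, t]) G r - \int[lebesgue_measure]_(r in `[0, s]) G r.
Proof.
move=> s0 st tT mG Gc Gcont.
have t0 : 0 < t by exact: le_lt_trans st.
have mGt : measurable_fun `[0, t] G.
  apply: (measurable_funS _ _ mG) => // x /=; rewrite !in_itv/= => /andP[-> xr].
  exact: le_trans tT.
have Gtc x : 0 <= x <= t -> `|G x| <= c.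
  by move=> /andP[x0 xt]; apply: Gc; rewrite x0 (le_trans xt).
have c0 : 0 <= c by rewrite (le_trans _ (Gtc 0 _))// lexx ltW.
have iG : lebesgue_measure.-integrable `[0, t] (EFin \o G).
  apply/integrableP; split; first exact/measurable_EFinP.
  apply: (@le_lt_trans _ _ (\int[lebesgue_measure]_(x in `[0%R, t]) (cst c%:E) x)%E).
    apply: ge0_le_integral_any => [x _|x _|//|x].
    - exact: abse_ge0.
    - by rewrite lee_fin.
    - by rewrite /= in_itv/= => sx; rewrite lee_fin Gtc.
  rewrite integral_cst; last exact: measurable_itv.
  apply: lte_mul_pinfty => //.
  by rewrite [X in (X < _)%E]lebesgue_measure_itv/= lte_fin t0 -EFinB ltry.
rewrite Rintegral_itvB ?bnd_simp ?(ltW st)//.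
have iGo : lebesgue_measure.-integrable `]s, t[ (EFin \o G).
  apply: integrableS iG => //= x /=; rewrite !in_itv/= => /andP[sx xt].
  by rewrite (le_trans s0 (ltW sx)) ltW.
rewrite -Rintegral_itv_bndo_bndc// Rintegral_itv_obnd_cbnd//.
apply: (@riemann_sum_cvg _ _ _ st G c).
- apply: (measurable_funS _ _ mGt) => // x /=; rewrite !in_itv/= => /andP[sx xt].
  by rewrite (le_trans s0 sx) ltW.
- by move=> x /andP[sx xt]; apply: Gtc; rewrite (le_trans s0 sx) ltW.
- exact: aeW.
Qed.

Section driven.
Context d (Omega : measurableType d) (R : realType) (P : probability Omega R).
Context (Pc : measure_is_complete P).
Context (F : R -> set (set Omega)) (W : R -> Omega -> R) (FW : fbm P F W).

(** Simple integrals vanish at time 0, so [J 0] is a limit in probability of 0; Fatou's lemma with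
    exponent 1 and bound 0 makes the mean of its absolute value vanish. *)
Lemma ito_integral_start T H J : 0 <= T -> ito_integral P F T W H J ->
  \forall w \ae P, J 0 w = 0.
Proof.
move=> T0 [FJ _ [S [simS _ cI]]].
have sp0 k w : sp_integral (S k) W 0 w = 0.
  have [t00 hS] := simS k; apply: big1 => j _.
  have tj i : (i <= sp_size (S k))%N -> 0 <= sp_time (S k) i.
    elim: i => // i IH iS; have [le_i _ _] := hS i iS.
    by apply: le_trans le_i; apply: IH; exact: ltnW.
  by rewrite !min_l ?subrr ?mulr0//; apply: tj => //; exact: ltnW.
have J0 : cvgp P (fun _ => cst 0) (J 0).
  apply: cvgpE.
  rewrite [X in cvg_to0_in_probability _ X](_ : _ = (fun k w => `|J 0 w - sp_integral (S k) W 0 w|%:E)).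
    by apply: cI; rewrite in_itv/= lexx.
  by apply/funext => k; apply/funext => w; rewrite sp0 distrC.
have mJ : measurable_fun setT (J 0).
  by apply: (adapted_measurable FW (lexx 0)); apply: FJ; rewrite /= in_itv/= lexx.
have near0 : \forall n \near \oo, mean_le P (fun w : Omega => (1 : R) * `|(cst 0 : Omega -> R) w| ^+ 1) (0 : R).
  apply: nearW => n; rewrite [X in mean_le _ X](_ : _ = cst 0).
    exact: mean_le_cst.
  by apply/funext => w; rewrite normr0 expr1 mulr0.
have p01 (w : Omega) : 0 <= (1 : R) <= 1 by rewrite ler01 lexx.
have := mean_le_cvgp (fun _ => @measurable_cst _ _ Omega R setT 0) mJ
  (@measurable_cst _ _ Omega R setT 1) p01 J0 near0.
move=> [m0 p0 h].
have : (\int[P]_w `|(J 0 w)%:E| = 0)%E.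
  apply/eqP; rewrite eq_le integral_ge0 ?andbT//.
  by move: h; under eq_integral do rewrite expr1 mul1r.
have mJ' : measurable_fun setT (EFin \o J 0) by exact/measurable_EFinP.
move/(ae_eq_integral_abs P measurableT mJ').
by apply: filterS => w /(_ Logic.I) [].
Qed.

Lemma lip_continuous (f : R -> R) beta :
  (forall x y, `|f x - f y| <= beta * `|x - y|) -> continuous f.
Proof.
move=> fl x; apply/cvgrPdist_lt => e e0.
have b1 : 0 < `|beta| + 1 by rewrite ltr_wpDl.
exists (e / (`|beta| + 1)) => /=; first by rewrite divr_gt0.
move=> y /=; rewrite ltr_pdivlMr// => h; apply: le_lt_trans (fl x y) _.
apply: le_lt_trans h; rewrite mulrC ler_wpM2l// (le_trans (ler_norm _))// lerDl.
exact: ler01.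
Qed.

Context (b sigma : R -> R) (beta : R).
Hypothesis b_lip : forall x y, `|b x - b y| <= beta * `|x - y|.
Hypothesis s_lip : forall x y, `|sigma x - sigma y| <= beta * `|x - y|.

(** [U] is known only through an equation that holds almost everywhere. Its increment is therefore
    measurable by completeness, and this is proved along with the limit. *)
Lemma driven_ito_incr T Y H U s t : 0 < T -> driven_by P F T b sigma Y W H U ->
  0 <= s -> s < t -> t <= T ->
  (forall r, s <= r < t -> rv_wrt (F r) (H r)) ->
  (\forall w \ae P, [/\ measurable_fun `[0, T] (fun r => H r w),
     exists c : R, forall r, 0 <= r <= T -> `|H r w| <= c &
     forall r, s < r < t -> {for r, continuous (fun r => H r w)}]) ->
  ito_incr P W s t (fun r w => b (H r w)) (fun r w => sigma (H r w))
    (fun w => U t w - U s w) /\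
  measurable_fun setT (fun w => U t w - U s w).
Proof.
move=> T0 [J IJ UJ] s0 st tT FH niceH.
have bc := lip_continuous b_lip; have sc := lip_continuous s_lip.
have mb : measurable_fun setT b by exact: continuous_measurable_fun.
have ms : measurable_fun setT sigma by exact: continuous_measurable_fun.
have lip0 (f : R -> R) (x c : R) : (forall x y, `|f x - f y| <= beta * `|x - y|) ->
    `|x| <= c -> `|f x| <= `|f 0| + `|beta| * c.
  move=> fl xc; have := ler_normD (f 0) (f x - f 0); rewrite addrC subrK.
  move=> /le_trans; apply; rewrite lerD2l (le_trans (fl _ _))// subr0.
  by apply: (@le_trans _ _ (`|beta| * `|x|)); [rewrite ler_wpM2r// ler_norm|rewrite ler_wpM2l].
have sT : s <= T by apply: le_trans tT; exact: ltW.
have noise : cvgp P (rsum W s t (fun r w => sigma (H r w))) (fun w => J t w - J s w).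
  apply: (riemann_ito Pc FW s0 st IJ tT).
    move=> r /[dup] rr /andP[sr _]; apply: rv_wrt_comp => //; last exact: FH.
    by apply: (fbm_sa FW); exact: le_trans sr.
  apply: filterS niceH => w [_ [c Hc] Hcont]; split.
    exists (`|sigma 0| + `|beta| * c) => r /andP[sr rt]; apply: lip0 => //.
    by apply: Hc; rewrite (le_trans s0 sr) (le_trans (ltW rt)).
  move=> r rr; apply: continuous_comp; [exact: Hcont|exact: sc].
pose D n w := \sum_(0 <= j < n.+1) b (H (gridpt s t n j) w) * mesh s t n.
pose I w := \int[lebesgue_measure]_(r in `[0, t]) b (H r w) -
            \int[lebesgue_measure]_(r in `[0, s]) b (H r w).
have DI : \forall w \ae P, D^~ w @ \oo --> I w.
  apply: filterS niceH => w [mH [c Hc] Hcont].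
  apply: (drift_riemann_cvg (c := `|b 0| + `|beta| * c) s0 st tT).
  - exact: measurableT_comp.
  - by move=> r rT; apply: lip0 => //; exact: Hc.
  - by move=> r rr; apply: continuous_comp; [exact: Hcont|exact: bc].
have mD n : measurable_fun setT (D n).
  apply: measurable_sum_nat => j jn; apply: measurable_funM => //.
  apply: measurableT_comp => //.
  have sr : s <= gridpt s t n j by exact: gridpt_ge.
  apply: (adapted_measurable FW (le_trans s0 sr)); apply: FH.
  by rewrite sr gridpt_lt_end.
have mI : measurable_fun setT I by exact: (ae_cvg_measurable Pc mD DI).
have h := cvgpD (cvgp_of_ae mD mI DI) noise.
have UIJ : \forall w \ae P, U t w - U s w = I w + (J t w - J s w).
  apply: filterS UJ => w UE.
  rewrite !UE ?in_itv/= ?s0//; last by rewrite (le_trans s0 (ltW st)).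
  by rewrite /I; ring.
split.
  apply: (cvgp_ae_eq h) => [n|//].
  by apply: aeW => w; rewrite /rs /D /rsum -big_split.
have JF r : 0 <= r <= T -> measurable_fun setT (J r).
  move=> rT; have [FJ _ _] := IJ.
  apply: (adapted_measurable FW (proj1 (andP rT))).
  by apply: FJ; rewrite /= in_itv.
apply: (ae_eq_measurable Pc (x := fun w => I w + (J t w - J s w))).
  apply: measurable_funD => //; apply: measurable_funB; apply: JF.
    by rewrite tT (le_trans s0 (ltW st)).
  by rewrite s0.
by apply: filterS UIJ => w ->.
Qed.

Lemma driven_start T Y H U : 0 < T -> driven_by P F T b sigma Y W H U ->
  \forall w \ae P, U 0 w = Y w.
Proof.
move=> T0 [J IJ UJ]; have J0 := ito_integral_start (ltW T0) IJ.
apply: filterS2 UJ J0 => w UE J0'; rewrite UE ?in_itv/= ?lexx ?ltW//.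
by rewrite J0' addr0 set_itv1 /Rintegral integral_set1/= addr0.
Qed.

Lemma driven_exo T Y X U kap : 0 < T -> driven_by P F T b sigma Y W X U ->
  adapted F `[0, +oo[%classic X -> ae_continuous P `[0, +oo[ X ->
  (\forall w \ae P, forall t, 0 <= t -> X t w = U t w + kap t) ->
  exo_sde P F W b sigma T Y X kap.
Proof.
move=> T0 XU FX Xc XE.
have sub : `[0, T]%classic `<=` (`[0, +oo[%classic : set R).
  by move=> x /=; rewrite !in_itv/= => /andP[-> _].
have Xc' : \forall w \ae P, {within `[0, T], continuous (fun r => X r w)}.
  by apply: filterS Xc => w; exact: continuous_subspaceW.
have FX' r : 0 <= r -> rv_wrt (F r) (X r).
  by move=> r0; apply: FX; rewrite /= in_itv/= r0.
split.
- by move=> r /andP[r0 _]; exact: FX'.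
- exact: Xc'.
- apply: filterS2 XE (driven_start T0 XU) => w XE' U0; rewrite XE' ?lexx// addrK U0//.
- move=> s t s0 st tT.
  have h := driven_ito_incr T0 XU s0 st tT _ _.
  apply: (cvgp_ae_eq (proj1 (h _ _))).
  + by move=> r /andP[sr _]; apply: FX'; exact: le_trans sr.
  + apply: filterS Xc' => w Xw; split.
    * by apply: subspace_continuous_measurable_fun.
    * have nc : {within `[0, T], continuous (fun s => `|X s w|)}.
        by move=> z; apply: cvg_norm; exact: Xw.
      have [c _ hc] := EVT_max (ltW T0) nc; exists `|X c w| => r rT.
      by apply: hc; rewrite in_itv.
    * move=> r /andP[sr rt]; apply: (within_continuous_continuous T0 Xw).
      by rewrite in_itv/= (le_lt_trans s0 sr) (lt_le_trans rt).
  + by move=> n; exact: aeW.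
  + apply: filterS XE => w XE'; rewrite !XE'//; last by rewrite (le_trans s0 (ltW st)).
    by rewrite !addrK.
Qed.

End driven.

(** * Independence of generated sigma-algebras *)

Section sigma_independence.
Context d (Omega : measurableType d) (R : realType) (P : probability Omega R).

Lemma indep_systemsC (G H : set (set Omega)) : indep_systems P G H -> indep_systems P H G.
Proof. by move=> GH A B HA GB; rewrite setIC GH// muleC. Qed.

(** Dynkin's pi-lambda argument: for fixed [B] in [H], the events independent of [B] form a Dynkin
    system containing the pi-system [G]. *)
Lemma indep_sigmal (G H : set (set Omega)) : setI_closed G -> G `<=` measurable ->
  H `<=` measurable -> indep_systems P G H -> indep_systems P <<s G >> H.
Proof.
move=> GI Gm Hm GH A B GA HB; have mB := Hm _ HB.
pose D := [set A | measurable A /\ P (A `&` B) = (P A * P B)%E].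
suff : D A by case.
move: A GA; rewrite -setI_closed_g_dynkin_g_sigma_algebra//.
apply: smallest_sub; last by move=> A GA; split; [exact: Gm|exact: GH].
split.
- by split => //; rewrite setTI probability_setT mul1e.
- move=> A [mA AB]; split; first exact: measurableC.
  have -> : ~` A `&` B = B `\` (A `&` B).
    by rewrite setDIr setDv setU0 setDE setIC.
  rewrite measureD//; [|exact: measurableI|by rewrite ltey_eq fin_num_measure].
  rewrite [X in (_ - X)%E](_ : _ = (P A * P B)%E); last by rewrite setICA setIid; exact: AB.
  rewrite probability_setC//.
  have e (x y : \bar R) : x \is a fin_num -> y \is a fin_num -> (y - x * y = (1 - x) * y)%E.
    by move: x y => [x||] [y||]// _ _; congr (_%:E); rewrite mulrBl mul1r.
  by apply: e; exact: fin_num_measure.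
- move=> A tA DA; have mA n : measurable (A n) by case: (DA n).
  split; first exact: bigcupT_measurable.
  have -> : \bigcup_k A k `&` B = \bigcup_k (A k `&` B) by rewrite setI_bigcupl.
  rewrite !measure_bigcup//=; first last.
  - exact: trivIset_setIr.
  - by move=> n _; exact: measurableI.
  rewrite muleC -(fineK (fin_num_measure P B mB)) -nneseriesZl//.
  apply: eq_eseriesr => n _; have [_ ->] := DA n.
  by rewrite fineK ?fin_num_measure// muleC.
Qed.

Lemma sigma_sub_measurable (G : set (set Omega)) : G `<=` measurable -> <<s G >> `<=` measurable.
Proof. by move=> Gm; apply: smallest_sub => //; exact: sigma_algebra_measurable. Qed.

Lemma indep_sigma (G H : set (set Omega)) : setI_closed G -> setI_closed H ->
  G `<=` measurable -> H `<=` measurable ->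
  indep_systems P G H -> indep_systems P <<s G >> <<s H >>.
Proof.
move=> GI HI Gm Hm GH; apply: indep_systemsC; apply: indep_sigmal => //.
  exact: sigma_sub_measurable.
by apply: indep_systemsC; exact: indep_sigmal.
Qed.

(** Events equal almost everywhere to a member of [<<s G>>] form a sigma-algebra, so null sets can
    be discarded before a probability is computed. *)
Lemma sigma_negligible_ae (G : set (set Omega)) D :
  <<s P.-negligible `|` G >> D ->
  exists2 E, <<s G >> E & \forall w \ae P, D w <-> E w.
Proof.
have [s0 sC sU] := smallest_sigma_algebra setT G.
move: D; apply: smallest_sub => [|A [nA|GA]]; last 2 first.
- exists set0 => //; apply: negligibleS nA => w /= h; apply: contrapT => nAw; apply: h; tauto.
- by exists A; [exact: sub_sigma_algebra|exact: aeW].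
split.
- by exists set0 => //; exact: aeW.
- move=> A [E GE AE]; exists (setT `\` E); first exact: sC.
  by apply: filterS AE => w h; split=> -[_ nA]; split=> // /h.
- move=> A hA; have /choice [E hE] : forall n, exists E, <<s G >> E /\ \forall w \ae P, A n w <-> E w.
    by move=> n; have [E GE AE] := hA n; exists E.
  exists (\bigcup_k E k); first by apply: sU => n; case: (hE n).
  have /ae_foralln : forall n, \forall w \ae P, A n w <-> E n w by move=> n; case: (hE n).
  by apply: filterS => w h; split=> -[n _ An]; exists n => //; apply/h.
Qed.

Lemma probability_ae_eq (A B : set Omega) : measurable A -> measurable B ->
  (\forall w \ae P, A w <-> B w) -> P A = P B.
Proof.
move=> mA mB AB; rewrite -!measurable_mu_extE//.
by apply/eqP; rewrite eq_le !outer_le_ae//; apply: filterS AB => w [].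
Qed.

End sigma_independence.

(** * Augmented filtrations and independence *)

Section augmented_filtrations.
Context d (Omega : measurableType d) (R : realType) (P : probability Omega R).
Context (I : eqType) (Y : I -> Omega -> R) (W : I -> R -> Omega -> R).
Hypothesis Y_measurable : forall i, measurable_fun setT (Y i).
Hypothesis W_bm : forall i, brownian_motion P (W i).
Hypothesis Y_indep : mutually_indep_systems P (fun i => g_sigma_algebra_preimage (Y i)).
Hypothesis W_indep : mutually_indep_systems P (fun i => sigma_process (W i)).
Hypothesis WY_indep : indep_systems P (sigma_rvs setT Y) <<s \bigcup_i sigma_process (W i) >>.

Definition aug_gen (J : set I) (t : R) : set (set Omega) :=
  \bigcup_(i in J) g_sigma_algebra_preimage (Y i) `|`
  \bigcup_(i in J) sigma_rvs `[0, t]%classic (W i).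

(** Filtrations indexed by a set of particles: a singleton gives that of one copy, an initial
    segment that of the particle system or of the earlier copies, and disjoint sets give independent
    ones. *)
Definition augJ (J : set I) (t : R) : set (set Omega) :=
  <<s P.-negligible `|` aug_gen J t >>.

Definition rect (s : seq I) (A C : I -> set Omega) : set Omega :=
  [set w | forall i, i \in s -> A i w /\ C i w].

(** A pi-system which generates [augJ] up to null sets. Requiring [A] and [C] to be the whole space
    off the list lets two rectangles be written over a common list. *)
Definition rects (J : set I) (t : R) : set (set Omega) :=
  [set E | exists s A C, [/\ uniq s, [set` s] `<=` J,
    forall i, g_sigma_algebra_preimage (Y i) (A i),
    forall i, sigma_rvs `[0, t]%classic (W i) (C i) &
    E = rect s A C /\ forall i, i \notin s -> A i = setT /\ C i = setT]].

Let sY i : sigma_algebra setT (g_sigma_algebra_preimage (Y i)).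
Proof. apply: sigma_algebra_preimage; exact: sigma_algebra_measurable. Qed.

Let sW t i : sigma_algebra setT (sigma_rvs `[0, t]%classic (W i)).
Proof. exact: smallest_sigma_algebra. Qed.

Lemma sigma_algebraI (G : set (set Omega)) A B : sigma_algebra setT G -> G A -> G B -> G (A `&` B).
Proof.
move=> sG GA GB; have GE : <<s G >> = G by exact: sigma_algebra_id.
rewrite -GE; apply: (@measurableI _ (g_sigma_algebraType G)); exact: sub_sigma_algebra.
Qed.

Lemma sigma_algebra_bigcap (G : set (set Omega)) (s : seq I) A : sigma_algebra setT G ->
  (forall i, i \in s -> G (A i)) -> G (\bigcap_(i in [set` s]) A i).
Proof.
move=> sG; elim: s => [|i s IH] GA.
  rewrite [X in G X](_ : _ = setT); first exact: sigma_algebraT.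
  by apply/seteqP; split=> w // _ j; rewrite /= in_nil.
rewrite [X in G X](_ : _ = A i `&` \bigcap_(i in [set` s]) A i).
  apply: sigma_algebraI => //; first by apply: GA; exact: mem_head.
  by apply: IH => j js; apply: GA; rewrite inE js orbT.
apply/seteqP; split=> [w h|w [h1 h2] j /=].
  by split=> [|j /= js]; apply: h; rewrite /= inE ?eqxx ?js ?orbT.
by rewrite inE => /predU1P[->|/h2].
Qed.

Lemma sigma_rvs_process t i : sigma_rvs `[0, t]%classic (W i) `<=` sigma_process (W i).
Proof.
apply: sub_smallest2r; first exact: smallest_sigma_algebra.
by apply: bigcup_subset => x /=; rewrite !in_itv/= => /andP[->].
Qed.

Lemma Y_sub i : g_sigma_algebra_preimage (Y i) `<=` measurable.
Proof. by move=> _ [B mB <-]; exact: Y_measurable. Qed.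

Lemma W_sub i : sigma_process (W i) `<=` measurable.
Proof.
apply: sigma_sub_measurable => A [t /=]; rewrite in_itv/= andbT => t0 [B mB <-].
exact: (bm_measurable (W_bm i)).
Qed.

Lemma rectE s A C : rect s A C = \bigcap_(i in [set` s]) A i `&` \bigcap_(i in [set` s]) C i.
Proof.
apply/seteqP; split=> [w h|w [hA hC] i si]; last by split; [exact: hA|exact: hC].
by split=> i /h[].
Qed.

Lemma rect_enlarge s s' A C : {subset s <= s'} ->
  (forall i, i \notin s -> A i = setT /\ C i = setT) -> rect s A C = rect s' A C.
Proof.
move=> ss AC; apply/seteqP; split=> w h i si; last exact/h/ss.
by have [/h//|/AC[-> ->]] := boolP (i \in s).
Qed.

Lemma rectsI J t : setI_closed (rects J t).
Proof.
move=> _ _ [s [A [C [us sJ YA WC [-> AC]]]]] [s' [A' [C' [us' sJ' YA' WC' [-> AC']]]]].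
exists (undup (s ++ s')), (fun i => A i `&` A' i), (fun i => C i `&` C' i); split.
- exact: undup_uniq.
- by move=> i /=; rewrite mem_undup mem_cat => /orP[/sJ|/sJ'].
- by move=> i; exact: (sigma_algebraI (sY i) (YA i) (YA' i)).
- by move=> i; exact: (sigma_algebraI (sW t i) (WC i) (WC' i)).
- rewrite (rect_enlarge (s' := undup (s ++ s')) _ AC); last by move=> i si; rewrite mem_undup mem_cat si.
  rewrite (rect_enlarge (s' := undup (s ++ s')) _ AC'); last by move=> i si; rewrite mem_undup mem_cat si orbT.
  split.
    apply/seteqP; split=> [w [h h'] i si|w h].
      by have [? ?] := h i si; have [? ?] := h' i si.
    by split=> i /h[[? ?] [? ?]].
  by move=> i; rewrite mem_undup mem_cat negb_or => /andP[/AC[-> ->] /AC'[-> ->]]; rewrite setTI.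
Qed.

Lemma rects_measurable J t : rects J t `<=` measurable.
Proof.
move=> _ [s [A [C [us sJ YA WC [-> AC]]]]]; rewrite rectE.
have sm := @sigma_algebra_measurable _ Omega.
apply: measurableI; apply: (sigma_algebra_bigcap sm) => i _; first exact: Y_sub (YA i).
by apply: (@W_sub i); exact: sigma_rvs_process (WC i).
Qed.

Lemma aug_gen_rects J t : aug_gen J t `<=` rects J t.
Proof.
move=> E [[i Ji GE]|[i Ji GE]].
- exists [:: i], (fun j => if j == i then E else setT), (fun=> setT); split => //.
  + by move=> j /=; rewrite inE => /eqP ->.
  + by move=> j; case: eqP => [->//|_]; exact: sigma_algebraT.
  + by move=> j; exact: sigma_algebraT.
  + split; last by move=> j; rewrite inE => /negbTE ->.
    apply/seteqP; split=> [w Ew j|w h]; last by have [] := h i (mem_head _ _); rewrite eqxx.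
    by rewrite inE => ->.
- exists [:: i], (fun=> setT), (fun j => if j == i then E else setT); split => //.
  + by move=> j /=; rewrite inE => /eqP ->.
  + by move=> j; exact: sigma_algebraT.
  + by move=> j; case: eqP => [->//|_]; exact: sigma_algebraT.
  + split; last by move=> j; rewrite inE => /negbTE ->.
    apply/seteqP; split=> [w Ew j|w h]; last by have [] := h i (mem_head _ _); rewrite eqxx.
    by rewrite inE => ->.
Qed.

(** All three independence assumptions meet here: initial values are separated from paths, then each
    of the two intersections factors over the indices. *)
Lemma probability_rect s A C : uniq s ->
  (forall i, g_sigma_algebra_preimage (Y i) (A i)) ->
  (forall i, sigma_process (W i) (C i)) ->
  P (rect s A C) = (\prod_(i <- s) P (A i) * \prod_(i <- s) P (C i))%E.
Proof.
move=> us YA WC; rewrite rectE WY_indep; first by rewrite Y_indep// W_indep.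
- apply: sigma_algebra_bigcap; first exact: smallest_sigma_algebra.
  by move=> i _; apply: sub_sigma_algebra; exists i.
- apply: sigma_algebra_bigcap; first exact: smallest_sigma_algebra.
  by move=> i _; apply: sub_sigma_algebra; exists i.
Qed.

Lemma augJ_ae J t D : augJ J t D ->
  exists2 E, <<s rects J t >> E & \forall w \ae P, D w <-> E w.
Proof.
move=> /sigma_negligible_ae[E GE DE]; exists E => //.
apply: sub_smallest2r GE; first exact: smallest_sigma_algebra.
exact: aug_gen_rects.
Qed.

Lemma augJ_measurable (Pc : measure_is_complete P) J t : augJ J t `<=` measurable.
Proof.
apply: sigma_sub_measurable => A [/Pc//|/aug_gen_rects]; exact: rects_measurable.
Qed.

Lemma sigma_rects_measurable J t : <<s rects J t >> `<=` measurable.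
Proof. by apply: sigma_sub_measurable; exact: rects_measurable. Qed.

(** Once null sets are discarded, rectangles over two disjoint index sets form a single rectangle
    over the concatenated lists, whose probability factors. *)
Lemma augJ_indep (Pc : measure_is_complete P) J J' t : J `&` J' = set0 ->
  indep_systems P (augJ J t) (augJ J' t).
Proof.
move=> JJ D D' JD JD'.
have mD := augJ_measurable Pc JD; have mD' := augJ_measurable Pc JD'.
have [E JE DE] := augJ_ae JD; have [E' JE' DE'] := augJ_ae JD'.
have mE := sigma_rects_measurable JE; have mE' := sigma_rects_measurable JE'.
rewrite (probability_ae_eq mD mE DE) (probability_ae_eq mD' mE' DE').
rewrite (probability_ae_eq (measurableI _ _ mD mD') (measurableI _ _ mE mE')); last first.
  by apply: filterS2 DE DE' => w h h'; split=> -[? ?]; split; tauto.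
move: E E' JE JE' {DE DE' mE mE'}.
apply: indep_sigma; try exact: rectsI; try exact: rects_measurable.
move=> _ _ [s [A [C [us sJ YA WC [-> AC]]]]] [s' [A' [C' [us' sJ' YA' WC' [-> AC']]]]].
have ss i : i \in s -> i \notin s'.
  move=> si; apply/negP => si'; have : (J `&` J') i by split; [exact: sJ|exact: sJ'].
  by rewrite JJ.
have E : rect s A C `&` rect s' A' C' =
    rect (s ++ s') (fun i => A i `&` A' i) (fun i => C i `&` C' i).
  apply/seteqP; split=> [w [h h'] i|w h].
    rewrite mem_cat => /orP[si|si].
      by have [? ?] := h i si; have [-> ->] := AC' i (ss i si).
    have [? ?] := h' i si; have [|-> ->] := AC i; last by [].
    by apply/negP => /ss; rewrite si.
  split=> i si; have := h i; rewrite mem_cat si ?orbT => /(_ isT)[[? ?] [? ?]] //.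
rewrite E !probability_rect//.
- rewrite !big_cat/=.
  have e1 : (\prod_(i <- s) P (A i `&` A' i) = \prod_(i <- s) P (A i))%E.
    by apply: eq_big_seq => i /ss /AC' [-> _]; rewrite setIT.
  have e2 : (\prod_(i <- s) P (C i `&` C' i) = \prod_(i <- s) P (C i))%E.
    by apply: eq_big_seq => i /ss /AC' [_ ->]; rewrite setIT.
  have ss' i : i \in s' -> i \notin s by move=> si'; apply/negP => /ss; rewrite si'.
  have e3 : (\prod_(i <- s') P (A i `&` A' i) = \prod_(i <- s') P (A' i))%E.
    by apply: eq_big_seq => i /ss' /AC [-> _]; rewrite setTI.
  have e4 : (\prod_(i <- s') P (C i `&` C' i) = \prod_(i <- s') P (C' i))%E.
    by apply: eq_big_seq => i /ss' /AC [_ ->]; rewrite setTI.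
  by rewrite e1 e2 e3 e4 muleACA.
- by move=> i; exact: sigma_rvs_process (WC' i).
- by move=> i; exact: sigma_rvs_process (WC i).
- rewrite cat_uniq us us' andbT/=; apply/hasPn => i si'; apply/negP => /ss.
  by rewrite si'.
- by move=> i; exact: (sigma_algebraI (sY i) (YA i) (YA' i)).
- by move=> i; apply: sigma_rvs_process; exact: (sigma_algebraI (sW t i) (WC i) (WC' i)).
Qed.

Lemma W_rv_wrt i r t : 0 <= r <= t -> rv_wrt (sigma_rvs `[0, t]%classic (W i)) (W i r).
Proof. by move=> rt A GA; apply: sub_sigma_algebra; exists r => //=; rewrite in_itv. Qed.

(** An event about an increment of [W i] after time s belongs to the path of [W i], so it joins the
    i-th factor of a rectangle, where [bm_indep] splits it off; the other factors are untouched. *)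
Lemma augJ_fbm (Pc : measure_is_complete P) J i : J i -> fbm P (augJ J) (W i).
Proof.
move=> Ji; split.
- by move=> t _; exact: smallest_sigma_algebra.
- by move=> t _; exact: augJ_measurable.
- move=> s t s0 st; apply: sub_smallest2r; first exact: smallest_sigma_algebra.
  apply: setUS; apply: setUS; apply: subset_bigcup => j _.
  apply: sub_smallest2r; first exact: smallest_sigma_algebra.
  apply: bigcup_subset => x /=; rewrite !in_itv/= => /andP[-> xs].
  exact: le_trans st.
- move=> t t0 A GA; apply: sub_sigma_algebra; right; right; exists i => //.
  by apply: (W_rv_wrt (r := t)) => //; rewrite t0 lexx.
- exact: (bm_continuous (W_bm i)).
- move=> s t s0 st A mA; have := bm_increment (W_bm i) s0 st mA.
  by rewrite /pushforward.
- move=> s t s0 st D D' JD GD'.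
  have mD := augJ_measurable Pc JD.
  have WD' : sigma_process (W i) D'.
    apply: (@sigma_rvs_process t i).
    have h := rv_wrtB (sW t i) (@W_rv_wrt i t t _) (@W_rv_wrt i s t _).
    by apply: (h _ _ D' GD'); rewrite ?s0 ?lexx ?(le_trans s0 (ltW st))// ltW.
  have mD' := W_sub WD'.
  have [E JE DE] := augJ_ae JD; have mE := sigma_rects_measurable JE.
  rewrite (probability_ae_eq mD mE DE).
  rewrite (probability_ae_eq (measurableI _ _ mD mD') (measurableI _ _ mE mD')); last first.
    by apply: filterS DE => w h; split=> -[? ?]; split=> //; tauto.
  move: E D' JE GD' WD' mD' {DE mE} => E D' JE GD' WD' mD'.
  (* The increment event stays fixed, as a system with one member, so that Dynkin's argument runs
     over the rectangles only. *)
  have : indep_systems P <<s rects J s >> [set D']; last by apply.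
  apply: indep_sigmal; [exact: rectsI|exact: rects_measurable|by move=> _ ->|].
  move=> _ _ [l [A [C [ul lJ YA WC [-> AC]]]]] ->.
  (* Adding [i] to the list ensures that some factor can carry the increment. *)
  pose l' := undup (i :: l).
  have il' : i \in l' by rewrite mem_undup mem_head.
  have ul' : uniq l' by exact: undup_uniq.
  have WC' j : sigma_process (W j) (C j) by exact: sigma_rvs_process (WC j).
  rewrite (rect_enlarge (s' := l') _ AC); last by move=> j jl; rewrite mem_undup inE jl orbT.
  pose C' j := if j == i then C j `&` D' else C j.
  have -> : rect l' A C `&` D' = rect l' A C'.
    apply/seteqP; split=> [w [h Dw] j /h[Aj Cj]|w h].
      by split=> //; rewrite /C'; case: eqP.
    split=> [j jl|].
      by have [? ] := h j jl; rewrite /C'; case: eqP => [_ []|].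
    by have [_] := h i il'; rewrite /C' eqxx => -[].
  have WC'' j : sigma_process (W j) (C' j).
    rewrite /C'; case: eqP => [->|//].
    exact: (sigma_algebraI (smallest_sigma_algebra _ _) (WC' i) WD').
  rewrite !probability_rect// -muleA; congr (_ * _)%E.
  rewrite (bigD1_seq i)//= [in RHS](bigD1_seq i)//= {1}/C' eqxx.
  rewrite setIC (bm_indep (W_bm i) s0 st)//.
  rewrite -muleA muleC; congr (_ * _)%E; congr (_ * _)%E.
  by apply: eq_bigr => j /negbTE; rewrite /C' => ->.
Qed.

End augmented_filtrations.

(** * The reflection functional and flatness *)

Section root_inf.
Context (R : realType) (m M : R) (m0 : 0 < m).

Definition bi_incr (f : R -> R) :=
  forall x y, x <= y -> m * (y - x) <= f y - f x <= M * (y - x).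

(** [G0] with the integral replaced by an arbitrary function of the shift, so that laws and
    empirical measures are treated alike. *)
Definition root_inf (f : R -> R) := inf [set x | 0 <= x /\ 0 <= f x].

Context (f : R -> R) (ff : bi_incr f).

Lemma root_inf_nonempty : [set x | 0 <= x /\ 0 <= f x] !=set0.
Proof.
have x0 : 0 <= `|f 0| / m by rewrite divr_ge0// ltW.
exists (`|f 0| / m); split => //; have /andP[h _] := ff x0; move: h.
rewrite subr0 mulrC divfK ?gt_eqF//; have := ler_norm (- f 0); rewrite normrN; lra.
Qed.

Lemma root_inf_lb : has_lbound [set x | 0 <= x /\ 0 <= f x].
Proof. by exists 0; apply/lbP => x []. Qed.

Lemma root_inf_le x : 0 <= x -> 0 <= f x -> root_inf f <= x.
Proof. by move=> x0 fx; apply: ge_inf => //; exact: root_inf_lb. Qed.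

Lemma root_inf_ge0 : 0 <= root_inf f.
Proof. by apply: lb_le_inf; [exact: root_inf_nonempty|apply/lbP => x []]. Qed.

Lemma bi_incr_M0 : 0 < M.
Proof. by have /andP[h1 h2] := ff (@ler01 R); move: m0 h1 h2; lra. Qed.

(** A negative value at the infimum would, by the upper slope [M], persist on an interval to its
    right, yet that interval meets the set. *)
Lemma root_infP : 0 <= f (root_inf f).
Proof.
rewrite leNgt; apply/negP => fneg.
have M0 := bi_incr_M0.
have e0 : 0 < - f (root_inf f) / M by rewrite divr_gt0// oppr_gt0.
have [x [x0 fx] xe] := inf_adherent e0 (conj root_inf_nonempty root_inf_lb).
have gx := root_inf_le x0 fx.
have /andP[_ h] := ff gx.
have : x - root_inf f < - f (root_inf f) / M by rewrite ltrBlDl.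
by rewrite ltr_pdivlMr// mulrC; move: fx h; lra.
Qed.

Lemma root_inf_eq0 : 0 < root_inf f -> f (root_inf f) = 0.
Proof.
move=> g0; apply/eqP; rewrite eq_le root_infP andbT leNgt; apply/negP => fpos.
have M0 := bi_incr_M0.
pose e := Num.min (root_inf f) (f (root_inf f) / M).
have e0 : 0 < e by rewrite lt_min g0 divr_gt0.
have eM : e * M <= f (root_inf f) by rewrite -ler_pdivlMr// ge_min lexx orbT.
have eg : e <= root_inf f by rewrite ge_min lexx.
have le1 : root_inf f - e <= root_inf f by rewrite gerBl ltW.
have /andP[_ h] := ff le1.
have : root_inf f <= root_inf f - e.
  by apply: root_inf_le; [rewrite subr_ge0|move: h eM; lra].
by move: e0; lra.
Qed.

Lemma root_inf_bound : root_inf f <= `|f 0| / m.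
Proof.
have x0 : 0 <= `|f 0| / m by rewrite divr_ge0// ltW.
apply: root_inf_le => //; have /andP[h _] := ff x0; move: h.
rewrite subr0 mulrC divfK ?gt_eqF//; have := ler_norm (- f 0); rewrite normrN; lra.
Qed.

(** With f x = E h(x + U_s) and x = K_s this bounds the constraint from below by a multiple of the
    gap between K and g. *)
Lemma bi_incr_lower x : 0 <= f x -> m * (x - root_inf f) <= f x.
Proof.
move=> fx; have [gx|gx] := leP (root_inf f) x.
  by have /andP[h _] := ff gx; have := root_infP; lra.
by apply: le_trans fx; rewrite pmulr_rle0// subr_le0 ltW.
Qed.

End root_inf.

(** The two maps are compared at the root of [f] only. If the root of [g] lies to its left, the root
    of [f] is positive, so [f] vanishes there, while [g] has risen at slope at least [m] from a
    nonnegative value. If it lies to the right, [g] is nonnegative after a further shift by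
    [c / m]. *)
Lemma root_inf_lip (R : realType) (m M : R) (f g : R -> R) : 0 < m ->
  bi_incr m M f -> bi_incr m M g ->
  `|root_inf f - root_inf g| <= `|f (root_inf f) - g (root_inf f)| / m.
Proof.
move=> m0 ff gg; set a := root_inf f; set c := `|_ - g a|.
have a0 : 0 <= a := root_inf_ge0 m0 ff.
have fa : 0 <= f a := root_infP m0 ff.
have c0 : 0 <= c / m by apply: divr_ge0; [exact: normr_ge0|exact: ltW].
have h1 : root_inf g <= a + c / m.
  apply: root_inf_le; first exact: addr_ge0.
  have ac : a <= a + c / m by rewrite lerDl.
  have /andP[h _] := gg _ _ ac; move: h.
  rewrite [a + _]addrC addrK mulrC divfK ?gt_eqF//.
  by have := ler_norm (f a - g a); rewrite -/c; lra.
suff h2 : a - root_inf g <= c / m by rewrite ler_norml; apply/andP; split; lra.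
have [ag|ga] := leP a (root_inf g); first by apply: le_trans c0; rewrite subr_le0.
have := bi_incr_lower m0 gg (x := a) _.
have g0 : 0 <= root_inf g := root_inf_ge0 m0 gg.
have fa0 : f a = 0 by apply: (root_inf_eq0 m0 ff); exact: le_lt_trans ga.
have gga : 0 <= g a.
  have /andP[h _] := gg _ _ (ltW ga); have := root_infP m0 gg.
  have : 0 <= m * (a - root_inf g) by rewrite mulr_ge0// ?subr_ge0 ltW.
  move: h; lra.
move=> /(_ gga) h; rewrite ler_pdivlMr// mulrC; apply: le_trans h _.
by rewrite /c fa0 sub0r normrN ger0_norm.
Qed.

Section laws.
Context (R : realType) (h : R -> R) (m M : R) (m0 : 0 < m).
Hypothesis h_incr : bi_incr m M h.

Lemma G0_root_inf (nu : set R -> \bar R) (f : R -> R) :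
  (forall x, (\int[nu]_z (h (x + z))%:E = (f x)%:E)%E) -> G0 h nu = root_inf f.
Proof.
move=> nuf; rewrite /G0 /root_inf; congr (inf _); apply/seteqP.
by split=> x /= [x0]; rewrite nuf lee_fin.
Qed.

Lemma bi_incr_lip x y : `|h x - h y| <= M * `|x - y|.
Proof.
have M0 := bi_incr_M0 m0 h_incr.
wlog xy : x y / x <= y => [hw|].
  by have [/hw//|/ltW/hw] := leP x y; rewrite [leLHS]distrC [`|x - y|]distrC.
have /andP[a b'] := h_incr xy.
rewrite distrC [`|x - y|]distrC [`|y - x|]ger0_norm ?subr_ge0// ger0_norm//.
by apply: le_trans a; rewrite mulr_ge0// ?subr_ge0// ltW.
Qed.

Lemma bi_incr_measurable : measurable_fun setT h.
Proof.
apply: continuous_measurable_fun; exact: lip_continuous bi_incr_lip.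
Qed.

Lemma empirical_integral (N : nat) (u : nat -> R) x :
  (\int[empirical_measure N u]_z (h (x + z))%:E =
   (N%:R^-1 * \sum_(0 <= i < N) h (x + u i))%:E)%E.
Proof.
have mh : measurable_fun setT (fun z => (h (x + z))%:E).
  apply/measurable_EFinP; apply: (measurableT_comp bi_incr_measurable).
  exact: measurable_funD.
have ge0_emp (f : R -> R) : (forall z, 0 <= f z) -> measurable_fun setT f ->
    (\int[empirical_measure N u]_z (f z)%:E = (N%:R^-1 * \sum_(0 <= i < N) f (u i))%:E)%E.
  move=> f0 mf; have mf' : measurable_fun setT (EFin \o f) by exact/measurable_EFinP.
  have f0' z : setT z -> (0 <= (f z)%:E)%E by rewrite lee_fin.
  rewrite /empirical_measure ge0_integral_mscale//.
  rewrite (@ge0_integral_measure_sum _ _ _ (fun i => [the measure _ R of \d_(u i)]))//.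
  rewrite EFinM; congr (_ * _)%E.
  rewrite big_mkord -sumEFin; apply: eq_bigr => i _.
  by rewrite integral_dirac// diracT mul1e.
have mp (s : R) : measurable_fun setT (fun z => Num.max (s * h (x + z)) 0).
  apply: measurable_maxr => //; apply: measurable_funM => //.
  by apply: (measurableT_comp bi_incr_measurable); exact: measurable_funD.
rewrite integralE.
have -> : (fun z => (h (x + z))%:E)^\+%E = (fun z => (Num.max (1 * h (x + z)) 0)%:E).
  by apply/funext => z; rewrite funepos.unlock mul1r EFin_max.
have -> : (fun z => (h (x + z))%:E)^\-%E = (fun z => (Num.max (- 1 * h (x + z)) 0)%:E).
  by apply/funext => z; rewrite funeneg.unlock mulN1r EFin_max.
rewrite !ge0_emp// -?EFinB; try by move=> z; rewrite le_max lexx orbT.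
congr (_%:E); rewrite -mulrBr -sumrB; congr (_ * _); apply: eq_bigr => i _.
rewrite mul1r mulN1r; have [a|a] := leP (h (x + u i)) 0.
  have a' : 0 <= - h (x + u i) by rewrite oppr_ge0.
  by rewrite (max_l a') sub0r opprK.
have a' : - h (x + u i) <= 0 by rewrite oppr_le0 ltW.
by rewrite (max_r a') subr0.
Qed.

Lemma bi_incr_mean N (u : nat -> R) : (0 < N)%N ->
  bi_incr m M (fun x => N%:R^-1 * \sum_(0 <= i < N) h (x + u i)).
Proof.
move=> N0 x y xy; rewrite -mulrBr -sumrB.
have NN : (0 : R) < N%:R by rewrite ltr0n.
rewrite [N%:R^-1 * _]mulrC ler_pdivlMr// ler_pdivrMr//.
have hi i : m * (y - x) <= h (y + u i) - h (x + u i) <= M * (y - x).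
  have /h_incr : x + u i <= y + u i by rewrite lerD2r.
  by rewrite opprD addrACA subrr addr0.
have e (c : R) : c * N%:R = \sum_(0 <= i < N) c by rewrite sumr_const_nat subn0 mulr_natr.
by rewrite !e; apply/andP; split; apply: ler_sum => i _; have /andP[] := hi i.
Qed.

Context d (Omega : measurableType d) (P : probability Omega R).

Definition shift_mean (U : Omega -> R) (x : R) := exact_mean P (fun w => h (x + U w)).

Lemma shift_integrable (U : Omega -> R) x a : measurable_fun setT U ->
  mean_le P (fun w => `|U w|) a -> P.-integrable setT (fun w => (h (x + U w))%:E).
Proof.
move=> mU Ua.
have M0 := bi_incr_M0 m0 h_incr.
have mhU : measurable_fun setT (fun w => h (x + U w)).
  apply: (measurableT_comp bi_incr_measurable); exact: measurable_funD.
have := mean_leD (mean_le_cst P (normr_ge0 (h x))) (mean_leZ (ltW M0) Ua).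
move=> hh; apply: (@mean_le_norm_integrable _ _ _ P (fun w => h (x + U w)) (`|h x| + M * a)) => //.
apply: (mean_le_le _ _ _ hh) => [|w|w]; first exact: measurableT_comp.
  exact: normr_ge0.
have := ler_normD (h x) (h (x + U w) - h x); rewrite addrC subrK => /le_trans; apply.
have := bi_incr_lip (x + U w) x; have -> : x + U w - x = U w by ring.
by rewrite lerD2l.
Qed.

Lemma shift_meanE (U : Omega -> R) x a : measurable_fun setT U ->
  mean_le P (fun w => `|U w|) a ->
  ((shift_mean U x)%:E = \int[P]_w (h (x + U w))%:E)%E.
Proof.
move=> mU Ua; rewrite /shift_mean /exact_mean fineK//.
exact: (integrable_fin_num _ (shift_integrable x mU Ua)).
Qed.

Lemma shift_meanB_le (U V : Omega -> R) x y a a' e : measurable_fun setT U ->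
  measurable_fun setT V ->
  mean_le P (fun w => `|U w|) a -> mean_le P (fun w => `|V w|) a' ->
  mean_le P (fun w => `|(x + U w) - (y + V w)|) e ->
  `|shift_mean U x - shift_mean V y| <= M * e.
Proof.
move=> mU mV Ua Va UV.
have M0 := bi_incr_M0 m0 h_incr.
have iU := shift_integrable x mU Ua; have iV := shift_integrable y mV Va.
rewrite -lee_fin -abse_EFin EFinB (shift_meanE x mU Ua) (shift_meanE y mV Va).
rewrite -integralB//.
apply: le_trans (le_abse_integral _ _ _) _ => //; first by apply: emeasurable_funB; apply: measurable_int; [exact: iU|exact: iV].
have [_ _ hh] := mean_leZ (ltW M0) UV.
apply: le_trans hh; apply: ge0_le_integral_any => // w _.
- by rewrite lee_fin mulr_ge0// ltW.
- by rewrite -EFinB abse_EFin lee_fin bi_incr_lip.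
Qed.

Lemma shift_mean_bi_incr (U : Omega -> R) a : measurable_fun setT U ->
  mean_le P (fun w => `|U w|) a -> bi_incr m M (shift_mean U).
Proof.
move=> mU Ua x y xy.
have iU z := shift_integrable z mU Ua.
have -> : shift_mean U y - shift_mean U x =
    fine (\int[P]_w ((h (y + U w))%:E - (h (x + U w))%:E))%E.
  rewrite integralB// -(shift_meanE x mU Ua) -(shift_meanE y mU Ua)//.
have iB := integrableB measurableT (iU y) (iU x).
have hw w : m * (y - x) <= h (y + U w) - h (x + U w) <= M * (y - x).
  have /h_incr : x + U w <= y + U w by rewrite lerD2r.
  by rewrite opprD addrACA subrr addr0.
have ic (c : R) : P.-integrable setT (cst c%:E) by exact: finite_measure_integrable_cst.
have cE (c : R) : (c%:E = \int[P]_w (cst c%:E) w)%E.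
  by rewrite integral_cst// [X in (_ * X)%E](_ : _ = 1%E) ?mule1//; exact: probability_setT.
apply/andP; split.
  rewrite -lee_fin fineK; last exact: integrable_fin_num iB.
  rewrite cE; apply: le_integral => // w _; rewrite lee_fin; by case/andP: (hw w).
rewrite -lee_fin fineK; last exact: integrable_fin_num iB.
rewrite [leRHS]cE; apply: le_integral => // w _; rewrite lee_fin; by case/andP: (hw w).
Qed.

Lemma G0_pushforward (U : Omega -> R) a : measurable_fun setT U ->
  mean_le P (fun w => `|U w|) a -> G0 h (pushforward P U) = root_inf (shift_mean U).
Proof.
move=> mU Ua; apply: G0_root_inf => x.
rewrite (shift_meanE x mU Ua) integral_pushforward//=.
- apply/measurable_EFinP; apply: (measurableT_comp bi_incr_measurable).
  exact: measurable_funD.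
- exact: shift_integrable Ua.
Qed.

End laws.

(* If K t exceeded sup g, then psi would be bounded below by a positive constant
   on the interval where K covers the upper half of the gap, yet K charges that
   interval. *)
Lemma flat_K_sup (R : realType) (K : cumulative R R) (g : R -> R) (psi : R -> \bar R) (m t : R) :
  0 < m -> 0 <= t -> {within `[0, +oo[, continuous K} -> K 0 = 0 ->
  (forall s, 0 <= s <= t -> 0 <= g s <= K s) ->
  (forall s, 0 <= s <= t -> (0 <= psi s)%E) ->
  (forall s, 0 <= s <= t -> ((m * (K s - g s))%:E <= psi s)%E) ->
  (\int[lebesgue_stieltjes_measure K]_(s in `]0%R, t]) psi s = 0)%E ->
  K t = sup [set g s | s in `[0, t]].
Proof.
move=> m0 t0 Kc K0 gK psi0 psig intpsi.
have Kmono : {homo K : x y / x <= y} by exact: cumulative_is_nondecreasing.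
have Sne : [set g s | s in `[0, t]] !=set0.
  by exists (g 0), 0 => //=; rewrite in_itv/= lexx t0.
have Sub : ubound [set g s | s in `[0, t]] (K t).
  move=> _ [s /= sT <-]; have st : 0 <= s <= t by move: sT; rewrite in_itv.
  by have /andP[_ st'] := st; have /andP[_ /le_trans] := gK s st; apply; exact: Kmono.
set S := sup _.
have SK : S <= K t by exact: ge_sup.
have gS s : 0 <= s <= t -> g s <= S.
  by move=> st; apply: ub_le_sup; [exists (K t)|exists s => //=; rewrite in_itv].
apply/eqP; rewrite eq_le SK andbT leNgt; apply/negP => SKt.
pose c := (K t - S) / 2.
have c0 : 0 < c by rewrite divr_gt0// subr_gt0.
have S0 : 0 <= S.
  by apply: le_trans (gS 0 _); rewrite ?lexx//; have /andP[] := gK 0 (introT andP (conj (lexx _) t0)).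
have Kct : {within `[0, t], continuous K}.
  by apply: continuous_subspaceW Kc => x /=; rewrite !in_itv/= => /andP[->].
have lev : Num.min (K 0) (K t) <= S + c <= Num.max (K 0) (K t).
  have K0t : K 0 <= K t by exact: Kmono.
  rewrite (min_l K0t) (max_r K0t) K0; move: S0 SKt c0; rewrite /c.
  by move=> ? ? ?; apply/andP; split; lra.
have [s1] := IVT t0 Kct lev.
rewrite in_itv/= => /andP[s10 s1t] Ks1.
have : ((\int[lebesgue_stieltjes_measure K]_(s in `]s1, t]) (m * c)%:E) <= 0)%E.
  rewrite -intpsi; apply: ge0_le_integral_any => [x _|x /=|x /=|x /=].
  - by rewrite lee_fin mulr_ge0// ltW.
  - by rewrite in_itv/= => /andP[x0 xt]; apply: psi0; rewrite xt ltW.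
  - by rewrite !in_itv/= => /andP[x0 ->]; rewrite (le_lt_trans s10).
  - rewrite in_itv/= => /andP[s1x xt].
    have xT : 0 <= x <= t by rewrite xt (le_trans s10)// ltW.
    apply: le_trans (psig x xT); rewrite lee_fin (ler_wpM2l (ltW m0))//.
    have hK : K s1 <= K x by apply: Kmono; exact: ltW.
    by have := gS x xT; move: hK; rewrite Ks1; lra.
rewrite integral_cst; last exact: measurable_itv.
have KE : lebesgue_stieltjes_measure K `]s1, t]%classic = (K t - K s1)%:E.
  rewrite /lebesgue_stieltjes_measure /measure_extension/= measurable_mu_extE/=; last exact: is_ocitv.
  by rewrite wlength_itv_bnd.
rewrite [X in (_ * X)%E](_ : _ = (K t - K s1)%:E); last exact: KE.
have cK : c = K t - (S + c) by rewrite /c; field.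
have pos : 0 < m * c * (K t - (S + c)) by rewrite -cK; apply: mulr_gt0 => //; apply: mulr_gt0.
by rewrite -EFinM lee_fin Ks1 leNgt pos.
Qed.

(** * Low moments from higher ones *)

Section moment_roots.
Context d (Omega : measurableType d) (R : realType) (P : probability Omega R).
Variables (f : Omega -> R) (lam : R).
Hypotheses (mf : measurable_fun setT f) (lam0 : 0 < lam).

Let amgm (x : R) : 0 <= x -> x <= lam + lam^-1 * x ^+ 2.
Proof.
move=> x0; have -> : lam + lam^-1 * x ^+ 2 = lam^-1 * (lam ^+ 2 + x ^+ 2).
  by rewrite mulrDr expr2 mulKf ?gt_eqF.
by rewrite mulrC ler_pdivlMr//; nra.
Qed.

(** Young's inequality with weight [lam] stands in for Jensen's, at the cost of a factor 2. *)
Lemma mean_le_abs_sqr : mean_le P (fun w => f w ^+ 2) (lam ^+ 2) ->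
  mean_le P (fun w => `|f w|) (2 * lam).
Proof.
move=> h; have l0 := ltW lam0.
have li0 : 0 <= lam^-1 by rewrite invr_ge0.
have := mean_leD (mean_le_cst P l0) (mean_leZ li0 h).
rewrite [X in mean_le _ _ X](_ : _ = 2 * lam); last by rewrite expr2 mulKf ?gt_eqF// mulr_natl mulr2n.
apply: mean_le_le => [|w|w]; [exact: measurableT_comp|exact: normr_ge0|].
by rewrite -[f w ^+ 2]real_normK ?num_real// amgm.
Qed.

Lemma mean_le_sqr_pow4 : mean_le P (fun w => f w ^+ 4) (lam ^+ 4) ->
  mean_le P (fun w => f w ^+ 2) (2 * lam ^+ 2).
Proof.
move=> h; have l2 : 0 < lam ^+ 2 by rewrite exprn_gt0.
have li0 : 0 <= (lam ^+ 2)^-1 by rewrite invr_ge0 ltW.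
have := mean_leD (mean_le_cst P (ltW l2)) (mean_leZ li0 h).
rewrite [X in mean_le _ _ X](_ : _ = 2 * lam ^+ 2); last first.
  by rewrite (exprM lam 2 2) expr2 mulKf ?gt_eqF// mulr_natl mulr2n.
apply: mean_le_le => [|w|w]; [exact: measurable_funX|exact: sqr_ge0|].
have -> : lam ^+ 2 + (lam ^+ 2)^-1 * f w ^+ 4 = (lam ^+ 2)^-1 * ((lam ^+ 2) ^+ 2 + (f w ^+ 2) ^+ 2).
  by rewrite mulrDr [in RHS]expr2 mulKf ?gt_eqF// -exprM.
rewrite mulrC ler_pdivlMr//; have := sqr_ge0 (f w); set x := f w ^+ 2; nra.
Qed.

Lemma mean_le_abs_pow4 : mean_le P (fun w => f w ^+ 4) (lam ^+ 4) ->
  mean_le P (fun w => `|f w|) (2 * lam).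
Proof.
move=> /mean_le_sqr_pow4 h.
have l0 := ltW lam0; have li0 : 0 <= (2 * lam)^-1 by rewrite invr_ge0 mulr_ge0.
have := mean_leD (mean_le_cst P l0) (mean_leZ li0 h).
rewrite [X in mean_le _ _ X](_ : _ = 2 * lam); last by field; rewrite gt_eqF.
apply: mean_le_le => [|w|w]; [exact: measurableT_comp|exact: normr_ge0|].
have -> : lam + (2 * lam)^-1 * f w ^+ 2 = (2 * lam)^-1 * (2 * lam ^+ 2 + f w ^+ 2).
  by field; rewrite gt_eqF.
rewrite mulrC ler_pdivlMr ?mulr_gt0// -[f w ^+ 2]real_normK ?num_real//.
have := sqr_ge0 (lam - `|f w|); have := sqr_ge0 lam; nra.
Qed.

End moment_roots.

(** The added 1 keeps the root positive when the moment vanishes, as a weight in Young's inequality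
    must be. *)
Lemma ge_pow4_root (R : realType) (Q : R) : 0 <= Q ->
  exists2 lam : R, 0 < lam & lam ^+ 4 = Q + 1.
Proof.
move=> Q0; have Q1 : 0 < Q + 1 by rewrite ltr_wpDl.
exists (Num.sqrt (Num.sqrt (Q + 1))); first by rewrite !sqrtr_gt0.
by rewrite (exprM _ 2 2) sqr_sqrtr ?sqrtr_ge0// sqr_sqrtr// ltW.
Qed.

Lemma sup_le_sup_mono (R : realType) (g : R -> R) (s t c : R) : 0 <= s -> s <= t ->
  (forall r, 0 <= r <= t -> 0 <= g r) ->
  has_ubound [set g r | r in `[0, s]] ->
  (forall r, s <= r <= t -> g r <= g s + c) -> 0 <= c ->
  sup [set g r | r in `[0, t]] <= sup [set g r | r in `[0, s]] + c.
Proof.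
move=> s0 st g0 ub gc c0; apply: ge_sup.
  by exists (g 0), 0 => //=; rewrite in_itv/= lexx (le_trans s0).
move=> _ [r /= rt <-]; move: rt; rewrite in_itv/= => /andP[r0 rt].
have [rs|sr] := leP r s.
  by rewrite ler_wpDr// ub_le_sup//; exists r => //=; rewrite in_itv/= r0.
apply: le_trans (gc r _) _; first by rewrite (ltW sr).
by rewrite lerD2r ub_le_sup//; exists s => //=; rewrite in_itv/= s0 lexx.
Qed.

(** * Moments and Hoelder bounds when K is bounded *)

Section flat_estimates.
Context d (Omega : measurableType d) (R : realType) (P : probability Omega R).
Context (Pc : measure_is_complete P).
Context (b sigma h : R -> R) (beta T m M y4 : R).
Context (beta0 : 0 <= beta) (T0 : 0 < T) (m0 : 0 < m).
Hypothesis b_lip : forall x y, `|b x - b y| <= beta * `|x - y|.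
Hypothesis s_lip : forall x y, `|sigma x - sigma y| <= beta * `|x - y|.
Hypothesis b_grow : forall x, `|b x| <= beta * (1 + `|x|).
Hypothesis s_grow : forall x, `|sigma x| <= beta * (1 + `|x|).
Hypothesis h_incr : bi_incr m M h.

(* Constants of the moment bounds: [root_inf (shift_mean h P U) ^+ 4] is at most
   [K_c0 + K_c1 * E U^4]. *)
Definition K_c0 := (8 * `|h 0| ^+ 4 + 128 * M ^+ 4) / m ^+ 4.
Definition K_c1 := 128 * M ^+ 4 / m ^+ 4.
Definition K_bound4 := K_c0 + K_c1 * moment4_const beta T y4 K_c0 K_c1.
(** [1 + K_bound4] bounds K itself, since K is at most K^4 once it exceeds 1; it then plays the part
    of [k0] in [exo_moment]. *)
Definition U_bound4 := moment4_const beta T y4 ((1 + K_bound4) ^+ 4) 0.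
Definition U_incr4 := incr4_const beta T U_bound4 ((1 + K_bound4) ^+ 4) + 1.
(** The square of the Hoelder bound [2 * (M / m) * lam_incr s t] for K, divided by t - s. *)
Definition K_incr2 := 4 * (M / m) ^+ 2 * Num.sqrt U_incr4.
Definition X_incr2 := 4 * Num.sqrt U_incr4 + 2 * K_incr2.

Let M0 : 0 < M := bi_incr_M0 m0 h_incr.

Let K_c00 : 0 <= K_c0.
Proof. by rewrite divr_ge0 ?exprn_ge0 ?(ltW m0)// addr_ge0// mulr_ge0// exprn_ge0// ltW. Qed.

Let K_c10 : 0 <= K_c1.
Proof. by rewrite divr_ge0 ?exprn_ge0 ?(ltW m0)// mulr_ge0// exprn_ge0// ltW. Qed.

Lemma K_bound4_ge0 : 0 <= y4 -> 0 <= K_bound4.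
Proof. by move=> y0; rewrite addr_ge0// mulr_ge0// moment4_const_ge0. Qed.

Lemma U_bound4_ge0 : 0 <= y4 -> 0 <= U_bound4.
Proof. by move=> y0; apply: moment4_const_ge0 => //; rewrite exprn_ge0// addr_ge0// K_bound4_ge0. Qed.

Lemma incr4_const_ge0 m4 k4 : 0 <= m4 -> 0 <= k4 -> 0 <= incr4_const beta T m4 k4.
Proof.
move=> m40 k40; rewrite /incr4_const; have := msum4_const_ge0 R => C0.
apply: mulr_ge0; first by rewrite mulr_ge0// addr_ge0// sqr_ge0.
by rewrite mulr_ge0 ?addr_ge0// mulr_ge0// exprn_ge0.
Qed.

Lemma U_incr4_gt0 : 0 <= y4 -> 0 < U_incr4.
Proof.
move=> y0; apply: ltr_wpDl => //; apply: incr4_const_ge0; first exact: U_bound4_ge0.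
by rewrite exprn_ge0// addr_ge0// K_bound4_ge0.
Qed.

Lemma K_incr2_ge0 : 0 <= K_incr2.
Proof. by rewrite mulr_ge0 ?sqrtr_ge0// mulr_ge0// sqr_ge0. Qed.

Lemma X_incr2_ge0 : 0 <= X_incr2.
Proof. by apply: addr_ge0; apply: mulr_ge0 => //; exact: K_incr2_ge0. Qed.

(** The root is at most |E h(U)| / m, and |E h(U)| <= |h 0| + M E|U| with E|U| <= 2 lam and lam^4 =
    Q + 1; the fourth power then gives 8 * 2^4 = 128. *)
Lemma K_of_U4 (U : Omega -> R) Q : measurable_fun setT U ->
  mean_le P (fun w => U w ^+ 4) Q ->
  root_inf (shift_mean h P U) ^+ 4 <= K_c0 + K_c1 * Q.
Proof.
move=> mU UQ; have Q0 := mean_le_ge0 UQ.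
have [lam lam0 lamE] := ge_pow4_root Q0.
have Ua : mean_le P (fun w => `|U w|) (2 * lam).
  apply: mean_le_abs_pow4 => //; apply: mean_le_trans UQ; by rewrite lamE lerDl.
have bi := shift_mean_bi_incr m0 h_incr mU Ua.
have g0 := root_inf_ge0 m0 bi; have gb := root_inf_bound m0 bi.
have s0 : `|shift_mean h P U 0| <= `|h 0| + M * (2 * lam).
  have mz : mean_le P (fun w : Omega => `|cst (0 : R) w|) 0.
    have -> : (fun w : Omega => `|cst (0 : R) w|) = cst 0 by apply/funext => w; rewrite normr0.
    exact: mean_le_cst.
  have h1 : `|shift_mean h P U 0 - shift_mean h P (cst 0) 0| <= M * (2 * lam).
    apply: (shift_meanB_le m0 h_incr mU (measurable_cst _) Ua mz).
    have -> : (fun w => `|0 + U w - (0 + cst 0 w)|) = (fun w => `|U w|) => //.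
    by apply/funext => w; rewrite /= addr0 subr0 add0r.
  have h2 : shift_mean h P (cst 0 : Omega -> R) 0 = h 0.
    rewrite /shift_mean /exact_mean; under eq_integral do rewrite /= addr0.
    by rewrite integral_cst// [X in (_ * X)%E](_ : _ = 1%E) ?mule1//; exact: probability_setT.
  rewrite h2 in h1; have := ler_normD (h 0) (shift_mean h P U 0 - h 0).
  by rewrite addrC subrK => /le_trans; apply; rewrite lerD2l.
have g4 : root_inf (shift_mean h P U) ^+ 4 <= ((`|h 0| + M * (2 * lam)) / m) ^+ 4.
  apply: lerXn2r; rewrite ?nnegrE//.
    by rewrite divr_ge0 ?(ltW m0)// addr_ge0// !mulr_ge0// ltW.
  by apply: le_trans gb _; rewrite ler_pM2r// invr_gt0.
apply: (le_trans g4); rewrite expr_div_n.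
have -> : K_c0 + K_c1 * Q = (8 * `|h 0| ^+ 4 + 128 * M ^+ 4 * (Q + 1)) / m ^+ 4.
  by rewrite /K_c0 /K_c1; ring.
apply: ler_wpM2r; first by rewrite invr_ge0 exprn_ge0// ltW.
have := pow4D_le `|h 0| (M * (2 * lam)) => /le_trans; apply.
have -> : (M * (2 * lam)) ^+ 4 = 16 * M ^+ 4 * lam ^+ 4 by ring.
by rewrite lamE; lra.
Qed.

Context (F : R -> set (set Omega)) (W : R -> Omega -> R) (FW : fbm P F W).

Section exogenous.
Context (Y : Omega -> R) (X : R -> Omega -> R) (K : R -> R).
Hypothesis XS : exo_sde P F W b sigma T Y X K.
Hypothesis Y4 : mean_le P (fun w => Y w ^+ 4) y4.
Hypothesis K4 : forall r, 0 <= r <= T -> 0 <= K r <= 1 + K_bound4.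

Let y40 : 0 <= y4 := mean_le_ge0 Y4.

Lemma exo_U4 t : 0 <= t <= T -> mean_le P (fun w => (X t w - K t) ^+ 4) U_bound4.
Proof. exact: (exo_moment FW beta0 T0 b_lip s_lip b_grow s_grow XS Y4 K4). Qed.

Lemma exo_X_measurable t : 0 <= t <= T -> measurable_fun setT (X t).
Proof. by move=> tT; apply: (adapted_measurable FW _ (exo_adapted XS tT)); case/andP: tT. Qed.

Lemma exo_U_measurable t : 0 <= t <= T -> measurable_fun setT (fun w => X t w - K t).
Proof. by move=> tT; apply: measurable_funB => //; exact: exo_X_measurable. Qed.

Lemma exo_U_incr4 s t : 0 <= s -> s < t -> t <= T ->
  mean_le P (fun w => ((X t w - K t) - (X s w - K s)) ^+ 4) (U_incr4 * (t - s) ^+ 2).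
Proof.
move=> s0 st tT; have hU := exo_incr_moment FW beta0 T0 b_lip s_lip b_grow s_grow XS exo_U4
  (k4 := (1 + K_bound4) ^+ 4) _ s0 st tT.
apply: mean_le_trans (hU _).
  by apply: ler_wpM2r; rewrite ?sqr_ge0// lerDl.
move=> r rT; have /andP[K0 KK] := K4 rT.
by apply: lerXn2r => //; rewrite nnegrE// (le_trans K0).
Qed.

(** The weight with which increments of U enter Young's inequality: its fourth power bounds their
    fourth moment, so it is a modulus of Hoelder order 1/2. *)
Definition lam_incr (s t : R) := Num.sqrt (Num.sqrt U_incr4 * (t - s)).

Lemma lam_incr_gt0 s t : s < t -> 0 < lam_incr s t.
Proof. by move=> st; rewrite sqrtr_gt0 mulr_gt0 ?sqrtr_gt0 ?U_incr4_gt0// subr_gt0. Qed.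

Lemma lam_incr2 s t : s < t -> lam_incr s t ^+ 2 = Num.sqrt U_incr4 * (t - s).
Proof. by move=> st; rewrite sqr_sqrtr// mulr_ge0 ?sqrtr_ge0// subr_ge0 ltW. Qed.

Lemma lam_incr4 s t : s < t -> lam_incr s t ^+ 4 = U_incr4 * (t - s) ^+ 2.
Proof.
by move=> st; rewrite (exprM _ 2 2) lam_incr2// exprMn sqr_sqrtr// ltW// U_incr4_gt0.
Qed.

Lemma exo_U_incr1 s t : 0 <= s -> s < t -> t <= T ->
  mean_le P (fun w => `|(X t w - K t) - (X s w - K s)|) (2 * lam_incr s t).
Proof.
move=> s0 st tT; apply: mean_le_abs_pow4.
- apply: measurable_funB; apply: exo_U_measurable.
    by rewrite tT (le_trans s0)// ltW.
  by rewrite s0 (le_trans (ltW st)).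
- exact: lam_incr_gt0.
- by rewrite lam_incr4//; exact: exo_U_incr4.
Qed.

Lemma exo_X_incr2 s t : 0 <= s -> s < t -> t <= T ->
  (K t - K s) ^+ 2 <= K_incr2 * (t - s) ->
  mean_le P (fun w => (X t w - X s w) ^+ 2) (X_incr2 * (t - s)).
Proof.
move=> s0 st tT KK.
have tT' : 0 <= t <= T by rewrite tT (le_trans s0)// ltW.
have sT' : 0 <= s <= T by rewrite s0 (le_trans (ltW st)).
have hU : mean_le P (fun w => ((X t w - K t) - (X s w - K s)) ^+ 2) (2 * lam_incr s t ^+ 2).
  apply: mean_le_sqr_pow4; [|exact: lam_incr_gt0|by rewrite lam_incr4//; exact: exo_U_incr4].
  by apply: measurable_funB; exact: exo_U_measurable.
have := mean_leD (mean_leZ (ler0n R 2) hU) (mean_leZ (ler0n R 2) (mean_le_cst P (sqr_ge0 (K t - K s)))).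
move=> hh; apply: (mean_le_trans _ (mean_le_le _ _ _ hh)).
- rewrite lam_incr2// /X_incr2.
  apply: (@le_trans _ _ (4 * Num.sqrt U_incr4 * (t - s) + 2 * (K_incr2 * (t - s)))).
    have -> : 4 * Num.sqrt U_incr4 * (t - s) = 2 * (2 * (Num.sqrt U_incr4 * (t - s))) by ring.
    by rewrite lerD2l ler_wpM2l.
  by rewrite [leRHS]mulrDl -[2 * K_incr2 * _]mulrA.
- by apply: measurable_funX; apply: measurable_funB; exact: exo_X_measurable.
- by move=> w; exact: sqr_ge0.
- move=> w /=; set u := X t w - K t - _; set v := K t - K s.
  have -> : X t w - X s w = u + v by rewrite /u /v; ring.
  by have := sqr_ge0 (u - v); nra.
Qed.

Lemma exo_U_abs t : 0 <= t <= T -> exists a, mean_le P (fun w => `|X t w - K t|) a.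
Proof.
move=> tT; have [lam lam0 lamE] := ge_pow4_root (U_bound4_ge0 y40).
exists (2 * lam); apply: mean_le_abs_pow4 => //; first exact: exo_U_measurable.
by rewrite lamE; apply: mean_le_trans (exo_U4 tT); rewrite lerDl.
Qed.

(** Written with X - K, which is measurable, in place of [U], which agrees with it almost
    everywhere; [flat_G0] identifies the two. *)
Definition gfun t := root_inf (shift_mean h P (fun w => X t w - K t)).

Lemma gfun_incr s t : 0 <= s <= T -> 0 <= t <= T -> s < t ->
  `|gfun t - gfun s| <= 2 * (M / m) * lam_incr s t.
Proof.
move=> sT tT st.
have [a ha] := exo_U_abs tT; have [a' ha'] := exo_U_abs sT.
have mt := exo_U_measurable tT; have ms := exo_U_measurable sT.
have := root_inf_lip m0 (shift_mean_bi_incr m0 h_incr mt ha) (shift_mean_bi_incr m0 h_incr ms ha').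
move=> /le_trans; apply; rewrite ler_pdivrMr//.
have -> : 2 * (M / m) * lam_incr s t * m = M * (2 * lam_incr s t).
  by field; rewrite gt_eqF.
apply: (shift_meanB_le m0 h_incr mt ms ha ha').
have -> : (fun w => `|gfun t + (X t w - K t) - (gfun t + (X s w - K s))|) =
    (fun w => `|(X t w - K t) - (X s w - K s)|).
  by apply/funext => w; congr (`|_|); ring.
apply: exo_U_incr1 => //; first by case/andP: sT.
by case/andP: tT.
Qed.

Lemma gfun_ge0 t : 0 <= t <= T -> 0 <= gfun t.
Proof.
move=> tT; have [a ha] := exo_U_abs tT.
exact: (root_inf_ge0 m0 (shift_mean_bi_incr m0 h_incr (exo_U_measurable tT) ha)).
Qed.

End exogenous.

Lemma sup_gfun_incr Y X K : exo_sde P F W b sigma T Y X K ->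
  mean_le P (fun w => Y w ^+ 4) y4 ->
  (forall r, 0 <= r <= T -> 0 <= K r <= 1 + K_bound4) ->
  forall s t, 0 <= s -> s < t -> t <= T ->
  has_ubound [set gfun X K r | r in `[0, s]] ->
  sup [set gfun X K r | r in `[0, t]] <=
    sup [set gfun X K r | r in `[0, s]] + 2 * (M / m) * lam_incr s t.
Proof.
move=> XS Y4 K4 s t s0 st tT ub; have y40 := mean_le_ge0 Y4.
have Mm : 0 <= 2 * (M / m) by rewrite mulr_ge0// divr_ge0// ltW.
apply: sup_le_sup_mono => //; first exact: ltW.
- move=> r /andP[r0 rt]; apply: (gfun_ge0 XS) => //; by rewrite r0 (le_trans rt).
- move=> r /andP[sr rt]; move: sr; rewrite le_eqVlt => /predU1P[<-|sr].
    by rewrite lerDl mulr_ge0// sqrtr_ge0.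
  have rT : r <= T by exact: le_trans tT.
  have hr : 0 <= r <= T by rewrite rT (le_trans s0)// ltW.
  have hs : 0 <= s <= T by rewrite s0 (le_trans (ltW sr)).
  have := gfun_incr XS Y4 K4 hs hr sr; rewrite ler_norml => /andP[_].
  rewrite lerBlDl => /le_trans; apply; rewrite lerD2l ler_wpM2l// ler_wsqrtr//.
  by rewrite ler_wpM2l ?sqrtr_ge0// lerB.
- by rewrite mulr_ge0// sqrtr_ge0.
Qed.

End flat_estimates.

(** * A priori bounds for the flat solution *)

Section flat_solution.
Context d (Omega : measurableType d) (R : realType) (P : probability Omega R).
Context (Pc : measure_is_complete P).
Context (b sigma h : R -> R) (beta T m M y4 : R).
Context (beta0 : 0 <= beta) (T0 : 0 < T) (m0 : 0 < m).
Hypothesis b_lip : forall x y, `|b x - b y| <= beta * `|x - y|.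
Hypothesis s_lip : forall x y, `|sigma x - sigma y| <= beta * `|x - y|.
Hypothesis b_grow : forall x, `|b x| <= beta * (1 + `|x|).
Hypothesis s_grow : forall x, `|sigma x| <= beta * (1 + `|x|).
Hypothesis h_incr : bi_incr m M h.
Context (Y : Omega -> R) (W X U : R -> Omega -> R) (K : cumulative R R).
Context (FW : fbm P (aug_filtration1 P Y W) W).
Hypothesis Y4 : mean_le P (fun w => Y w ^+ 4) y4.
Hypothesis FS : flat_solution P b sigma h Y W X U K.

Let M0 : 0 < M := bi_incr_M0 m0 h_incr.
Let y40 : 0 <= y4 := mean_le_ge0 Y4.
Let Kb := K_bound4 h beta T m M y4.
Let c0 := K_c0 h m M.
Let c1 := K_c1 m M.
Let U' t w := X t w - K t.
Let g := gfun P h X K.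

Lemma flat_exo : exo_sde P (aug_filtration1 P Y W) W b sigma T Y X K.
Proof.
apply: (driven_exo Pc FW b_lip s_lip T0 (flat_U FS T0)).
- exact: (flat_adapted FS).
- exact: (flat_continuous FS).
- exact: (flat_eq FS).
Qed.

Let Kmono : {homo K : x y / x <= y}.
Proof. exact: cumulative_is_nondecreasing. Qed.

Let K_ge0 t : 0 <= t -> 0 <= K t.
Proof. by move=> t0; rewrite -(flat_K0 FS) Kmono. Qed.

Let mU' t : 0 <= t <= T -> measurable_fun setT (U' t).
Proof. exact: (exo_U_measurable FW flat_exo). Qed.

Let U'_abs t : 0 <= t <= T -> exists a, mean_le P (fun w => `|U' t w|) a.
Proof.
move=> tT; have KK r : 0 <= r <= T -> 0 <= K r <= K T.
  by move=> /andP[r0 rT]; rewrite K_ge0//= Kmono.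
have hU := exo_moment FW beta0 T0 b_lip s_lip b_grow s_grow flat_exo Y4 KK tT.
have [lam lam0 lamE] := ge_pow4_root (mean_le_ge0 hU).
exists (2 * lam); apply: mean_le_abs_pow4 => //; first exact: mU'.
by rewrite lamE; apply: mean_le_trans hU; rewrite lerDl.
Qed.

Let bi t : 0 <= t <= T -> bi_incr m M (shift_mean h P (U' t)).
Proof.
move=> tT; have [a ha] := U'_abs tT.
exact: (shift_mean_bi_incr m0 h_incr (mU' tT) ha).
Qed.

Lemma flat_U_ae t : 0 <= t -> \forall w \ae P, U' t w = U t w.
Proof. by move=> t0; apply: filterS (flat_eq FS) => w /(_ t t0); rewrite /U' => ->; rewrite addrK. Qed.

Lemma flat_U_measurable t : 0 <= t <= T -> measurable_fun setT (U t).
Proof.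
by move=> tT; apply: (ae_eq_measurable Pc (mU' tT)); apply: flat_U_ae; case/andP: tT.
Qed.

Lemma flat_G0 t : 0 <= t <= T -> G0 h (pushforward P (U t)) = g t.
Proof.
move=> tT; have t0 : 0 <= t by case/andP: tT.
have [a ha] := U'_abs tT; have mU := flat_U_measurable tT.
have Ua : mean_le P (fun w => `|U t w|) a.
  apply: (mean_le_ae _ _ _ ha) => [|w|]; [exact: measurableT_comp|exact: normr_ge0|].
  by apply: filterS (flat_U_ae t0) => w ->.
rewrite (G0_pushforward m0 h_incr mU Ua) /g /gfun; congr root_inf; apply/funext => x.
rewrite /shift_mean /exact_mean; congr fine; apply: ae_eq_integral => //.
- exact: measurable_int (shift_integrable m0 h_incr x mU Ua).
- exact: measurable_int (shift_integrable m0 h_incr x (mU' tT) ha).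
- by apply: filterS (flat_U_ae t0) => w wE _; rewrite -wE.
Qed.

Let EhX t : 0 <= t <= T -> ('E_P[h \o X t] = (shift_mean h P (U' t) (K t))%:E)%E.
Proof.
move=> tT; have [a ha] := U'_abs tT.
rewrite (shift_meanE m0 h_incr (K t) (mU' tT) ha) unlock.
by apply: eq_integral => w _; rewrite /U' addrC subrK.
Qed.

(** [flat_K_sup] is applied with psi s = E h(X_s), which is at least m (K_s - g_s) by
    [bi_incr_lower]; the constraint gives g <= K. *)
Lemma flat_K_sup_gfun t : 0 <= t <= T -> K t = sup [set g s | s in `[0, t]].
Proof.
move=> tT; have /andP[t0 tT'] := tT.
have sT s : 0 <= s <= t -> 0 <= s <= T by move=> /andP[-> st]; rewrite (le_trans st).
have pos s : 0 <= s <= T -> 0 <= shift_mean h P (U' s) (K s).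
  move=> hs; have s0 : 0 <= s by case/andP: hs.
  by have := flat_constraint FS s0; rewrite EhX// lee_fin.
apply: (flat_K_sup m0 t0 (flat_K_continuous FS) (flat_K0 FS) _ _ _ (flat_minimality FS t0)).
- move=> s /[dup] hs /sT hsT; have s0 : 0 <= s by case/andP: hs.
  rewrite (root_inf_ge0 m0 (bi hsT))/=; apply: root_inf_le; first exact: K_ge0.
  exact: pos.
- by move=> s /sT/andP[s0 _]; exact: (flat_constraint FS).
- move=> s /sT hs; rewrite EhX// lee_fin; apply: (bi_incr_lower m0 (bi hs)).
  exact: pos.
Qed.

(** On [0, T] K is at first bounded by K T, which makes the moments of U finite. Flatness then gives
    K^4 <= c0 + c1 sup E U^4, and [exo_moment_self] turns this into a bound in which K T no longer
    occurs. *)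
Lemma flat_K4 t : 0 <= t <= T -> 0 <= K t <= 1 + Kb.
Proof.
move=> tT; have t0 : 0 <= t by case/andP: tT.
rewrite K_ge0//=.
have c00 : 0 <= c0.
  by rewrite divr_ge0 ?exprn_ge0 ?(ltW m0)// addr_ge0// mulr_ge0// exprn_ge0// ltW.
have c10 : 0 <= c1 by rewrite divr_ge0 ?exprn_ge0 ?(ltW m0)// mulr_ge0// exprn_ge0// ltW.
have KK r : 0 <= r <= T -> 0 <= K r <= K T.
  by move=> /andP[r0 rT]; rewrite K_ge0//= Kmono.
have g4 s Q : 0 <= s <= T -> exact_mean P (fun w => (X s w - K s) ^+ 4) <= Q ->
    g s ^+ 4 <= c0 + c1 * Q.
  move=> hs hQ; apply: (K_of_U4 m0 h_incr (mU' hs)).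
  apply: mean_le_trans hQ _; apply: mean_le_exact.
  exact: (exo_moment FW beta0 T0 b_lip s_lip b_grow s_grow flat_exo Y4 KK hs).
(* A bound on all g s^4 passes to their supremum by taking fourth roots. *)
have sup4 r q : 0 <= r <= T -> (forall s, 0 <= s <= r -> g s ^+ 4 <= q) -> K r ^+ 4 <= q.
  move=> rT hq; have /andP[r0 rT'] := rT.
  have g0 s : 0 <= s <= r -> 0 <= g s.
    move=> /andP[s0 sr]; have hs : 0 <= s <= T by rewrite s0 (le_trans sr).
    exact: (root_inf_ge0 m0 (bi hs)).
  have q0 : 0 <= q by apply: le_trans (hq 0 _); rewrite ?exprn_even_ge0// lexx.
  have rE : Num.sqrt (Num.sqrt q) ^+ 4 = q.
    by rewrite (exprM _ 2 2) sqr_sqrtr ?sqrtr_ge0// sqr_sqrtr.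
  rewrite -rE; apply: lerXn2r; rewrite ?nnegrE ?K_ge0 ?sqrtr_ge0//.
  rewrite flat_K_sup_gfun//; apply: ge_sup.
    by exists (g 0), 0 => //=; rewrite in_itv/= lexx.
  move=> _ [s /= sr <-]; have {}sr : 0 <= s <= r by move: sr; rewrite in_itv.
  by rewrite -(@ler_pXn2r _ 4%N)// ?nnegrE ?sqrtr_ge0 ?g0// rE hq.
have kQ r Q : 0 <= r <= T ->
    (forall s, 0 <= s <= r -> exact_mean P (fun w => (X s w - K s) ^+ 4) <= Q) ->
    K r ^+ 4 <= c0 + c1 * Q.
  move=> rT hQ; apply: sup4 => // s sr; apply: g4; last exact: hQ.
  by have /andP[-> sr'] := sr; rewrite (le_trans sr')//; case/andP: rT.
have K4 : K t ^+ 4 <= Kb.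
  apply: (kQ) => // s /andP[s0 st]; apply: exact_mean_le.
  apply: (exo_moment_self FW beta0 T0 b_lip s_lip b_grow s_grow flat_exo Y4 KK c00 c10 kQ).
  by rewrite s0 (le_trans st)//; case/andP: tT.
have K0 := K_ge0 t0; have [K1|K1] := leP (K t) 1.
  by rewrite (le_trans K1)// lerDl (le_trans _ K4)// exprn_even_ge0.
have K14 : K t <= K t ^+ 4 by rewrite -[leLHS]expr1 ler_eXn2l.
by apply: (le_trans K14); apply: (le_trans K4); rewrite lerDr.
Qed.

Lemma flat_K_incr s t : 0 <= s -> s < t -> t <= T ->
  K t - K s <= 2 * (M / m) * lam_incr h beta T m M y4 s t.
Proof.
move=> s0 st tT.
have hs : 0 <= s <= T by rewrite s0 (le_trans (ltW st)).
have ht : 0 <= t <= T by rewrite tT (le_trans s0)// ltW.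
rewrite lerBlDl !flat_K_sup_gfun//.
apply: (sup_gfun_incr beta0 T0 m0 b_lip s_lip b_grow s_grow h_incr FW flat_exo Y4 flat_K4) => //.
exists (K s); move=> _ [r /= rs <-]; have {}rs : 0 <= r <= s by move: rs; rewrite in_itv.
have hr : 0 <= r <= T by have /andP[-> rs'] := rs; rewrite (le_trans rs')//; case/andP: hs.
have /andP[r0 rs'] := rs; apply: le_trans (Kmono rs').
rewrite flat_K_sup_gfun//; apply: ub_le_sup; last by exists r => //=; rewrite in_itv/= r0 lexx.
exists (1 + Kb) => _ [z /= zr <-]; have {}zr : 0 <= z <= r by move: zr; rewrite in_itv.
have hz : 0 <= z <= T by have /andP[-> zr'] := zr; rewrite (le_trans zr')//; case/andP: hr.
have /andP[_] := flat_K4 hz; apply: le_trans; apply: root_inf_le.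
  by have /andP[z0 _] := zr; exact: K_ge0.
have z0 : 0 <= z by case/andP: hz.
by have := flat_constraint FS z0; rewrite EhX// lee_fin.
Qed.

Lemma flat_K_incr2 s t : 0 <= s -> s < t -> t <= T ->
  (K t - K s) ^+ 2 <= K_incr2 h beta T m M y4 * (t - s).
Proof.
move=> s0 st tT.
have -> : K_incr2 h beta T m M y4 * (t - s) = (2 * (M / m) * lam_incr h beta T m M y4 s t) ^+ 2.
  rewrite [RHS]exprMn (lam_incr2 _ _ _ _ _ _ st) /K_incr2; ring.
apply: lerXn2r; rewrite ?nnegrE ?flat_K_incr//.
  by rewrite subr_ge0 Kmono// ltW.
by rewrite mulr_ge0 ?sqrtr_ge0// mulr_ge0// divr_ge0// ltW.
Qed.

End flat_solution.

(** * Error of the Euler scheme and equality of laws *)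

(** Shows that a_k = A ((1 + rho)^k - 1) solves a_K = rho * sum over k < K of (A + a_k) exactly;
    both error recursions below are solved in this form. *)
Lemma gronwall_sum (R : realType) (rho : R) K :
  rho * \sum_(0 <= k < K) (1 + rho) ^+ k = (1 + rho) ^+ K - 1.
Proof. by rewrite subrX1 big_mkord addrAC subrr add0r. Qed.

Lemma runmax_measurable d (Omega : measurableType d) (R : realType)
    (u : nat -> Omega -> R) K : (forall k, (k <= K)%N -> measurable_fun setT (u k)) ->
  measurable_fun setT (fun w => runmax (fun k => u k w) K).
Proof.
elim: K => [|K IH] mu; first by apply: measurableT_comp => //; exact: mu.
apply: measurable_maxr; last by apply: measurableT_comp => //; exact: mu.
by apply: IH => k kK; apply: mu; rewrite (leq_trans kK).
Qed.

Section euler_error.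
Context d (Omega : measurableType d) (R : realType) (P : probability Omega R).
Context (F : R -> set (set Omega)) (W : R -> Omega -> R) (FW : fbm P F W).
Context (b sigma : R -> R) (beta T : R) (beta0 : 0 <= beta) (T0 : 0 < T).
Hypothesis b_lip : forall x y, `|b x - b y| <= beta * `|x - y|.
Hypothesis s_lip : forall x y, `|sigma x - sigma y| <= beta * `|x - y|.
Context (Y : Omega -> R) (X : R -> Omega -> R) (kap : R -> R) (cx : R) (cx0 : 0 <= cx).
Hypothesis XS : exo_sde P F W b sigma T Y X kap.
Hypothesis X_incr : forall s t, 0 <= s -> s < t -> t <= T ->
  mean_le P (fun w => (X t w - X s w) ^+ 2) (cx * (t - s)).

Let mX r : 0 <= r <= T -> measurable_fun setT (X r).
Proof. by move=> rT; apply: (adapted_measurable FW _ (exo_adapted XS rT)); case/andP: rT. Qed.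

(** The factor 2 T + 520 is that of [ito_max2]; 2 beta^2 comes from the Lipschitz bound on X_r -
    H_r, split at the left end of the cell. *)
Definition err_const := (2 * T + 520) * (2 * beta ^+ 2).

Lemma err_const_ge0 : 0 <= err_const.
Proof.
rewrite /err_const; apply: mulr_ge0; last by apply: mulr_ge0 => //; exact: sqr_ge0.
by apply: addr_ge0; [apply: mulr_ge0 => //; exact: ltW|exact: ler0n].
Qed.

(** Common to the explicit scheme and to the particle system. [H] is the argument at which the
    coefficients of the approximation are evaluated, [e k] bounds its mean square distance to X at
    the left end of cell k, and the maximum runs over a grid [p] times finer than the cells. *)
Lemma error_max (delta : R) (K p : nat) (H : R -> Omega -> R) (A : nat -> Omega -> R)
    (e : nat -> R) : 0 < delta -> (0 < p)%N -> K%:R * delta <= T ->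
  (forall r, 0 <= r < K%:R * delta -> rv_wrt (F r) (H r)) ->
  (forall k r, (k < K)%N -> k%:R * delta <= r < k.+1%:R * delta ->
    mean_le P (fun w => (X (k%:R * delta) w - H r w) ^+ 2) (e k)) ->
  (forall k, (k <= K * p)%N -> measurable_fun setT (A k)) ->
  (forall k, (k < K * p)%N -> ito_incr P W (k%:R * (delta / p%:R)) (k.+1%:R * (delta / p%:R))
     (fun r w => b (H r w)) (fun r w => sigma (H r w)) (fun w => A k.+1 w - A k w)) ->
  let D k w := X (k%:R * (delta / p%:R)) w - kap (k%:R * (delta / p%:R)) - A k w in
  mean_le P (fun w => runmax (fun k => D k w - D 0%N w) (K * p) ^+ 2)
    (err_const * (delta * \sum_(0 <= k < K) (cx * delta + e k))).
Proof.
move=> d0 p0 KT FH eH mA iA D.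
have pR : (0 : R) < p%:R by rewrite ltr0n.
set dl := delta / p%:R in D iA *; have dl0 : 0 < dl by rewrite divr_gt0.
have deltaE : delta = p%:R * dl by rewrite /dl mulrC divfK// gt_eqF.
clearbody dl.
have KpE : (K * p)%:R * dl = K%:R * delta by rewrite natrM -mulrA -deltaE.
have rT r : 0 <= r < K%:R * delta -> 0 <= r <= T.
  by move=> /andP[-> rK]; rewrite (le_trans (ltW rK)).
have kT k : (k <= K * p)%N -> 0 <= k%:R * dl <= T.
  move=> kK; rewrite mulr_ge0 ?(ltW dl0)//= (le_trans _ KT)// -KpE.
  by rewrite ler_wpM2r ?(ltW dl0)// ler_nat.
have cont (f : R -> R) : (forall x y, `|f x - f y| <= beta * `|x - y|) -> measurable_fun setT f.
  by move=> fl; apply: continuous_measurable_fun; exact: lip_continuous fl.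
have FHX (f : R -> R) r : (forall x y, `|f x - f y| <= beta * `|x - y|) ->
    0 <= r < K%:R * delta -> rv_wrt (F r) (fun w => f (X r w) - f (H r w)).
  move=> fl hr; have sa : sigma_algebra setT (F r) by apply: (fbm_sa FW); case/andP: hr.
  apply: rv_wrtB => //; apply: rv_wrt_comp => //; try exact: cont.
    by apply: (exo_adapted XS); exact: rT.
  exact: FH.
have b20 : 0 <= beta ^+ 2 by exact: sqr_ge0.
have qf (f : R -> R) k r : (forall x y, `|f x - f y| <= beta * `|x - y|) ->
    (k < K * p)%N -> k%:R * dl <= r < k.+1%:R * dl ->
    mean_le P (fun w => (f (X r w) - f (H r w)) ^+ 2)
      (beta ^+ 2 * (2 * (cx * delta) + 2 * e (k %/ p)%N)).
  move=> fl kK /andP[kr rk].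
  set j := (k %/ p)%N.
  have jK : (j < K)%N by rewrite ltn_divLR.
  have jr : j%:R * delta <= r < j.+1%:R * delta.
    rewrite deltaE (mulrA j%:R) (mulrA j.+1%:R) -!natrM; apply/andP; split.
      by apply: le_trans kr; rewrite ler_wpM2r ?(ltW dl0)// ler_nat leq_trunc_div.
    apply: lt_le_trans rk _; rewrite ler_wpM2r ?(ltW dl0)// ler_nat.
    exact: ltn_ceil.
  have jT : 0 <= j%:R * delta <= T.
    rewrite mulr_ge0 ?(ltW d0)//= (le_trans _ KT)// ler_wpM2r ?(ltW d0)// ler_nat.
    exact: ltnW.
  have jKd : j.+1%:R * delta <= K%:R * delta by rewrite ler_wpM2r ?(ltW d0)// ler_nat.
  have hr : 0 <= r < K%:R * delta.
    by have /andP[jr1 jr2] := jr; rewrite (le_trans _ jr1) ?(lt_le_trans jr2)//; case/andP: jT.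
  have xr : mean_le P (fun w => (X r w - X (j%:R * delta) w) ^+ 2) (cx * delta).
    have /andP[jr1 jr2] := jr; move: jr1; rewrite le_eqVlt => /predU1P[->|jr1].
      have -> : (fun w => (X r w - X r w) ^+ 2) = cst 0.
        by apply/funext => w; rewrite subrr expr0n.
      by apply: mean_le_trans (mean_le_cst P (lexx 0)); rewrite mulr_ge0// ltW.
    have rT' : r <= T by have /andP[] := rT r hr.
    apply: mean_le_trans (X_incr _ jr1 rT'); last by case/andP: jT.
    rewrite ler_wpM2l// lerBlDr; move: jr2; rewrite -natr1 mulrDl mul1r addrC; exact: ltW.
  have := mean_leZ b20 (mean_leD (mean_leZ (ler0n R 2) xr) (mean_leZ (ler0n R 2) (eH j r jK jr))).
  apply: mean_le_le.
  - apply: measurable_funX; apply: (adapted_measurable FW _ (FHX f r fl hr)).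
    by case/andP: hr.
  - by move=> w; exact: sqr_ge0.
  - move=> w; apply: (@le_trans _ _ ((beta * `|X r w - H r w|) ^+ 2)).
      by rewrite -[leLHS]real_normK ?num_real// lerXn2r// ?nnegrE ?mulr_ge0.
    rewrite exprMn real_normK ?num_real// ler_wpM2l//.
    have -> : X r w - H r w = (X r w - X (j%:R * delta) w) + (X (j%:R * delta) w - H r w) by ring.
    set u := X r w - _; set v := X _ w - _; have := sqr_ge0 (u - v); nra.
have mD k : (k <= K * p)%N -> measurable_fun setT (D k).
  move=> kK; apply: measurable_funB; last exact: mA.
  by apply: measurable_funB => //; apply: mX; exact: kT.
have cell k : k%:R * dl < k.+1%:R * dl by rewrite ltr_pM2r// ltr_nat.
have iD k : (k < K * p)%N -> ito_incr P W (k%:R * dl) (k.+1%:R * dl)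
    (fun r w => b (X r w) - b (H r w)) (fun r w => sigma (X r w) - sigma (H r w))
    (fun w => D k.+1 w - D k w).
  move=> kK; have /andP[k0 _] := kT k (ltnW kK); have /andP[_ k1] := kT k.+1 kK.
  have h := ito_incrB (exo_incr XS k0 (cell k) k1) (iA k kK).
  apply: (cvgp_ae_eq h) => [n|]; first exact: aeW.
  by apply: aeW => w; rewrite /D; ring.
have cv r : 0 <= r < (K * p)%:R * dl -> 0 <= r < K%:R * delta by rewrite KpE.
have := ito_max2 FW dl0 (K := (K * p)%N)
  (q := fun k => beta ^+ 2 * (2 * (cx * delta) + 2 * e (k %/ p)%N))
  (fun r hr => FHX b r b_lip (cv r hr)) (fun r hr => FHX sigma r s_lip (cv r hr))
  (fun k r => qf b k r b_lip) (fun k r => qf sigma k r s_lip) mD iD.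
rewrite KpE; apply: mean_le_trans.
rewrite big_nat_mul.
have -> : \sum_(0 <= k < K) \sum_(0 <= j < p)
    beta ^+ 2 * (2 * (cx * delta) + 2 * e ((k * p + j) %/ p)%N) =
    p%:R * (2 * beta ^+ 2 * \sum_(0 <= k < K) (cx * delta + e k)).
  rewrite !mulr_sumr; apply: eq_bigr => k _.
  rewrite (eq_big_nat _ _ (F2 := fun=> beta ^+ 2 * (2 * (cx * delta) + 2 * e k))).
    rewrite sumr_const_nat subn0 -[LHS]mulr_natl; ring.
  by move=> j /andP[_ jp]; rewrite divnMDl// divn_small// addn0.
set S := \sum_(0 <= k < K) _.
have S0 : 0 <= S.
  rewrite /S big_nat_cond; apply: sumr_ge0 => k /andP[/andP[_ kK] _].
  rewrite addr_ge0// ?mulr_ge0 ?(ltW d0)//.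
  apply: (mean_le_ge0 (eH k (k%:R * delta) kK _)).
  by rewrite lexx/= ltr_pM2r// ltr_nat.
have -> : dl * (p%:R * (2 * beta ^+ 2 * S)) = 2 * beta ^+ 2 * (delta * S).
  by rewrite deltaE; ring.
rewrite /err_const -[leRHS]mulrA; apply: ler_wpM2r.
  by apply: mulr_ge0; apply: mulr_ge0 => //; exact: ltW.
by rewrite lerD2r; apply: ler_wpM2l.
Qed.

Section scheme.
Context (delta : R) (d0 : 0 < delta) (n : nat) (nT : n%:R * delta <= T).
Hypothesis FY : rv_wrt (F 0) Y.

(** Explicit Euler scheme for X - kap with the exact [kap]: a function of the initial value and of
    Brownian increments alone, so that its law is determined by theirs. *)
Fixpoint scheme (k : nat) (w : Omega) : R :=
  if k is j.+1 then
    scheme j w + b (scheme j w + kap (j%:R * delta)) * delta +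
    sigma (scheme j w + kap (j%:R * delta)) * (W (j.+1%:R * delta) w - W (j%:R * delta) w)
  else Y w.

Let kd0 k : 0 <= k%:R * delta. Proof. by rewrite mulr_ge0// ltW. Qed.
Let kdS k : k%:R * delta < k.+1%:R * delta. Proof. by rewrite ltr_pM2r// ltr_nat. Qed.

Let cont (f : R -> R) : (forall x y, `|f x - f y| <= beta * `|x - y|) -> measurable_fun setT f.
Proof. by move=> fl; apply: continuous_measurable_fun; exact: lip_continuous fl. Qed.

Let sa k : sigma_algebra setT (F (k%:R * delta)).
Proof. exact: (fbm_sa FW). Qed.

Lemma scheme_coef_adapted k : rv_wrt (F (k%:R * delta)) (scheme k) ->
  rv_wrt (F (k%:R * delta)) (fun w => scheme k w + kap (k%:R * delta)).
Proof. by move=> FV; apply: rv_wrtD => //; exact: rv_wrt_cst. Qed.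

Lemma scheme_adapted k : rv_wrt (F (k%:R * delta)) (scheme k).
Proof.
elim: k => [|k IH]; first by rewrite mul0r.
have FS : F (k%:R * delta) `<=` F (k.+1%:R * delta).
  by apply: (fbm_mono FW) => //; exact: ltW.
have FV := rv_wrtS FS IH; have FVk := rv_wrtS FS (scheme_coef_adapted IH).
apply: rv_wrtD => //; last first.
  apply: rv_wrtM => //; first by apply: rv_wrt_comp => //; exact: cont.
  apply: rv_wrtB => //; first exact: (fbm_adapted FW).
  by apply: (rv_wrtS FS); exact: (fbm_adapted FW).
apply: rv_wrtD => //; apply: rv_wrtM => //; last exact: rv_wrt_cst.
by apply: rv_wrt_comp => //; exact: cont.
Qed.

Lemma scheme_measurable k : measurable_fun setT (scheme k).
Proof. by apply: (adapted_measurable FW (kd0 k)); exact: scheme_adapted. Qed.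

Let H r w := let k := Num.trunc (r / delta) in scheme k w + kap (k%:R * delta).

Let HE k r : k%:R * delta <= r < k.+1%:R * delta ->
  H r = (fun w => scheme k w + kap (k%:R * delta)).
Proof.
move=> kr; rewrite /H (truncn_def (n := k))//.
by rewrite ler_pdivlMr// ltr_pdivrMr.
Qed.

Let FH r : 0 <= r -> rv_wrt (F r) (H r).
Proof.
move=> r0; set k := Num.trunc (r / delta).
have kr : k%:R * delta <= r < k.+1%:R * delta.
  by rewrite -ler_pdivlMr// -ltr_pdivrMr// truncn_itv// divr_ge0// ltW.
rewrite (HE kr); apply: (rv_wrtS (fbm_mono FW (kd0 k) (proj1 (andP kr)))).
by apply: scheme_coef_adapted; exact: scheme_adapted.
Qed.

(** With constant coefficients every Riemann sum is already the increment, so one step of the scheme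
    is an Ito increment to which [error_max] applies. *)
Lemma const_ito_incr s t (x : Omega -> R) (Hf : R -> Omega -> R) : s < t ->
  (forall r, s <= r < t -> Hf r = x) ->
  ito_incr P W s t (fun r w => b (Hf r w)) (fun r w => sigma (Hf r w))
    (fun w => b (x w) * (t - s) + sigma (x w) * (W t w - W s w)).
Proof.
move=> st Hx; apply: (cvgp_ae_eq (cvgp_cst P (fun w => b (x w) * (t - s) + sigma (x w) * (W t w - W s w)))); last exact: aeW.
move=> N; apply: aeW => w; rewrite /rs.
rewrite (eq_big_nat _ _ (F2 := fun j => b (x w) * mesh s t N +
  sigma (x w) * (W (gridpt s t N j.+1) w - W (gridpt s t N j) w))); last first.
  by move=> j /andP[_ jN]; rewrite !Hx// gridpt_ge//= gridpt_lt_end.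
rewrite big_split/= sumr_const_nat subn0 -mulr_sumr telescope_sumr// gridpt_last gridpt0.
by congr (_ + _); rewrite -[LHS]mulr_natl mulrCA /mesh [N.+1%:R * _]mulrC divfK// pnatr_eq0.
Qed.

Let U k w := X (k%:R * delta) w - kap (k%:R * delta).

(** Strong induction, because the error on cell k is bounded by the running maximum up to k; the
    closed form solves the recursion by [gronwall_sum]. *)
Lemma scheme_error K : (K <= n)%N ->
  mean_le P (fun w => runmax (fun k => U k w - scheme k w) K ^+ 2)
    (cx * delta * ((1 + err_const * delta) ^+ K - 1)).
Proof.
have ec0 : 0 <= err_const * delta.
  by apply: mulr_ge0; [exact: err_const_ge0|exact: ltW].
elim/ltn_ind: K => K IH Kn.
have KT : K%:R * delta <= T.
  by apply: le_trans nT; rewrite ler_wpM2r ?(ltW d0)// ler_nat.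
have kT k : (k <= K)%N -> 0 <= k%:R * delta <= T.
  by move=> kK; rewrite kd0/= (le_trans _ KT)// ler_wpM2r ?(ltW d0)// ler_nat.
have mU k : (k <= K)%N -> measurable_fun setT (U k).
  by move=> kK; apply: measurable_funB => //; apply: mX; exact: kT.
have eH k r : (k < K)%N -> k%:R * delta <= r < k.+1%:R * delta ->
    mean_le P (fun w => (X (k%:R * delta) w - H r w) ^+ 2)
      (cx * delta * ((1 + err_const * delta) ^+ k - 1)).
  move=> kK kr; rewrite (HE kr).
  apply: (mean_le_le _ _ _ (IH k kK (leq_trans (ltnW kK) Kn))).
  - apply: measurable_funX; apply: measurable_funB; first by apply: mX; exact: kT (ltnW kK).
    by apply: measurable_funD => //; exact: scheme_measurable.
  - by move=> w; exact: sqr_ge0.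
  - move=> w; have := runmax_ge (fun k => U k w - scheme k w) (leqnn k).
    rewrite /U => h; rewrite -[leLHS]real_normK ?num_real//.
    apply: lerXn2r; rewrite ?nnegrE ?normr_ge0 ?runmax_ge0//.
    by rewrite opprD addrA addrAC.
have iA k : (k < K * 1)%N -> ito_incr P W (k%:R * (delta / 1%:R)) (k.+1%:R * (delta / 1%:R))
     (fun r w => b (H r w)) (fun r w => sigma (H r w)) (fun w => scheme k.+1 w - scheme k w).
  move=> kK; rewrite divr1.
  apply: (cvgp_ae_eq (const_ito_incr (kdS k) (HE (k := k)))) => [N|]; first exact: aeW.
  apply: aeW => w /=; have -> : k.+1%:R * delta - k%:R * delta = delta.
    by rewrite -natr1 mulrDl mul1r addrC addKr.
  by ring.
have := error_max d0 (ltn0Sn 0) KT (fun r hr => FH (proj1 (andP hr))) eH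
  (fun k _ => scheme_measurable k) iA.
rewrite /= muln1 !divr1 mul0r => h.
apply: (mean_le_trans _ (mean_le_ae _ _ _ h)).
- rewrite (eq_bigr (fun k => cx * delta * (1 + err_const * delta) ^+ k)); last first.
    by move=> k _; rewrite mulrBr mulr1 addrC subrK.
  rewrite -mulr_sumr -gronwall_sum.
  by rewrite le_eqVlt; apply/orP; left; apply/eqP; ring.
- apply: measurable_funX; apply: runmax_measurable => k kK.
  by apply: measurable_funB; [exact: mU|exact: scheme_measurable].
- by move=> w; exact: sqr_ge0.
- apply: filterS (exo_start XS) => w h0.
  apply: lerXn2r; rewrite ?nnegrE ?runmax_ge0//.
  apply: runmax_le => k kK; apply: le_trans (runmax_ge _ kK).
  by rewrite h0 subrr subr0.
Qed.

End scheme.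

End euler_error.

Section same_law.
Context d (Omega : measurableType d) (R : realType) (P : probability Omega R).

Definition same_law (X X' : Omega -> R) :=
  forall A : set R, measurable A -> P (X @^-1` A) = P (X' @^-1` A).

Lemma same_law_pair (X Y X' Y' : Omega -> R) : measurable_fun setT X ->
  measurable_fun setT Y -> measurable_fun setT X' -> measurable_fun setT Y' ->
  indep_rv P X Y -> indep_rv P X' Y' -> same_law X X' -> same_law Y Y' ->
  forall C : set (R * R), measurable C ->
  P [set w | C (X w, Y w)] = P [set w | C (X' w, Y' w)].
Proof.
move=> mX mY mX' mY' XY XY' XX' YY' C mC.
rewrite (indep_joint_law mX mY XY mC).
have mZ : measurable_fun setT (fun w => (X' w, Y' w)) by exact: measurable_fun_pair.
pose Z : {mfun Omega >-> (R * R)%type} := mfun_Sub (mem_set mZ).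
rewrite (product_measure_unique (m' := distribution P Z))// => A B mA mB.
transitivity (P (X' @^-1` A `&` Y' @^-1` B)); first by [].
by rewrite XY'// -XX'// -YY'.
Qed.

Lemma same_law_comp2 (phi : R * R -> R) (X Y X' Y' : Omega -> R) :
  measurable_fun setT phi -> measurable_fun setT X ->
  measurable_fun setT Y -> measurable_fun setT X' -> measurable_fun setT Y' ->
  indep_rv P X Y -> indep_rv P X' Y' -> same_law X X' -> same_law Y Y' ->
  same_law (fun w => phi (X w, Y w)) (fun w => phi (X' w, Y' w)).
Proof.
move=> mphi mX mY mX' mY' XY XY' XX' YY' A mA.
apply: (same_law_pair mX mY mX' mY' XY XY' XX' YY' (C := phi @^-1` A)).
by rewrite -[X in measurable X]setTI; exact: mphi.
Qed.

Lemma same_law_shift_mean (h : R -> R) (m M : R) (X X' : Omega -> R) a a' x :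
  0 < m -> bi_incr m M h -> measurable_fun setT X -> measurable_fun setT X' ->
  mean_le P (fun w => `|X w|) a -> mean_le P (fun w => `|X' w|) a' ->
  same_law X X' -> shift_mean h P X x = shift_mean h P X' x.
Proof.
move=> m0 hh mX mX' Xa Xa' XX'.
have mhx : measurable_fun setT (fun z => (h (x + z))%:E).
  apply/measurable_EFinP; apply: (measurableT_comp (bi_incr_measurable m0 hh)).
  exact: measurable_funD.
rewrite /shift_mean /exact_mean; congr fine.
transitivity (\int[distribution P (mfun_of mX)]_z (h (x + z))%:E)%E.
  rewrite integral_pushforward//=; exact: (shift_integrable m0 hh x mX Xa).
transitivity (\int[distribution P (mfun_of mX')]_z (h (x + z))%:E)%E; last first.
  rewrite integral_pushforward//=; exact: (shift_integrable m0 hh x mX' Xa').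
by apply: eq_measure_integral => A mA _; exact: XX'.
Qed.

(** Each step applies one fixed map to the current value and to an independent increment whose law
    depends on the step size only. *)
Lemma scheme_same_law (F F' : R -> set (set Omega)) (W W' : R -> Omega -> R)
    (FW : fbm P F W) (FW' : fbm P F' W') (b sigma : R -> R) (beta : R)
    (Y Y' : Omega -> R) (kap : R -> R) (delta : R) :
  (forall x y, `|b x - b y| <= beta * `|x - y|) ->
  (forall x y, `|sigma x - sigma y| <= beta * `|x - y|) -> 0 < delta ->
  rv_wrt (F 0) Y -> rv_wrt (F' 0) Y' -> same_law Y Y' ->
  forall k, same_law (scheme W b sigma Y kap delta k) (scheme W' b sigma Y' kap delta k).
Proof.
move=> bl sl d0 FY FY' YY'; elim=> [|k IH]; first exact: YY'.
have kd0 : 0 <= k%:R * delta by rewrite mulr_ge0// ltW.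
have kdS : k%:R * delta < k.+1%:R * delta by rewrite ltr_pM2r// ltr_nat.
have cont (f : R -> R) : (forall x y, `|f x - f y| <= beta * `|x - y|) -> measurable_fun setT f.
  by move=> fl; apply: continuous_measurable_fun; exact: lip_continuous fl.
have FV : rv_wrt (F (k%:R * delta)) (scheme W b sigma Y kap delta k).
  exact: (scheme_adapted FW bl sl d0 FY).
have FV' : rv_wrt (F' (k%:R * delta)) (scheme W' b sigma Y' kap delta k).
  exact: (scheme_adapted FW' bl sl d0 FY').
pose phi (z : R * R) := z.1 + b (z.1 + kap (k%:R * delta)) * delta +
   sigma (z.1 + kap (k%:R * delta)) * z.2.
have mk : measurable_fun setT (fun z : R * R => z.1 + kap (k%:R * delta)).
  exact: measurable_funD.
have mphi : measurable_fun setT phi.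
  apply: measurable_funD; last first.
    by apply: measurable_funM => //; exact: (measurableT_comp (cont _ sl) mk).
  apply: measurable_funD => //; apply: measurable_funM => //.
  exact: (measurableT_comp (cont _ bl) mk).
apply: (same_law_comp2 (phi := phi)) => //.
- exact: (adapted_measurable FW kd0 FV).
- exact: (fbm_incr_measurable FW).
- exact: (adapted_measurable FW' kd0 FV').
- exact: (fbm_incr_measurable FW').
- exact: (fbm_indep_rv FW).
- exact: (fbm_indep_rv FW').
- by move=> A mA; rewrite (fbm_law FW)// (fbm_law FW').
Qed.

End same_law.

Lemma sqrD_weighted (R : realFieldType) (x y : R) :
  (x + y) ^+ 2 <= 5 * x ^+ 2 + 5 / 4 * y ^+ 2.
Proof. have := sqr_ge0 (2 * x - y / 2); nra. Qed.

(** Splitting twice with the conjugate weights 5 and 5/4 leaves 125/64 on y^4, below the 2 that the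
    dyadic induction can afford. *)
Lemma pow4D_weighted (R : realFieldType) (x y : R) :
  (x + y) ^+ 4 <= 125 * x ^+ 4 + 2 * y ^+ 4.
Proof.
have h : ((x + y) ^+ 2) ^+ 2 <= (5 * x ^+ 2 + 5 / 4 * y ^+ 2) ^+ 2.
  apply: lerXn2r; rewrite ?nnegrE ?sqr_ge0 ?sqrD_weighted//.
  by rewrite addr_ge0// mulr_ge0// sqr_ge0.
have h2 := sqrD_weighted (5 * x ^+ 2) (5 / 4 * y ^+ 2).
rewrite (exprM _ 2 2); apply: (le_trans h); apply: (le_trans h2).
have -> : 5 * (5 * x ^+ 2) ^+ 2 = 125 * x ^+ 4 by ring.
have -> : 5 / 4 * (5 / 4 * y ^+ 2) ^+ 2 = 125 / 64 * y ^+ 4 by field.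
rewrite lerD2l ler_wpM2r//; first exact: exprn_even_ge0.
by rewrite ler_pdivrMr//; lra.
Qed.

(** * Fluctuations of averages of independent processes *)

Section independent_sums.
Context d (Omega : measurableType d) (R : realType) (P : probability Omega R).
Context (N : nat) (xi : nat -> Omega -> R) (q : R) (q0 : 0 < q).
Let S k w := \sum_(0 <= i < k) xi i w.
Hypothesis xi_measurable : forall i, (i < N)%N -> measurable_fun setT (xi i).
Hypothesis xi_mean0 : forall i, (i < N)%N -> mean0 P (xi i).
Hypothesis xi4 : forall i, (i < N)%N -> mean_le P (fun w => xi i w ^+ 4) (q ^+ 2).
Hypothesis xi_indep : forall i, (i < N)%N -> indep_rv P (S i) (xi i).

Let xi2 i : (i < N)%N -> mean_le P (fun w => xi i w ^+ 2) (2 * q).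
Proof.
move=> iN; have qs : q = Num.sqrt q ^+ 2 by rewrite sqr_sqrtr// ltW.
rewrite qs; apply: mean_le_sqr_pow4; [exact: xi_measurable|by rewrite sqrtr_gt0|].
by rewrite (exprM _ 2 2) -qs; exact: xi4.
Qed.

Let mS k : (k <= N)%N -> measurable_fun setT (S k).
Proof. by move=> kN; apply: measurable_sum_nat => i ik; apply: xi_measurable; exact: leq_trans kN. Qed.

Let abs_le (f : Omega -> R) a : measurable_fun setT f -> mean_le P (fun w => f w ^+ 2) a ->
  mean_le P (fun w => `|f w|) (1 + a).
Proof.
move=> mf fa; apply: (mean_le_le _ _ _ (mean_leD (mean_le_cst P ler01) fa)) => [|w|w].
- exact: measurableT_comp.
- exact: normr_ge0.
- by rewrite -[f w ^+ 2]real_normK ?num_real//=; have := normr_ge0 (f w); nra.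
Qed.

Let abs3_le (f : Omega -> R) a : measurable_fun setT f -> mean_le P (fun w => f w ^+ 4) a ->
  mean_le P (fun w => `|f w ^+ 3|) (a + 1).
Proof.
move=> mf fa; apply: (mean_le_le _ _ _ (mean_leD fa (mean_le_cst P ler01))) => [|w|w].
- by apply: measurableT_comp => //; exact: measurable_funX.
- exact: normr_ge0.
- by have := expr3M_le (f w) 1; rewrite mulr1 expr1n.
Qed.

Let S_S k : S k.+1 = (fun w => S k w + xi k w).
Proof. by apply/funext => w; rewrite /S big_nat_recr. Qed.

Let mean0S k : (k <= N)%N -> mean0 P (S k).
Proof.
move=> kN; apply: mean0_sum_nat => i ik; apply: xi_mean0; exact: leq_trans kN.
Qed.

Lemma indep_sum2 k : (k <= N)%N -> mean_le P (fun w => S k w ^+ 2) (2 * k%:R * q).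
Proof.
elim: k => [|k IH] kN.
  have -> : (fun w => S 0 w ^+ 2) = cst 0.
    by apply/funext => w; rewrite /S big_nil expr0n.
  by rewrite mulr0 mul0r; exact: mean_le_cst.
have {}IH := IH (ltnW kN).
have -> : (fun w => S k.+1 w ^+ 2) =
    (fun w => (S k w ^+ 2 + xi k w ^+ 2) + 2 * (S k w * xi k w)).
  by apply/funext => w; rewrite S_S; ring.
have -> : 2 * k.+1%:R * q = 2 * k%:R * q + 2 * q by rewrite -natr1; ring.
apply: mean_le_add0; last first.
- move=> w; have -> : S k w ^+ 2 + xi k w ^+ 2 + 2 * (S k w * xi k w) = (S k w + xi k w) ^+ 2 by ring.
  exact: sqr_ge0.
- apply: mean0Z; apply: mean0_indepM; [exact: xi_indep| |exact: xi_mean0].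
  by apply: mean_le_norm_integrable (abs_le _ IH); apply: mS; exact: ltnW.
- by apply: mean_leD => //; exact: xi2.
Qed.

(** The step from k to k + 1 adds (24 k + 1) q^2, with 24 = 6 * 2 * 2, and 13 ((k + 1)^2 - k^2) = 26
    k + 13 covers it. *)
Lemma indep_sum4 k : (k <= N)%N -> mean_le P (fun w => S k w ^+ 4) (13 * k%:R ^+ 2 * q ^+ 2).
Proof.
elim: k => [|k IH] kN.
  have -> : (fun w => S 0 w ^+ 4) = cst 0.
    by apply/funext => w; rewrite /S big_nil expr0n.
  by rewrite expr0n mulr0 mul0r; exact: mean_le_cst.
have {}IH := IH (ltnW kN); have mk := mS (ltnW kN); have mxi := xi_measurable kN.
have S2 := indep_sum2 (ltnW kN).
have -> : (fun w => S k.+1 w ^+ 4) =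
    (fun w => (S k w ^+ 4 + 6 * (S k w ^+ 2 * xi k w ^+ 2) + xi k w ^+ 4) +
      (4 * (S k w ^+ 3 * xi k w) + 4 * (xi k w ^+ 3 * S k w))).
  by apply/funext => w; rewrite S_S; ring.
have ind2 : indep_rv P (fun w => S k w ^+ 2) (fun w => xi k w ^+ 2).
  exact: (indep_rv_comp (f := fun x => x ^+ 2) (g := fun x => x ^+ 2)) (xi_indep kN).
have ind3 : indep_rv P (fun w => S k w ^+ 3) (xi k).
  exact: (indep_rv_comp (f := fun x => x ^+ 3) (g := id)) (xi_indep kN).
have ind3' : indep_rv P (fun w => xi k w ^+ 3) (S k).
  exact: (indep_rv_comp (f := fun x => x ^+ 3) (g := id)) (indep_rvC (xi_indep kN)).
have SX := mean_le_indepM ind2 S2 (xi2 kN).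
have := mean_leD (mean_leD IH (mean_leZ (ler0n R 6) SX)) (xi4 kN).
move=> h; apply: mean_le_add0; last first.
- move=> w; set x := S k w; set y := xi k w.
  have -> : x ^+ 4 + 6 * (x ^+ 2 * y ^+ 2) + y ^+ 4 + (4 * (x ^+ 3 * y) + 4 * (y ^+ 3 * x)) = (x + y) ^+ 4 by ring.
  exact: exprn_even_ge0.
- apply: mean0D; apply: mean0Z; apply: mean0_indepM => //.
  + apply: mean_le_norm_integrable (abs3_le _ IH) => //; exact: measurable_funX.
  + exact: xi_mean0.
  + apply: mean_le_norm_integrable (abs3_le _ (xi4 kN)) => //; exact: measurable_funX.
  + by apply: mean0S; exact: ltnW.
- apply: mean_le_trans h; have -> : k.+1%:R = k%:R + 1 :> R by rewrite natr1.
  have k0 : (0 : R) <= k%:R by [].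
  have q20 : 0 <= q ^+ 2 by exact: sqr_ge0.
  have -> : 13 * k%:R ^+ 2 * q ^+ 2 + 6 * (2 * k%:R * q * (2 * q)) + q ^+ 2 =
    (13 * k%:R ^+ 2 + 24 * k%:R + 1) * q ^+ 2 by ring.
  apply: ler_wpM2r => //; have -> : 13 * (k%:R + 1) ^+ 2 = 13 * k%:R ^+ 2 + 26 * k%:R + 13 :> R by ring.
  lra.
Qed.

End independent_sums.

Section moricz.
Context d (Omega : measurableType d) (R : realType) (P : probability Omega R).
Context (z : nat -> Omega -> R) (c : R) (c0 : 0 <= c).
Hypothesis mz : forall k, measurable_fun setT (z k).
Hypothesis z4 : forall a k, mean_le P (fun w => (z (a + k)%N w - z a w) ^+ 4) (c * k%:R ^+ 2).

Let zmax a K w := runmax (fun k => z (a + k)%N w - z a w) K.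

Let zmax_measurable a K : measurable_fun setT (zmax a K).
Proof. by apply: runmax_measurable => k _; apply: measurable_funB. Qed.

(* Dyadic induction on the two halves of a block; the weight 2 that
   [pow4D_weighted] puts on the second half closes it, as 1 + 1 + 2 = 2^2. *)
Lemma moricz L a : mean_le P (fun w => zmax a (2 ^ L) w ^+ 4) (125 * c * (2 ^ L)%:R ^+ 2).
Proof.
elim: L a => [|L IH] a.
  rewrite expn0 expr1n mulr1; have h := z4 a 1; rewrite expr1n mulr1 in h.
  apply: (mean_le_trans _ (mean_le_le _ _ _ h)).
  - by rewrite ler_peMl// ler1n.
  - exact: measurable_funX.
  - by move=> w; rewrite exprn_even_ge0.
  - move=> w; rewrite /zmax/= addn0 subrr normr0 max_r//.
    by rewrite -normrX ger0_norm// exprn_even_ge0.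
have := mean_leD (mean_leD (IH a) (mean_leZ (ler0n R 125) (z4 a (2 ^ L))))
  (mean_leZ (ler0n R 2) (IH (a + 2 ^ L)%N)).
move=> h; apply: (mean_le_trans _ (mean_le_le _ _ _ h)).
- have -> : (2 ^ L.+1)%:R = 2 * (2 ^ L)%:R :> R by rewrite expnS natrM.
  by set x := (2 ^ L)%:R; rewrite le_eqVlt; apply/orP; left; apply/eqP; ring.
- exact: measurable_funX.
- by move=> w; rewrite exprn_even_ge0.
move=> w; set M1 := zmax a (2 ^ L) w; set M2 := zmax (a + 2 ^ L)%N (2 ^ L) w; set D := z (a + 2 ^ L)%N w - z a w.
change (zmax a (2 ^ L.+1) w ^+ 4 <= M1 ^+ 4 + 125 * D ^+ 4 + 2 * M2 ^+ 4).
have M10 : 0 <= M1 by exact: runmax_ge0.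
have M20 : 0 <= M2 by exact: runmax_ge0.
have hle : zmax a (2 ^ L.+1) w <= Num.max M1 (`|D| + M2).
  apply: runmax_le => k kL; have [k1|k1] := leqP k (2 ^ L).
    by rewrite le_max; apply/orP; left; exact: (runmax_ge (fun k => z (a + k)%N w - z a w)).
  rewrite le_max; apply/orP; right.
  have kE : (a + k = a + 2 ^ L + (k - 2 ^ L))%N by rewrite -addnA subnKC// ltnW.
  have -> : z (a + k)%N w - z a w = D + (z (a + k)%N w - z (a + 2 ^ L)%N w) by rewrite /D; ring.
  apply: le_trans (ler_normD _ _) _; rewrite lerD2l kE.
  apply: (runmax_ge (fun j => z (a + 2 ^ L + j)%N w - z (a + 2 ^ L)%N w)).
  by rewrite leq_subLR addnn -mul2n -expnS.
have D4 : D ^+ 4 = `|D| ^+ 4 by rewrite -normrX ger0_norm// exprn_even_ge0.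
have mx0 : 0 <= Num.max M1 (`|D| + M2) by rewrite le_max M10.
apply: (@le_trans _ _ (Num.max M1 (`|D| + M2) ^+ 4)).
  by apply: lerXn2r; rewrite ?nnegrE//; exact: runmax_ge0.
have hD := pow4D_weighted `|D| M2; rewrite -D4 in hD.
have M14 : 0 <= M1 ^+ 4 by exact: exprn_even_ge0.
have D40 : 0 <= D ^+ 4 by exact: exprn_even_ge0.
have M24 : 0 <= M2 ^+ 4 by exact: exprn_even_ge0.
have goal : Num.max M1 (`|D| + M2) ^+ 4 <= M1 ^+ 4 + (125 * D ^+ 4 + 2 * M2 ^+ 4).
  have [h1|h1] := leP M1 (`|D| + M2); first by apply: (le_trans hD); rewrite lerDr.
  by rewrite lerDl addr_ge0// mulr_ge0.
by apply: (le_trans goal); rewrite [leLHS]addrA.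
Qed.

End moricz.

Lemma pow2_between n : (0 < n)%N -> exists L, (n <= 2 ^ L <= 2 * n)%N.
Proof.
move=> n0; exists (up_log 2 n); rewrite up_logP//=.
have [n1|n1] := leqP n 1.
  by have -> : n = 1%N by apply/eqP; rewrite eqn_leq n1.
have := up_log_gtn (isT : (1 < 2)%N) n1.
have : (0 < up_log 2 n)%N by rewrite up_log_gt0.
by case: (up_log 2 n) => // l _ /= h; rewrite expnS leq_mul2l ltnW.
Qed.

Section averaged_maximum.
Context d (Omega : measurableType d) (R : realType) (P : probability Omega R).
Context (N n : nat) (N0 : (0 < N)%N) (n0 : (0 < n)%N) (G G' : nat -> set (set Omega)).
Context (Z : nat -> nat -> Omega -> R) (q0 q : R) (q00 : 0 < q0) (qq0 : 0 < q).
Hypothesis G_sigma : forall i, sigma_algebra setT (G i).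
Hypothesis G'_sigma : forall i, sigma_algebra setT (G' i).
Hypothesis G_measurable : forall i, G i `<=` measurable.
Hypothesis GG' : forall i j, (j < i)%N -> G j `<=` G' i.
Hypothesis G_indep : forall i, indep_systems P (G' i) (G i).
Hypothesis GZ : forall i k, (k <= n)%N -> rv_wrt (G i) (Z i k).
Hypothesis Z_mean0 : forall i k, (k <= n)%N -> mean0 P (Z i k).
Hypothesis Z_start4 : forall i, mean_le P (fun w => Z i 0%N w ^+ 4) (q0 ^+ 2).
Hypothesis Z_incr4 : forall i j k, (j < k <= n)%N ->
  mean_le P (fun w => (Z i k w - Z i j w) ^+ 4) ((q * (k - j)%:R) ^+ 2).

Let avg (xi : nat -> Omega -> R) w := N%:R^-1 * \sum_(0 <= i < N) xi i w.

(** Earlier variables are measurable for [G' i], so each partial sum is independent of the next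
    term, which is the form of independence that [indep_sum4] takes. *)
Let avg4 (xi : nat -> Omega -> R) (r : R) : 0 < r ->
  (forall i, rv_wrt (G i) (xi i)) -> (forall i, mean0 P (xi i)) ->
  (forall i, mean_le P (fun w => xi i w ^+ 4) (r ^+ 2)) ->
  mean_le P (fun w => avg xi w ^+ 4) (13 * (r / N%:R) ^+ 2).
Proof.
move=> r0 Gxi mxi xi4.
have NR : (0 : R) < N%:R by rewrite ltr0n.
have ind i : indep_rv P (fun w => \sum_(0 <= j < i) xi j w) (xi i).
  move=> A B mA mB; apply: G_indep.
    apply: rv_wrt_preimage => //; apply: rv_wrt_sum_nat => // j ji.
    exact: rv_wrtS (GG' ji) (Gxi j).
  exact: rv_wrt_preimage.
have h := indep_sum4 r0 (fun i _ => rv_wrt_measurable (@G_measurable i) (Gxi i))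
  (fun i _ => mxi i) (fun i _ => xi4 i) (fun i _ => ind i) (leqnn N).
have n4 : 0 <= (N%:R^-1 : R) ^+ 4 by rewrite exprn_ge0// invr_ge0 ltW.
have := mean_leZ n4 h.
have -> : (fun w => N%:R^-1 ^+ 4 * (\sum_(0 <= i < N) xi i w) ^+ 4) = (fun w => avg xi w ^+ 4).
  by apply/funext => w; rewrite /avg exprMn.
by apply: mean_le_trans; rewrite le_eqVlt; apply/orP; left; apply/eqP; field; rewrite gt_eqF.
Qed.

(** Frozen after index [n], so that the increment bound holds on blocks of every length, in
    particular on one whose length is a power of 2 above [n]. *)
Let z k := avg (fun i => Z i (minn k n)).

Let GZm i k : rv_wrt (G i) (Z i (minn k n)).
Proof. by apply: GZ; exact: geq_minr. Qed.

Let mz k : measurable_fun setT (z k).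
Proof.
apply: measurable_funM => //; apply: measurable_sum_nat => i _.
exact: (rv_wrt_measurable (@G_measurable i)).
Qed.

Let z4 a k : mean_le P (fun w => (z (a + k)%N w - z a w) ^+ 4)
  (13 * (q / N%:R) ^+ 2 * k%:R ^+ 2).
Proof.
have NR : (0 : R) < N%:R by rewrite ltr0n.
have c0 : 0 <= 13 * (q / N%:R) ^+ 2 * k%:R ^+ 2.
  by apply: mulr_ge0; [apply: mulr_ge0 => //|]; exact: sqr_ge0.
have zE w : z (a + k)%N w - z a w = avg (fun i w => Z i (minn (a + k) n) w - Z i (minn a n) w) w.
  by rewrite /z /avg -mulrBr -sumrB.
under [X in mean_le _ X]funext do rewrite zE.
have [e|ne] := eqVneq (minn (a + k) n) (minn a n).
  have -> : (fun w => avg (fun i w => Z i (minn (a + k) n) w - Z i (minn a n) w) w ^+ 4) = cst 0.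
    apply/funext => w; rewrite e /avg big1 ?mulr0 ?expr0n// => i _; exact: subrr.
  exact: mean_le_trans (mean_le_cst P (lexx 0)).
have jk : (minn a n < minn (a + k) n <= n)%N.
  rewrite geq_minr andbT ltn_neqAle eq_sym ne/= leq_min geq_minr andbT.
  by rewrite (leq_trans (geq_minl _ _))// leq_addr.
have dk : (minn (a + k) n - minn a n <= k)%N by lia.
have d0 : (0 < minn (a + k) n - minn a n)%N by rewrite subn_gt0; case/andP: jk.
have r0 : 0 < q * (minn (a + k) n - minn a n)%:R by rewrite mulr_gt0// ltr0n.
apply: mean_le_trans (avg4 r0 _ _ _).
- rewrite -[leRHS]mulrA ler_wpM2l// -exprMn; apply: lerXn2r; rewrite ?nnegrE.
  + by rewrite divr_ge0 ?ltW.
  + by rewrite mulr_ge0// divr_ge0// ltW.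
  + by rewrite mulrAC ler_wpM2l ?ler_nat// divr_ge0// ltW.
- by move=> i; apply: rv_wrtB.
- move=> i; have -> : (fun w => Z i (minn (a + k) n) w - Z i (minn a n) w) =
      (fun w => Z i (minn (a + k) n) w + (- 1) * Z i (minn a n) w).
    by apply/funext => w; rewrite mulN1r.
  by apply: mean0D; [|apply: mean0Z]; apply: Z_mean0; exact: geq_minr.
- by move=> i; exact: Z_incr4.
Qed.

(** The start [z 0] and the largest increment from it are bounded apart: the first by the fourth
    moment of an average, the second by [moricz] on a block of 2^L steps. *)
Lemma averaged_max : mean_le P (fun w => runmax (fun k => avg (fun i => Z i k) w) n ^+ 2)
  ((16 * q0 + 328 * (q * n%:R)) / N%:R).
Proof.
have NR : (0 : R) < N%:R by rewrite ltr0n.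
have nR : (0 : R) < n%:R by rewrite ltr0n.
have [L /andP[nL Ln]] := pow2_between n0.
have c0 : 0 <= 13 * (q / N%:R) ^+ 2 by rewrite mulr_ge0// sqr_ge0.
have h1 := moricz c0 mz z4 L 0.
(* 41^2 = 1681 exceeds 125 * 13, the product of the constants of [moricz] and [indep_sum4], and 2 n
   bounds the block length. *)
pose lam := Num.sqrt (41 * (q * (2 * n%:R) / N%:R)).
have l0 : 0 < 41 * (q * (2 * n%:R) / N%:R) by rewrite mulr_gt0// divr_gt0// !mulr_gt0.
have lam0 : 0 < lam by rewrite sqrtr_gt0.
have lam2 : lam ^+ 2 = 41 * (q * (2 * n%:R) / N%:R) by rewrite sqr_sqrtr// ltW.
have h2 : mean_le P (fun w => runmax (fun k => z (0 + k)%N w - z 0%N w) (2 ^ L) ^+ 2) (2 * lam ^+ 2).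
  apply: mean_le_sqr_pow4 => //; first by apply: runmax_measurable => k _; apply: measurable_funB.
  apply: mean_le_trans h1; rewrite (exprM _ 2 2) lam2.
  have -> : 125 * (13 * (q / N%:R) ^+ 2) * (2 ^ L)%:R ^+ 2 = 1625 * ((q / N%:R) ^+ 2 * (2 ^ L)%:R ^+ 2) by ring.
  have -> : (41 * (q * (2 * n%:R) / N%:R)) ^+ 2 = 1681 * ((q / N%:R) ^+ 2 * (2 * n%:R) ^+ 2) by ring.
  have xy : (q / N%:R) ^+ 2 * (2 ^ L)%:R ^+ 2 <= (q / N%:R) ^+ 2 * (2 * n%:R) ^+ 2.
    rewrite ler_wpM2l ?sqr_ge0//; apply: lerXn2r; rewrite ?nnegrE ?mulr_ge0//.
    by rewrite -natrM ler_nat.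
  have x0 : 0 <= (q / N%:R) ^+ 2 * (2 ^ L)%:R ^+ 2.
    by apply: mulr_ge0; exact: sqr_ge0.
  move: xy x0; set x := _ * (2 ^ L)%:R ^+ 2; set y := _ * (2 * n%:R) ^+ 2; lra.
have h3 : mean_le P (fun w => z 0%N w ^+ 4) (13 * (q0 / N%:R) ^+ 2).
  apply: avg4 => // i; rewrite min0n.
    exact: Z_mean0.
  exact: Z_start4.
(* 4^2 exceeds the 13 of [indep_sum4]. *)
pose lam' := Num.sqrt (4 * (q0 / N%:R)).
have l0' : 0 < 4 * (q0 / N%:R) by rewrite mulr_gt0// divr_gt0.
have lam0' : 0 < lam' by rewrite sqrtr_gt0.
have lam2' : lam' ^+ 2 = 4 * (q0 / N%:R) by rewrite sqr_sqrtr// ltW.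
have h4 : mean_le P (fun w => z 0%N w ^+ 2) (2 * lam' ^+ 2).
  apply: mean_le_sqr_pow4 => //; apply: mean_le_trans h3; rewrite (exprM _ 2 2) lam2'.
  have -> : (4 * (q0 / N%:R)) ^+ 2 = 16 * (q0 / N%:R) ^+ 2 by ring.
  by rewrite ler_wpM2r ?sqr_ge0//; lra.
have := mean_leD (mean_leZ (ler0n R 2) h4) (mean_leZ (ler0n R 2) h2).
move=> h; apply: (mean_le_trans _ (mean_le_le _ _ _ h)).
- by rewrite lam2 lam2' le_eqVlt; apply/orP; left; apply/eqP; field; rewrite gt_eqF.
- apply: measurable_funX; apply: runmax_measurable => k kn.
  by have := mz k; rewrite /z (minn_idPl kn).
- by move=> w; exact: sqr_ge0.
move=> w; set M := runmax (fun k => z (0 + k)%N w - z 0%N w) (2 ^ L).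
have M0 : 0 <= M by exact: runmax_ge0.
apply: (@le_trans _ _ ((`|z 0%N w| + M) ^+ 2)).
  apply: lerXn2r; rewrite ?nnegrE ?runmax_ge0 ?addr_ge0//.
  apply: runmax_le => k kn.
  have -> : avg (fun i => Z i k) w = z 0%N w + (z (0 + k)%N w - z 0%N w).
    by rewrite addrC subrK add0n /z (minn_idPl kn).
  apply: le_trans (ler_normD _ _) _; rewrite lerD2l.
  exact: (runmax_ge (fun k => z (0 + k)%N w - z 0%N w) (leq_trans kn nL)).
have -> : z 0%N w ^+ 2 = `|z 0%N w| ^+ 2 by rewrite real_normK ?num_real.
have := sqr_ge0 (`|z 0%N w| - M); rewrite /M /=; nra.
Qed.

End averaged_maximum.

(** * The filtrations of the statement *)

Section filtrations.
Context d (Omega : measurableType d) (R : realType) (P : probability Omega R).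
Context (Pc : measure_is_complete P).

(** Lets the filtrations of the statement, indexed by [unit] or ['I_N], be read as [augJ] of one
    family. *)
Lemma aug_filtrationE (I : Type) (J : eqType) (Y : I -> Omega -> R) (W : I -> R -> Omega -> R)
    (Y' : J -> Omega -> R) (W' : J -> R -> Omega -> R) (D : set J) :
  (forall i, exists2 j, D j & Y i = Y' j /\ W i = W' j) ->
  (forall j, D j -> exists i, Y i = Y' j /\ W i = W' j) ->
  aug_filtration P Y W = augJ P Y' W' D.
Proof.
move=> IJ JI; apply/funext => t; rewrite /aug_filtration /augJ /aug_gen -setUA.
congr (<<s _ `|` _ >>); congr (_ `|` _); apply/seteqP; split.
- by move=> A [i _ GA]; have [j Dj [e _]] := IJ i; exists j; rewrite -?e.
- by move=> A [j Dj GA]; have [i [e _]] := JI j Dj; exists i; rewrite ?e.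
- by move=> A [i _ GA]; have [j Dj [_ e]] := IJ i; exists j; rewrite -?e.
- by move=> A [j Dj GA]; have [i [_ e]] := JI j Dj; exists i; rewrite ?e.
Qed.

(** A single pair is the family indexed by [unit], for which mutual independence reduces to trivial
    identities. *)
Lemma fbm_single (Y : Omega -> R) (W : R -> Omega -> R) : measurable_fun setT Y ->
  brownian_motion P W ->
  indep_systems P (g_sigma_algebra_preimage Y) (sigma_process W) ->
  fbm P (aug_filtration1 P Y W) W.
Proof.
move=> mY Wbm YW.
have unit_indep (G : set (set Omega)) : mutually_indep_systems P (fun _ : unit => G).
  move=> s A us _; case: s us => [|[] [|[] s]]//= _.
    rewrite big_nil [X in P X](_ : _ = setT); first exact: probability_setT.
    by apply/seteqP; split=> // w _ i; rewrite /= in_nil.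
  rewrite big_seq1; congr (P _); apply/seteqP; split => [w h|w Aw i].
    by apply: h; rewrite /= inE.
  by rewrite /= inE => /eqP ->.
have cupE (G : set (set Omega)) : \bigcup_(i in [set: unit]) G = G.
  by apply/seteqP; split=> [A [_ _ GA]|A GA] //; exists tt.
rewrite /aug_filtration1 (aug_filtrationE (Y' := fun _ : unit => Y) (W' := fun _ => W) (D := setT)).
- have Jt : [set: unit] tt by [].
  apply: (augJ_fbm (W := fun _ : unit => W) _ _ _ _ _ Pc Jt) => //.
  have -> : sigma_rvs setT (fun _ : unit => Y) = g_sigma_algebra_preimage Y.
    rewrite /sigma_rvs cupE.
    apply: sigma_algebra_id; apply: sigma_algebra_preimage; exact: sigma_algebra_measurable.
  rewrite cupE.
  by rewrite sigma_algebra_id//; exact: smallest_sigma_algebra.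
- by move=> i; exists tt.
- by move=> [] _; exists tt.
Qed.

Lemma aug_filtration1_start (Y : Omega -> R) (W : R -> Omega -> R) :
  rv_wrt (aug_filtration1 P Y W 0) Y.
Proof. by move=> A GA; apply: sub_sigma_algebra; left; right; exists tt. Qed.

End filtrations.

(** * The copies have the law of the flat solution *)

Section exo_transfer.
Context d (Omega : measurableType d) (R : realType) (P : probability Omega R).
Context (b sigma : R -> R) (T : R).

Lemma exo_sde_sub (F F' : R -> set (set Omega)) W Y X kap :
  (forall t, 0 <= t <= T -> F t `<=` F' t) ->
  exo_sde P F W b sigma T Y X kap -> exo_sde P F' W b sigma T Y X kap.
Proof.
move=> FF [h1 h2 h3 h4]; split => // r rT; apply: rv_wrtS (h1 r rT); exact: FF.
Qed.

(** 136 = 8 + 8 * 16: in absolute value the mean [e] is at most E|D| <= 2 lam, and (D - e)^4 is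
    split with factor 8. *)
Lemma center4 (D : Omega -> R) (e lam : R) : measurable_fun setT D -> 0 < lam ->
  mean_le P (fun w => D w ^+ 4) (lam ^+ 4) -> (\int[P]_w (D w)%:E = e%:E)%E ->
  mean_le P (fun w => (D w - e) ^+ 4) (136 * lam ^+ 4).
Proof.
move=> mD l0 D4 De.
have D1 := mean_le_abs_pow4 mD l0 D4.
have el : `|e| <= 2 * lam.
  rewrite -lee_fin -abse_EFin -De; have [_ _ h] := D1; apply: le_trans h.
  by apply: le_trans (le_abse_integral _ _ _) _ => //; exact/measurable_EFinP.
have := mean_leD (mean_leZ (ler0n R 8) D4) (mean_leZ (ler0n R 8)
  (mean_le_cst P (exprn_even_ge0 e (isT : ~~ odd 4)))).
move=> h; apply: (mean_le_trans _ (mean_le_le _ _ _ h)).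
- have e4 : e ^+ 4 <= (2 * lam) ^+ 4.
    rewrite -[e ^+ 4]ger0_norm ?exprn_even_ge0// normrX lerXn2r// nnegrE//.
    by rewrite mulr_ge0// ltW.
  move: e4; rewrite exprMn; have : 0 <= lam ^+ 4 by rewrite exprn_ge0// ltW.
  set x := lam ^+ 4; lra.
- by apply: measurable_funX; apply: measurable_funB.
- by move=> w; rewrite exprn_even_ge0.
- move=> w; have := pow4D_le (D w) (- e).
  by have -> : (- e) ^+ 4 = e ^+ 4 by ring.
Qed.

Context (h : R -> R) (beta m M y4 : R).
Context (beta0 : 0 <= beta) (T0 : 0 < T) (m0 : 0 < m).
Hypothesis b_lip : forall x y, `|b x - b y| <= beta * `|x - y|.
Hypothesis s_lip : forall x y, `|sigma x - sigma y| <= beta * `|x - y|.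
Hypothesis b_grow : forall x, `|b x| <= beta * (1 + `|x|).
Hypothesis s_grow : forall x, `|sigma x| <= beta * (1 + `|x|).
Hypothesis h_incr : bi_incr m M h.
Context (K : R -> R).
Hypothesis K4 : forall r, 0 <= r <= T -> 0 <= K r <= 1 + K_bound4 h beta T m M y4.
Hypothesis K_incr : forall s t, 0 <= s -> s < t -> t <= T ->
  (K t - K s) ^+ 2 <= K_incr2 h beta T m M y4 * (t - s).

Let M0 : 0 < M := bi_incr_M0 m0 h_incr.
Let cx := X_incr2 h beta T m M y4.
Let ec := err_const beta T.
(** Constant of the mean square error of the explicit scheme, where (1 + ec * delta)^n is bounded by
    exp (ec * T); the 1 keeps it positive. *)
Let BB := cx * expR (ec * T) + 1.

Let cx0 : 0 <= cx. Proof. exact: X_incr2_ge0. Qed.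

Let BB0 : 0 < BB. Proof. by apply: ltr_wpDl => //; apply: mulr_ge0 => //; exact: expR_ge0. Qed.

Section one_system.
Context (F : R -> set (set Omega)) (W : R -> Omega -> R) (FW : fbm P F W).
Context (Y : Omega -> R) (X : R -> Omega -> R).
Hypothesis XS : exo_sde P F W b sigma T Y X K.
Hypothesis Y4 : mean_le P (fun w => Y w ^+ 4) y4.
Hypothesis FY : rv_wrt (F 0) Y.

Lemma exo_X_sqr s t : 0 <= s -> s < t -> t <= T ->
  mean_le P (fun w => (X t w - X s w) ^+ 2) (cx * (t - s)).
Proof.
move=> s0 st tT.
apply: (exo_X_incr2 beta0 T0 m0 b_lip s_lip b_grow s_grow h_incr FW XS Y4 K4) => //.
exact: K_incr.
Qed.

Lemma scheme_L1 t n : 0 < t -> t <= T ->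
  mean_le P (fun w => `|X t w - K t - scheme W b sigma Y K (t / n.+1%:R) n.+1 w|)
    (2 * Num.sqrt (BB * (T / n.+1%:R))).
Proof.
move=> t0 tT; set delta := t / n.+1%:R.
have nR : (0 : R) < n.+1%:R by rewrite ltr0n.
have d0 : 0 < delta by rewrite divr_gt0.
have tE : n.+1%:R * delta = t by rewrite /delta mulrC divfK// gt_eqF.
have nT : n.+1%:R * delta <= T by rewrite tE.
have l0 : 0 < BB * (T / n.+1%:R) by apply: mulr_gt0 => //; exact: divr_gt0.
have tT' : 0 <= t <= T by rewrite ltW.
have mXt := exo_U_measurable FW XS tT'.
have mV : measurable_fun setT (scheme W b sigma Y K delta n.+1).
  by apply: (scheme_measurable FW b_lip s_lip K d0 FY).
apply: mean_le_abs_sqr; [by apply: measurable_funB|by rewrite sqrtr_gt0|].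
rewrite sqr_sqrtr; last exact: ltW.
have h1 := scheme_error FW beta0 T0 b_lip s_lip cx0 XS exo_X_sqr d0 nT FY (leqnn n.+1).
apply: (mean_le_trans _ (mean_le_le _ _ _ h1)).
- have ec0 : 0 <= ec by exact: err_const_ge0.
  have dT : delta <= T / n.+1%:R by rewrite ler_pM2r// invr_gt0.
  have e1 : (1 + ec * delta) ^+ n.+1 - 1 <= expR (ec * T).
    rewrite lerBlDr; apply: (@le_trans _ _ (expR (ec * T))); last by rewrite lerDl.
    have -> : expR (ec * T) = expR (ec * T / n.+1%:R) ^+ n.+1.
      by rewrite -expRM_natl; congr expR; field; rewrite gt_eqF.
    apply: lerXn2r; rewrite ?nnegrE ?expR_ge0//.
      by rewrite addr_ge0// mulr_ge0// ltW.
    apply: (@le_trans _ _ (1 + ec * T / n.+1%:R)); last exact: expR_ge1Dx.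
    by rewrite lerD2l -mulrA ler_wpM2l.
  apply: (@le_trans _ _ (cx * delta * expR (ec * T))).
    by rewrite ler_wpM2l// mulr_ge0// ltW.
  rewrite mulrAC; apply: ler_pM => //.
  + by rewrite mulr_ge0// expR_ge0.
  + exact: ltW.
  + by rewrite lerDl.
- by apply: measurable_funX; apply: measurable_funB.
- by move=> w; exact: sqr_ge0.
- move=> w; have := runmax_ge (fun k => X (k%:R * delta) w - K (k%:R * delta) - scheme W b sigma Y K delta k w) (leqnn n.+1).
  rewrite tE => hh; rewrite -[leLHS]real_normK ?num_real//.
  by apply: lerXn2r; rewrite ?nnegrE ?normr_ge0 ?runmax_ge0.
Qed.

Lemma scheme_abs t n : 0 < t -> t <= T ->
  exists a, mean_le P (fun w => `|scheme W b sigma Y K (t / n.+1%:R) n.+1 w|) a.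
Proof.
move=> t0 tT; set delta := t / n.+1%:R; have tT' : 0 <= t <= T by rewrite ltW.
have d0 : 0 < delta by rewrite divr_gt0// ltr0n.
have [a ha] := exo_U_abs beta0 T0 m0 b_lip s_lip b_grow s_grow h_incr FW XS Y4 K4 tT'.
exists (a + 2 * Num.sqrt (BB * (T / n.+1%:R))).
apply: (mean_le_le _ _ _ (mean_leD ha (scheme_L1 n t0 tT))).
- have mV : measurable_fun setT (scheme W b sigma Y K delta n.+1).
    by apply: (scheme_measurable FW b_lip s_lip K d0 FY).
  exact: measurableT_comp.
- by move=> w; exact: normr_ge0.
- move=> w; rewrite -/delta; set V := scheme W b sigma Y K delta n.+1 w.
  have {1}-> : V = (X t w - K t) - (X t w - K t - V) by ring.
  exact: ler_normB.
Qed.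

Lemma scheme_shift_mean t n x : 0 < t -> t <= T ->
  `|shift_mean h P (fun w => X t w - K t) x - shift_mean h P (scheme W b sigma Y K (t / n.+1%:R) n.+1) x|
    <= M * (2 * Num.sqrt (BB * (T / n.+1%:R))).
Proof.
move=> t0 tT; set delta := t / n.+1%:R; have tT' : 0 <= t <= T by rewrite ltW.
have d0 : 0 < delta by rewrite divr_gt0// ltr0n.
have [a ha] := exo_U_abs beta0 T0 m0 b_lip s_lip b_grow s_grow h_incr FW XS Y4 K4 tT'.
have [a' ha'] := scheme_abs n t0 tT.
have mV : measurable_fun setT (scheme W b sigma Y K delta n.+1).
  by apply: (scheme_measurable FW b_lip s_lip K d0 FY).
apply: (shift_meanB_le m0 h_incr (exo_U_measurable FW XS tT') mV ha ha').
have := scheme_L1 n t0 tT; rewrite (_ : (fun w => `|x + _ - (x + _)|) =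
  (fun w => `|X t w - K t - scheme W b sigma Y K delta n.+1 w|))//.
by apply/funext => w; congr (`|_|); ring.
Qed.

End one_system.

(* Both solutions are L^1 limits of explicit schemes, which have the same law. *)
Lemma exo_shift_mean_eq (F F' : R -> set (set Omega)) (W W' : R -> Omega -> R)
    (Y Y' : Omega -> R) (X X' : R -> Omega -> R) :
  fbm P F W -> fbm P F' W' ->
  exo_sde P F W b sigma T Y X K -> exo_sde P F' W' b sigma T Y' X' K ->
  mean_le P (fun w => Y w ^+ 4) y4 -> mean_le P (fun w => Y' w ^+ 4) y4 ->
  rv_wrt (F 0) Y -> rv_wrt (F' 0) Y' -> same_law P Y Y' ->
  forall t x, 0 <= t <= T ->
  shift_mean h P (fun w => X t w - K t) x = shift_mean h P (fun w => X' t w - K t) x.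
Proof.
move=> FW FW' XS XS' Y4 Y4' FY FY' YY' t x tT; have /andP[t0 tT'] := tT.
(* At time 0 the scheme has no positive step size, but there both processes reduce to their initial
   values. *)
move: t0; rewrite le_eqVlt => /predU1P[t0|t0].
  have mU := exo_U_measurable FW XS tT; have mU' := exo_U_measurable FW' XS' tT.
  have [a ha] := exo_U_abs beta0 T0 m0 b_lip s_lip b_grow s_grow h_incr FW XS Y4 K4 tT.
  have [a' ha'] := exo_U_abs beta0 T0 m0 b_lip s_lip b_grow s_grow h_incr FW' XS' Y4' K4 tT.
  apply: (same_law_shift_mean x m0 h_incr mU mU' ha ha') => A mA.
  have mY := adapted_measurable FW (lexx 0) FY.
  have mY' := adapted_measurable FW' (lexx 0) FY'.
  have pre (f : Omega -> R) : measurable_fun setT f -> measurable (f @^-1` A).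
    by move=> mf; rewrite -[X in measurable X]setTI; exact: mf.
  transitivity (P (Y @^-1` A)); last transitivity (P (Y' @^-1` A)).
  - apply: probability_ae_eq; try exact: pre.
    by apply: filterS (exo_start XS) => w; rewrite -t0 /= => ->.
  - exact: YY'.
  - apply: probability_ae_eq; try exact: pre.
    by apply: filterS (exo_start XS') => w; rewrite -t0 /= => ->.
apply/eqP; rewrite -subr_eq0 -normr_eq0 eq_le normr_ge0 andbT leNgt; apply/negP.
set D := `|_| => D0.
have hn n : D <= 4 * M * Num.sqrt (BB * (T / n.+1%:R)).
  have h1 := scheme_shift_mean FW XS Y4 FY n x t0 tT'.
  have h2 := scheme_shift_mean FW' XS' Y4' FY' n x t0 tT'.
  have d0 : 0 < t / n.+1%:R by rewrite divr_gt0// ltr0n.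
  have mV : measurable_fun setT (scheme W b sigma Y K (t / n.+1%:R) n.+1).
    by apply: (scheme_measurable FW b_lip s_lip K d0 FY).
  have mV' : measurable_fun setT (scheme W' b sigma Y' K (t / n.+1%:R) n.+1).
    by apply: (scheme_measurable FW' b_lip s_lip K d0 FY').
  have [a ha] := scheme_abs FW XS Y4 FY n t0 tT'.
  have [a' ha'] := scheme_abs FW' XS' Y4' FY' n t0 tT'.
  have e : shift_mean h P (scheme W b sigma Y K (t / n.+1%:R) n.+1) x =
           shift_mean h P (scheme W' b sigma Y' K (t / n.+1%:R) n.+1) x.
    apply: (same_law_shift_mean x m0 h_incr mV mV' ha ha').
    by apply: (scheme_same_law FW FW' K b_lip s_lip d0 FY FY' YY').
  move: h1 h2; rewrite /= e; set v := shift_mean h P (scheme _ _ _ _ _ _ _) x.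
  set u := shift_mean _ _ _ _; set u' := shift_mean _ _ (fun w => X' t w - K t) _ => h1 h2.
  have : D <= `|u - v| + `|u' - v|.
    have -> : D = `|u - u'| by [].
    have -> : u - u' = (u - v) - (u' - v) by ring.
    exact: ler_normB.
  move: h1 h2; set z := Num.sqrt _; lra.
(* The gap is at most a constant divided by the square root of n + 1; this n makes that bound
   smaller than the gap itself. *)
have [n hn'] : exists n : nat, 16 * M ^+ 2 * BB * T / D ^+ 2 < n.+1%:R.
  by exists (Num.trunc (16 * M ^+ 2 * BB * T / D ^+ 2)); exact: truncnS_gt.
have D2 : 0 < D ^+ 2 by rewrite exprn_gt0.
have nR : (0 : R) < n.+1%:R by rewrite ltr0n.
have : D ^+ 2 <= (4 * M * Num.sqrt (BB * (T / n.+1%:R))) ^+ 2.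
  apply: lerXn2r; rewrite ?nnegrE ?hn ?(ltW D0)//.
  by rewrite mulr_ge0 ?sqrtr_ge0// mulr_ge0// ltW.
rewrite exprMn sqr_sqrtr; last by rewrite mulr_ge0 ?divr_ge0 ?(ltW BB0) ?(ltW T0) ?(ltW nR).
move: hn'; rewrite ltr_pdivrMr// => hn'.
have -> : (4 * M) ^+ 2 * (BB * (T / n.+1%:R)) = (16 * M ^+ 2 * BB * T) / n.+1%:R by ring.
by rewrite ler_pdivlMr// [D ^+ 2 * _]mulrC leNgt hn'.
Qed.

End exo_transfer.

(** * The particle system *)

Section euler_grid.
Context (R : realType) (T : R) (T0 : 0 < T) (n : nat) (n0 : (0 < n)%N).
Let delta := T / n%:R.

Let nR : (0 : R) < n%:R. Proof. by rewrite ltr0n. Qed.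
Let d0 : 0 < delta. Proof. exact: divr_gt0. Qed.

Lemma grid_cell k s : k%:R * delta <= s < k.+1%:R * delta -> grid T n s = k%:R * delta.
Proof.
move=> ks; rewrite /grid (floor_def (m := k%:Z)); first by rewrite /delta mulrA.
have -> : (k%:Z + 1)%:~R = k.+1%:R :> R by rewrite -natr1 intrD.
rewrite -pmulrn ler_pdivlMr// ltr_pdivrMr//.
move: ks; rewrite /delta !mulrA ler_pdivrMr// ltr_pdivlMr//.
Qed.

Lemma trunc_cell s : 0 <= s ->
  (Num.trunc (s / delta))%:R * delta <= s < (Num.trunc (s / delta)).+1%:R * delta.
Proof.
by move=> s0; rewrite -ler_pdivlMr// -ltr_pdivrMr// truncn_itv// divr_ge0// ltW.
Qed.

Lemma grid_trunc s : 0 <= s -> grid T n s = (Num.trunc (s / delta))%:R * delta.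
Proof. by move=> s0; apply: grid_cell; exact: trunc_cell. Qed.

Lemma trunc_le s : 0 <= s -> s <= T -> (Num.trunc (s / delta) <= n)%N.
Proof.
move=> s0 sT; have /andP[h _] := trunc_cell s0.
rewrite -(ler_nat R) -(ler_pM2r d0); apply: (le_trans h).
by rewrite /delta mulrC divfK// gt_eqF.
Qed.

Lemma trunc_cell_eq k s : k%:R * delta <= s < k.+1%:R * delta -> Num.trunc (s / delta) = k.
Proof. by move=> ks; apply: truncn_def; rewrite ler_pdivlMr// ltr_pdivrMr. Qed.

Lemma grid_step_measurable (a : R -> R) : measurable_fun `[0, T] (fun r => a (grid T n r)).
Proof.
pose f r := \sum_(0 <= k < n.+1) a (k%:R * delta) * \1_(`[k%:R * delta, k.+1%:R * delta[%classic) r.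
apply: (@eq_measurable_fun _ _ _ _ _ f) => [r|]; last first.
  apply: measurable_funTS; apply: measurable_sum_nat => k _.
  by apply: measurable_funM => //; apply: measurable_indic; exact: measurable_itv.
rewrite inE/= in_itv/= => /andP[r0 rT].
rewrite grid_trunc// /f (bigD1_seq (Num.trunc (r / delta))); last first.
- exact: iota_uniq.
- by rewrite mem_index_iota ltnS trunc_le.
rewrite /= indicE mem_set ?mulr1; last by rewrite /= in_itv/= trunc_cell.
rewrite big1 ?addr0// => k kr; rewrite indicE memNset ?mulr0// => /=.
by rewrite in_itv/= => /trunc_cell_eq h; rewrite h eqxx in kr.
Qed.

Lemma grid_step_bounded (a : R -> R) : exists c : R,
  forall r, 0 <= r <= T -> `|a (grid T n r)| <= c.
Proof.
exists (\sum_(0 <= k < n.+1) `|a (k%:R * delta)|) => r /andP[r0 rT].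
rewrite grid_trunc// (bigD1_seq (Num.trunc (r / delta))).
- by rewrite lerDl sumr_ge0.
- by rewrite mem_index_iota ltnS trunc_le.
- exact: iota_uniq.
Qed.

Lemma grid_step_continuous (a : R -> R) k r : k%:R * delta < r < k.+1%:R * delta ->
  {for r, continuous (fun x => a (grid T n x))}.
Proof.
move=> /andP[kr rk]; apply: cvg_near_cst.
have : \forall x \near r, k%:R * delta < x < k.+1%:R * delta.
  have h1 : \forall x \near r, k%:R * delta < x by exact: lt_nbhsr.
  have h2 : \forall x \near r, x < k.+1%:R * delta by exact: lt_nbhsl.
  by apply: filterS2 h1 h2 => x -> ->.
apply: filterS => x /andP[kx xk]; rewrite !(@grid_cell k)//; apply/andP; split => //; exact: ltW.
Qed.

Lemma subcell p k r : (0 < p)%N -> k%:R * (delta / p%:R) <= r <= k.+1%:R * (delta / p%:R) ->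
  (k %/ p)%:R * delta <= r <= (k %/ p).+1%:R * delta.
Proof.
move=> p0; have pR : (0 : R) < p%:R by rewrite ltr0n.
set dl := delta / p%:R; have dl0 : 0 < dl by rewrite divr_gt0.
have -> : delta = p%:R * dl by rewrite /dl mulrC divfK// gt_eqF.
rewrite (mulrA _ p%:R dl) (mulrA (k %/ p).+1%:R p%:R dl) -!natrM => /andP[kr rk].
apply/andP; split.
  by apply: le_trans kr; rewrite ler_wpM2r ?(ltW dl0)// ler_nat leq_trunc_div.
by apply: (le_trans rk); rewrite ler_wpM2r ?(ltW dl0)// ler_nat; exact: ltn_ceil.
Qed.

End euler_grid.

Section euler_particle.
Context d (Omega : measurableType d) (R : realType) (P : probability Omega R).
Context (Pc : measure_is_complete P).
Context (F : R -> set (set Omega)) (W : R -> Omega -> R) (FW : fbm P F W).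
Context (b sigma : R -> R) (beta T : R) (T0 : 0 < T).
Hypothesis b_lip : forall x y, `|b x - b y| <= beta * `|x - y|.
Hypothesis s_lip : forall x y, `|sigma x - sigma y| <= beta * `|x - y|.
Context (n : nat) (n0 : (0 < n)%N) (Y : Omega -> R) (X U : R -> Omega -> R).
Hypothesis FX : adapted F `[0, T]%classic X.
Hypothesis XU : driven_by P F T b sigma Y W (fun s => X (grid T n s)) U.
Hypothesis mY : measurable_fun setT Y.
Let delta := T / n%:R.

Let nR : (0 : R) < n%:R. Proof. by rewrite ltr0n. Qed.
Let d0 : 0 < delta. Proof. exact: divr_gt0. Qed.
Let nd : n%:R * delta = T. Proof. by rewrite /delta mulrC divfK// gt_eqF. Qed.

Lemma euler_coef_adapted r : 0 <= r <= T -> rv_wrt (F r) (X (grid T n r)).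
Proof.
move=> /andP[r0 rT]; rewrite grid_trunc//; set k := Num.trunc _.
have /andP[kr _] := trunc_cell T0 n0 r0.
have k0 : 0 <= k%:R * delta by rewrite mulr_ge0// ltW.
apply: (rv_wrtS (fbm_mono FW k0 kr)); apply: FX; rewrite /= in_itv/= k0/=.
exact: le_trans kr rT.
Qed.

(** The coefficient is constant inside an Euler cell and may jump at its ends; a subcell never has a
    grid time in its interior. *)
Lemma euler_cell p k : (0 < p)%N -> (k < n * p)%N ->
  ito_incr P W (k%:R * (delta / p%:R)) (k.+1%:R * (delta / p%:R))
    (fun r w => b (X (grid T n r) w)) (fun r w => sigma (X (grid T n r) w))
    (fun w => U (k.+1%:R * (delta / p%:R)) w - U (k%:R * (delta / p%:R)) w) /\
  measurable_fun setT (fun w => U (k.+1%:R * (delta / p%:R)) w - U (k%:R * (delta / p%:R)) w).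
Proof.
move=> p0 kn; have pR : (0 : R) < p%:R by rewrite ltr0n.
have dl0 : 0 < delta / p%:R by rewrite divr_gt0.
have kT : k.+1%:R * (delta / p%:R) <= T.
  rewrite -nd mulrA ler_pdivrMr// [n%:R * _ * _]mulrAC -natrM.
  by rewrite ler_wpM2r ?(ltW d0)// ler_nat.
have k0 : 0 <= k%:R * (delta / p%:R) by rewrite mulr_ge0// ltW.
apply: (driven_ito_incr Pc FW b_lip s_lip T0 XU) => //.
- by rewrite ltr_pM2r// ltr_nat.
- move=> r /andP[kr rk]; apply: euler_coef_adapted.
  by rewrite (le_trans k0 kr) (le_trans (ltW rk)).
- apply: aeW => w; split.
  + exact: (grid_step_measurable T0 n0 (fun r => X r w)).
  + exact: (grid_step_bounded T0 n0 (fun r => X r w)).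
  + move=> r /andP[kr rk].
    apply: (@grid_step_continuous R T T0 n n0 (fun r => X r w) (k %/ p)%N).
    have kk : k%:R * (delta / p%:R) <= k.+1%:R * (delta / p%:R).
      by rewrite ler_wpM2r ?(ltW dl0)// ler_nat.
    have h1 := @subcell R T T0 n n0 p k (k%:R * (delta / p%:R)) p0 _.
    have h2 := @subcell R T T0 n n0 p k (k.+1%:R * (delta / p%:R)) p0 _.
    have /andP[a1 _] := h1 (introT andP (conj (lexx _) kk)).
    have /andP[_ a2] := h2 (introT andP (conj kk (lexx _))).
    by rewrite (le_lt_trans a1 kr) (lt_le_trans rk a2).
Qed.

(** The equation holds only almost everywhere, so measurability is propagated from the initial
    value, one increment at a time. *)
Lemma euler_measurable p k : (0 < p)%N -> (k <= n * p)%N ->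
  measurable_fun setT (U (k%:R * (delta / p%:R))).
Proof.
move=> p0; elim: k => [|k IH] kn.
  rewrite mul0r; apply: (ae_eq_measurable Pc mY).
  by apply: filterS (driven_start FW T0 XU) => w ->.
have [_ h] := euler_cell p0 kn.
have -> : U (k.+1%:R * (delta / p%:R)) = (fun w =>
    (U (k.+1%:R * (delta / p%:R)) w - U (k%:R * (delta / p%:R)) w) + U (k%:R * (delta / p%:R)) w).
  by apply/funext => w; rewrite subrK.
by apply: measurable_funD => //; apply: IH; exact: ltnW.
Qed.

Lemma euler_continuous : \forall w \ae P, {within `[0, T], continuous (fun t => U t w)}.
Proof.
have [J [_ Jc _] UJ] := XU.
have mb : measurable_fun setT b.
  by apply: continuous_measurable_fun; exact: lip_continuous b_lip.
apply: filterS2 UJ Jc => w UE Jw.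
pose f r := b (X (grid T n r) w).
have fI : lebesgue_measure.-integrable `[0, T] (EFin \o f).
  have mf : measurable_fun `[0, T] f.
    apply: (measurableT_comp mb); exact: (grid_step_measurable T0 n0 (fun r => X r w)).
  have [c hc] := grid_step_bounded T0 n0 (fun r => b (X r w)).
  have c0 : 0 <= c by rewrite (le_trans _ (hc 0 _))// lexx ltW.
  apply/integrableP; split; first exact/measurable_EFinP.
  apply: (@le_lt_trans _ _ (\int[lebesgue_measure]_(x in `[0%R, T]) (cst c%:E) x)%E).
    apply: ge0_le_integral_any => [x _|x _|//|x].
    - exact: abse_ge0.
    - by rewrite lee_fin.
    - by rewrite /= in_itv/= => sx; rewrite lee_fin hc.
  rewrite integral_cst; last exact: measurable_itv.
  apply: lte_mul_pinfty => //.
  by rewrite [X in (X < _)%E]lebesgue_measure_itv/= lte_fin T0 -EFinB ltry.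
have fc := parameterized_integral_continuous (ltW T0) fI.
have cc : {within `[0, T], continuous (fun t => Y w +
    parameterized_integral lebesgue_measure 0 t f + J t w)}.
  move=> t; apply: cvgD; last exact: Jw.
  by apply: cvgD; [exact: cvg_cst|exact: fc].
apply: (subspace_eq_continuous _ cc) => t.
move=> tT; have tT' : t \in `[0, T] by move: tT; rewrite inE.
exact: (esym (UE t tT')).
Qed.

End euler_particle.

Lemma sup_close (R : realType) (A B : set R) (c : R) : A !=set0 -> B !=set0 ->
  has_ubound A -> (forall a, A a -> exists2 b, B b & a <= b + c) ->
  (forall b, B b -> exists2 a, A a & b <= a + c) -> `|sup A - sup B| <= c.
Proof.
move=> A0 B0 [u uA] AB BA.
have uB : has_ubound B.
  exists (u + c) => x /BA[a Aa xa]; rewrite (le_trans xa)// lerD2r; exact: uA.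
rewrite ler_norml lerNl opprB !lerBlDl; apply/andP; split.
  apply: ge_sup => // x /BA[a Aa xa]; rewrite (le_trans xa)// lerD2r.
  by apply: ub_le_sup => //; exists u.
by apply: ge_sup => // x /AB[a Ba xa]; apply: (le_trans xa); rewrite lerD2r; exact: ub_le_sup.
Qed.

(** Each time is paired with the grid time to its left. Upwards this costs [kap], the oscillation of
    g over a cell; downwards it costs only [r], since grid times before t are themselves among the
    times of the first supremum. *)
Lemma reflection_error (R : realType) (delta : R) (g : R -> R) (ghat : nat -> R)
    (k : nat) (t r kap : R) : 0 < delta -> 0 <= t -> t < k.+1%:R * delta ->
  has_ubound [set g s | s in `[0, t]] ->
  (forall j, (j <= k)%N -> j%:R * delta <= t -> `|g (j%:R * delta) - ghat j| <= r) ->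
  (forall j s, j%:R * delta <= s <= t -> s < j.+1%:R * delta -> g s <= g (j%:R * delta) + kap) ->
  0 <= kap ->
  `|sup [set g s | s in `[0, t]] - sup [set ghat (Num.trunc (s / delta)) | s in `[0, t]]| <= r + kap.
Proof.
move=> d0 t0 tk ub gr gkap kap0.
have tr s : 0 <= s -> (Num.trunc (s / delta))%:R * delta <= s < (Num.trunc (s / delta)).+1%:R * delta.
  by move=> s0; rewrite -ler_pdivlMr// -ltr_pdivrMr// truncn_itv// divr_ge0// ltW.
have jk s : 0 <= s <= t -> (Num.trunc (s / delta) <= k)%N.
  move=> /andP[s0 st]; have /andP[h _] := tr s s0.
  by rewrite -ltnS -(ltr_nat R) -(ltr_pM2r d0) (le_lt_trans h)// (le_lt_trans st).
apply: sup_close => //.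
- by exists (g 0), 0 => //=; rewrite in_itv/= lexx.
- by exists (ghat (Num.trunc (0 / delta))), 0 => //=; rewrite in_itv/= lexx.
- move=> _ [s /= sT <-]; have sT' : 0 <= s <= t by move: sT; rewrite in_itv.
  exists (ghat (Num.trunc (s / delta))); first by exists s.
  have /andP[s0 st] := sT'; have /andP[h1 h2] := tr s s0.
  have a1 := gkap _ s (introT andP (conj h1 st)) h2.
  have := gr _ (jk s sT') (le_trans h1 st); rewrite ler_norml => /andP[_ a2].
  by move: a1 a2; lra.
- move=> _ [s /= sT <-]; have sT' : 0 <= s <= t by move: sT; rewrite in_itv.
  have /andP[s0 st] := sT'; have /andP[h1 h2] := tr s s0.
  exists (g ((Num.trunc (s / delta))%:R * delta)).
    exists ((Num.trunc (s / delta))%:R * delta) => //=; rewrite in_itv/= (le_trans h1 st) andbT.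
    by rewrite mulr_ge0// ltW.
  have := gr _ (jk s sT') (le_trans h1 st); rewrite ler_norml => /andP[a2 _].
  by move: a2 kap0; lra.
Qed.

(** * The recursion for the error of the particles *)

Section error_recursion.
Context d (Omega : measurableType d) (R : realType) (P : probability Omega R).
Context (Pc : measure_is_complete P).
Context (b sigma h : R -> R) (beta T m M cx kap2 Cz : R).
Context (beta0 : 0 <= beta) (T0 : 0 < T) (m0 : 0 < m) (cx0 : 0 <= cx) (kap20 : 0 <= kap2).
Hypothesis b_lip : forall x y, `|b x - b y| <= beta * `|x - y|.
Hypothesis s_lip : forall x y, `|sigma x - sigma y| <= beta * `|x - y|.
Hypothesis h_incr : bi_incr m M h.
Context (N n : nat) (N0 : (0 < N)%N) (n0 : (0 < n)%N).
Let delta := T / n%:R.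
Context (F : R -> set (set Omega)) (W : nat -> R -> Omega -> R).
Context (Y : nat -> Omega -> R) (Xb Xt Ut : nat -> R -> Omega -> R) (K : R -> R).
Context (g : R -> R) (Phi : R -> R -> R).
Hypothesis FW : forall i, (i < N)%N -> fbm P F (W i).
Hypothesis XbS : forall i, (i < N)%N -> exo_sde P F (W i) b sigma T (Y i) (Xb i) K.
Hypothesis Xb_incr : forall i, (i < N)%N -> forall s t, 0 <= s -> s < t -> t <= T ->
  mean_le P (fun w => (Xb i t w - Xb i s w) ^+ 2) (cx * (t - s)).
Hypothesis mY : forall i, (i < N)%N -> measurable_fun setT (Y i).
Hypothesis FXt : forall i, (i < N)%N -> adapted F `[0, T]%classic (Xt i).
Hypothesis Xt_driven : forall i, (i < N)%N ->
  driven_by P F T b sigma (Y i) (W i) (fun s => Xt i (grid T n s)) (Ut i).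
Hypothesis XtE : forall i, (i < N)%N -> \forall w \ae P, forall t, t \in `[0, T] ->
  Xt i t w = Ut i t w +
    sup [set G0 h (empirical_measure N (fun j => Ut j (grid T n s) w)) | s in `[0, t]].
Hypothesis K_sup : forall t, 0 <= t <= T -> K t = sup [set g s | s in `[0, t]].
Hypothesis g_ub : forall t, 0 <= t <= T -> has_ubound [set g s | s in `[0, t]].
Hypothesis Phi_incr : forall t, 0 <= t <= T -> bi_incr m M (Phi t).
Hypothesis gE : forall t, 0 <= t <= T -> g t = root_inf (Phi t).
Hypothesis g_hold : forall s t, 0 <= s -> s <= t -> t <= T -> t - s <= delta ->
  g t <= g s + Num.sqrt (kap2 * delta).

Let zb k w := N%:R^-1 * \sum_(0 <= i < N)
  (h (g (k%:R * delta) + (Xb i (k%:R * delta) w - K (k%:R * delta))) -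
   Phi (k%:R * delta) (g (k%:R * delta))).

Hypothesis zb_max : mean_le P (fun w => runmax (fun k => zb k w) n ^+ 2) (Cz / N%:R).

Let M0 : 0 < M := bi_incr_M0 m0 h_incr.
Let nR : (0 : R) < n%:R. Proof. by rewrite ltr0n. Qed.
Let NR : (0 : R) < N%:R. Proof. by rewrite ltr0n. Qed.
Let d0 : 0 < delta. Proof. exact: divr_gt0. Qed.
Let nd : n%:R * delta = T. Proof. by rewrite /delta mulrC divfK// gt_eqF. Qed.

Let e i k w := Xb i (k%:R * delta) w - K (k%:R * delta) - Ut i (k%:R * delta) w.
(** The sampling term is maximised over the whole grid, which makes it a fixed source in the
    recursion; the particle errors are maximised only up to k, as the induction requires. *)
Let rr k w := m^-1 * (runmax (fun j => zb j w) n +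
  M * (N%:R^-1 * \sum_(0 <= i < N) runmax (fun j => e i j w) k)).
Let kap := Num.sqrt (kap2 * delta).
Let ghat w k := G0 h (empirical_measure N (fun j => Ut j (k%:R * delta) w)).

Let kT k : (k <= n)%N -> 0 <= k%:R * delta <= T.
Proof.
by move=> kn; rewrite mulr_ge0 ?(ltW d0)//= -[leRHS]nd ler_wpM2r ?(ltW d0)// ler_nat.
Qed.

(** [root_inf_lip] is used with the deterministic map in first position, so the comparison takes
    place at g. There the empirical mean of h splits into the fluctuation [zb] and terms at most [M]
    times the errors on U. *)
Lemma root_error w k j : (j <= k)%N -> (k <= n)%N ->
  `|g (j%:R * delta) - ghat w j| <= rr k w.
Proof.
move=> jk kn; have jT := kT (leq_trans jk kn).
set t := j%:R * delta in jT *.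
pose Ph x := N%:R^-1 * \sum_(0 <= i < N) h (x + Ut i t w).
have ghatE : ghat w j = root_inf Ph.
  by apply: G0_root_inf => x; rewrite (empirical_integral m0 h_incr).
have Phi2 : bi_incr m M Ph by apply: bi_incr_mean.
rewrite ghatE gE//.
apply: le_trans (root_inf_lip m0 (Phi_incr jT) Phi2) _.
rewrite mulrC /rr; apply: ler_wpM2l; first by rewrite invr_ge0 ltW.
rewrite -gE// distrC.
have Ni0 : 0 <= (N%:R^-1 : R) by rewrite invr_ge0 ltW.
have -> : Ph (g t) - Phi t (g t) = zb j w + N%:R^-1 * \sum_(0 <= i < N)
    (h (g t + Ut i t w) - h (g t + (Xb i t w - K t))).
  rewrite /zb -mulrDr -big_split/= -/t.
  rewrite [in RHS](eq_bigr (fun i => h (g t + Ut i t w) - Phi t (g t))); last by move=> i _; ring.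
  by rewrite sumrB mulrBr sumr_const_nat subn0 -[X in _ - _ * X]mulr_natl mulKf// gt_eqF.
apply: le_trans (ler_normD _ _) _; apply: lerD.
  exact: (runmax_ge (fun j => zb j w) (leq_trans jk kn)).
rewrite normrM ger0_norm// mulrCA; apply: ler_wpM2l => //.
apply: le_trans (ler_norm_sum _ _ _) _; rewrite mulr_sumr; apply: ler_sum => i _.
apply: le_trans (bi_incr_lip m0 h_incr _ _) _; rewrite (ler_pM2l M0).
apply: le_trans (runmax_ge (fun j => e i j w) jk).
by rewrite /e -/t distrC le_eqVlt; apply/orP; left; apply/eqP; congr (`|_|); ring.
Qed.

(** Up to time t only grid indices up to k are visited, so the two running suprema differ by at most
    [rr k w + kap]. *)
Lemma Xt_error i : (i < N)%N -> \forall w \ae P, forall t k, 0 <= t <= T -> (k <= n)%N ->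
  t < k.+1%:R * delta ->
  `|Xb i t w - Xt i t w| <= `|Xb i t w - K t - Ut i t w| + rr k w + kap.
Proof.
move=> iN; apply: filterS (XtE iN) => w XE t k tT kn tk.
have /andP[t0 tT'] := tT.
rewrite XE; last by rewrite in_itv.
have E : [set G0 h (empirical_measure N (fun j => Ut j (grid T n s) w)) | s in `[0, t]] =
   [set ghat w (Num.trunc (s / delta)) | s in `[0, t]].
  apply/seteqP; split=> [_ [s /= sT <-]|_ [s /= sT <-]].
    have s0 : 0 <= s by move: sT; rewrite in_itv/= => /andP[].
    by exists s; [exact: sT|rewrite /ghat (grid_trunc T0 n0 s0)].
  have s0 : 0 <= s by move: sT; rewrite in_itv/= => /andP[].
  by exists s; [exact: sT|rewrite /ghat (grid_trunc T0 n0 s0)].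
rewrite E.
have h1 : `|K t - sup [set ghat w (Num.trunc (s / delta)) | s in `[0, t]]| <= rr k w + kap.
  rewrite K_sup//; apply: (reflection_error d0 t0 tk (g_ub tT)).
  - by move=> j jk _; exact: root_error.
  - move=> j s /andP[js st] sj; apply: g_hold => //.
    + by rewrite mulr_ge0// ltW.
    + exact: le_trans st tT'.
    + by rewrite lerBlDr; move: sj; rewrite -natr1 mulrDl mul1r addrC; exact: ltW.
  - exact: sqrtr_ge0.
set S := sup _ in h1 *.
have -> : Xb i t w - (Ut i t w + S) = (Xb i t w - K t - Ut i t w) + (K t - S) by ring.
by apply: le_trans (ler_normD _ _) _; rewrite -[leRHS]addrA lerD2l.
Qed.

(** Squaring a sum of three terms gives the 3; inside, 1 stands for the error of the particle itself
    and 2 (M / m)^2 for that of the average, through [rr_sqr]. [err_src] collects the terms free of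
    the unknown, and [err_seq] solves the resulting recursion exactly. *)
Definition err_rate := 3 * (1 + 2 * (M / m) ^+ 2).
Definition err_src := cx * delta + (6 * Cz / (m ^+ 2 * N%:R) + 3 * (kap2 * delta)).
Definition err_seq k := err_src / err_rate * ((1 + err_const beta T * delta * err_rate) ^+ k - 1).

Let rate0 : 0 < err_rate.
Proof. by rewrite mulr_gt0// ltr_pwDl// mulr_ge0// sqr_ge0. Qed.

Let Cz0 : 0 <= Cz / N%:R. Proof. exact: mean_le_ge0 zb_max. Qed.

Let src0 : 0 <= err_src.
Proof.
apply: addr_ge0; first by rewrite mulr_ge0// ltW.
apply: addr_ge0; last by rewrite mulr_ge0// mulr_ge0// ltW.
have -> : 6 * Cz / (m ^+ 2 * N%:R) = 6 / m ^+ 2 * (Cz / N%:R).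
  by field; rewrite !gt_eqF.
by rewrite mulr_ge0// divr_ge0// sqr_ge0.
Qed.

Let seq0 k : 0 <= err_seq k.
Proof.
apply: mulr_ge0; first by rewrite divr_ge0// ltW.
rewrite subr_ge0 exprn_ege1// lerDl; apply: mulr_ge0; last exact: ltW.
by apply: mulr_ge0; [exact: err_const_ge0|exact: ltW].
Qed.

Let me i k : (i < N)%N -> (k <= n)%N -> measurable_fun setT (e i k).
Proof.
move=> iN kn; apply: measurable_funB.
  by apply: measurable_funB => //; apply: (exo_X_measurable (FW iN) (XbS iN)); exact: kT.
have := euler_measurable Pc (FW iN) T0 b_lip s_lip n0 (FXt iN) (Xt_driven iN) (mY iN)
  (p := 1) (k := k) (ltn0Sn 0).
by rewrite divr1 muln1; exact.
Qed.

(** Jensen's inequality puts the square inside the average over the particles, where their common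
    bound [a] survives. *)
Lemma rr_sqr k a : (k <= n)%N ->
  (forall i, (i < N)%N -> mean_le P (fun w => runmax (fun j => e i j w) k ^+ 2) a) ->
  mean_le P (fun w => rr k w ^+ 2) (2 / m ^+ 2 * (Cz / N%:R) + 2 * (M / m) ^+ 2 * a).
Proof.
move=> kn ha.
have m2 : 0 <= 2 / m ^+ 2 by rewrite divr_ge0// sqr_ge0.
have Mm2 : 0 <= 2 * (M / m) ^+ 2 by rewrite mulr_ge0// sqr_ge0.
have Ni0 : 0 <= (N%:R^-1 : R) by rewrite invr_ge0 ltW.
have avg : mean_le P (fun w => N%:R^-1 * \sum_(0 <= i < N) runmax (fun j => e i j w) k ^+ 2) a.
  have := mean_leZ Ni0 (mean_le_sum_nat (fun i iN => ha i iN)).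
  by apply: mean_le_trans; rewrite sumr_const_nat subn0 -[X in _ * X]mulr_natl mulKf// gt_eqF.
have := mean_leD (mean_leZ m2 zb_max) (mean_leZ Mm2 avg).
have [mavg _ _] := avg; have [mz _ _] := zb_max.
apply: mean_le_le.
- apply: measurable_funX; apply: measurable_funM => //; apply: measurable_funD.
    apply: runmax_measurable => j jn; apply: measurable_funM => //.
    apply: measurable_sum_nat => i iN; apply: measurable_funB => //.
    apply: (measurableT_comp (bi_incr_measurable m0 h_incr)); apply: measurable_funD => //.
    by apply: measurable_funB => //; apply: (exo_X_measurable (FW iN) (XbS iN)); exact: kT.
  apply: measurable_funM => //; apply: measurable_funM => //.
  apply: measurable_sum_nat => i iN; apply: runmax_measurable => j jk.
  by apply: me => //; exact: leq_trans kn.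
- by move=> w; exact: sqr_ge0.
- move=> w; rewrite /rr; set Z := runmax _ n; set a' := fun i => runmax (fun j => e i j w) k.
  have jen : (N%:R^-1 * \sum_(0 <= i < N) a' i) ^+ 2 <= N%:R^-1 * \sum_(0 <= i < N) a' i ^+ 2.
    rewrite exprMn expr2 -mulrA ler_wpM2l// mulrC ler_pdivrMr// mulrC.
    have := sum_sqr_le N a' (@ler01 R); rewrite mulr1.
    by under eq_bigr do rewrite mulr1; under [X in _ <= _ * X]eq_bigr do rewrite mulr1.
  set A := N%:R^-1 * \sum_(0 <= i < N) a' i in jen *.
  have -> : (m^-1 * (Z + M * A)) ^+ 2 = (m ^+ 2)^-1 * (Z + M * A) ^+ 2.
    by rewrite exprMn exprVn.
  apply: (@le_trans _ _ ((m ^+ 2)^-1 * (2 * Z ^+ 2 + 2 * M ^+ 2 * A ^+ 2))).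
    apply: ler_wpM2l; first by rewrite invr_ge0 sqr_ge0.
    by have := sqr_ge0 (Z - M * A); nra.
  have -> : (m ^+ 2)^-1 * (2 * Z ^+ 2 + 2 * M ^+ 2 * A ^+ 2) =
      2 / m ^+ 2 * Z ^+ 2 + 2 * (M / m) ^+ 2 * A ^+ 2.
    by field; rewrite gt_eqF.
  by rewrite lerD2l ler_wpM2l.
Qed.

Let Hsum K' : err_const beta T * (delta * \sum_(0 <= k < K')
   (cx * delta + (err_rate * err_seq k + (6 * Cz / (m ^+ 2 * N%:R) + 3 * (kap2 * delta))))) = err_seq K'.
Proof.
rewrite (eq_bigr (fun k => err_src * (1 + err_const beta T * delta * err_rate) ^+ k)); last first.
  move=> k _; rewrite /err_seq.
  have -> : err_rate * (err_src / err_rate * ((1 + err_const beta T * delta * err_rate) ^+ k - 1)) =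
     err_src * ((1 + err_const beta T * delta * err_rate) ^+ k - 1).
    by rewrite mulrA [err_rate * _]mulrC divfK// gt_eqF.
  by rewrite /err_src; ring.
rewrite -mulr_sumr /err_seq -gronwall_sum.
by set S := \sum_(0 <= k < K') _; field; rewrite gt_eqF.
Qed.

(** On cell k the coefficients see the particle at the grid time k * delta, where its error is that
    on U plus the reflection error of [Xt_error]. *)
Let cellH i k a r : (i < N)%N -> (k <= n)%N -> k%:R * delta <= r < k.+1%:R * delta ->
  (forall j, (j < N)%N -> mean_le P (fun w => runmax (fun l => e j l w) k ^+ 2) a) ->
  mean_le P (fun w => (Xb i (k%:R * delta) w - Xt i (grid T n r) w) ^+ 2)
    (err_rate * a + (6 * Cz / (m ^+ 2 * N%:R) + 3 * (kap2 * delta))).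
Proof.
move=> iN kn kr ha; rewrite (grid_cell T0 n0 kr).
have mXb : measurable_fun setT (Xb i (k%:R * delta)).
  by apply: (exo_X_measurable (FW iN) (XbS iN)); exact: kT.
have mXt : measurable_fun setT (Xt i (k%:R * delta)).
  apply: (adapted_measurable (FW iN) (proj1 (andP (kT kn)))); apply: (FXt iN).
  by rewrite /= in_itv/= kT.
have kapE : kap ^+ 2 = kap2 * delta by rewrite sqr_sqrtr// mulr_ge0// ltW.
have := mean_leZ (ler0n R 3) (mean_leD (mean_leD (ha i iN) (rr_sqr kn ha)) (mean_le_cst P (sqr_ge0 kap))).
move=> hh; apply: (mean_le_trans _ (mean_le_ae _ _ _ hh)).
- rewrite kapE /err_rate le_eqVlt; apply/orP; left; apply/eqP; field.
  by rewrite !gt_eqF.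
- by apply: measurable_funX; apply: measurable_funB.
- by move=> w; exact: sqr_ge0.
- apply: filterS (Xt_error iN) => w hw.
  have kk : k%:R * delta < k.+1%:R * delta by rewrite ltr_pM2r// ltr_nat.
  have := hw _ k (kT kn) kn kk; rewrite -/(e i k w) => h1.
  have h2 := runmax_ge (fun l => e i l w) (leqnn k).
  rewrite -[leLHS]real_normK ?num_real//=.
  set x := `|_ - _| in h1 *; set y := runmax _ k in h2 *; set z := rr k w in h1 *.
  have x0 : 0 <= x by exact: normr_ge0.
  have xyz : x <= y + z + kap by apply: (le_trans h1); rewrite !lerD2r.
  apply: (@le_trans _ _ ((y + z + kap) ^+ 2)).
    by apply: lerXn2r => //; rewrite nnegrE//; exact: le_trans xyz.
  have := sqr_ge0 (y - z); have := sqr_ge0 (y - kap); have := sqr_ge0 (z - kap); nra.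
Qed.

(** The induction treats all particles at once, since the reflection of each depends on the average
    error of all. *)
Lemma grid_error K' : (K' <= n)%N -> forall i, (i < N)%N ->
  mean_le P (fun w => runmax (fun k => e i k w) K' ^+ 2) (err_seq K').
Proof.
elim/ltn_ind: K' => K' IH Kn i iN.
have KT : K'%:R * delta <= T by have /andP[] := kT Kn.
have := error_max (FW iN) beta0 b_lip s_lip cx0 (XbS iN) (Xb_incr iN) d0 (ltn0Sn 0) KT
  (H := fun r => Xt i (grid T n r)) (A := fun k => Ut i (k%:R * (delta / 1%:R)))
  (e := fun k => err_rate * err_seq k + (6 * Cz / (m ^+ 2 * N%:R) + 3 * (kap2 * delta))) _ _ _ _.
rewrite Hsum muln1 => hh.
apply: (mean_le_ae _ _ _ (hh _ _ _ _)).
- apply: measurable_funX; apply: runmax_measurable => k kK.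
  by apply: me => //; exact: leq_trans Kn.
- by move=> w; exact: sqr_ge0.
- apply: filterS2 (exo_start (XbS iN)) (driven_start (FW iN) T0 (Xt_driven iN)) => w h1 h2.
  apply: lerXn2r; rewrite ?nnegrE ?runmax_ge0//; apply: runmax_le => k kK.
  apply: le_trans (runmax_ge _ kK); by rewrite /= divr1 mul0r h1 h2 subrr subr0.
- move=> r /andP[r0 rK]; apply: (euler_coef_adapted (FW iN) T0 n0 (FXt iN)).
  by rewrite r0 (le_trans (ltW rK)).
- move=> k r kK kr; apply: cellH => //; first by apply: ltnW; exact: leq_trans kK Kn.
  by move=> j jN; apply: IH => //; apply: ltnW; exact: leq_trans kK Kn.
- move=> k kK.
  have := euler_measurable Pc (FW iN) T0 b_lip s_lip n0 (FXt iN) (Xt_driven iN) (mY iN)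
    (p := 1) (k := k) (ltn0Sn 0).
  by rewrite divr1 muln1; apply; exact: leq_trans kK Kn.
- move=> k kK.
  have [] := euler_cell Pc (FW iN) T0 b_lip s_lip n0 (FXt iN) (Xt_driven iN) (p := 1) (k := k) (ltn0Sn 0).
    by rewrite muln1; exact: leq_trans kK Kn.
  by rewrite !divr1.
Qed.

Let Dp p i k w := Xb i (k%:R * (delta / p%:R)) w - K (k%:R * (delta / p%:R)) -
  Ut i (k%:R * (delta / p%:R)) w.

Let Dp_measurable p i k : (0 < p)%N -> (i < N)%N -> (k <= n * p)%N ->
  measurable_fun setT (Dp p i k).
Proof.
move=> p0 iN kn; have pR : (0 : R) < p%:R by rewrite ltr0n.
apply: measurable_funB; last first.
  exact: (euler_measurable Pc (FW iN) T0 b_lip s_lip n0 (FXt iN) (Xt_driven iN) (mY iN)).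
apply: measurable_funB => //; apply: (exo_X_measurable (FW iN) (XbS iN)).
have dl0 : 0 < delta / p%:R by rewrite divr_gt0.
apply/andP; split; first by rewrite mulr_ge0// ltW.
rewrite -[leRHS]nd mulrA ler_pdivrMr// [n%:R * _ * _]mulrAC -natrM.
by rewrite ler_wpM2r ?(ltW d0)// ler_nat.
Qed.

(* Letting [p] run through the powers of 2 gives the supremum over all times. *)
Lemma refined_error p i : (0 < p)%N -> (i < N)%N ->
  mean_le P (fun w => runmax (fun k => Dp p i k w - Dp p i 0%N w) (n * p) ^+ 2) (err_seq n).
Proof.
move=> p0 iN.
have KT : n%:R * delta <= T by rewrite nd.
have := error_max (FW iN) beta0 b_lip s_lip cx0 (XbS iN) (Xb_incr iN) d0 p0 KT
  (H := fun r => Xt i (grid T n r)) (A := fun k => Ut i (k%:R * (delta / p%:R)))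
  (e := fun k => err_rate * err_seq k + (6 * Cz / (m ^+ 2 * N%:R) + 3 * (kap2 * delta))) _ _ _ _.
rewrite Hsum => hh; apply: hh.
- move=> r /andP[r0 rK]; apply: (euler_coef_adapted (FW iN) T0 n0 (FXt iN)).
  by rewrite r0 (le_trans (ltW rK)).
- move=> k r kK kr; apply: cellH => //; first exact: ltnW.
  by move=> j jN; apply: grid_error => //; exact: ltnW.
- move=> k kK.
  exact: (euler_measurable Pc (FW iN) T0 b_lip s_lip n0 (FXt iN) (Xt_driven iN) (mY iN)).
- move=> k kK.
  by have [] := euler_cell Pc (FW iN) T0 b_lip s_lip n0 (FXt iN) (Xt_driven iN) p0 kK.
Qed.

Hypothesis K_cont : {within `[0, T], continuous K}.

Definition err_total := 3 * (err_seq n + (2 / m ^+ 2 * (Cz / N%:R) + 2 * (M / m) ^+ 2 * err_seq n) +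
  kap2 * delta).

Let dyad_dense t eta : 0 <= t <= T -> 0 < eta ->
  exists l k : nat, [/\ (k <= n * 2 ^ l)%N, 0 <= k%:R * (delta / (2 ^ l)%:R) <= T &
    `|k%:R * (delta / (2 ^ l)%:R) - t| < eta].
Proof.
move=> /andP[t0 tT] eta0.
have [l hl] : exists l : nat, delta / eta < (2 ^ l)%:R.
  exists (Num.trunc (delta / eta)).+1; apply: (lt_trans (truncnS_gt _)).
  by rewrite ltr_nat ltn_expl.
have pR : (0 : R) < (2 ^ l)%:R by rewrite ltr0n expn_gt0.
set dl := delta / (2 ^ l)%:R; have dl0 : 0 < dl by rewrite divr_gt0.
have dle : dl < eta.
  by rewrite /dl ltr_pdivrMr// mulrC -ltr_pdivrMr.
pose k := Num.trunc (t / dl).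
have /andP[k1 k2] : k%:R * dl <= t < k.+1%:R * dl.
  by rewrite -ler_pdivlMr// -ltr_pdivrMr// truncn_itv// divr_ge0// ltW.
have TE : (n * 2 ^ l)%:R * dl = T by rewrite /dl natrM mulrACA divff ?gt_eqF// mulr1.
exists l, k; split.
- by rewrite -(ler_nat R) -(ler_pM2r dl0) TE (le_trans k1).
- by rewrite mulr_ge0 ?(ltW dl0)//= (le_trans k1).
- rewrite distrC ger0_norm ?subr_ge0//; apply: lt_trans dle.
  by rewrite ltrBlDr; move: k2; rewrite -natr1 mulrDl mul1r addrC.
Qed.

(** Running maxima over dyadic refinements increase with the level, and by continuity their limit
    dominates the error on U at all times; the reflection contributes [rr n] and [kap] uniformly in
    time. Monotone convergence passes the bound of [refined_error] to the limit. *)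
Lemma sup_error i : (i < N)%N -> (sup_square_error P T (Xb i) (Xt i) <= err_total%:E)%E.
Proof.
move=> iN.
pose Q l w := runmax (fun k => Dp (2 ^ l) i k w - Dp (2 ^ l) i 0%N w) (n * 2 ^ l).
pose Fl l w := 3 * (Q l w ^+ 2 + rr n w ^+ 2 + kap ^+ 2).
have p0 l : (0 < 2 ^ l)%N by rewrite expn_gt0.
have kapE : kap ^+ 2 = kap2 * delta by rewrite sqr_sqrtr// mulr_ge0// ltW.
have rrn := rr_sqr (leqnn n) (fun j jN => grid_error (leqnn n) jN).
have FB l : mean_le P (Fl l) err_total.
  rewrite /err_total -kapE; apply: mean_leZ => //; apply: mean_leD; last exact: (mean_le_cst P (sqr_ge0 kap)).
  by apply: mean_leD; [exact: refined_error|exact: rrn].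
have Fmono l l' w : (l <= l')%N -> Fl l w <= Fl l' w.
  move=> /subnK <-; elim: (l' - l)%N => [|j IH]; first by rewrite add0n.
  apply: (le_trans IH); rewrite addSn; move: (j + l)%N => {l l' IH} l.
  apply: ler_wpM2l => //; rewrite -!addrA lerD2r; apply: lerXn2r; rewrite ?nnegrE ?runmax_ge0//.
  apply: runmax_le => k kn.
  have tE q : q%:R * (delta / (2 ^ l)%:R) = (2 * q)%:R * (delta / (2 ^ l.+1)%:R).
    by rewrite expnS !natrM; field; rewrite gt_eqF// ltr0n expn_gt0.
  have DE q : Dp (2 ^ l) i q w = Dp (2 ^ l.+1) i (2 * q) w by rewrite /Dp tE.
  rewrite !DE muln0.
  apply: (runmax_ge (fun k => Dp (2 ^ l.+1) i k w - Dp (2 ^ l.+1) i 0%N w)).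
  by rewrite expnS mulnCA leq_mul2l.
pose G l w := (Fl l w)%:E.
have mG l : measurable_fun setT (G l) by apply/measurable_EFinP; have [] := FB l.
have G0' l w : setT w -> (0 <= G l w)%E by have [_ hF _] := FB l; rewrite lee_fin.
have Gmono w : setT w -> {homo G^~ w : l l' / (l <= l')%N >-> (l <= l')%E}.
  by move=> _ l l' ll; rewrite lee_fin; exact: Fmono.
have intG : (\int[P]_w limn (G^~ w) <= err_total%:E)%E.
  have cv : (\int[P]_w G l w)%E @[l --> \oo] --> (\int[P]_w limn (G^~ w))%E.
    exact: (cvg_monotone_convergence measurableT mG G0' Gmono).
  rewrite -(cvg_lim (@ereal_hausdorff R) cv); apply: lime_le; first by apply/cvg_ex; eexists; exact: cv.
  by apply: nearW => l; have [_ _ hF] := FB l.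
have Glim w l : (G l w <= limn (G^~ w))%E.
  have nd' : nondecreasing_seq (G^~ w) by apply/nondecreasing_seqP => j; exact: Gmono.
  have := ereal_nondecreasing_cvgn nd' => /(cvg_lim (@ereal_hausdorff R)) ->.
  by apply: ereal_sup_ubound; exists l.
have key : \forall w \ae P, forall t, t \in `[0, T] ->
    (((Xb i t w - Xt i t w) ^+ 2)%:E <= limn (G^~ w))%E.
  have c1 := exo_cont (XbS iN).
  have c2 := euler_continuous T0 b_lip n0 (Xt_driven iN).
  have hs := exo_start (XbS iN); have hU := driven_start (FW iN) T0 (Xt_driven iN).
  apply: filterS2 (filterI c1 c2) (filterI (filterI hs hU) (Xt_error iN)) => w [Xc Uc] [[X0 U0] XE] t.
  rewrite in_itv/= => tT; have /andP[t0 tT'] := tT.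
  (* Index [n] makes the closed interval lie within the first [n.+1] cells, its right end
     included. *)
  have tn : t < n.+1%:R * delta.
    by rewrite (le_lt_trans tT')// -[ltLHS]nd ltr_pM2r// ltr_nat.
  have h1 := XE t n tT (leqnn n) tn.
  pose E s := Xb i s w - K s - Ut i s w.
  have Ec : {within `[0, T], continuous (fun s => E s ^+ 2)}.
    have Ec0 : {within `[0, T], continuous E}.
      move=> s; apply: cvgB; last exact: Uc.
      by apply: cvgB; [exact: Xc|exact: K_cont].
    by move=> s; apply: (cvgM (Ec0 s) (Ec0 s)).
  have c0 : (Xb i t w - Xt i t w) ^+ 2 <= 3 * (E t ^+ 2 + rr n w ^+ 2 + kap ^+ 2).
    rewrite -[leLHS]real_normK ?num_real//.
    rewrite -[E t ^+ 2]real_normK ?num_real//.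
    move: h1; rewrite -/(E t); set x := `|_ - _|; set y := `|E t|; set z := rr n w => h1.
    have x0 : 0 <= x by exact: normr_ge0.
    apply: (@le_trans _ _ ((y + z + kap) ^+ 2)).
      by apply: lerXn2r => //; rewrite nnegrE//; exact: le_trans h1.
    have := sqr_ge0 (y - z); have := sqr_ge0 (y - kap); have := sqr_ge0 (z - kap); nra.
  apply: (@le_trans _ _ (3 * (E t ^+ 2 + rr n w ^+ 2 + kap ^+ 2))%:E).
    by rewrite lee_fin.
  apply/lee_addgt0Pr => eps eps0.
  have tin : `[0, T]%classic t by rewrite /= in_itv/= tT.
  have eps3 : 0 < eps / 3 by rewrite divr_gt0.
  have [eta eta0 heta] := within_cont_dist Ec tin eps3.
  have [l [k [kn kT' kt]]] := dyad_dense tT eta0.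
  have := heta (k%:R * (delta / (2 ^ l)%:R)) _ kt.
  rewrite /= in_itv/= kT' => /(_ isT); rewrite ltr_norml => /andP[h2 _].
  apply: (@le_trans _ _ (G l w + eps%:E)%E); last by rewrite leeD2r.
  rewrite -EFinD lee_fin /Fl.
  have hQ : E (k%:R * (delta / (2 ^ l)%:R)) ^+ 2 <= Q l w ^+ 2.
    rewrite -[leLHS]real_normK ?num_real//; apply: lerXn2r; rewrite ?nnegrE ?runmax_ge0//.
    have D0 : Dp (2 ^ l) i 0%N w = 0 by rewrite /Dp mul0r X0 U0 subrr.
    have := runmax_ge (fun k => Dp (2 ^ l) i k w - Dp (2 ^ l) i 0%N w) kn.
    by rewrite {1}D0 subr0.
  move: h2 hQ; set x := E _ ^+ 2; set y := E t ^+ 2; set z := Q l w ^+ 2; lra.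
have [A [mA A0 sA]] := key.
rewrite /sup_square_error.
(* The domination holds off a null set, while the comparison of integrals is pointwise; adding +oo
   on that set repairs this without changing the integral. *)
apply: (@le_trans _ _ (\int[P]_w (limn (G^~ w) + (+oo * (\1_A w)%:E)))%E).
  apply: ge0_le_integral_any => [w _|w _|//|w _].
  - apply: (@le_trans _ _ ((Xb i 0 w - Xt i 0 w) ^+ 2)%:E); first by rewrite lee_fin sqr_ge0.
    by apply: ereal_sup_ubound; exists 0 => //=; rewrite in_itv/= lexx ltW.
  - apply: adde_ge0; first by apply: le_trans (Glim w 0%N); exact: G0'.
    by apply: mule_ge0 => //; rewrite lee_fin.
  - have [wA|wA] := pselect (A w).
      rewrite indicE mem_set// mule1 addey ?leey//.
      by rewrite gt_eqF// (lt_le_trans _ (Glim w 0%N))// ltNye.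
    rewrite indicE memNset// mule0 adde0.
    apply: ub_ereal_sup => _ [t /= tT <-]; apply: contrapT => hn; apply: wA; apply: sA => /= h'.
    by apply: hn; apply: h'.
have mlim : measurable_fun setT (fun w => limn (G^~ w)).
  rewrite [X in measurable_fun _ X](_ : _ = (fun w => limn_esup (G^~ w))).
    exact: measurable_fun_limn_esup.
  apply/funext => w; rewrite is_cvg_limn_esupE//.
  have nd' : nondecreasing_seq (G^~ w) by apply/nondecreasing_seqP => j; exact: Gmono.
  by apply/cvg_ex; eexists; exact: (ereal_nondecreasing_cvgn nd').
have mind : measurable_fun setT (fun w => +oo * (\1_A w : R)%:E)%E.
  by apply: measurable_funeM; apply/measurable_EFinP; exact: measurable_indic.
rewrite ge0_integralD//.
- rewrite ge0_integralZl//.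
    by rewrite integral_indic// setIT [X in (_ * X)%E](_ : _ = 0%E) ?mule0 ?adde0//; exact: A0.
  by apply/measurable_EFinP; exact: measurable_indic.
- by move=> w _; apply: le_trans (Glim w 0%N); exact: G0'.
Qed.

End error_recursion.

(** * Constants uniform in the numbers of particles and of steps *)

Section err_bound.
Context (R : realType) (beta T m M cx kap2 Cz : R).
Context (T0 : 0 < T) (m0 : 0 < m) (M0 : 0 < M) (cx0 : 0 <= cx) (kap20 : 0 <= kap2) (Cz0 : 0 <= Cz).

(** The exponential bounds (1 + x / n)^n uniformly in n. *)
Definition seq_bound := (cx * T + 6 * Cz / m ^+ 2 + 3 * kap2 * T) / err_rate m M *
  expR (err_const beta T * T * err_rate m M).

Definition err_bound :=
  3 * ((1 + 2 * (M / m) ^+ 2) * seq_bound + 2 / m ^+ 2 * Cz + kap2 * T).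

Let rate0 : 0 < err_rate m M.
Proof. by rewrite mulr_gt0// ltr_pwDl// mulr_ge0// sqr_ge0. Qed.

Let src0 : 0 <= cx * T + 6 * Cz / m ^+ 2 + 3 * kap2 * T.
Proof.
have T0' := ltW T0.
apply: addr_ge0; first apply: addr_ge0.
- exact: mulr_ge0.
- by apply: divr_ge0; [exact: mulr_ge0|exact: sqr_ge0].
- by rewrite mulr_ge0// mulr_ge0.
Qed.

Lemma err_total_le (N n : nat) : (0 < N)%N -> (0 < n)%N ->
  err_total beta T m M cx kap2 Cz N n <= err_bound * (n%:R^-1 + N%:R^-1).
Proof.
move=> N0 n0.
have nR : (0 : R) < n%:R by rewrite ltr0n.
have NR : (0 : R) < N%:R by rewrite ltr0n.
set a := n%:R^-1; set c := N%:R^-1.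
have a0 : 0 < a by rewrite invr_gt0.
have c0 : 0 < c by rewrite invr_gt0.
have T0' := ltW T0.
have h6 : 0 <= 6 * Cz / m ^+ 2 by apply: divr_ge0; [exact: mulr_ge0|exact: sqr_ge0].
have srcE : 0 <= err_src T m cx kap2 Cz N n <= (cx * T + 6 * Cz / m ^+ 2 + 3 * kap2 * T) * (a + c).
  have -> : err_src T m cx kap2 Cz N n = cx * T * a + 6 * Cz / m ^+ 2 * c + 3 * kap2 * T * a.
    by rewrite /err_src /a /c; field; rewrite !gt_eqF.
  have h1 : 0 <= cx * T by exact: mulr_ge0.
  have h3 : 0 <= 3 * kap2 * T by rewrite mulr_ge0// mulr_ge0.
  set x := cx * T in h1 *; set y := 6 * Cz / m ^+ 2 in h6 *; set z := 3 * kap2 * T in h3 *.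
  have := mulr_ge0 h1 (ltW a0); have := mulr_ge0 h1 (ltW c0).
  have := mulr_ge0 h6 (ltW a0); have := mulr_ge0 h6 (ltW c0).
  have := mulr_ge0 h3 (ltW a0); have := mulr_ge0 h3 (ltW c0).
  by move=> *; apply/andP; split; lra.
have powE : (1 + err_const beta T * (T / n%:R) * err_rate m M) ^+ n - 1 <=
    expR (err_const beta T * T * err_rate m M).
  have ec0 := err_const_ge0 beta T0.
  have x0 : 0 <= err_const beta T * (T / n%:R) * err_rate m M.
    by rewrite mulr_ge0 ?(ltW rate0)// mulr_ge0// divr_ge0// ltW.
  have -> : err_const beta T * T * err_rate m M = n%:R * (err_const beta T * (T / n%:R) * err_rate m M).
    by field; rewrite gt_eqF.
  rewrite expRM_natl; apply: (@le_trans _ _ ((1 + err_const beta T * (T / n%:R) * err_rate m M) ^+ n)).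
    by rewrite lerBlDr lerDl.
  apply: lerXn2r; rewrite ?nnegrE ?expR_ge0 ?addr_ge0//; exact: expR_ge1Dx.
have seqE : err_seq beta T m M cx kap2 Cz N n n <= seq_bound * (a + c).
  rewrite /err_seq /seq_bound.
  have /andP[s0 s1] := srcE.
  apply: (@le_trans _ _ (err_src T m cx kap2 Cz N n / err_rate m M * expR (err_const beta T * T * err_rate m M))).
    by apply: ler_wpM2l => //; rewrite divr_ge0// ltW.
  rewrite [leRHS]mulrAC; apply: ler_wpM2r; first exact: expR_ge0.
  by rewrite mulrAC ler_wpM2r// invr_ge0 ltW.
rewrite /err_total /err_bound -/c.
have M2 : 0 <= 2 * (M / m) ^+ 2 by rewrite mulr_ge0// sqr_ge0.
have m2 : 0 <= 2 / m ^+ 2 * Cz by rewrite mulr_ge0// divr_ge0// sqr_ge0.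
have -> : kap2 * (T / n%:R) = kap2 * T * a by rewrite mulrA.
have k0 : 0 <= kap2 * T by rewrite mulr_ge0.
have e1 : 2 / m ^+ 2 * (Cz * c) = 2 / m ^+ 2 * Cz * c by rewrite mulrA.
rewrite e1; move: M2 m2 k0 seqE; set u := 2 * _ ^+ 2; set v := 2 / _ * Cz; set z := kap2 * T.
set s := err_seq _ _ _ _ _ _ _ _ _ _; set S := seq_bound => u0 v0 z0 sS.
have h1 : u * s <= u * (S * (a + c)) by exact: ler_wpM2l.
have := mulr_ge0 v0 (ltW a0); have := mulr_ge0 z0 (ltW c0) => h2 h3.
nra.
Qed.

End err_bound.

(** * The sampling error at grid times *)

Section sampling.
Context d (Omega : measurableType d) (R : realType) (P : probability Omega R).
Context (Pc : measure_is_complete P).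
Context (b sigma h : R -> R) (beta T m M y4 : R).
Context (beta0 : 0 <= beta) (T0 : 0 < T) (m0 : 0 < m).
Hypothesis b_lip : forall x y, `|b x - b y| <= beta * `|x - y|.
Hypothesis s_lip : forall x y, `|sigma x - sigma y| <= beta * `|x - y|.
Hypothesis b_grow : forall x, `|b x| <= beta * (1 + `|x|).
Hypothesis s_grow : forall x, `|sigma x| <= beta * (1 + `|x|).
Hypothesis h_incr : bi_incr m M h.
Context (K : R -> R).
Hypothesis K4 : forall r, 0 <= r <= T -> 0 <= K r <= 1 + K_bound4 h beta T m M y4.
Hypothesis K_incr : forall s t, 0 <= s -> s < t -> t <= T ->
  (K t - K s) ^+ 2 <= K_incr2 h beta T m M y4 * (t - s).
Context (Y : nat -> Omega -> R) (W : nat -> R -> Omega -> R) (Xb : nat -> R -> Omega -> R).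
Hypothesis Y_measurable : forall i, measurable_fun setT (Y i).
Hypothesis W_bm : forall i, brownian_motion P (W i).
Hypothesis Y_indep : mutually_indep_systems P (fun i => g_sigma_algebra_preimage (Y i)).
Hypothesis W_indep : mutually_indep_systems P (fun i => sigma_process (W i)).
Hypothesis WY_indep : indep_systems P (sigma_rvs setT Y) <<s \bigcup_i sigma_process (W i) >>.
Hypothesis Y4 : forall i, mean_le P (fun w => Y i w ^+ 4) y4.
Hypothesis XbS : forall i,
  exo_sde P (aug_filtration1 P (Y i) (W i)) (W i) b sigma T (Y i) (Xb i) K.
Context (Phi : R -> R -> R) (g : R -> R) (cg : R).
Hypothesis PhiE : forall i t x, 0 <= t <= T ->
  shift_mean h P (fun w => Xb i t w - K t) x = Phi t x.
Hypothesis cg0 : 0 <= cg.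
Hypothesis g_incr : forall s t, 0 <= s -> s < t -> t <= T ->
  `|g t - g s| <= cg * lam_incr h beta T m M y4 s t.

Lemma aug_filtration1E i : aug_filtration1 P (Y i) (W i) = augJ P Y W [set i].
Proof.
by apply: aug_filtrationE => [_|j ->]; [exists i|exists tt].
Qed.

Lemma augJ_fbm1 i : fbm P (augJ P Y W [set i]) (W i).
Proof. exact: (augJ_fbm Y_measurable W_bm Y_indep W_indep WY_indep Pc). Qed.

Let XbJ i : exo_sde P (augJ P Y W [set i]) (W i) b sigma T (Y i) (Xb i) K.
Proof. by have := XbS i; rewrite aug_filtration1E. Qed.

Let M0 : 0 < M := bi_incr_M0 m0 h_incr.
Let U i t w := Xb i t w - K t.

Let mU i t : 0 <= t <= T -> measurable_fun setT (U i t).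
Proof. by move=> tT; exact: (exo_U_measurable (augJ_fbm1 i) (XbJ i) tT). Qed.

Let U_abs i t : 0 <= t <= T -> exists a, mean_le P (fun w => `|U i t w|) a.
Proof.
exact: (exo_U_abs beta0 T0 m0 b_lip s_lip b_grow s_grow h_incr (augJ_fbm1 i) (XbJ i) (Y4 i) K4).
Qed.

Let hU_integrable i t x : 0 <= t <= T -> P.-integrable setT (fun w => (h (x + U i t w))%:E).
Proof.
by move=> tT; have [a ha] := U_abs i tT; exact: (shift_integrable m0 h_incr x (mU i tT) ha).
Qed.

Let hU_mean i t x : 0 <= t <= T -> (\int[P]_w (h (x + U i t w))%:E = (Phi t x)%:E)%E.
Proof.
move=> tT; have [a ha] := U_abs i tT.
by rewrite -(PhiE i x tT) (shift_meanE m0 h_incr x (mU i tT) ha).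
Qed.

Let y40 : 0 <= y4 := mean_le_ge0 (Y4 0).
Let U40 : 0 < U_incr4 h beta T m M y4 := U_incr4_gt0 beta0 T0 m0 h_incr y40.
(** Increments of h(g_s + U_s) are at most M (|dU| + cg l), with l the value of [lam_incr]; the
    factor 2 lets the fourth power of [L * l] dominate the two terms produced by [pow4D_le]. *)
Let L := 2 * M * (cg + 1).

Let L0 : 0 < L. Proof. by rewrite mulr_gt0 ?mulr_gt0// ltr_wpDl. Qed.

(** 16 and 328 come from [averaged_max], and 12 from 12^2 = 144, which exceeds the factor 136 of
    [center4]. *)
Definition sampling_const :=
  16 * (12 * (M ^+ 2 * Num.sqrt (U_bound4 h beta T m M y4 + 1))) +
  328 * (12 * (2 * M * (cg + 1)) ^+ 2 * Num.sqrt (U_incr4 h beta T m M y4) * T).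

Context (N n : nat) (N0 : (0 < N)%N) (n0 : (0 < n)%N).
Let delta := T / n%:R.
Let nR : (0 : R) < n%:R. Proof. by rewrite ltr0n. Qed.
Let d0 : 0 < delta. Proof. exact: divr_gt0. Qed.
Let nd : n%:R * delta = T. Proof. by rewrite /delta mulrC divfK// gt_eqF. Qed.
Let kT k : (k <= n)%N -> 0 <= k%:R * delta <= T.
Proof.
by move=> kn; rewrite mulr_ge0 ?(ltW d0)//= -[leRHS]nd ler_wpM2r ?(ltW d0)// ler_nat.
Qed.

Let Z i k w := h (g (k%:R * delta) + (Xb i (k%:R * delta) w - K (k%:R * delta))) -
  Phi (k%:R * delta) (g (k%:R * delta)).

Let mh := bi_incr_measurable m0 h_incr.

Let mhU i t x : 0 <= t <= T -> measurable_fun setT (fun w => h (x + U i t w)).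
Proof.
move=> tT; apply: (measurableT_comp mh); apply: measurable_funD => //; exact: mU.
Qed.

Let Z_mean0 i k : (k <= n)%N -> mean0 P (Z i k).
Proof.
move=> kn; have tT := kT kn.
have iU := hU_integrable i (g (k%:R * delta)) tT.
have ic : P.-integrable setT (cst (Phi (k%:R * delta) (g (k%:R * delta)))%:E).
  exact: finite_measure_integrable_cst.
split; first exact: (integrableB measurableT iU ic).
rewrite /Z; under eq_integral do rewrite EFinB.
rewrite (integralB measurableT iU ic) hU_mean// integral_cst//.
rewrite [X in (_ - _ * X)%E](_ : _ = 1%E); last exact: probability_setT.
by rewrite mule1 subee.
Qed.

Let sqrtX4 (x : R) : 0 <= x -> Num.sqrt (Num.sqrt x) ^+ 4 = x.
Proof. by move=> x0; rewrite (exprM _ 2 2) !sqr_sqrtr ?sqrtr_ge0. Qed.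

Let Z_start4 i : mean_le P (fun w => Z i 0%N w ^+ 4)
  ((12 * (M ^+ 2 * Num.sqrt (U_bound4 h beta T m M y4 + 1))) ^+ 2).
Proof.
have tT := kT (leq0n n); set t := 0%:R * delta in tT.
have Ub0 : 0 <= U_bound4 h beta T m M y4 by exact: U_bound4_ge0 m0 h_incr y40.
have U4 := exo_U4 beta0 T0 b_lip s_lip b_grow s_grow (augJ_fbm1 i) (XbJ i) (Y4 i) K4 tT.
pose lam := M * Num.sqrt (Num.sqrt (U_bound4 h beta T m M y4 + 1)).
have lam0 : 0 < lam by rewrite mulr_gt0// !sqrtr_gt0 ltr_wpDl.
have lam2 : lam ^+ 2 = M ^+ 2 * Num.sqrt (U_bound4 h beta T m M y4 + 1).
  by rewrite exprMn sqr_sqrtr ?sqrtr_ge0.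
have D4 : mean_le P (fun w => (h (g t + U i t w) - h (g t)) ^+ 4) (lam ^+ 4).
  have lam4 : M ^+ 4 * U_bound4 h beta T m M y4 <= lam ^+ 4.
    by rewrite /lam exprMn sqrtX4 ?ler_wpM2l ?exprn_ge0 ?lerDl ?addr_ge0// ltW.
  apply: (mean_le_trans lam4); apply: (mean_le_le _ _ _ (mean_leZ (exprn_ge0 4 (ltW M0)) U4)).
  - by apply: measurable_funX; apply: measurable_funB => //; exact: mhU.
  - by move=> w; exact: exprn_even_ge0.
  - move=> w; rewrite -exprMn -[leLHS]ger0_norm ?exprn_even_ge0// -[leRHS]ger0_norm ?exprn_even_ge0//.
    rewrite !normrX; apply: lerXn2r; rewrite ?nnegrE//.
    have := bi_incr_lip m0 h_incr (g t + U i t w) (g t).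
    have -> : g t + U i t w - g t = U i t w by rewrite addrC addKr.
    by rewrite normrM (gtr0_norm M0).
have mD : measurable_fun setT (fun w => h (g t + U i t w) - h (g t)).
  by apply: measurable_funB => //; exact: mhU.
have e : (\int[P]_w (h (g t + U i t w) - h (g t))%:E = (Phi t (g t) - h (g t))%:E)%E.
  under eq_integral do rewrite EFinB.
  rewrite (integralB measurableT (hU_integrable i (g t) tT)); last exact: finite_measure_integrable_cst.
  rewrite hU_mean// integral_cst// [X in (_ - _ * X)%E](_ : _ = 1%E) ?mule1//; exact: probability_setT.
have h1 := center4 mD lam0 D4 e.
rewrite -lam2; have -> : (fun w => Z i 0%N w ^+ 4) =
    (fun w => (h (g t + U i t w) - h (g t) - (Phi t (g t) - h (g t))) ^+ 4).
  by apply/funext => w; congr (_ ^+ 4); rewrite /Z -/t /U; ring.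
apply: mean_le_trans h1; have -> : (12 * lam ^+ 2) ^+ 2 = 144 * lam ^+ 4 by ring.
by apply: ler_wpM2r; rewrite ?ler_nat// exprn_ge0// ltW.
Qed.

Let Z_incr4 i j k : (j < k <= n)%N -> mean_le P (fun w => (Z i k w - Z i j w) ^+ 4)
  ((12 * L ^+ 2 * Num.sqrt (U_incr4 h beta T m M y4) * delta * (k - j)%:R) ^+ 2).
Proof.
move=> /andP[jk kn]; have jn := leq_trans (ltnW jk) kn.
have tT := kT kn; have sT := kT jn.
have st : j%:R * delta < k%:R * delta by rewrite ltr_pM2r// ltr_nat.
have kjE : k%:R * delta - j%:R * delta = delta * (k - j)%:R.
  by rewrite -mulrBl mulrC natrB// ltnW.
rewrite /Z; set t := k%:R * delta in tT st kjE *; set s := j%:R * delta in sT st kjE *.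
have /andP[s0 _] := sT; have /andP[_ tT'] := tT.
have U4 := exo_U_incr4 beta0 T0 b_lip s_lip b_grow s_grow (augJ_fbm1 i) (XbJ i) (Y4 i) K4 s0 st tT'.
pose l := lam_incr h beta T m M y4 s t.
have l0 : 0 < l by exact: (lam_incr_gt0 beta0 T0 m0 h_incr (Y4 0) st).
have l4 : l ^+ 4 = U_incr4 h beta T m M y4 * (t - s) ^+ 2.
  exact: (lam_incr4 beta0 T0 m0 h_incr (Y4 0) st).
have l2 : l ^+ 2 = Num.sqrt (U_incr4 h beta T m M y4) * (t - s) by exact: lam_incr2.
have mD : measurable_fun setT (fun w => h (g t + U i t w) - h (g s + U i s w)).
  by apply: measurable_funB; exact: mhU.
have D4 : mean_le P (fun w => (h (g t + U i t w) - h (g s + U i s w)) ^+ 4) ((L * l) ^+ 4).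
  have h8 : 0 <= 8 * M ^+ 4 by rewrite mulr_ge0// exprn_ge0// ltW.
  have h9 : 0 <= M ^+ 4 * (8 * (cg * l) ^+ 4).
    by rewrite mulr_ge0 ?exprn_ge0 ?(ltW M0)// mulr_ge0// exprn_ge0// mulr_ge0// ltW.
  have LE : 8 * M ^+ 4 * (U_incr4 h beta T m M y4 * (t - s) ^+ 2) + M ^+ 4 * (8 * (cg * l) ^+ 4) <= (L * l) ^+ 4.
    rewrite -l4 /L; have -> : 8 * M ^+ 4 * l ^+ 4 + M ^+ 4 * (8 * (cg * l) ^+ 4) =
      (M * l) ^+ 4 * (8 * (1 + cg ^+ 4)) by ring.
    have -> : (2 * M * (cg + 1) * l) ^+ 4 = (M * l) ^+ 4 * (16 * (cg + 1) ^+ 4) by ring.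
    apply: ler_wpM2l; first exact: exprn_even_ge0.
    have -> : 16 * (cg + 1) ^+ 4 = 8 * (1 + cg ^+ 4) + (8 + 8 * cg ^+ 4 + 64 * cg ^+ 3 + 96 * cg ^+ 2 + 64 * cg) by ring.
    rewrite lerDl; do 4?[apply: addr_ge0]; rewrite ?mulr_ge0 ?exprn_ge0//; exact: ler0n.
  apply: (mean_le_trans LE).
  apply: (mean_le_le _ _ _ (mean_leD (mean_leZ h8 U4) (mean_le_cst P h9))).
  - exact: measurable_funX.
  - by move=> w; exact: exprn_even_ge0.
  - move=> w /=; set dU := Xb i t w - K t - (Xb i s w - K s).
    have -> : 8 * M ^+ 4 * dU ^+ 4 + M ^+ 4 * (8 * (cg * l) ^+ 4) =
        M ^+ 4 * (8 * `|dU| ^+ 4 + 8 * (cg * l) ^+ 4).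
      rewrite -[`|dU| ^+ 4]normrX ger0_norm ?exprn_even_ge0//; ring.
    apply: (@le_trans _ _ ((M * (`|dU| + cg * l)) ^+ 4)).
      rewrite -[leLHS]ger0_norm ?exprn_even_ge0// normrX; apply: lerXn2r; rewrite ?nnegrE//.
        by rewrite mulr_ge0 ?(ltW M0)// addr_ge0// mulr_ge0// ltW.
      apply: (le_trans (bi_incr_lip m0 h_incr _ _)); apply: ler_wpM2l; first exact: ltW.
      have -> : g t + U i t w - (g s + U i s w) = dU + (g t - g s) by rewrite /dU /U; ring.
      by apply: (le_trans (ler_normD _ _)); rewrite lerD2l; exact: g_incr.
    by rewrite exprMn; apply: ler_wpM2l; [rewrite exprn_ge0// ltW|exact: pow4D_le].
have e : (\int[P]_w (h (g t + U i t w) - h (g s + U i s w))%:E = (Phi t (g t) - Phi s (g s))%:E)%E.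
  under eq_integral do rewrite EFinB.
  by rewrite (integralB measurableT (hU_integrable i (g t) tT) (hU_integrable i (g s) sT)) !hU_mean.
have h1 := center4 mD (mulr_gt0 L0 l0) D4 e.
have -> : (fun w => (h (g t + (Xb i t w - K t)) - Phi t (g t) - (h (g s + (Xb i s w - K s)) - Phi s (g s))) ^+ 4) =
    (fun w => (h (g t + U i t w) - h (g s + U i s w) - (Phi t (g t) - Phi s (g s))) ^+ 4).
  by apply/funext => w; congr (_ ^+ 4); rewrite /U; ring.
apply: mean_le_trans h1.
have -> : (12 * L ^+ 2 * Num.sqrt (U_incr4 h beta T m M y4) * delta * (k - j)%:R) ^+ 2 = 144 * (L * l) ^+ 4.
  rewrite -[_ * delta * _]mulrA -kjE -[_ * _ * (t - s)]mulrA -l2; ring.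
by apply: ler_wpM2r; rewrite ?ler_nat// exprn_ge0// mulr_ge0// ltW.
Qed.

Lemma sampling_max : mean_le P
  (fun w => runmax (fun k => N%:R^-1 * \sum_(0 <= i < N) Z i k w) n ^+ 2) (sampling_const / N%:R).
Proof.
have q0 : 0 < 12 * (M ^+ 2 * Num.sqrt (U_bound4 h beta T m M y4 + 1)).
  rewrite mulr_gt0// mulr_gt0 ?exprn_gt0// sqrtr_gt0 ltr_wpDl//.
  exact: U_bound4_ge0 m0 h_incr y40.
have q1 : 0 < 12 * L ^+ 2 * Num.sqrt (U_incr4 h beta T m M y4) * delta.
  by rewrite mulr_gt0// mulr_gt0 ?sqrtr_gt0// mulr_gt0// exprn_gt0.
(* The filtrations are taken at the final time, so that they contain the whole path of a copy on
   [0, T]; those of copy i and of the copies before it have disjoint index sets. *)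
have := averaged_max N0 n0 (G := fun i => augJ P Y W [set i] T)
  (G' := fun i => augJ P Y W [set j | (j < i)%N] T) (Z := Z) q0 q1 _ _ _ _ _ _ _ Z_start4 Z_incr4.
rewrite /sampling_const -/L.
have -> : 12 * L ^+ 2 * Num.sqrt (U_incr4 h beta T m M y4) * delta * n%:R =
  12 * L ^+ 2 * Num.sqrt (U_incr4 h beta T m M y4) * T by rewrite -mulrA [delta * _]mulrC nd.
apply.
- by move=> i; exact: smallest_sigma_algebra.
- by move=> i; exact: smallest_sigma_algebra.
- by move=> i; exact: (augJ_measurable Y_measurable W_bm Pc).
- move=> i j ji; apply: sub_smallest2r; first exact: smallest_sigma_algebra.
  move=> A [HA|[[k -> HA]|[k -> HA]]]; first by left.
    by right; left; exists j.
  by right; right; exists j.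
- move=> i; apply: (augJ_indep Y_measurable W_bm Y_indep W_indep WY_indep Pc).
  by rewrite -subset0 => k [/= ki kE]; move: ki; rewrite kE ltnn.
- move=> i k kn; have tT := kT kn; have sG := fbm_sa (augJ_fbm1 i) (ltW T0).
  have /andP[t0 tT'] := tT.
  have XG := rv_wrtS (fbm_mono (augJ_fbm1 i) t0 tT') (exo_adapted (XbJ i) tT).
  apply: rv_wrtB => //; last exact: rv_wrt_cst.
  apply: rv_wrt_comp => //; apply: rv_wrtD => //; first exact: rv_wrt_cst.
  by apply: rv_wrtB => //; exact: rv_wrt_cst.
- by move=> i k; exact: Z_mean0.
Qed.

End sampling.

(** * The error bound for the particle system *)

Section particle_error.
Context d (Omega : measurableType d) (R : realType) (P : probability Omega R).
Context (Pc : measure_is_complete P).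
Context (b sigma h : R -> R) (beta T m M y4 : R) (X0 : {RV P >-> R}).
Context (beta0 : 0 <= beta) (T0 : 0 < T) (m0 : 0 < m).
Hypothesis b_lip : forall x y, `|b x - b y| <= beta * `|x - y|.
Hypothesis s_lip : forall x y, `|sigma x - sigma y| <= beta * `|x - y|.
Hypothesis b_grow : forall x, `|b x| <= beta * (1 + `|x|).
Hypothesis s_grow : forall x, `|sigma x| <= beta * (1 + `|x|).
Hypothesis h_incr : bi_incr m M h.
Hypothesis X04 : mean_le P (fun w => X0 w ^+ 4) y4.

Lemma distribution_mean4 (Z : {RV P >-> R}) :
  (forall A : set R, measurable A -> distribution P Z A = distribution P X0 A) ->
  mean_le P (fun w => Z w ^+ 4) y4.
Proof.
move=> ZX; have [mX _ hX] := X04; split.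
- exact: measurable_funX.
- by move=> w; exact: exprn_even_ge0.
have mp : measurable_fun setT (fun x : R => (x ^+ 4)%:E).
  by apply/measurable_EFinP; exact: exprn_measurable.
have p0 (x : R) : (0 <= (x ^+ 4)%:E)%E by rewrite lee_fin exprn_even_ge0.
have h1 := ge0_integral_distribution Z mp p0.
have h2 := ge0_integral_distribution X0 mp p0.
apply: le_trans hX; rewrite -[leLHS]/(\int[P]_w ((fun x : R => (x ^+ 4)%:E) \o Z) w)%E.
rewrite -[leRHS]/(\int[P]_w ((fun x : R => (x ^+ 4)%:E) \o X0) w)%E -h1 -h2.
by rewrite (eq_measure_integral (distribution P X0))// => A mA _; exact: ZX.
Qed.

Let cx := X_incr2 h beta T m M y4.
Let kap2 := K_incr2 h beta T m M y4.
Let cg := 2 * (M / m).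
Let Cz := sampling_const h beta T m M y4 cg.

(** The copies are driven by the running supremum of [G0] over the laws of [U]; flatness identifies
    it with K, so each copy solves the same equation with exogenous K. The copies are then moved to
    the joint filtration of the N particles, in which the Euler system is written. *)
Lemma particle_error (B X U : R -> Omega -> R) (K : cumulative R R)
    (Y : nat -> {RV P >-> R}) (W Xb : nat -> R -> Omega -> R) :
  mean_reflected_setting b sigma h X0 B X U K Y W Xb ->
  forall (N n : nat) (Xt Ut : nat -> R -> Omega -> R),
  (0 < N)%N -> (0 < n)%N ->
  euler_system P b sigma h T N n (fun i => Y i : Omega -> R) W Xt Ut ->
  forall i : nat, (i < N)%N ->
  (sup_square_error P T (Xb i) (Xt i) <=
    (err_bound beta T m M cx kap2 Cz * (n%:R^-1 + N%:R^-1))%:E)%E.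
Proof.
move=> S N n Xt Ut N0 n0 ES i iN.
have mX0 : measurable_fun setT (X0 : Omega -> R) by exact: measurable_funPT.
have mY j : measurable_fun setT (Y j : Omega -> R) by exact: measurable_funPT.
have Y4 j : mean_le P (fun w => Y j w ^+ 4) y4.
  by apply: distribution_mean4 => A mA; exact: (setting_Y_law S).
have FB := fbm_single Pc mX0 (setting_B S) (setting_B_X0 S).
have FS := setting_X S.
have K4 := flat_K4 Pc beta0 T0 m0 b_lip s_lip b_grow s_grow h_incr FB X04 FS.
have K_incr := flat_K_incr2 Pc beta0 T0 m0 b_lip s_lip b_grow s_grow h_incr FB X04 FS.
have XS := flat_exo Pc T0 b_lip s_lip FB FS.
(* The equation of a copy concerns all times, beyond T as well, hence the horizon t + 1. *)
have K_sup t : 0 <= t -> K t = sup [set gfun P h X K s | s in `[0, t]].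
  move=> t0; have t1 : 0 < t + 1 by rewrite ltr_wpDl.
  apply: (flat_K_sup_gfun Pc beta0 t1 m0 b_lip s_lip b_grow s_grow h_incr FB X04 FS).
  by rewrite t0 lerDl ler01.
have mu_sup t : 0 <= t -> sup [set G0 h (pushforward P (U s)) | s in `[0, t]] = K t.
  move=> t0; rewrite (K_sup t t0); congr sup; apply: eq_imagel => s /=.
  rewrite in_itv/= => /andP[s0 st]; have t1 : 0 < t + 1 by rewrite ltr_wpDl.
  apply: (flat_G0 Pc beta0 t1 m0 b_lip s_lip b_grow s_grow h_incr FB X04 FS).
  by rewrite s0 (le_trans st)// lerDl ler01.
pose YY j : Omega -> R := Y j.
have Wbm := setting_W S.
have FJ j : fbm P (augJ P YY W [set j]) (W j).
  exact: (augJ_fbm1 Pc mY Wbm (setting_Y_indep S) (setting_W_indep S) (setting_W_Y S)).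
have F1 j : fbm P (aug_filtration1 P (YY j) (W j)) (W j) by rewrite aug_filtration1E; exact: FJ.
have XbS j : exo_sde P (aug_filtration1 P (YY j) (W j)) (W j) b sigma T (YY j) (Xb j) K.
  have [Xa Xc [U' U'd U'E]] := setting_Xbar S j.
  apply: (driven_exo Pc (F1 j) b_lip s_lip T0 (U'd T T0) Xa Xc).
  by apply: filterS U'E => w hw t t0; rewrite hw// mu_sup.
pose Phi t x := shift_mean h P (fun w => X t w - K t) x.
have PhiE j t x : 0 <= t <= T -> shift_mean h P (fun w => Xb j t w - K t) x = Phi t x.
  move=> tT; apply/esym.
  apply: (exo_shift_mean_eq beta0 T0 m0 b_lip s_lip b_grow s_grow h_incr K4 K_incr FB (F1 j)
    XS (XbS j) X04 (Y4 j)) => //; try exact: aug_filtration1_start.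
  by move=> A mA; exact/esym/(setting_Y_law S).
have gi s t := gfun_incr beta0 T0 m0 b_lip s_lip b_grow s_grow h_incr FB XS X04 K4 (s := s) (t := t).
have cg0 : 0 <= cg.
  by apply: mulr_ge0 => //; apply: divr_ge0; apply: ltW => //; exact: (bi_incr_M0 m0 h_incr).
have g_incr s t : 0 <= s -> s < t -> t <= T ->
    `|gfun P h X K t - gfun P h X K s| <= cg * lam_incr h beta T m M y4 s t.
  move=> s0 st tT; apply: gi => //.
    by rewrite s0 (le_trans (ltW st)).
  by rewrite tT (le_trans s0 (ltW st)).
have zb := sampling_max Pc beta0 T0 m0 b_lip s_lip b_grow s_grow h_incr K4 mY Wbm
  (setting_Y_indep S) (setting_W_indep S) (setting_W_Y S) Y4 XbS PhiE cg0 g_incr N0 n0.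
pose FN := aug_filtration P (fun j : 'I_N => Y j : Omega -> R) (fun j : 'I_N => W j).
have FNE : FN = augJ P YY W [set j | (j < N)%N].
  apply: aug_filtrationE => [j|j /= jN]; first by exists (j : nat) => //=.
  by exists (Ordinal jN).
have FNf j : (j < N)%N -> fbm P FN (W j).
  move=> jN; rewrite FNE.
  exact: (augJ_fbm mY Wbm (setting_Y_indep S) (setting_W_indep S) (setting_W_Y S) Pc).
have XbN j : (j < N)%N -> exo_sde P FN (W j) b sigma T (YY j) (Xb j) K.
  move=> jN; apply: exo_sde_sub (XbS j) => t _; rewrite aug_filtration1E FNE.
  apply: sub_smallest2r; first exact: smallest_sigma_algebra.
  move=> A [HA|[[k -> HA]|[k -> HA]]]; first by left.
    by right; left; exists j.
  by right; right; exists j.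
have sU0 : 0 <= Num.sqrt (U_incr4 h beta T m M y4) by exact: sqrtr_ge0.
apply: le_trans (sup_error Pc beta0 T0 m0 (cx := cx) (kap2 := kap2) (Cz := Cz) _ _ b_lip s_lip h_incr
  N0 n0 FNf XbN _ (fun j _ => mY j) _ (Xt := Xt) (Ut := Ut) _ _ (g := gfun P h X K) (Phi := Phi) _ _ _ _ _ zb _ iN) _.
- exact: X_incr2_ge0.
- exact: K_incr2_ge0.
- move=> j jN s t s0 st tT.
  exact: (exo_X_sqr beta0 T0 m0 b_lip s_lip b_grow s_grow h_incr K4 K_incr (FNf j jN) (XbN j jN) (Y4 j)).
- by move=> j jN; have [] := ES j jN.
- by move=> j jN; have [] := ES j jN.
- by move=> j jN; have [] := ES j jN.
- by move=> t /andP[t0 _]; exact: K_sup.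
- move=> t /andP[t0 tT]; exists (gfun P h X K 0 + cg * Num.sqrt (Num.sqrt (U_incr4 h beta T m M y4) * T)).
  move=> _ [s /= sT <-]; have /andP[s0 st] : 0 <= s <= t by move: sT; rewrite in_itv.
  have [{}s0|s0'] := ltP 0 s; last first.
    have -> : s = 0 by apply/eqP; rewrite eq_le s0'.
    by rewrite lerDl mulr_ge0// sqrtr_ge0.
  have := g_incr 0 s (lexx _) s0 (le_trans st tT); rewrite ler_norml lerBlDl => /andP[_ h1].
  apply: (le_trans h1); rewrite lerD2l; apply: ler_wpM2l => //.
  by rewrite /lam_incr ler_wsqrtr// ler_wpM2l// subr0 (le_trans st).
- move=> t tT; have [a ha] := exo_U_abs beta0 T0 m0 b_lip s_lip b_grow s_grow h_incr FB XS X04 K4 tT.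
  exact: (shift_mean_bi_incr m0 h_incr (exo_U_measurable FB XS tT) ha).
- by [].
- move=> s t s0; rewrite le_eqVlt => /predU1P[<- _ _|st tT tsd].
    by rewrite lerDl sqrtr_ge0.
  have := g_incr s t s0 st tT; rewrite ler_norml lerBlDl => /andP[_ h1].
  apply: (le_trans h1); rewrite lerD2l.
  (* The Hoelder constant is moved under the root in order to match [kap2 * delta]. *)
  have -> : cg = Num.sqrt (4 * (M / m) ^+ 2).
    have -> : 4 * (M / m) ^+ 2 = cg ^+ 2 by rewrite /cg; ring.
    by rewrite sqrtr_sqr ger0_norm.
  rewrite /lam_incr -sqrtrM; last by rewrite mulr_ge0// sqr_ge0.
  have c0 : 0 <= 4 * (M / m) ^+ 2 * Num.sqrt (U_incr4 h beta T m M y4).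
    by apply: mulr_ge0 => //; apply: mulr_ge0 => //; exact: sqr_ge0.
  apply: ler_wsqrtr; rewrite /kap2 /K_incr2 [leLHS]mulrA.
  exact: (ler_wpM2l c0 tsd).
- apply: continuous_subspaceW (flat_K_continuous FS) => t /=.
  by rewrite !in_itv/= => /andP[-> _].
rewrite lee_fin; apply: err_total_le => //.
- exact: X_incr2_ge0.
- exact: K_incr2_ge0.
- have := mean_le_ge0 zb; rewrite pmulr_lge0// invr_gt0 ltr0n//.
Qed.

End particle_error.

(** * Hypotheses and rates of the statement *)

Lemma lipschitz_growth (R : realType) (f g : R -> R) : lipschitz f -> lipschitz g ->
  exists beta : R, [/\ 0 <= beta,
    forall x y, `|f x - f y| <= beta * `|x - y|,
    forall x y, `|g x - g y| <= beta * `|x - y|,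
    forall x, `|f x| <= beta * (1 + `|x|) &
    forall x, `|g x| <= beta * (1 + `|x|)].
Proof.
move=> /pinfty_ex_gt0[k k0 hk] /pinfty_ex_gt0[l l0 hl].
have fk x y : `|f x - f y| <= k * `|x - y| by exact: (hk (x, y)).
have gl x y : `|g x - g y| <= l * `|x - y| by exact: (hl (x, y)).
have f0 := normr_ge0 (f 0); have g0 := normr_ge0 (g 0).
exists (k + l + `|f 0| + `|g 0|); split.
- by move: k0 l0; lra.
- by move=> x y; apply: le_trans (fk x y) _; apply: ler_wpM2r => //; move: l0; lra.
- by move=> x y; apply: le_trans (gl x y) _; apply: ler_wpM2r => //; move: k0; lra.
- move=> x; have := fk x 0; rewrite subr0 => h1; have x0 := normr_ge0 x.
  have := ler_normD (f x - f 0) (f 0); rewrite subrK => h2; nra.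
- move=> x; have := gl x 0; rewrite subr0 => h1; have x0 := normr_ge0 x.
  have := ler_normD (g x - g 0) (g 0); rewrite subrK => h2; nra.
Qed.

Lemma bilipschitz_bi_incr (R : realType) (m M : R) (h : R -> R) : {homo h : x y / x < y} ->
  (forall x y, m * `|x - y| <= `|h x - h y| <= M * `|x - y|) -> bi_incr m M h.
Proof.
move=> h_incr h_lip x y; rewrite le_eqVlt => /predU1P[->|xy].
  by rewrite !subrr !mulr0 lexx.
have := h_lip y x; rewrite !gtr0_norm// subr_gt0//; exact: h_incr.
Qed.

Lemma moment4_finite d (Omega : measurableType d) (R : realType) (P : probability Omega R)
    (X : {RV P >-> R}) (p : R) : 4 < p -> (\int[P]_w (`|X w| `^ p)%:E < +oo)%E ->
  exists y4, mean_le P (fun w => X w ^+ 4) y4.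
Proof.
move=> p4 Xp; have mX : measurable_fun setT (X : Omega -> R) by exact: measurable_funPT.
have Xpm : mean_le P (fun w => `|X w| `^ p) (fine (\int[P]_w (`|X w| `^ p)%:E)%E).
  split.
  - apply: (measurableT_comp (measurable_powR p)); exact: measurableT_comp.
  - by move=> w; exact: powR_ge0.
  - rewrite fineK// ge0_fin_numE//; apply: integral_ge0 => w _; rewrite lee_fin; exact: powR_ge0.
eexists; apply: (mean_le_le _ _ _ (mean_leD (mean_le_cst P (@ler01 R)) Xpm)).
- exact: measurable_funX.
- by move=> w; exact: exprn_even_ge0.
- move=> w /=; have -> : X w ^+ 4 = `|X w| ^+ 4 by rewrite -normrX ger0_norm// exprn_even_ge0.
  have [x1|x1] := leP `|X w| 1.
    by apply: (@le_trans _ _ 1); rewrite ?exprn_ile1// lerDl powR_ge0.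
  rewrite -powR_mulrn//; apply: (@le_trans _ _ (`|X w| `^ p)); last by rewrite lerDr.
  by apply: ler_powR; exact: ltW.
Qed.

(** The inequality ln (1 + x) <= x at x = 1/n - 1 gives ln n >= 1 - 1/n, which is at least 1/2 for n
    >= 2. *)
Lemma inv_le_ln_div (R : realType) (n : nat) : (2 <= n)%N -> n%:R^-1 <= 2 * (ln n%:R / n%:R) :> R.
Proof.
move=> n2; have nR : (0 : R) < n%:R by rewrite ltr0n (leq_trans _ n2).
rewrite mulrA ler_pdivlMr// mulVf ?gt_eqF//.
have hn : n%:R^-1 <= 2^-1 :> R by rewrite lef_pV2 ?posrE// ler_nat.
have i0 : 0 < n%:R^-1 :> R by rewrite invr_gt0.
have := @le_ln1Dx R (n%:R^-1 - 1); rewrite subrKC lnV ?posrE//.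
have -> : -1 < n%:R^-1 - 1 :> R by move: i0; lra.
by move=> /(_ isT); move: hn; lra.
Qed.

Lemma inv_le_inv_sqrt (R : realType) (N : nat) : (1 <= N)%N -> N%:R^-1 <= (Num.sqrt N%:R)^-1 :> R.
Proof.
move=> N1; have N1R : (1 : R) <= N%:R by rewrite ler1n.
have s0 : 0 < Num.sqrt N%:R :> R by rewrite sqrtr_gt0 (lt_le_trans _ N1R).
rewrite lef_pV2 ?posrE ?(lt_le_trans _ N1R)//.
have s1 : 1 <= Num.sqrt N%:R :> R by have := ler_wsqrtr N1R; rewrite sqrtr1.
by rewrite -[leRHS]sqr_sqrtr// expr2 ler_peMr// ltW.
Qed.

Theorem theorem4p4 (R : realType) (d : measure_display)
    (Omega : measurableType d) (P : probability Omega R)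
    (P_complete : measure_is_complete P)
    (b sigma h : R -> R) (m M p T : R) (X0 : {RV P >-> R})
    (b_lip : lipschitz b) (sigma_lip : lipschitz sigma)
    (h_incr : {homo h : x y / x < y})
    (m_gt0 : 0 < m) (m_le_M : m <= M)
    (h_bilip : forall x y : R,
       m * `|x - y| <= `|h x - h y| <= M * `|x - y|)
    (X0_constraint : (0 <= 'E_P[h \o X0])%E)
    (p_gt4 : 4 < p)
    (X0_moment : (\int[P]_w (`|X0 w| `^ p)%:E < +oo)%E)
    (T_gt0 : 0 < T) :
  (exists C : R,
    forall (B X U : R -> Omega -> R) (K : cumulative R R)
      (Y : nat -> {RV P >-> R}) (W Xbar : nat -> R -> Omega -> R),
    mean_reflected_setting b sigma h X0 B X U K Y W Xbar ->
    forall (N n : nat) (Xt Ut : nat -> R -> Omega -> R),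
    (1 <= N)%N -> (2 <= n)%N ->
    euler_system P b sigma h T N n (fun i => Y i : Omega -> R) W Xt Ut ->
    forall i : nat, (i < N)%N ->
    (sup_square_error P T (Xbar i) (Xt i)
      <= (C * (ln n%:R / n%:R + (Num.sqrt N%:R)^-1))%:E)%E)
  /\
  (C2_bounded_derivatives h ->
   exists2 C : R, 0 < C &
    forall (B X U : R -> Omega -> R) (K : cumulative R R)
      (Y : nat -> {RV P >-> R}) (W Xbar : nat -> R -> Omega -> R),
    mean_reflected_setting b sigma h X0 B X U K Y W Xbar ->
    forall (N n : nat) (Xt Ut : nat -> R -> Omega -> R),
    (1 <= N)%N -> (2 <= n)%N ->
    euler_system P b sigma h T N n (fun i => Y i : Omega -> R) W Xt Ut ->
    forall i : nat, (i < N)%N ->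
    (sup_square_error P T (Xbar i) (Xt i)
      <= (C * (ln n%:R / n%:R + N%:R^-1))%:E)%E).
Proof.
have [beta [beta0 bl sl bg sg]] := lipschitz_growth b_lip sigma_lip.
have hi := bilipschitz_bi_incr h_incr h_bilip.
have [y4 X04] := moment4_finite p_gt4 X0_moment.
have [C0 C00 HC] : exists2 C : R, 0 <= C &
  forall (B X U : R -> Omega -> R) (K : cumulative R R)
    (Y : nat -> {RV P >-> R}) (W Xbar : nat -> R -> Omega -> R),
  mean_reflected_setting b sigma h X0 B X U K Y W Xbar ->
  forall (N n : nat) (Xt Ut : nat -> R -> Omega -> R),
  (0 < N)%N -> (0 < n)%N ->
  euler_system P b sigma h T N n (fun i => Y i : Omega -> R) W Xt Ut ->
  forall i : nat, (i < N)%N ->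
  (sup_square_error P T (Xbar i) (Xt i) <= (C * (n%:R^-1 + N%:R^-1))%:E)%E.
  (* The absolute value makes the constant nonnegative without tracking the signs of its parts. *)
  exists `|err_bound beta T m M (X_incr2 h beta T m M y4) (K_incr2 h beta T m M y4)
    (sampling_const h beta T m M y4 (2 * (M / m)))|; first exact: normr_ge0.
  move=> B X U K Y W Xbar S N n Xt Ut N0 n0 ES i iN.
  apply: le_trans (particle_error P_complete beta0 T_gt0 m_gt0 bl sl bg sg hi X04 S N0 n0 ES iN) _.
  by rewrite lee_fin; apply: ler_wpM2r; [rewrite addr_ge0// invr_ge0|exact: ler_norm].
(* The factor 2 comes from 1/n <= 2 ln n / n; the added 1 makes the constant positive, as the second
   part asks. *)
have rate (N n : nat) (r : R) : (1 <= N)%N -> (2 <= n)%N -> N%:R^-1 <= r ->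
    C0 * (n%:R^-1 + N%:R^-1) <= (2 * C0 + 1) * (ln n%:R / n%:R + r).
  move=> N1 n2 Nr; have h1 := inv_le_ln_div R n2.
  have i0 : 0 <= n%:R^-1 :> R by rewrite invr_ge0.
  have j0 : 0 <= N%:R^-1 :> R by rewrite invr_ge0.
  move: h1 i0 j0 Nr; set u := ln _ / _; set v := n%:R^-1; set z := N%:R^-1 => h1 i0 j0 Nr.
  apply: (@le_trans _ _ (C0 * (2 * u + 2 * r))); first by apply: ler_wpM2l => //; lra.
  lra.
split.
  exists (2 * C0 + 1) => B X U K Y W Xbar S N n Xt Ut N1 n2 ES i iN.
  apply: le_trans (HC _ _ _ _ _ _ _ S N n _ _ N1 (ltnW n2) ES i iN) _.
  by rewrite lee_fin; apply: rate => //; exact: inv_le_inv_sqrt.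
move=> _; exists (2 * C0 + 1); first by rewrite ltr_wpDl// mulr_ge0.
move=> B X U K Y W Xbar S N n Xt Ut N1 n2 ES i iN.
apply: le_trans (HC _ _ _ _ _ _ _ S N n _ _ N1 (ltnW n2) ES i iN) _.
by rewrite lee_fin; exact: rate.
Qed.
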